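(* Let $n\ge1$ be an integer, $\gamma>0$, $1\le q<\infty$, $\alpha\in\mathbb{R}$, $0<p<\infty$, and let $k$ be a nonnegative integer such that $pk+\alpha>-1$. Then for any holomorphic function $f$ on $\mathbb{B}_n$, the following are equivalent: $f\in\mathcal{A}^p_\alpha$; $A^{(q)}_\gamma(\mathcal{R}^kf)\in L^p(\mathbb{B}_n,dv_\alpha)$; $M^{(q)}_\gamma(\mathcal{R}^kf)\in L^p(\mathbb{B}_n,dv_\alpha)$. Here $$A^{(q)}_\gamma(\mathcal{R}^kf)(z)=\left(\int_{D(z,\gamma)}\left|(1-|w|^2)^k\mathcal{R}^kf(w)\right|^q d\tau(w)\right)^{1/q}$$ and $$M^{(q)}_\gamma(\mathcal{R}^kf)(z)=\sup_{w\in\mathbb{B}_n:\ z\in D(w,\gamma)}\left(\int_{D(w,\gamma)}\left|(1-|u|^2)^k\mathcal{R}^kf(u)\right|^q\frac{dv_\alpha(u)}{v_\alpha(D(w,\gamma))}\right)^{1/q}.$$ Moreover, $$\|f-f(0)\|_{\mathcal{A}^p_\alpha}\approx\|A^{(q)}_\gamma(\mathcal{R}^kf)\|_{L^p(\mathbb{B}_n,dv_\alpha)}\approx\|M^{(q)}_\gamma(\mathcal{R}^kf)\|_{L^p(\mathbb{B}_n,dv_\alpha)},$$ where the comparison constants depend only on $\gamma,q,\alpha,p,k$ and $n$.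
   Context: $\mathbb{B}_n=\{z\in\mathbb{C}^n:|z|<1\}$ is the open unit ball, and $dv$ is Lebesgue measure on $\mathbb{B}_n$ normalized to have total mass $1$. For $\alpha\in\mathbb{R}$, $dv_\alpha(z)=c_\alpha(1-|z|^2)^\alpha dv(z)$, where $c_\alpha=1$ if $\alpha\le-1$ and $c_\alpha=\Gamma(n+\alpha+1)/[n!\,\Gamma(\alpha+1)]$ if $\alpha>-1$. The invariant measure is $d\tau(z)=(1-|z|^2)^{-(n+1)}dv(z)$. $\|g\|_{L^p(\mathbb{B}_n,dv_\alpha)}=\left(\int_{\mathbb{B}_n}|g|^p\,dv_\alpha\right)^{1/p}$. For holomorphic $f$, $\mathcal{R}f(z)=\sum_{j=1}^n z_j\frac{\partial f}{\partial z_j}(z)$ is the radial derivative, $\mathcal{R}^k$ is its $k$-th iterate, and $\mathcal{R}^0f=f$. The Bergman metric is $\beta(z,w)=\frac12\log\frac{1+|\varphi_z(w)|}{1-|\varphi_z(w)|}$, where $\varphi_z$ is the involutive holomorphic automorphism of $\mathbb{B}_n$ with $\varphi_z(0)=z$, $\varphi_z(z)=0$, $\varphi_z\circ\varphi_z=\mathrm{id}$. Bergman balls are $D(z,\gamma)=\{w\in\mathbb{B}_n:\beta(z,w)<\gamma\}$. For $0<p<\infty$ and $\alpha\in\mathbb{R}$, the generalized Bergman space $\mathcal{A}^p_\alpha$ is the set of holomorphic $f$ on $\mathbb{B}_n$ such that $(1-|z|^2)^m\mathcal{R}^mf\in L^p(\mathbb{B}_n,dv_\alpha)$ for a fixed nonnegative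 integer $m$ with $pm+\alpha>-1$; this does not depend on the choice of $m$, and for $\alpha>-1$ it is the usual weighted Bergman space of holomorphic functions in $L^p(\mathbb{B}_n,dv_\alpha)$. With $N$ the smallest nonnegative integer such that $pN+\alpha>-1$, it carries the (quasi-)norm $$\|f\|_{\mathcal{A}^p_\alpha}=|f(0)|+\left(\int_{\mathbb{B}_n}(1-|z|^2)^{pN}|\mathcal{R}^Nf(z)|^p\,dv_\alpha(z)\right)^{1/p}.$$ For nonnegative (possibly infinite) quantities, $X\approx Y$ means $C^{-1}Y\le X\le CY$ for a constant $C>0$ not depending on $f$.
   Formalization: For k=0 the claim ‖f−f(0)‖≈‖A(f)‖ fails (f=1: the left side is 0, the right side is not). For k=0 the formal theorem states ‖f−f(0)‖≤C‖A(f)‖ and ‖f‖≈‖A(f)‖ instead; k≥1, A≈M for all k, and the membership equivalences are as stated. *)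

(* Defs.v *)
From HB Require Import structures.
From mathcomp Require Import all_boot all_order all_algebra.
From mathcomp Require Import all_classical all_reals all_analysis.
From mathcomp Require Import measurable_realfun complex ring lra.

Set Implicit Arguments.
Unset Strict Implicit.
Unset Printing Implicit Defensive.

Import Order.TTheory GRing.Theory Num.Theory numFieldNormedType.Exports.

Local Open Scope classical_set_scope.
Local Open Scope ring_scope.

(* C^n is 'rV[R[i]]_n. The instances below give R[i] the topology and the norm
   of the regular module R[i]^o, so that [differentiable] on 'rV[R[i]]_n is
   complex Frechet differentiability, and give matrices over R[i] the Borel
   sigma-algebra. The library norm of 'rV[R[i]]_n is the sup norm; the Euclidean
   norm is [enorm] below. *)

HB.instance Definition _ (R : rcfType) := PseudoPointedMetric.copy R[i] R[i]^o.
HB.instance Definition _ (R : rcfType) := NormedModule.copy R[i] R[i]^o.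

HB.instance Definition _ (R : realType) (m n : nat) :=
  Measurable.copy 'M[R[i]]_(m, n) (g_sigma_algebraType (@open 'M[R[i]]_(m, n))).

Section LebesgueMeasure.
Variable R : realType.
Implicit Types n : nat.

Local Notation Rm := (measurableTypeR R).
Local Notation Rm2 := (Rm * Rm)%type.

Definition tcons2 n (p : n.-tuple Rm2 * Rm * Rm) : n.+1.-tuple Rm2 :=
  [tuple of (p.1.2, p.2) :: p.1.1].

Lemma measurable_tcons2 n : measurable_fun [set: _] (@tcons2 n).
Proof.
apply: measurable_cons; last exact: measurableT_comp.
by apply: measurable_fun_pair => //=; exact: measurableT_comp.
Qed.

Definition row_of_tuple n (t : n.-tuple Rm2) : 'rV[R[i]]_n :=
  \row_j ((tnth t j).1 +i* (tnth t j).2)%C.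

Lemma measurable_row_of_tuple n : measurable_fun [set: _] (@row_of_tuple n).
Proof.
have mE : @measurable _ 'rV[R[i]]_n = <<s @open 'rV[R[i]]_n >> by [].
apply: (measurability _ mE) => // _ [U oU <-].
rewrite setTI.
pose box (x : n.-tuple (rat * rat) * nat) : set (n.-tuple Rm2) :=
  \bigcap_(j : 'I_n) ((@tnth n Rm2)^~ j @^-1`
    (ball (ratr (tnth x.1 j).1 : R) x.2.+1%:R^-1 `*`
     ball (ratr (tnth x.1 j).2 : R) x.2.+1%:R^-1)).
have mbox x : measurable (box x).
  apply: fin_bigcap_measurable => // j _.
  rewrite -[X in measurable X]setTI; apply: measurable_tnth => //.
  by apply: measurableX; rewrite ball_itv; exact: measurable_itv.
suff -> : @row_of_tuple n @^-1` U =
    \bigcup_(x in [set x | box x `<=` @row_of_tuple n @^-1` U]) box x.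
  rewrite bigcup_mkcond; apply: countable_bigcupT_measurable => // x.
  by case: ifP.
apply/seteqP; split=> [t Ut|t [x xU xt]]; last exact: xU.
have /nbhs_ballP[e /= e0 eU] : nbhs (row_of_tuple t : 'rV[R[i]]_n) U.
  exact: open_nbhs_nbhs.
have [r r0 eE] : exists2 r : R, 0 < r & e = r%:C%C.
  by move: e0; case: (e) => a b; rewrite ltcE /= => /andP[/eqP -> a0]; exists a.
have [k kr] : exists k : nat, k.+1%:R^-1 < r / 4.
  exists (Num.truncn (4 / r)).
  rewrite invf_plt ?posrE ?divr_gt0// invf_div.
  exact: truncnS_gt.
have rat_near (y : R) : exists q : rat, ball (ratr q : R) k.+1%:R^-1 y.
  have [|z [Bz [q _ qz]]] := @dense_rat R (ball y k.+1%:R^-1) _ (ball_open _ _).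
    by exists y; exact: ballxx.
  by exists q; rewrite qz; exact: ball_sym.
have [Q QP] := choice rat_near.
pose x : n.-tuple (rat * rat) * nat :=
  ([tuple (Q (tnth t j).1, Q (tnth t j).2) | j < n], k).
exists x => /=; last first.
  by move=> j _ /=; rewrite tnth_mktuple /=; split=> /=; exact: QP.
move=> s sx; apply: eU; split => // i j; rewrite !mxE.
have := sx j I; rewrite /= tnth_mktuple /= => -[] /=.
have := QP (tnth t j).1; have := QP (tnth t j).2.
rewrite /ball /= => A1 A2 B1 B2.
rewrite eE.
set w := (X in `|X|).
suff /(_ : _ -> (Normc.normc w)%:C%C < r%:C%C) : Normc.normc w < r.
  by apply; rewrite ltcR.
rewrite /w /=.
rewrite -[r in _ < r](gtr0_norm r0) -sqrtr_sqr ltr_sqrt ?exprn_gt0//.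
move: A1 A2 B1 B2; rewrite !ltr_norml.
move: (ratr _) (ratr _) (k.+1%:R^-1) kr => p q d kr.
move=> /andP[a1 a2] /andP[b1 b2] /andP[c1 c2] /andP[d1 d2].
have H1 : `|(tnth t j).1 - (tnth s j).1| < r / 2 by rewrite ltr_norml; lra.
have H2 : `|(tnth t j).2 - (tnth s j).2| < r / 2 by rewrite ltr_norml; lra.
rewrite -(real_normK (num_real ((tnth t j).1 - _))).
rewrite -(real_normK (num_real ((tnth t j).2 - _))).
move: (normr_ge0 ((tnth t j).1 - (tnth s j).1)) H1.
move: (normr_ge0 ((tnth t j).2 - (tnth s j).2)) H2.
by move: `|_| `|_| => y z; nra.
Qed.

Definition image_measure d d' (T : measurableType d) (T' : measurableType d')
    (m : {measure set T -> \bar R}) (f : T -> T')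
    (mf : measurable_fun [set: T] f) : {measure set T' -> \bar R} :=
  measure_function_pushforward__canonical__measure_function_Measure m mf.

Lemma image_measureE d d' (T : measurableType d) (T' : measurableType d')
    (m : {measure set T -> \bar R}) (f : T -> T')
    (mf : measurable_fun [set: T] f) (A : set T') :
  image_measure m mf A = m (f @^-1` A).
Proof. by []. Qed.

Definition lebesgueR : {sigma_finite_measure set Rm -> \bar R} :=
  @lebesgue_measure R.

(* The n-fold product of the planar Lebesgue measure, adding the real and the
   imaginary part of one complex coordinate at each step. *)
Fixpoint lebesgue_tuple n : {measure set (n.-tuple Rm2) -> \bar R} :=
  match n with
  | 0 => \d_ ([tuple] : 0.-tuple Rm2)
  | n'.+1 => image_measure ((lebesgue_tuple n' \x lebesgueR) \x lebesgueR)%E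
               (@measurable_tcons2 n')
  end.

Definition lebesgueC n : {measure set 'rV[R[i]]_n -> \bar R} :=
  image_measure (lebesgue_tuple n) (@measurable_row_of_tuple n).

End LebesgueMeasure.

Section Ball.
Variables (R : realType) (n : nat).
Local Notation C := R[i].
Local Notation Cn := 'rV[R[i]]_n.
Implicit Types (z w : Cn) (alpha : R).

Definition hdot z w : C := \sum_(j < n) z 0 j * ((w 0 j)^*)%C.

Definition enorm z : R := Num.sqrt (\sum_(j < n) Normc.normc (z 0 j) ^+ 2).

Definition uball : set Cn := [set z | enorm z < 1].

Lemma uball_mass_ge0 : 0 <= (fine (lebesgueC R n uball))^-1.
Proof. by rewrite invr_ge0 fine_ge0. Qed.

(* Lebesgue measure scaled to give the unit ball mass 1; only ever used on
   subsets of the ball. *)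
Definition vol : {measure set Cn -> \bar R} :=
  mscale (NngNum uball_mass_ge0) (lebesgueC R n).

Definition Gamma (s : R) : R :=
  \int[@lebesgue_measure R]_(t in `]0, +oo[) (t `^ (s - 1) * expR (- t)).

Definition calpha alpha : R :=
  if alpha <= -1 then 1
  else Gamma (n%:R + alpha + 1) / (n`!%:R * Gamma (alpha + 1)).

Definition defect z : R := 1 - enorm z ^+ 2.

(* Densities of dv_alpha and dtau with respect to dv. *)
Definition valpha_density alpha z : R := calpha alpha * defect z `^ alpha.

Definition tau_density z : R := (defect z ^+ n.+1)^-1.

Definition valpha alpha (D : set Cn) : \bar R :=
  \int[vol]_(z in D) (valpha_density alpha z)%:E.

Definition Lp_norm (p alpha : R) (g : Cn -> \bar R) : \bar R :=
  ((\int[vol]_(z in uball) (`|g z| `^ p * (valpha_density alpha z)%:E))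
    `^ p^-1)%E.

Definition in_Lp (p alpha : R) (g : Cn -> \bar R) : Prop :=
  measurable_fun uball g /\ (Lp_norm p alpha g < +oo)%E.

(* Orthogonal projection of w onto the complex line of z (0 when z = 0). *)
Definition line_proj z w : Cn := (hdot w z / hdot z z) *: z.

(* The involutive automorphism exchanging 0 and z; for z = 0 it is w |-> - w. *)
Definition phi z w : Cn :=
  (1 - hdot w z)^-1 *:
    (z - line_proj z w - ((Num.sqrt (defect z))%:C)%C *: (w - line_proj z w)).

Lemma hdotZl c z x : hdot (c *: x) z = c * hdot x z.
Proof. by rewrite /hdot mulr_sumr; apply: eq_bigr => j _; rewrite mxE mulrA. Qed.

Lemma hdotBl z x y : hdot (x - y) z = hdot x z - hdot y z.
Proof. by rewrite /hdot -sumrB; apply: eq_bigr => j _; rewrite !mxE mulrBl. Qed.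

Lemma hdotzz z : hdot z z = ((enorm z ^+ 2)%:C)%C.
Proof.
rewrite /enorm sqr_sqrtr; last by apply: sumr_ge0 => j _; exact: sqr_ge0.
rewrite rmorph_sum; apply: eq_bigr => j _; case: (z 0 j) => a b /=.
rewrite sqr_sqrtr ?addr_ge0 ?sqr_ge0//; simpc.
by congr (_ +i* _)%C; ring.
Qed.

Lemma hdotzz_eq0 z : (hdot z z == 0) = (z == 0).
Proof.
apply/idP/eqP => [|->]; last first.
  by rewrite /hdot big1// => j _; rewrite mxE mul0r.
rewrite hdotzz fmorph_eq0.
rewrite sqrf_eq0 sqrtr_eq0 => H.
have {}H : \sum_(j < n) Normc.normc (z 0 j) ^+ 2 = 0.
  by apply/eqP; rewrite eq_le H sumr_ge0// => j _; exact: sqr_ge0.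
apply/rowP => j; rewrite !mxE.
move/eqP : H; rewrite psumr_eq0; last by move=> ? _; exact: sqr_ge0.
move/allP => /(_ j (mem_index_enum j)) /=.
by rewrite sqrf_eq0 => /eqP /Normc.eq0_normc.
Qed.

Lemma phi_zero z : phi z 0 = z.
Proof.
have h0 : hdot 0 z = 0 by rewrite /hdot big1// => j _; rewrite mxE mul0r.
by rewrite /phi /line_proj h0 mul0r scale0r !subr0 invr1 scale1r scaler0 subr0.
Qed.

Lemma phi_self z : phi z z = 0.
Proof.
have -> : phi z z = (1 - hdot z z)^-1 *: 0; last by rewrite scaler0.
rewrite /phi; congr (_ *: _).
have -> : line_proj z z = z; last by rewrite subrr scaler0 subr0.
have [->|z0] := eqVneq z 0; first by rewrite /line_proj scaler0.
by rewrite /line_proj divff ?scale1r// hdotzz_eq0.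
Qed.

(* The condition <w, z> != 1 always holds when z and w are in the ball. *)
Lemma phi_involutive z w : uball z -> hdot w z != 1 -> phi z (phi z w) = w.
Proof.
move=> zB wz.
have a1 : 1 - hdot w z != 0 by rewrite subr_eq0 eq_sym.
have [z0|z0] := eqVneq z 0.
  have D x : hdot x z = 0.
    by rewrite z0 /hdot big1// => j _; rewrite mxE conjc0 mulr0.
  have d1 : defect z = 1.
    rewrite /defect; suff -> : enorm z = 0 by rewrite expr0n subr0.
    rewrite z0 /enorm big1 ?sqrtr0// => j _; rewrite mxE Normc.normc0 expr0n//.
  rewrite /phi /line_proj !D !mul0r !scale0r !subr0 d1 sqrtr1 invr1 !scale1r.
  by rewrite z0 !sub0r opprK.
have N0 : hdot z z != 0 by rewrite hdotzz_eq0.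
pose s := ((Num.sqrt (defect z))%:C)%C.
have s2 : s ^+ 2 = 1 - hdot z z.
  rewrite hdotzz /s -rmorphXn sqr_sqrtr /defect ?rmorphB//= subr_ge0.
  by rewrite exprn_ile1// ?sqrtr_ge0// ltW.
have s20 : 1 - hdot z z != 0.
  rewrite hdotzz -[1]/(1%:C)%C -rmorphB fmorph_eq0 subr_eq0 eq_sym lt_eqF//.
  by rewrite exprn_ilt1 ?sqrtr_ge0.
have H : hdot (phi z w) z = (hdot z z - hdot w z) / (1 - hdot w z).
  rewrite /phi /line_proj hdotZl !hdotBl !hdotZl !hdotBl !hdotZl.
  by field; rewrite a1 N0.
rewrite {1}/phi /line_proj H -/s.
apply/rowP => j; rewrite !mxE -/s.
move: (hdot w z) (hdot z z) a1 N0 s2 s20 => a N a1 N0 s2 s20.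
have Ns : N = 1 - s ^+ 2 by rewrite s2; ring.
rewrite {}Ns in N0 *.
rewrite -s2 in s20; have s0 : s != 0 by apply: contraNneq s20 => ->; rewrite expr0n.
clearbody s; field; rewrite N0 a1 /=.
by have -> : 1 - a - (1 - s ^+ 2 - a) = s ^+ 2 by ring.
Qed.

Definition bergman_dist z w : R :=
  2^-1 * ln ((1 + enorm (phi z w)) / (1 - enorm (phi z w))).

Definition bergman_ball z (gamma : R) : set Cn :=
  [set w | uball w /\ bergman_dist z w < gamma].

Implicit Types f : Cn -> C.

Definition holomorphic_on_ball f : Prop :=
  forall z, uball z -> differentiable f z.

Definition radial f : Cn -> C :=
  fun z => \sum_(j < n) z 0 j * 'D_(delta_mx 0 j) f z.

Definition radial_iter (k : nat) f : Cn -> C := iter k radial f.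

(* |(1 - |z|^2)^k R^k f (z)| *)
Definition weighted_radial (k : nat) f z : R :=
  defect z ^+ k * Normc.normc (radial_iter k f z).

Definition bergman_mem (p alpha : R) f : Prop :=
  holomorphic_on_ball f /\
  exists m : nat, -1 < p * m%:R + alpha /\
    in_Lp p alpha (fun z => (weighted_radial m f z)%:E).

(* The least N with p N + alpha > -1; such an N exists whenever 0 < p, and the
   value for p <= 0 is irrelevant. *)
Definition bergman_order (p alpha : R) : nat :=
  match pselect (exists N : nat, -1 < p * N%:R + alpha) with
  | left exN => ex_minn exN
  | right _ => 0
  end.

Definition bergman_norm (p alpha : R) f : \bar R :=
  let N := bergman_order p alpha in
  ((Normc.normc (f 0))%:E +
   (\int[vol]_(z in uball)
      (defect z `^ (p * N%:R) * Normc.normc (radial_iter N f z) `^ p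
       * valpha_density alpha z)%:E) `^ p^-1)%E.

Definition area_fun (q gamma : R) (k : nat) f : Cn -> \bar R := fun z =>
  ((\int[vol]_(w in bergman_ball z gamma)
      (weighted_radial k f w `^ q * tau_density w)%:E) `^ q^-1)%E.

Definition maximal_fun (alpha q gamma : R) (k : nat) f : Cn -> \bar R := fun z =>
  ereal_sup [set
    ((\int[vol]_(u in bergman_ball w gamma)
        (weighted_radial k f u `^ q * valpha_density alpha u)%:E)
      / valpha alpha (bergman_ball w gamma)) `^ q^-1
    | w in [set w | uball w /\ bergman_ball w gamma z]]%E.

End Ball.

Definition comparable_upto (R : realType) (c : R) (X Y : \bar R) : Prop :=
  (c^-1%:E * Y <= X)%E /\ (X <= c%:E * Y)%E.

(* Main.v *)
(** Bergman balls are the sets where (1 - |z|^2)(1 - |w|^2) > kap |1 - <w, z>|^2;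
    they contain the image of a fixed cube under an affine map adapted to z, so
    the one-variable inequality |f(0)|^q <= C r^-2 int |f|^q, for every q > 0,
    gives the sub-mean value inequality for |f|^q over Bergman balls. Hence
    |R^k f(z)|^p (1 - |z|^2)^(kp) is bounded by its averages, by the area and by
    the maximal function, and Tonelli's theorem integrates averages back. So all
    three norms are compared with the energy of order k, the integral of
    |R^k f|^p (1 - |z|^2)^(kp + alpha).

    Energies of orders k and k + 1 are comparable: one direction is Cauchy's
    estimate on Bergman balls; the other one is a Hardy inequality, obtained by
    comparing the integral of |g|^p over the shell t^2 <= |z| < t with the one
    over t^4 <= |z| < t^2 through the dilations by t and t^2. The error is an
    average of |R g|^p, and kp + alpha > -1 makes the comparison a contraction. *)

Require Import Defs.
From HB Require Import structures.
From mathcomp Require Import all_boot all_order all_algebra.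
From mathcomp Require Import all_classical all_reals all_analysis.
From mathcomp Require Import measurable_realfun complex ring lra.

Set Implicit Arguments.
Unset Strict Implicit.
Unset Printing Implicit Defensive.

Import Order.TTheory GRing.Theory Num.Theory numFieldNormedType.Exports.

Local Open Scope classical_set_scope.
Local Open Scope ring_scope.

(** * Hermitian geometry and orthogonal projections *)

Section Hermitian.
Variables (R : realType) (n : nat).
Local Notation C := R[i].
Local Notation Cn := 'rV[R[i]]_n.
Local Notation normc := (@Normc.normc R).
Local Notation rc := (real_complex R).
Local Notation Re := (@complex.Re R).
Local Notation Im := (@complex.Im R).
Implicit Types (z w u : Cn) (c : C).

(** Holomorphy means complex Frechet differentiability at each point, with nothing known about the
    derivative. So Goursat's theorem on rectangles comes first, and the holomorphy of [radial f] is
    obtained from difference quotients with uniform Cauchy bounds. Sharp constants never matter: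
    squares replace discs and the lower bound 4 replaces 2 pi. For exponents below 1 Jensen's
    inequality does not apply to |f|^p, hence the weighted maximum in [submean_square]. Volumes are
    computed under affine maps only: a Bergman ball is given by an explicit inequality, so no change
    of variables by an automorphism occurs. In the Hardy inequality the energy may be infinite, so
    an error term cannot be absorbed by subtraction. The induction over shells bounds the mass
    inside radius [T j] together with a multiple of the last shell, and the limit is taken at the
    end. One loss is unavoidable: for [k = 0] the constant [f 0] contributes to the area and maximal
    functions but not to [f - f 0]. *)

Lemma normc_ge0 c : 0 <= normc c.
Proof. by case: c => a b /=; exact: sqrtr_ge0. Qed.

Lemma norm_normc c : `|c| = rc (normc c).
Proof. by case: c => a b; rewrite complex.normc_def. Qed.

Lemma normc_sqr c : normc c ^+ 2 = Re c ^+ 2 + Im c ^+ 2.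
Proof. by case: c => a b /=; rewrite sqr_sqrtr// addr_ge0// sqr_ge0. Qed.

Lemma normc_real (x : R) : normc (rc x) = `|x|.
Proof. by rewrite /= expr0n addr0 sqrtr_sqr. Qed.

Lemma normcD c d : normc (c + d) <= normc c + normc d.
Proof. exact: le_normcD. Qed.

Lemma normc_opp c : normc (- c) = normc c.
Proof. exact: normcN. Qed.

Lemma normcB c d : normc (c - d) = normc (d - c).
Proof. by rewrite -normc_opp opprB. Qed.

Lemma normc_conj c : normc (c^*)%C = normc c.
Proof. by case: c => a b /=; rewrite sqrrN. Qed.

Lemma normc_eq0 c : (normc c == 0) = (c == 0).
Proof. by apply/eqP/eqP => [/Normc.eq0_normc//|->]; rewrite Normc.normc0. Qed.

Lemma normcX c m : normc (c ^+ m) = normc c ^+ m.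
Proof.
by elim: m => [|m IH]; rewrite ?expr0 ?Normc.normc1// !exprS Normc.normcM IH.
Qed.

Lemma normc_sum (I : Type) (s : seq I) (P : pred I) (F : I -> C) :
  normc (\sum_(i <- s | P i) F i) <= \sum_(i <- s | P i) normc (F i).
Proof.
apply: (big_ind2 (fun x y => normc x <= y)) => //.
- by rewrite Normc.normc0.
- by move=> x1 y1 x2 y2 h1 h2; apply: (le_trans (normcD _ _)); exact: lerD.
Qed.

Lemma Re_le_normc c : `|Re c| <= normc c.
Proof.
case: c => a b /=; rewrite -sqrtr_sqr ler_wsqrtr// lerDl; exact: sqr_ge0.
Qed.

Lemma Im_le_normc c : `|Im c| <= normc c.
Proof.
case: c => a b /=; rewrite -sqrtr_sqr ler_wsqrtr// lerDr; exact: sqr_ge0.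
Qed.

Lemma normc_le_ReIm c : normc c <= `|Re c| + `|Im c|.
Proof.
rewrite -ler_sqr ?nnegrE ?normc_ge0 ?addr_ge0// normc_sqr sqrrD !real_normK ?num_real//.
by rewrite -addrA lerD2l lerDr mulrn_wge0// mulr_ge0.
Qed.

Lemma Re_mul (c d : C) : Re (c * d) = Re c * Re d - Im c * Im d.
Proof. by case: c => a b; case: d. Qed.

Lemma Im_mul (c d : C) : Im (c * d) = Re c * Im d + Im c * Re d.
Proof. by case: c => a b; case: d. Qed.

Lemma Re_add (c d : C) : Re (c + d) = Re c + Re d.
Proof. by case: c => a b; case: d. Qed.
Lemma Im_add (c d : C) : Im (c + d) = Im c + Im d.
Proof. by case: c => a b; case: d. Qed.
Lemma Re_opp (c : C) : Re (- c) = - Re c.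
Proof. by case: c. Qed.
Lemma Im_opp (c : C) : Im (- c) = - Im c.
Proof. by case: c. Qed.

Lemma mul_conj c : c * (c^*)%C = rc (normc c ^+ 2).
Proof.
rewrite normc_sqr; case: c => a b /=; simpc; congr (_ +i* _)%C; ring.
Qed.

Lemma hdotDl z w u : hdot (z + w) u = hdot z u + hdot w u.
Proof. by rewrite /hdot -big_split; apply: eq_bigr => j _; rewrite !mxE mulrDl. Qed.

Lemma hdotC z w : hdot w z = ((hdot z w)^*)%C.
Proof.
rewrite /hdot rmorph_sum; apply: eq_bigr => j _ /=.
by rewrite rmorphM /= conjcK mulrC.
Qed.

Lemma hdotDr z w u : hdot z (w + u) = hdot z w + hdot z u.
Proof. by rewrite hdotC hdotDl rmorphD /= -!hdotC. Qed.

Lemma hdotZr c z w : hdot z (c *: w) = (c^*)%C * hdot z w.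
Proof. by rewrite hdotC hdotZl rmorphM /= -!hdotC. Qed.

Lemma hdotNl z w : hdot (- z) w = - hdot z w.
Proof. by rewrite -scaleN1r hdotZl mulN1r. Qed.

Lemma hdotNr z w : hdot z (- w) = - hdot z w.
Proof. by rewrite hdotC hdotNl rmorphN /= -hdotC. Qed.

Lemma hdotBr z w u : hdot z (w - u) = hdot z w - hdot z u.
Proof. by rewrite hdotDr hdotNr. Qed.

Lemma hdot0l z : hdot 0 z = 0.
Proof. by rewrite -(scale0r z) hdotZl mul0r. Qed.

Lemma hdot0r z : hdot z 0 = 0.
Proof. by rewrite -(scale0r z) hdotZr conjc0 mul0r. Qed.

Lemma enorm_ge0 z : 0 <= enorm z.
Proof. exact: sqrtr_ge0. Qed.

Lemma enorm_sqr z : enorm z ^+ 2 = \sum_(j < n) normc (z 0 j) ^+ 2.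
Proof. by rewrite sqr_sqrtr// sumr_ge0// => j _; exact: sqr_ge0. Qed.

Lemma enorm_sqr_hdot z : enorm z ^+ 2 = Re (hdot z z).
Proof. by rewrite hdotzz. Qed.

Lemma enorm0 : enorm (0 : Cn) = 0.
Proof.
by apply/eqP; rewrite -sqrf_eq0 enorm_sqr_hdot hdot0l.
Qed.

Lemma enorm_eq0 z : (enorm z == 0) = (z == 0).
Proof. by rewrite -hdotzz_eq0 hdotzz fmorph_eq0 sqrf_eq0. Qed.

Lemma enormZ c z : enorm (c *: z) = normc c * enorm z.
Proof.
apply/eqP; rewrite -(@eqrXn2 _ 2) ?enorm_ge0// ?mulr_ge0 ?enorm_ge0 ?normc_ge0//.
apply/eqP; rewrite exprMn !enorm_sqr mulr_sumr; apply: eq_bigr => j _.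
by rewrite mxE Normc.normcM exprMn.
Qed.

Lemma enormN z : enorm (- z) = enorm z.
Proof. by rewrite -scaleN1r enormZ normc_opp Normc.normc1 mul1r. Qed.

Lemma enormB z w : enorm (z - w) = enorm (w - z).
Proof. by rewrite -enormN opprB. Qed.

Lemma coord_le_enorm z j : normc (z 0 j) <= enorm z.
Proof.
rewrite -ler_sqr ?nnegrE ?normc_ge0 ?enorm_ge0// enorm_sqr (bigD1 j)//=.
by rewrite lerDl sumr_ge0// => i _; exact: sqr_ge0.
Qed.

Lemma enorm_le_coord z (e : R) : 0 <= e -> (forall j, normc (z 0 j) <= e) ->
  enorm z <= n.+1%:R * e.
Proof.
move=> e0 H; rewrite -ler_sqr ?nnegrE ?enorm_ge0 ?mulr_ge0// enorm_sqr.
apply: (@le_trans _ _ (\sum_(j < n) e ^+ 2)).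
  by apply: ler_sum => j _; rewrite ler_sqr ?nnegrE ?normc_ge0.
rewrite sumr_const card_ord -[X in X <= _]mulr_natl exprMn ler_wpM2r ?sqr_ge0//.
by rewrite -natrX ler_nat (leq_trans (leqnSn n))// expnS expn1 leq_pmulr.
Qed.

Lemma enormD_sqr z w :
  enorm (z + w) ^+ 2 = enorm z ^+ 2 + enorm w ^+ 2 + 2 * Re (hdot z w).
Proof.
rewrite !enorm_sqr_hdot hdotDl !hdotDr (hdotC z w) !Re_add.
case: (hdot z w) => a b /=; ring.
Qed.

Lemma enorm_line_proj z w : z != 0 ->
  enorm (line_proj z w) ^+ 2 = normc (hdot w z) ^+ 2 / enorm z ^+ 2.
Proof.
move=> z0; rewrite /line_proj enormZ exprMn hdotzz Normc.normcM Normc.normcV.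
rewrite normc_real ger0_norm ?sqr_ge0// exprMn.
have : enorm z != 0 by rewrite enorm_eq0.
by move=> h; field.
Qed.

Lemma hdot_line_proj z w : hdot (line_proj z w) z = hdot w z.
Proof.
have [->|z0] := eqVneq z 0; first by rewrite !hdot0r.
by rewrite /line_proj hdotZl mulfVK// hdotzz_eq0.
Qed.

Lemma hdot_perp_proj z w u : hdot (w - line_proj z w) (line_proj z u) = 0.
Proof.
rewrite /line_proj -/(line_proj z w) hdotZr hdotBl.
by rewrite -/(line_proj z w) hdot_line_proj subrr mulr0.
Qed.

Lemma line_proj_pythagoras z w :
  enorm w ^+ 2 = enorm (line_proj z w) ^+ 2 + enorm (w - line_proj z w) ^+ 2.
Proof.
have := enormD_sqr (w - line_proj z w) (line_proj z w).
by rewrite subrK hdot_perp_proj mulr0 addr0 addrC.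
Qed.

Lemma cauchy_schwarz_hdot z w : normc (hdot z w) <= enorm z * enorm w.
Proof.
have [->|w0] := eqVneq w 0.
  by rewrite hdot0r Normc.normc0 enorm0 mulr0.
rewrite -ler_sqr ?nnegrE ?normc_ge0 ?mulr_ge0 ?enorm_ge0//.
have := line_proj_pythagoras w z; rewrite enorm_line_proj// => h.
have w1 : 0 < enorm w ^+ 2.
  by rewrite exprn_gt0// lt_neqAle enorm_ge0 andbT eq_sym enorm_eq0.
rewrite exprMn -ler_pdivrMr// h lerDl; exact: sqr_ge0.
Qed.

Lemma enormD z w : enorm (z + w) <= enorm z + enorm w.
Proof.
rewrite -ler_sqr ?nnegrE ?enorm_ge0 ?addr_ge0 ?enorm_ge0// enormD_sqr sqrrD.
have : Re (hdot z w) <= enorm z * enorm w.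
  exact: le_trans (ler_norm _) (le_trans (Re_le_normc _) (cauchy_schwarz_hdot _ _)).
lra.
Qed.

Lemma enorm_line_proj_le z w : enorm (line_proj z w) <= enorm w.
Proof.
rewrite -ler_sqr ?nnegrE ?enorm_ge0//.
by rewrite (line_proj_pythagoras z w) lerDl sqr_ge0.
Qed.

Lemma enorm_perp_proj_le z w : enorm (w - line_proj z w) <= enorm w.
Proof.
rewrite -ler_sqr ?nnegrE ?enorm_ge0//.
by rewrite (line_proj_pythagoras z w) lerDr sqr_ge0.
Qed.

Lemma line_projD z w u : line_proj z (w + u) = line_proj z w + line_proj z u.
Proof. by rewrite /line_proj hdotDl mulrDl scalerDl. Qed.

Lemma line_projZ z c w : line_proj z (c *: w) = c *: line_proj z w.
Proof. by rewrite /line_proj hdotZl -mulrA scalerA. Qed.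

Lemma line_proj_self z : line_proj z z = z.
Proof.
have [->|z0] := eqVneq z 0; first by rewrite /line_proj scaler0.
by rewrite /line_proj divff ?scale1r// hdotzz_eq0.
Qed.

Lemma line_proj_idem z w : line_proj z (line_proj z w) = line_proj z w.
Proof. by rewrite {1}/line_proj hdot_line_proj. Qed.

Lemma defect_gt0 z : uball z -> 0 < defect z.
Proof.
rewrite /uball /= => h; rewrite subr_gt0 exprn_ilt1// ?enorm_ge0//.
Qed.

Lemma defect_le1 z : defect z <= 1.
Proof. by rewrite gerBl sqr_ge0. Qed.

Lemma uball_defect z : 0 < defect z -> uball z.
Proof.
rewrite subr_gt0 => h; rewrite /uball/= -(@expr_lt1 _ 2)// ?enorm_ge0//.
Qed.

Lemma uball0 : uball (0 : Cn).
Proof. by rewrite /uball /= enorm0. Qed.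

(** The topology comes from the sup norm, with radii that are complex numbers. This is the passage
    to real radii and the Euclidean norm, used for every later continuity or openness argument. *)
Lemma nbhs_enorm z (U : set Cn) :
  nbhs z U <-> exists2 r : R, 0 < r & forall w, enorm (w - z) < r -> U w.
Proof.
split.
  move=> /nbhs_ballP[e /= e0 eU].
  have [r r0 eE] : exists2 r : R, 0 < r & e = rc r.
    by move: e0; case: (e) => a b; rewrite ltcE /= => /andP[/eqP -> a0]; exists a.
  exists r => // w wr; apply: eU; split => // i j.
  rewrite /ball /= eE ord1 -opprB normrN norm_normc ltcR.
  apply: le_lt_trans wr; have := coord_le_enorm (w - z) j.
  by rewrite !mxE.
move=> [r r0 H]; apply/nbhs_ballP.
(* The denominator [n.+2] makes the bound strict after the factor [n.+1] of [enorm_le_coord]. *)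
exists (rc (r / n.+2%:R)) => /=; first by rewrite ltcR divr_gt0.
move=> w [_ zw]; apply: H.
apply: (@le_lt_trans _ _ (n.+1%:R * (r / n.+2%:R))).
  apply: enorm_le_coord; first by rewrite divr_ge0// ltW.
  move=> j; have := zw 0 j; rewrite /ball /= -opprB normrN norm_normc ltcR.
  by rewrite !mxE => /ltW.
by rewrite mulrCA gtr_pMr// ltr_pdivrMr// mul1r ltr_nat.
Qed.

Lemma open_enorm (U : set Cn) :
  (forall z, U z -> exists2 r : R, 0 < r & forall w, enorm (w - z) < r -> U w) ->
  open U.
Proof. by move=> H; rewrite openE => z Uz; apply/nbhs_enorm/H. Qed.

Lemma uball_nbhs z : uball z ->
  exists2 r : R, 0 < r & forall w, enorm (w - z) < r -> uball w.
Proof.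
rewrite /uball /= => h; exists (1 - enorm z); first by rewrite subr_gt0.
move=> w wz; rewrite -(subrK z w); apply: (le_lt_trans (enormD _ _)); lra.
Qed.

Lemma open_uball : open (@uball R n).
Proof. exact/open_enorm/uball_nbhs. Qed.

Lemma open_measurable (U : set Cn) : open U -> measurable U.
Proof. exact: sub_sigma_algebra. Qed.

Lemma measurable_uball : measurable (@uball R n).
Proof. exact: open_measurable open_uball. Qed.

Lemma enorm_lip z w : `|enorm z - enorm w| <= enorm (z - w).
Proof.
have h1 := enormD (z - w) w; have h2 := enormD (w - z) z.
rewrite !subrK in h1 h2; rewrite enormB in h2.
rewrite ler_norml; lra.
Qed.

End Hermitian.

(** * Lebesgue measure under affine maps *)

Section SigmaFinitePack.
Context d (T : measurableType d) (R : realType).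
Variable m : {measure set T -> \bar R}.
Hypothesis sf : sigma_finite setT m.

(** An alias of [m] on which the proof of sigma-finiteness can be hung as a structure, as Tonelli's
    theorem requires; integrals against the alias are convertible to integrals against [m]. *)
Definition sigma_finite_fun of sigma_finite setT m : set T -> \bar R := m.
HB.instance Definition _ := Measure.copy (sigma_finite_fun sf) m.
HB.instance Definition _ :=
  Measure_isSigmaFinite.Build _ _ _ (sigma_finite_fun sf) sf.
Definition sigma_finite_pack : {sigma_finite_measure set T -> \bar R} :=
  sigma_finite_fun sf.
End SigmaFinitePack.

Lemma sigma_finite_image d d' (T : measurableType d) (T' : measurableType d')
    (R : realType) (m : {measure set T -> \bar R}) (f : T -> T') (g : T' -> T)
    (mf : measurable_fun [set: T] f) (mg : measurable_fun [set: T'] g) :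
  cancel f g -> sigma_finite setT m -> sigma_finite setT (image_measure m mf).
Proof.
move=> fg [F FT Fm]; exists (fun k => g @^-1` F k).
  by rewrite -preimage_bigcup -FT preimage_setT.
move=> k; have [mF Foo] := Fm k; split.
  by rewrite -[X in measurable X]setTI; exact: mg.
rewrite image_measureE (_ : _ @^-1` _ = F k)//.
by apply/seteqP; split=> x /=; rewrite fg.
Qed.

Section ProductSigmaFinite.
Context d d' (T : measurableType d) (T' : measurableType d') (R : realType).
Variables (m : {sigma_finite_measure set T -> \bar R})
  (m' : {sigma_finite_measure set T' -> \bar R}).

Lemma sigma_finite_prod : sigma_finite setT (m \x m')%E.
Proof.
have [F FT Fm] := sigma_finiteT m; have [G GT Gm] := sigma_finiteT m'.
pose H k := if unpickle k is Some (i, j) then F i `*` G j else set0.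
exists H.
  apply/esym; rewrite -subTset => -[x y] _; have : setT x by []; have : setT y by [].
  rewrite GT FT => -[j _ Gy] [i _ Fx].
  by exists (pickle (i, j)) => //; rewrite /H pickleK.
move=> k; rewrite /H; case: (unpickle k) => [[i j]|]; last by rewrite measure0.
have [mF Foo] := Fm i; have [mG Goo] := Gm j; split; first exact: measurableX.
by rewrite product_measure1E// lte_mul_pinfty// ge0_fin_numE.
Qed.

Definition prod_sfm := sigma_finite_pack sigma_finite_prod.
End ProductSigmaFinite.

Section Lebesgue.
Variable R : realType.
Local Notation Rm := (measurableTypeR R).
Local Notation Rm2 := (Rm * Rm)%type.
Local Notation Cn n := 'rV[R[i]]_n.
Local Notation lebR := (lebesgueR R).
Local Notation Re := (@complex.Re R).
Local Notation Im := (@complex.Im R).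

(** By uniqueness of Lebesgue measure it suffices to test intervals []b, c]]. For [s < 0] the
    preimage is open on the other side, hence the two cases. *)
Lemma lebesgue_affine (s a : R) (A : set Rm) : s != 0 -> measurable A ->
  (`|s|%:E * lebR ((fun x : Rm => (s * x + a : Rm)%R) @^-1` A) = lebR A)%E.
Proof.
move=> s0 mA.
have mphi : measurable_fun [set: Rm] (fun x : Rm => (s * x + a : Rm)).
  apply: measurable_funD; last exact: measurable_cst.
  exact: measurable_funM.
pose m := mscale (NngNum (normr_ge0 s)) (image_measure lebR mphi).
rewrite /lebesgueR/=.
suff : lebesgue_measure A = m A by move=> ->.
apply: lebesgue_measure_unique => //= _ [[b c]] _ <-.
rewrite /m /mscale /= /pushforward.
have [sp|sn] := ltP 0 s.
  rewrite (_ : _ @^-1` _ = `](b - a) / s, (c - a) / s]%classic); last first.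
    apply/seteqP; split => x /=; rewrite !in_itv/= ltr_pdivrMr// ler_pdivlMr// => /andP[? ?];
      apply/andP; split; lra.
  rewrite /lebesgueR/= !lebesgue_measure_itv/= !lte_fin ltr_pM2r ?invr_gt0// ltrD2r.
  case: ifPn => _; last by rewrite mule0.
  rewrite -!EFinD -EFinM gtr0_norm//; congr (_%:E); field; exact: s0.
have {}sn : s < 0 by rewrite lt_neqAle s0.
rewrite (_ : _ @^-1` _ = `[(c - a) / s, (b - a) / s[%classic); last first.
  apply/seteqP; split => x /=; rewrite !in_itv/= ltr_ndivlMr// ler_ndivrMr// => /andP[? ?];
    apply/andP; split; lra.
rewrite /lebesgueR/= !lebesgue_measure_itv/= !lte_fin ltr_nM2r ?invr_lt0// ltrD2r.
case: ifPn => _; last by rewrite mule0.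
rewrite -!EFinD -EFinM ltr0_norm//; congr (_%:E); field; exact: s0.
Qed.

Lemma ge0_integral_affine (s a : R) (f : Rm -> \bar R) : s != 0 ->
  measurable_fun [set: Rm] f -> (forall x, 0 <= f x)%E ->
  (\int[lebR]_x f (s * x + a)%R = (`|s|^-1)%:E * \int[lebR]_x f x)%E.
Proof.
move=> s0 mf f0.
have mphi : measurable_fun [set: Rm] (fun x : Rm => (s * x + a : Rm)).
  apply: measurable_funD; last exact: measurable_cst.
  exact: measurable_funM.
have sV0 : 0 <= `|s|^-1 by rewrite invr_ge0.
transitivity (\int[image_measure lebR mphi]_x f x)%E.
  by rewrite ge0_integral_pushforward.
rewrite -[RHS](ge0_integral_mscale lebR measurableT (NngNum sV0))//.
apply: eq_measure_integral => A mA _.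
rewrite image_measureE [RHS](_ : _ = (`|s|^-1)%:E * lebR A)%E//.
by rewrite -(lebesgue_affine a s0 mA) muleA -EFinM mulVf ?normr_eq0// mul1e.
Qed.

Definition tuncons2 n (t : n.+1.-tuple Rm2) : n.-tuple Rm2 * Rm * Rm :=
  ([tuple of behead t], (tnth t ord0).1, (tnth t ord0).2).

Lemma tcons2K n : cancel (@tcons2 R n) (@tuncons2 n).
Proof.
move=> [[t x] y]; congr (_, _, _).
by apply/val_inj => /=.
Qed.

Lemma measurable_tuncons2 n : measurable_fun setT (@tuncons2 n).
Proof.
apply: measurable_fun_pair; first apply: measurable_fun_pair.
- apply/measurable_fun_tnthP => i.
  rewrite (_ : _ \o _ = (fun t => tnth t (lift ord0 i))); last first.
    by apply/funext => t /=; rewrite !(tnth_nth (0, 0))/= nth_behead.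
  exact: measurable_tnth.
- by apply: measurableT_comp => //; exact: measurable_tnth.
- by apply: measurableT_comp => //; exact: measurable_tnth.
Qed.

Lemma sigma_finite_lebesgue_tuple n : sigma_finite setT (lebesgue_tuple R n).
Proof.
elim: n => [|n IH] /=.
  exact: (@sigma_finiteT _ _ _ (\d_ ([tuple] : 0.-tuple Rm2))).
apply: (@sigma_finite_image _ _ _ _ _ _ _ _ (@measurable_tcons2 R n)
  (@measurable_tuncons2 n) (@tcons2K n)).
exact: (@sigma_finiteT _ _ _
  (prod_sfm (prod_sfm (sigma_finite_pack IH) lebR) lebR)).
Qed.

Definition lebT n := sigma_finite_pack (sigma_finite_lebesgue_tuple n).

Lemma integral_lebesgue_tupleS n (G : n.+1.-tuple Rm2 -> \bar R) :
  measurable_fun setT G -> (forall t, 0 <= G t)%E ->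
  (\int[lebesgue_tuple R n.+1]_t G t =
   \int[lebesgue_tuple R n]_t \int[lebR]_x \int[lebR]_y G (tcons2 (t, x, y)))%E.
Proof.
move=> mG G0 /=.
rewrite ge0_integral_pushforward//; last exact: measurable_tcons2.
rewrite preimage_setT.
have mGt : measurable_fun setT (G \o @tcons2 R n).
  by apply: measurableT_comp => //; exact: measurable_tcons2.
rewrite (@fubini_tonelli1 _ _ _ _ _ (prod_sfm (lebT n) lebR) lebR)//.
rewrite (@fubini_tonelli1 _ _ _ _ _ (lebT n) lebR)//.
- exact: (@measurable_fun_fubini_tonelli_F _ _ _ _ _ lebR _ mGt (fun p => G0 _)).
- by move=> x; apply: integral_ge0 => y _; exact: G0.
- by move=> x; exact: G0.
Qed.


Lemma integral_lebesgue_tuple0 (G : 0.-tuple Rm2 -> \bar R) :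
  measurable_fun setT G ->
  (\int[lebesgue_tuple R 0]_t G t = G [tuple])%E.
Proof.
by move=> mG; rewrite integral_dirac// diracE mem_set// mul1e.
Qed.

Definition taff n (s : 'I_n -> R) (a : 'I_n -> Rm2) (t : n.-tuple Rm2) :
    n.-tuple Rm2 :=
  [tuple (s j * (tnth t j).1 + (a j).1, s j * (tnth t j).2 + (a j).2) | j < n].

Lemma measurable_taff n (s : 'I_n -> R) a : measurable_fun setT (@taff n s a).
Proof.
apply/measurable_fun_tnthP => i.
rewrite (_ : _ \o _ = (fun t =>
  (s i * (tnth t i).1 + (a i).1, s i * (tnth t i).2 + (a i).2))); last first.
  by apply/funext => t /=; rewrite tnth_mktuple.
apply: measurable_fun_pair; apply: measurable_funD => //; apply: measurable_funM => //;
  by apply: measurableT_comp => //; exact: measurable_tnth.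
Qed.

Lemma taff_tcons2 n (s : 'I_n.+1 -> R) a (t : n.-tuple Rm2) x y :
  taff s a (tcons2 (t, x, y)) =
  tcons2 (taff (s \o lift ord0) (a \o lift ord0) t,
          s ord0 * x + (a ord0).1, s ord0 * y + (a ord0).2).
Proof.
apply: eq_from_tnth => i; rewrite tnth_mktuple.
case: (unliftP ord0 i) => [j|] ->; last by rewrite !(tnth_nth (0, 0)).
have H (u : n.-tuple Rm2) x' y' : tnth (tcons2 (u, x', y')) (lift ord0 j) = tnth u j.
  by rewrite !(tnth_nth (0, 0)).
by rewrite !H tnth_mktuple.
Qed.

Section TonelliTuple.
Variables (n : nat) (G : n.+1.-tuple Rm2 -> \bar R).
Hypotheses (mG : measurable_fun setT G) (G0 : forall t, (0 <= G t)%E).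

Let mGt : measurable_fun setT (G \o @tcons2 R n).
Proof. by apply: measurableT_comp => //; exact: measurable_tcons2. Qed.

Let mJ : measurable_fun setT (fun p : n.-tuple Rm2 * Rm =>
  \int[lebR]_y G (tcons2 (p, y)))%E.
Proof. exact: (@measurable_fun_fubini_tonelli_F _ _ _ _ _ lebR _ mGt (fun p => G0 _)). Qed.

Lemma measurable_tonelli2 : measurable_fun setT (fun t =>
  \int[lebR]_x \int[lebR]_y G (tcons2 (t, x, y)))%E.
Proof.
apply: (@measurable_fun_fubini_tonelli_F _ _ _ _ _ lebR _ mJ).
by move=> p; exact: integral_ge0.
Qed.

Lemma measurable_tonelli1 t : measurable_fun setT (fun x =>
  \int[lebR]_y G (tcons2 (t, x, y)))%E.
Proof. exact: (measurableT_comp mJ). Qed.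

Lemma measurable_tonelli0 t x : measurable_fun setT (fun y => G (tcons2 (t, x, y))).
Proof. exact: (measurableT_comp mGt). Qed.

End TonelliTuple.

Lemma integral_taff n (s : 'I_n -> R) a (G : n.-tuple Rm2 -> \bar R) :
  (forall j, s j != 0) ->
  measurable_fun setT G -> (forall t, 0 <= G t)%E ->
  (\int[lebesgue_tuple R n]_t G (taff s a t) =
   (\prod_j (s j ^+ 2)^-1)%:E * \int[lebesgue_tuple R n]_t G t)%E.
Proof.
elim: n => [|n IH] in s a G *.
  move=> _ mG G0; rewrite big_ord0 mul1e !integral_lebesgue_tuple0//.
    by congr G; apply: eq_from_tnth => -[].
  by apply: measurableT_comp => //; exact: measurable_taff.
move=> s0 mG G0.
rewrite integral_lebesgue_tupleS//; last first.
  by apply: measurableT_comp => //; exact: measurable_taff.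
have sV : 0 <= `|s ord0|^-1 by rewrite invr_ge0.
under eq_integral => t _.
  under eq_integral => x _.
    under eq_integral do rewrite taff_tcons2.
    rewrite (ge0_integral_affine (a ord0).2 (s0 ord0)
      (measurable_tonelli0 mG _ _))//.
    over.
  rewrite ge0_integralZl_EFin//; last 2 first.
    - move=> x _; exact: integral_ge0.
    - apply: (measurableT_comp (f := fun x => \int[lebR]_y G (tcons2 (taff (s \o lift ord0) (a \o lift ord0) t, x, y)))%E).
        exact: measurable_tonelli1.
      by apply: measurable_funD => //; exact: measurable_funM.
  rewrite (ge0_integral_affine (a ord0).1 (s0 ord0) (measurable_tonelli1 mG G0 _))//; last first.
    by move=> x; exact: integral_ge0.
  over.
have K0 t : (0 <= \int[lebR]_x \int[lebR]_y G (tcons2 (t, x, y)))%E.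
  by apply: integral_ge0 => x _; exact: integral_ge0.
have mK := measurable_tonelli2 mG G0.
have mKt : measurable_fun setT ((fun t => \int[lebR]_x \int[lebR]_y G (tcons2 (t, x, y)))%E
    \o taff (s \o lift ord0) (a \o lift ord0)).
  by apply: measurableT_comp => //; exact: measurable_taff.
rewrite ge0_integralZl_EFin//; last 2 first.
  - by move=> t _; apply: mule_ge0 => //; exact: K0.
  - exact: measurable_funeM.
rewrite ge0_integralZl_EFin//.
have := IH (s \o lift ord0) (a \o lift ord0) _ (fun j => s0 _) mK K0.
move=> /= ->.
rewrite [in RHS]integral_lebesgue_tupleS// !muleA -!EFinM big_ord_recl/=.
congr (_%:E * _)%E; rewrite -invfM -expr2 real_normK ?num_real//.
Qed.

Lemma lsc_measurable n (f : Cn n -> R) :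
  (forall x, open [set z | x < f z]) -> measurable_fun setT f.
Proof.
move=> H; apply: (measurability _ (RGenOInfty.measurableE R)) => _ [_ [x ->] <-].
rewrite setTI (_ : _ @^-1` _ = [set z | x < f z]); first exact: (sub_sigma_algebra (H x)).
by apply/seteqP; split => z /=; rewrite in_itv/= andbT.
Qed.

Lemma lsc_emeasurable n (D : set (Cn n)) (f : Cn n -> \bar R) : open D ->
  (forall x : R, open [set z | D z /\ (x%:E < f z)%E]) -> measurable_fun D f.
Proof.
move=> oD H mD.
suff : measurable_fun D f by apply.
apply: (measurability _ (ErealGenOInfty.measurableE R)) => _ [_ [x ->] <-].
rewrite (_ : _ `&` _ = [set z | D z /\ (x%:E < f z)%E]); first exact: (sub_sigma_algebra (H x)).
by apply/seteqP; split => z /= [Dz]; rewrite in_itv/= andbT.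
Qed.

Lemma continuous_measurable n (f : Cn n -> R) :
  (forall z e, 0 < e -> exists2 r, 0 < r & forall w, enorm (w - z) < r ->
     `|f w - f z| < e) -> measurable_fun setT f.
Proof.
move=> H; apply: lsc_measurable => x; apply: open_enorm => z /= xz.
have [|r r0 rP] := H z (f z - x); first by rewrite subr_gt0.
by exists r => // w /rP; rewrite ltr_norml => /andP[? _]; lra.
Qed.

Lemma measurable_Re_coord n (j : 'I_n) :
  measurable_fun setT (fun z : Cn n => Re (z 0 j)).
Proof.
apply: continuous_measurable => z e e0; exists e => // w; apply: le_lt_trans.
rewrite -Re_opp -Re_add; apply: le_trans (Re_le_normc _) _.
by have := coord_le_enorm (w - z) j; rewrite !mxE.
Qed.

Lemma measurable_Im_coord n (j : 'I_n) :
  measurable_fun setT (fun z : Cn n => Im (z 0 j)).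
Proof.
apply: continuous_measurable => z e e0; exists e => // w; apply: le_lt_trans.
rewrite -Im_opp -Im_add; apply: le_trans (Im_le_normc _) _.
by have := coord_le_enorm (w - z) j; rewrite !mxE.
Qed.

Definition tuple_of_row n (z : Cn n) : n.-tuple Rm2 :=
  [tuple (Re (z 0 j), Im (z 0 j)) | j < n].

Lemma tuple_of_rowK n : cancel (@tuple_of_row n) (@row_of_tuple R n).
Proof.
by move=> z; apply/rowP => j; rewrite mxE tnth_mktuple /=; case: (z 0 j).
Qed.

Lemma row_of_tupleK n : cancel (@row_of_tuple R n) (@tuple_of_row n).
Proof.
move=> t; apply: eq_from_tnth => j; rewrite tnth_mktuple mxE /=.
by case: (tnth t j).
Qed.

Lemma measurable_tuple_of_row n : measurable_fun setT (@tuple_of_row n).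
Proof.
apply/measurable_fun_tnthP => j.
rewrite (_ : _ \o _ = fun z : Cn n => (Re (z 0 j), Im (z 0 j))); last first.
  by apply/funext => z /=; rewrite tnth_mktuple.
by apply: measurable_fun_pair; [exact: measurable_Re_coord|exact: measurable_Im_coord].
Qed.

(** The sigma-algebra on rows is generated by open sets; the bimeasurable bijection with tuples
    brings measurability down to real coordinates. *)
Lemma measurable_rowP d (T : measurableType d) n (h : T -> Cn n) :
  measurable_fun setT h <->
  (forall j, measurable_fun setT (fun x => Re (h x 0 j)) /\
             measurable_fun setT (fun x => Im (h x 0 j))).
Proof.
split => [mh j|H]; first split.
- exact: (measurableT_comp (@measurable_Re_coord n j)).
- exact: (measurableT_comp (@measurable_Im_coord n j)).
rewrite (_ : h = @row_of_tuple R n \o (@tuple_of_row n \o h)); last first.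
  by apply/funext => x /=; rewrite tuple_of_rowK.
apply: measurableT_comp; first exact: measurable_row_of_tuple.
apply/measurable_fun_tnthP => j.
rewrite (_ : _ \o _ = fun x => (Re (h x 0 j), Im (h x 0 j))); last first.
  by apply/funext => z /=; rewrite tnth_mktuple.
by have [? ?] := H j; apply: measurable_fun_pair.
Qed.

Lemma measurable_rowD d (T : measurableType d) n (h k : T -> Cn n) :
  measurable_fun setT h -> measurable_fun setT k ->
  measurable_fun setT (fun x => h x + k x).
Proof.
move=> /measurable_rowP mh /measurable_rowP mk; apply/measurable_rowP => j.
have [? ?] := mh j; have [? ?] := mk j; split.
  by under eq_fun do rewrite mxE Re_add; exact: measurable_funD.
by under eq_fun do rewrite mxE Im_add; exact: measurable_funD.
Qed.

Lemma measurable_rowZ d (T : measurableType d) n (c : T -> R[i]) (h : T -> Cn n) :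
  measurable_fun setT (fun x => Re (c x)) ->
  measurable_fun setT (fun x => Im (c x)) -> measurable_fun setT h ->
  measurable_fun setT (fun x => c x *: h x).
Proof.
move=> mc1 mc2 /measurable_rowP mh; apply/measurable_rowP => j.
have [? ?] := mh j; split.
  under eq_fun do rewrite mxE Re_mul.
  by apply: measurable_funB; exact: measurable_funM.
under eq_fun do rewrite mxE Im_mul.
by apply: measurable_funD; exact: measurable_funM.
Qed.

Lemma measurable_rowZc d (T : measurableType d) n (c : R[i]) (h : T -> Cn n) :
  measurable_fun setT h -> measurable_fun setT (fun x => c *: h x).
Proof. by move=> mh; apply: measurable_rowZ. Qed.

Lemma measurable_rowN d (T : measurableType d) n (h : T -> Cn n) :
  measurable_fun setT h -> measurable_fun setT (fun x => - h x).
Proof.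
by move=> mh; under eq_fun do rewrite -scaleN1r; exact: measurable_rowZc.
Qed.

Lemma measurable_rowB d (T : measurableType d) n (h k : T -> Cn n) :
  measurable_fun setT h -> measurable_fun setT k ->
  measurable_fun setT (fun x => h x - k x).
Proof. by move=> mh mk; apply: measurable_rowD => //; exact: measurable_rowN. Qed.

Lemma sigma_finite_lebesgueC n : sigma_finite setT (lebesgueC R n).
Proof.
apply: (@sigma_finite_image _ _ _ _ _ _ _ _ (@measurable_row_of_tuple R n)
  (@measurable_tuple_of_row n) (@row_of_tupleK n)).
exact: sigma_finite_lebesgue_tuple.
Qed.

Definition lebC n := sigma_finite_pack (sigma_finite_lebesgueC n).

Lemma integral_lebesgueC n (f : Cn n -> \bar R) :
  measurable_fun setT f -> (forall z, 0 <= f z)%E ->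
  (\int[lebesgueC R n]_z f z =
   \int[lebesgue_tuple R n]_t f (row_of_tuple t))%E.
Proof.
move=> mf f0; rewrite ge0_integral_pushforward ?preimage_setT//.
exact: measurable_row_of_tuple.
Qed.

Lemma integral_row_affine n (s : 'I_n -> R) (a : Cn n) (f : Cn n -> \bar R) :
  (forall j, s j != 0) ->
  measurable_fun setT f -> (forall z, 0 <= f z)%E ->
  (\int[lebesgueC R n]_z f (\row_j (real_complex R (s j) * z 0 j + a 0 j))%R =
   (\prod_j (s j ^+ 2)^-1)%:E * \int[lebesgueC R n]_z f z)%E.
Proof.
move=> s0 mf f0.
pose b j := (Re (a 0 j), Im (a 0 j)).
have E (t : n.-tuple Rm2) :
  (\row_j (real_complex R (s j) * row_of_tuple t 0 j + a 0 j)) =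
  row_of_tuple (taff s b t).
  apply/rowP => j; rewrite !mxE tnth_mktuple /= /b; case: (a 0 j) => x y /=.
  case: (tnth t j) => u v /=; simpc; by [].
have mrow : measurable_fun setT
    (fun z : Cn n => \row_j (real_complex R (s j) * z 0 j + a 0 j)).
  apply/measurable_rowP => j; split.
    under eq_fun do rewrite mxE Re_add Re_mul /= mul0r subr0.
    apply: measurable_funD => //; apply: measurable_funM => //.
    exact: measurable_Re_coord.
  under eq_fun do rewrite mxE Im_add Im_mul /= mul0r addr0.
  apply: measurable_funD => //; apply: measurable_funM => //.
  exact: measurable_Im_coord.
rewrite integral_lebesgueC//; last exact: measurableT_comp.
under eq_integral do rewrite E.
rewrite (integral_taff b s0 (G := f \o @row_of_tuple R n)).
- by rewrite integral_lebesgueC.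
- by apply: measurableT_comp => //; exact: measurable_row_of_tuple.
- by move=> t; exact: f0.
Qed.

Lemma integral_rowD n (a : Cn n) (f : Cn n -> \bar R) :
  measurable_fun setT f -> (forall z, 0 <= f z)%E ->
  (\int[lebesgueC R n]_z f (z + a)%R = \int[lebesgueC R n]_z f z)%E.
Proof.
move=> mf f0.
rewrite -[RHS]mul1e [1%E](_ : _ = (\prod_(j < n) (1 ^+ 2 : R)^-1)%:E); last first.
  by congr _%:E; rewrite big1// => j _; rewrite expr1n invr1.
rewrite -(integral_row_affine a (s := fun=> 1))//.
by apply: eq_integral => z _; congr f; apply/rowP => j; rewrite !mxE mul1r.
Qed.

Lemma integral_row_refl n (a : Cn n) (f : Cn n -> \bar R) :
  measurable_fun setT f -> (forall z, 0 <= f z)%E ->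
  (\int[lebesgueC R n]_z f (a - z)%R = \int[lebesgueC R n]_z f z)%E.
Proof.
move=> mf f0.
rewrite -[RHS]mul1e [1%E](_ : _ = (\prod_(j < n) ((-1) ^+ 2 : R)^-1)%:E); last first.
  by congr _%:E; rewrite big1// => j _; rewrite sqrrN expr1n invr1.
rewrite -(integral_row_affine a (s := fun=> -1))//.
apply: eq_integral => z _; congr f; apply/rowP => j.
by rewrite !mxE rmorphN1 mulN1r addrC.
Qed.

Lemma integral_row_scale n (t : R) (f : Cn n -> \bar R) : t != 0 ->
  measurable_fun setT f -> (forall z, 0 <= f z)%E ->
  (\int[lebesgueC R n]_z f (real_complex R t *: z) =
   ((t ^+ 2) ^- n)%:E * \int[lebesgueC R n]_z f z)%E.
Proof.
move=> t0 mf f0.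
have -> : (t ^+ 2) ^- n = \prod_(j < n) ((t : R) ^+ 2)^-1.
  by rewrite big_const_ord iter_mulr_1 exprVn.
rewrite -(integral_row_affine 0 (s := fun=> t))//.
by apply: eq_integral => z _; congr f; apply/rowP => j; rewrite !mxE addr0.
Qed.

(* The Fubini trick for Haar uniqueness: for all [f], [g] the double integral of
   [f x * g (S y - x)] equals both mu(f) nu(g) and nu(f) mu(g), nu being the
   image of mu; taking [g = f \o S] gives mu(f) ^ 2 = nu(f) ^ 2. *)
Lemma integral_involution n (S : Cn n -> Cn n) (f : Cn n -> \bar R) :
  measurable_fun setT S -> {morph S : x y / x + y} -> involutive S ->
  measurable_fun setT f -> (forall z, 0 <= f z)%E ->
  (\int[lebesgueC R n]_z f (S z) = \int[lebesgueC R n]_z f z)%E.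
Proof.
move=> mS SD SK mf f0.
have SN x : S (- x) = - S x.
  apply: (addIr (S x)); rewrite addNr -SD addNr.
  by apply: (addIr (S 0)); rewrite -SD !add0r.
pose g := f \o S.
have mg : measurable_fun setT g by exact: measurableT_comp.
have g0 z : (0 <= g z)%E by exact: f0.
pose mu (h : Cn n -> \bar R) := (\int[lebesgueC R n]_z h z)%E.
suff H : (mu f * mu (g \o S) = mu g * mu (f \o S))%E.
  move: H; rewrite (_ : g \o S = f); last by apply/funext => z /=; rewrite /g /= SK.
  rewrite -/g -/(mu g) -/(mu f).
  have mf0 : (0 <= mu f)%E by exact: integral_ge0.
  have mg0 : (0 <= mu g)%E by exact: integral_ge0.
  case: (mu f) mf0 => [x| |//] x0; case: (mu g) mg0 => [y| |//] y0;
    rewrite ?mulyy -?EFinM //.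
  move: x0 y0; rewrite !lee_fin => x0 y0 [] xy; congr _%:E; apply/eqP.
  by rewrite -(@eqrXn2 _ 2)// !expr2 xy.
pose F (p : Cn n * Cn n) := (f p.1 * g (S p.2 - p.1)%R)%E.
have mphi : measurable_fun setT (fun p : Cn n * Cn n => S p.2 - p.1).
  by apply: measurable_rowB; [exact: measurableT_comp|].
have mF : measurable_fun setT F.
  apply: emeasurable_funM; first exact: measurableT_comp.
  exact: (measurableT_comp mg mphi).
have F0 p : (0 <= F p)%E by exact: mule_ge0.
have nuE h y : measurable_fun setT h -> (forall z, 0 <= h z)%E ->
    (\int[lebesgueC R n]_z h (S z - y)%R = mu (h \o S))%E.
  move=> mh h0; rewrite /mu -(integral_rowD (- S y) (f := h \o S)).
  - by apply: eq_integral => z _ /=; rewrite SD SN SK.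
  - exact: measurableT_comp.
  - by move=> z; exact: h0.
have J1 : (\int[lebC n]_x \int[lebC n]_y F (x, y) = mu f * mu (g \o S))%E.
  transitivity (\int[lebC n]_x (f x * mu (g \o S)))%E.
    apply: eq_integral => x _.
    transitivity (f x * \int[lebesgueC R n]_y g (S y - x)%R)%E; last by rewrite nuE.
    rewrite -ge0_integralZl//.
    by apply: (measurableT_comp mg); apply: measurable_rowB.
  rewrite ge0_integralZr//.
  by apply: integral_ge0 => z _; exact: g0.
have J2 : (\int[lebC n]_y \int[lebC n]_x F (x, y) = mu g * mu (f \o S))%E.
  pose F' (p : Cn n * Cn n) := (f (S p.2 - p.1)%R * g p.1)%E.
  have mF' : measurable_fun setT F'.
    apply: emeasurable_funM; first exact: (measurableT_comp mf mphi).
    exact: measurableT_comp.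
  transitivity (\int[lebC n]_y \int[lebC n]_x F' (x, y))%E.
    apply: eq_integral => y _.
    rewrite -(integral_row_refl (S y) (f := fun x => F' (x, y)))//.
    - by apply: eq_integral => x _; rewrite /F /F' /= subKr.
    - by apply: (measurableT_comp mF').
    - by move=> z; exact: mule_ge0.
  rewrite -(@fubini_tonelli _ _ _ _ _ (lebC n) (lebC n) F' mF') //; last by move=> z; exact: mule_ge0.
  transitivity (\int[lebC n]_x (g x * mu (f \o S)))%E.
    apply: eq_integral => x _.
    transitivity ((\int[lebesgueC R n]_y f (S y - x)%R) * g x)%E; last first.
      by rewrite nuE// muleC.
    rewrite -ge0_integralZr//.
    by apply: (measurableT_comp mf); apply: measurable_rowB.
  rewrite ge0_integralZr//.
  by apply: integral_ge0 => z _; exact: f0.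
rewrite -J1 -J2; exact: (@fubini_tonelli _ _ _ _ _ (lebC n) (lebC n) F mF F0).
Qed.

End Lebesgue.

(** * Cubes and anisotropic dilations *)

Section Cube.
Variable R : realType.
Local Notation Rm := (measurableTypeR R).
Local Notation Rm2 := (Rm * Rm)%type.
Local Notation Cn n := 'rV[R[i]]_n.
Local Notation lebR := (lebesgueR R).
Local Notation Re := (@complex.Re R).
Local Notation Im := (@complex.Im R).

Definition cube (n : nat) (r : R) : set (Cn n) :=
  [set z | forall j, `|Re (z 0 j)| < r /\ `|Im (z 0 j)| < r].
Arguments cube : clear implicits.

Lemma measurable_cube n r : measurable (cube n r).
Proof.
rewrite (_ : cube n r = \bigcap_(j : 'I_n)
    ([set z | `|Re (z 0 j)| < r] `&` [set z | `|Im (z 0 j)| < r])); last first.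
  by apply/seteqP; split => z /= H j; [move=> _|]; exact: H.
apply: fin_bigcap_measurable => // j _; apply: measurableI.
  rewrite [X in measurable X](_ : _ = setT `&` (fun z : Cn n => Re (z 0 j)) @^-1` `]- r, r[%classic).
    by apply: measurable_Re_coord => //; exact: measurable_itv.
  by rewrite setTI; apply/seteqP; split => z /=; rewrite in_itv/= ltr_norml.
rewrite [X in measurable X](_ : _ = setT `&` (fun z : Cn n => Im (z 0 j)) @^-1` `]- r, r[%classic).
  by apply: measurable_Im_coord => //; exact: measurable_itv.
by rewrite setTI; apply/seteqP; split => z /=; rewrite in_itv/= ltr_norml.
Qed.

Lemma lebesgueC_cube n r : 0 < r -> lebesgueC R n (cube n r) = ((2 * r) ^+ 2 ^+ n)%:E.
Proof.
move=> r0; rewrite image_measureE.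
have mC n' : measurable (@row_of_tuple R n' @^-1` cube n' r).
  rewrite -[X in measurable X]setTI; apply: measurable_row_of_tuple => //.
  exact: measurable_cube.
elim: n => [|n IH] /=.
  by rewrite expr0 /= diracE mem_set// => -[].
rewrite /pushforward (_ : _ @^-1` _ =
  ((@row_of_tuple R n @^-1` cube n r) `*` ball (0 : R) r) `*` ball (0 : R) r); last first.
  apply/seteqP; split => [[[t x] y] H|[[t x] y] [[/= H1 H2] H3]].
    have := H ord0; rewrite !mxE (tnth_nth (0, 0))/= => -[Hx Hy].
    split; last by rewrite /ball/= sub0r normrN.
    split; last by rewrite /ball/= sub0r normrN.
    by move=> j; have := H (lift ord0 j); rewrite !mxE !(tnth_nth (0, 0)).
  move=> j; rewrite mxE; case: (unliftP ord0 j) => [i|] ->.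
    by have := H1 i; rewrite !mxE !(tnth_nth (0, 0)).
  have -> : tnth (tcons2 (t, x, y)) ord0 = (x, y) by [].
  by move: H2 H3; rewrite /ball/= !sub0r !normrN.
have mB : measurable (ball (0 : R) r : set Rm).
  by rewrite ball_itv; exact: measurable_itv.
rewrite (product_measure1E _ _ (measurableX (mC n) mB) mB).
rewrite [X in (X * _)%E](product_measure1E _ _ (mC n) mB) IH.
have E : lebesgue_measure (ball (0 : R) r : set Rm) = (2 * r)%:E.
  rewrite ball_itv lebesgue_measure_itv/= lte_fin sub0r add0r ifT; last lra.
  by rewrite opprK -EFinD -mulr2n mulr_natl.
transitivity (((2 * r) ^+ 2 ^+ n)%:E * (2 * r)%:E * (2 * r)%:E)%E.
  by congr (_ * _ * _)%E; exact: E.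
by rewrite -!EFinM [in RHS]exprSr -mulrA -expr2.
Qed.

End Cube.

Section LinearChange.
Variables (R : realType) (n : nat).
Local Notation Cn := 'rV[R[i]]_n.
Local Notation rc := (real_complex R).
Local Notation Re := (@complex.Re R).
Local Notation Im := (@complex.Im R).
Implicit Types (v z x y : Cn).

(** A linear involution, so [integral_involution] gives its invariance of volume without any
    determinant. It serves to turn an arbitrary complex line into a coordinate axis. *)
Definition householder v x : Cn := x - (2 * hdot x v / hdot v v) *: v.

Lemma householderD v : {morph householder v : x y / x + y}.
Proof.
move=> x y; rewrite /householder hdotDl mulrDr mulrDl scalerDl opprD.
by rewrite addrACA.
Qed.

Lemma householderZ v c x : householder v (c *: x) = c *: householder v x.
Proof.
rewrite /householder hdotZl scalerBr scalerA; congr (_ - _ *: _); ring.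
Qed.

Lemma householderK v : involutive (householder v).
Proof.
move=> x; have [->|v0] := eqVneq v 0; first by rewrite /householder !scaler0 !subr0.
have vv : hdot v v != 0 by rewrite hdotzz_eq0.
rewrite /householder hdotBl hdotZl -addrA -opprD -scalerDl.
rewrite [X in x - X *: v](_ : _ = 0) ?scale0r ?subr0//; field; exact: vv.
Qed.

Lemma householder_adj v x y : hdot (householder v x) y = hdot x (householder v y).
Proof.
rewrite /householder hdotBl hdotBr hdotZl hdotZr; congr (_ - _).
rewrite !rmorphM/= fmorphV/= -!hdotC.
rewrite (_ : ((1 + 1) -i* (0 + 0))%C = 2); first by ring.
by apply/eqP; rewrite eq_complex /= addr0 oppr0 !eqxx.
Qed.


Lemma Re_sum (I : Type) (s : seq I) (P : pred I) (F : I -> R[i]) :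
  Re (\sum_(i <- s | P i) F i) = \sum_(i <- s | P i) Re (F i).
Proof. exact: (big_morph Re (@Re_add R)). Qed.

Lemma Im_sum (I : Type) (s : seq I) (P : pred I) (F : I -> R[i]) :
  Im (\sum_(i <- s | P i) F i) = \sum_(i <- s | P i) Im (F i).
Proof. exact: (big_morph Im (@Im_add R)). Qed.

Lemma measurable_hdot d (T : measurableType d) (h k : T -> Cn) :
  measurable_fun setT h -> measurable_fun setT k ->
  measurable_fun setT (fun t : T => Re (hdot (h t) (k t))) /\
  measurable_fun setT (fun t : T => Im (hdot (h t) (k t))).
Proof.
move=> /measurable_rowP mh /measurable_rowP mk.
have Rc (c : R[i]) : Re (c^*)%C = Re c by case: c.
have Ic (c : R[i]) : Im (c^*)%C = - Im c by case: c.
split.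
  under eq_fun do rewrite /hdot Re_sum.
  apply: measurable_sum => j; have [? ?] := mh j; have [? ?] := mk j.
  under eq_fun do rewrite Re_mul Rc Ic mulrN opprK.
  by apply: measurable_funD; exact: measurable_funM.
under eq_fun do rewrite /hdot Im_sum.
apply: measurable_sum => j; have [? ?] := mh j; have [? ?] := mk j.
under eq_fun do rewrite Im_mul Rc Ic mulrN addrC.
by apply: measurable_funB; exact: measurable_funM.
Qed.

Lemma measurable_householder v : measurable_fun setT (householder v).
Proof.
have [mR mI] := measurable_hdot (@measurable_id _ Cn setT) (measurable_cst v : measurable_fun setT (fun _ : Cn => v)).
apply: measurable_rowB => //; apply: measurable_rowZ => //.
  under eq_fun do rewrite [2 * _]mulrC -mulrA Re_mul.
  by apply: measurable_funB; apply: measurable_funM.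
under eq_fun do rewrite [2 * _]mulrC -mulrA Im_mul.
by apply: measurable_funD; apply: measurable_funM.
Qed.

(* The reflection exchanging [z] and [c *: e], where |c| = |z| and <z, c e> is real. *)
Lemma householder_to_axis (z : Cn) (j : 'I_n) :
  exists v c, householder v z = c *: delta_mx 0 j /\ Normc.normc c = enorm z.
Proof.
pose c : R[i] := if z 0 j == 0 then rc (enorm z)
  else rc (enorm z / Normc.normc (z 0 j)) * z 0 j.
have nc : Normc.normc c = enorm z.
  rewrite /c; case: ifPn => z0; first by rewrite normc_real ger0_norm// enorm_ge0.
  have z1 : Normc.normc (z 0 j) != 0 by rewrite normc_eq0.
  rewrite Normc.normcM normc_real ger0_norm ?divr_ge0 ?enorm_ge0 ?normc_ge0//.
  by rewrite divfK.
have hze w : hdot w (c *: delta_mx 0 j) = w 0 j * (c^*)%C.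
  rewrite hdotZr mulrC /hdot (bigD1 j)//= big1 => [|i ij].
    by rewrite mxE !eqxx addr0 rmorph1 mulr1.
  by rewrite mxE (negbTE ij) andbF rmorph0 mulr0.
have zc : z 0 j * (c^*)%C = (z 0 j)^*%C * c.
  rewrite /c; case: ifPn => [/eqP ->|_]; first by rewrite conjc0 !mul0r.
  rewrite rmorphM /= oppr0 -/(rc _) [RHS]mulrC -mulrA [RHS]mulrC mulrA.
  by rewrite mulrAC.
pose v := z - c *: delta_mx 0 j.
exists v, c; split => //.
have [v0|v0] := eqVneq v 0.
  rewrite /householder v0 scaler0 subr0; apply/eqP; rewrite -subr_eq0.
  exact/eqP.
have vv : hdot v v != 0 by rewrite hdotzz_eq0.
have zv : hdot v v = 2 * hdot z v.
  rewrite {1 3}/v !hdotBl /v !hdotBr !hze.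
  rewrite (hdotC z (c *: delta_mx 0 j)) hze mxE mxE !eqxx mulr1.
  rewrite mul_conj nc -hdotzz rmorphM /= conjcK -zc; ring.
rewrite /householder -zv divff// scale1r /v opprB addrC subrK//.
Qed.

Lemma hdot_delta x (j : 'I_n) : hdot x (delta_mx 0 j) = x 0 j.
Proof.
rewrite /hdot (bigD1 j)//= big1 => [|i ij].
  by rewrite mxE !eqxx addr0 rmorph1 mulr1.
by rewrite mxE (negbTE ij) andbF rmorph0 mulr0.
Qed.

Definition line_dilation (s : R) z x : Cn := x + (rc s - 1) *: line_proj z x.

Lemma measurable_line_proj z : measurable_fun setT (line_proj z).
Proof.
have [mR mI] := measurable_hdot (@measurable_id _ Cn setT) (measurable_cst z : measurable_fun setT (fun _ : Cn => z)).
apply: measurable_rowZ => //.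
  under eq_fun do rewrite Re_mul.
  by apply: measurable_funB; apply: measurable_funM.
under eq_fun do rewrite Im_mul.
by apply: measurable_funD; apply: measurable_funM.
Qed.

(** A Householder reflection sends [z] to a multiple of a basis vector and conjugates the dilation
    to the scaling of one complex coordinate, that is of two real ones: hence [s ^+ 2]. *)
Lemma integral_line_dilation (s : R) z (f : Cn -> \bar R) : s != 0 -> z != 0 ->
  measurable_fun setT f -> (forall x, 0 <= f x)%E ->
  (\int[lebesgueC R n]_x f (line_dilation s z x) =
   ((s ^+ 2)^-1)%:E * \int[lebesgueC R n]_x f x)%E.
Proof.
move=> s0 z0 mf f0.
have [j _] : exists j, z 0 j != 0.
  by move: z0; apply: contra_neqP => H; apply/rowP => j; rewrite mxE;
    apply/eqP/negP => /negP zj; apply: H; exists j.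
have [v [c [Sz nc]]] := householder_to_axis z j.
set S := householder v in Sz.
have c0 : c != 0 by rewrite -normc_eq0 nc enorm_eq0.
pose D x : Cn := \row_i (rc (if i == j then s else 1) * x 0 i + (0 : Cn) 0 i).
have TE x : line_dilation s z x = S (D (S x)).
  have -> : D (S x) = S x + (rc s - 1) *: line_proj (S z) (S x).
    have ejj : (delta_mx 0 j : Cn) 0 j = 1 by rewrite mxE !eqxx.
    rewrite Sz /line_proj hdotZl !hdotZr !hdot_delta ejj mulr1.
    have cc : (c^*)%C != 0 by rewrite conjc_eq0.
    rewrite scalerA /D; move: (S x) => y; apply/rowP => i; rewrite !mxE addr0.
    have [->|ij] := eqVneq i j; last by rewrite andbF !mulr0 addr0 mul1r.
    by rewrite eqxx /= !mulr1; field; rewrite cc c0.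
  rewrite /S householderD householderK householderZ; congr (_ + _ *: _).
  by rewrite /line_proj householderZ !householder_adj !householderK.
under eq_integral do rewrite TE.
have mS := measurable_householder v.
have mfS : measurable_fun setT (f \o S) by exact: measurableT_comp.
have mD : measurable_fun setT D.
  apply/measurable_rowP => i; split.
    under eq_fun do rewrite mxE Re_add Re_mul /= mul0r subr0.
    apply: measurable_funD => //; apply: measurable_funM => //.
    exact: measurable_Re_coord.
  under eq_fun do rewrite mxE Im_add Im_mul /= mul0r addr0.
  apply: measurable_funD => //; apply: measurable_funM => //.
  exact: measurable_Im_coord.
rewrite (@integral_involution R n S (f \o S \o D) mS (householderD v) (householderK v))//; last 2 first.
- exact: measurableT_comp.
- by move=> x; exact: f0.
rewrite (integral_row_affine 0 (s := fun i => if i == j then s else 1) _ mfS)//; last 2 first.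
- by move=> i; case: ifP => // _; exact: oner_neq0.
- by move=> x; exact: f0.
rewrite (@integral_involution R n S f mS (householderD v) (householderK v))//.
congr (_%:E * _)%E; rewrite (bigD1 j)//= eqxx big1 ?mulr1// => i /negbTE ->.
by rewrite expr1n invr1.
Qed.

(* The linear part of the affine map carrying a fixed cube around 0 into a
   Bergman ball around z: such a ball has size 1 - |z|^2 along z and
   sqrt (1 - |z|^2) across. *)
Definition adapt z x : Cn :=
  rc (defect z) *: line_proj z x + rc (Num.sqrt (defect z)) *: (x - line_proj z x).

(** Factoring out a homogeneous dilation leaves a dilation of one complex line. The Jacobian is then
    [defect z ^+ n] from the first and one more [defect z] from the second. *)
Lemma adaptE z x : uball z ->
  adapt z x = rc (Num.sqrt (defect z)) *: line_dilation (Num.sqrt (defect z)) z x.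
Proof.
move=> /defect_gt0/ltW d0; rewrite /adapt -{1}(sqr_sqrtr d0).
apply/rowP => i; rewrite !mxE rmorphXn /=; ring.
Qed.

Lemma measurable_adapt z : measurable_fun setT (adapt z).
Proof.
by apply: measurable_rowD; apply: measurable_rowZc; [|apply: measurable_rowB => //];
  exact: measurable_line_proj.
Qed.

(** The factor is the density of the invariant measure at [z]: averages over Bergman balls against
    it become integrals over a fixed region. *)
Lemma integral_adapt z (f : Cn -> \bar R) : uball z ->
  measurable_fun setT f -> (forall x, 0 <= f x)%E ->
  (\int[lebesgueC R n]_x f (z + adapt z x)%R =
   ((defect z ^+ n.+1)^-1)%:E * \int[lebesgueC R n]_x f x)%E.
Proof.
move=> zB mf f0; have d0 := defect_gt0 zB.
have mfz : measurable_fun setT (fun x => f (z + x)).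
  by apply: (measurableT_comp mf); apply: measurable_rowD.
transitivity (((defect z ^+ n.+1)^-1)%:E * \int[lebesgueC R n]_x f (z + x)%R)%E; last first.
  congr (_ * _)%E; rewrite -(integral_rowD z mf f0).
  by apply: eq_integral => x _; rewrite addrC.
have s0 : Num.sqrt (defect z) != 0 by rewrite gt_eqF// sqrtr_gt0.
under eq_integral do rewrite adaptE//.
have [->|z0] := eqVneq z 0.
  have d1 : defect (0 : Cn) = 1 by rewrite /defect enorm0 expr0n subr0.
  rewrite d1 expr1n invr1 mul1e; apply: eq_integral => x _.
  by rewrite sqrtr1 /line_dilation subrr scale0r addr0 scale1r.
have mfs : measurable_fun setT (fun x => f (z + rc (Num.sqrt (defect z)) *: x)).
  by apply: (measurableT_comp mfz); apply: measurable_rowZc.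
rewrite (@integral_line_dilation _ z (fun x => f (z + rc (Num.sqrt (defect z)) *: x))%R)//.
rewrite (@integral_row_scale R n _ (fun x => f (z + x)%R))//.
rewrite sqr_sqrtr ?ltW// muleA -EFinM; congr (_%:E * _)%E.
by rewrite exprSr invfM mulrC.
Qed.

End LinearChange.

(** * Segment integrals and bisection *)

Section SegmentIntegral.
Variable R : realType.
Local Notation mu := (@lebesgue_measure R).
Implicit Types (g h : R -> R) (a b m x : R).

Definition seg_int g a b : R := \int[mu]_(x in `[a, b]) g x.

(** [y] may leave the segment: the integrands are traces of functions that are continuous around
    it. *)
Definition cont_on g a b := forall x, a <= x -> x <= b ->
  forall e, 0 < e -> exists2 r, 0 < r & forall y, `|y - x| < r -> `|g y - g x| < e.

Lemma cont_onB g h a b : cont_on g a b -> cont_on h a b ->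
  cont_on (fun x => g x - h x) a b.
Proof.
move=> Hg Hh x ax xb e e0; have e2 : 0 < e / 2 by rewrite divr_gt0.
have [r r0 rg] := Hg x ax xb _ e2; have [s s0 sh] := Hh x ax xb _ e2.
exists (Num.min r s) => [|y]; first by rewrite lt_min r0.
rewrite lt_min => /andP[/rg + /sh]; rewrite !ltr_norml; lra.
Qed.

Lemma cont_on_abs g a b : cont_on g a b -> cont_on (fun x => `|g x|) a b.
Proof.
move=> H x ax xb e e0; have [r r0 rg] := H x ax xb e e0; exists r => // y /rg.
exact: le_lt_trans (ler_dist_dist _ _).
Qed.

Lemma cont_on_integrable g a b : cont_on g a b -> mu.-integrable `[a, b] (EFin \o g).
Proof.
move=> H; apply: continuous_compact_integrable; first exact: segment_compact.
apply: continuous_in_subspaceT => x; rewrite inE/= in_itv/= => /andP[ax xb].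
apply/(@cvgrPdist_lt _ R^o) => e e0; have [r r0 rg] := H x ax xb e e0.
apply/nbhs_ballP; exists r => //= y; rewrite /ball/= => xy.
by rewrite distrC; apply: rg; rewrite distrC.
Qed.

Lemma seg_int_split g a m b : a <= m -> m <= b -> cont_on g a b ->
  seg_int g a b = seg_int g a m + seg_int g m b.
Proof.
move=> am mb /cont_on_integrable ig.
have := @Rintegral_itvB R g (BLeft a) (BRight b) m ig.
rewrite !bnd_simp am mb => /(_ isT isT).
rewrite Rintegral_itv_obnd_cbnd; last first.
  by apply: integrableS ig => //; apply: subset_itvr; rewrite bnd_simp.
by move=> /eqP; rewrite subr_eq addrC => /eqP.
Qed.

Lemma seg_int_bound g k M a b : a <= b -> cont_on g a b ->
  (forall x, a <= x -> x <= b -> `|g x - k| <= M) ->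
  `|seg_int g a b - k * (b - a)| <= M * (b - a).
Proof.
move=> ab /cont_on_integrable ig H.
have len : fine (mu `[a, b]) = b - a.
  rewrite lebesgue_measure_itv/= lte_fin.
  by move: ab; rewrite le_eqVlt => /predU1P[->|->//]; rewrite ltxx subrr.
have icst r : mu.-integrable `[a, b] (EFin \o fun=> r).
  by apply: cont_on_integrable => x _ _ e e0; exists 1 => // y _; rewrite subrr normr0.
have E r : \int[mu]_(x in `[a, b]) r = r * (b - a) by rewrite Rintegral_cst// len.
have lo : (k - M) * (b - a) <= seg_int g a b.
  rewrite -E; apply: le_Rintegral => // x /=; rewrite in_itv/= => /andP[ax xb].
  by have := H x ax xb; rewrite ler_norml; lra.
have hi : seg_int g a b <= (k + M) * (b - a).
  rewrite -E; apply: le_Rintegral => // x /=; rewrite in_itv/= => /andP[ax xb].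
  by have := H x ax xb; rewrite ler_norml; lra.
by rewrite ler_norml; move: lo hi; rewrite !mulrDl mulNr; lra.
Qed.

Lemma seg_int_le g h a b : a <= b -> cont_on g a b -> cont_on h a b ->
  (forall x, a <= x -> x <= b -> g x <= h x) -> seg_int g a b <= seg_int h a b.
Proof.
move=> ab /cont_on_integrable ig /cont_on_integrable ih H.
by apply: le_Rintegral => // x /=; rewrite in_itv/= => /andP[]; exact: H.
Qed.

Lemma seg_intB g h a b : cont_on g a b -> cont_on h a b ->
  seg_int (fun x => g x - h x) a b = seg_int g a b - seg_int h a b.
Proof.
move=> /cont_on_integrable ig /cont_on_integrable ih.
exact: RintegralB.
Qed.

Lemma seg_int_norm g a b : cont_on g a b ->
  `|seg_int g a b| <= seg_int (fun x => `|g x|) a b.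
Proof. by move=> /cont_on_integrable ig; exact: le_normr_Rintegral. Qed.

Lemma eq_seg_int g h a b : (forall x, a <= x -> x <= b -> g x = h x) ->
  seg_int g a b = seg_int h a b.
Proof.
move=> H; apply: eq_Rintegral => x; rewrite inE/= in_itv/= => /andP[].
exact: H.
Qed.

End SegmentIntegral.

Section Bisection.
Variables (R : realType) (J : R -> R -> R -> R -> R) (a0 b0 c0 d0 : R).
Hypotheses (ab0 : a0 < b0) (cd0 : c0 < d0).
Hypothesis addx : forall a m b c d, a0 <= a -> a <= m -> m <= b -> b <= b0 ->
  c0 <= c -> c <= d -> d <= d0 -> J a b c d = J a m c d + J m b c d.
Hypothesis addy : forall a b c m d, a0 <= a -> a <= b -> b <= b0 ->
  c0 <= c -> c <= m -> m <= d -> d <= d0 -> J a b c d = J a b c m + J a b m d.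
Hypothesis loc : forall x y, a0 <= x -> x <= b0 -> c0 <= y -> y <= d0 ->
  forall e, 0 < e -> exists2 r, 0 < r & forall a b c d,
    a0 <= a -> a <= x -> x <= b -> b <= b0 ->
    c0 <= c -> c <= y -> y <= d -> d <= d0 -> b - a < r -> d - c < r ->
    `|J a b c d| <= e * (b - a + (d - c)) ^+ 2.

Let rect := (R * R * R * R)%type.
Let sub_rect (q : rect) := let: (a, b, c, d) := q in
  [/\ a0 <= a, a <= b, b <= b0, c0 <= c & c <= d /\ d <= d0].
Let refines (q q' : rect) :=
  let: (a, b, c, d) := q in let: (a', b', c', d') := q' in
  [/\ sub_rect q', [/\ a <= a', b' <= b, c <= c' & d' <= d],
    b' - a' = (b - a) / 2, d' - c' = (d - c) / 2 &
    `|J a b c d| <= 4 * `|J a' b' c' d'| ].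

(** If all four quarters had |J| below a quarter of the total, additivity and the triangle
    inequality would be contradictory. The premise is put inside the specification so that the
    choice is a total function that can be iterated. *)
Let refine (q : rect) : {q' : rect | sub_rect q -> refines q q'}.
Proof.
apply/cid; case: q => [[[a b] c] d].
have [sq|nsq] := pselect (sub_rect (a, b, c, d)); last by exists (a, b, c, d).
move: (sq) => [aa ab bb cc [cd dd]].
pose m := (a + b) / 2; pose l := (c + d) / 2.
have am : a <= m by rewrite /m; lra.
have mb : m <= b by rewrite /m; lra.
have cl : c <= l by rewrite /l; lra.
have ld : l <= d by rewrite /l; lra.
have E : J a b c d = J a m c l + J a m l d + (J m b c l + J m b l d).
  by rewrite (@addx a m b)// (@addy a m c l d)// ?(@addy m b c l d)//; lra.
have [h1|h1] := leP `|J a b c d| (4 * `|J a m c l|).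
  by exists (a, m, c, l) => _; repeat (split => //); rewrite /m /l; lra.
have [h2|h2] := leP `|J a b c d| (4 * `|J a m l d|).
  by exists (a, m, l, d) => _; repeat (split => //); rewrite /m /l; lra.
have [h3|h3] := leP `|J a b c d| (4 * `|J m b c l|).
  by exists (m, b, c, l) => _; repeat (split => //); rewrite /m /l; lra.
have [h4|h4] := leP `|J a b c d| (4 * `|J m b l d|).
  by exists (m, b, l, d) => _; repeat (split => //); rewrite /m /l; lra.
exfalso; move: (ler_normD (J a m c l + J a m l d) (J m b c l + J m b l d)).
move: (ler_normD (J a m c l) (J a m l d)) (ler_normD (J m b c l) (J m b l d)).
rewrite -E; lra.
Qed.

Let q_ (k : nat) : rect := iter k (fun q => sval (refine q)) (a0, b0, c0, d0).
Let a_ k := (q_ k).1.1.1.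
Let b_ k := (q_ k).1.1.2.
Let c_ k := (q_ k).1.2.
Let d_ k := (q_ k).2.

Let qE k : q_ k = (a_ k, b_ k, c_ k, d_ k).
Proof. by rewrite /a_ /b_ /c_ /d_; case: (q_ k) => [[[]]]. Qed.

Let q_sub k : sub_rect (q_ k).
Proof.
elim: k => [|k IH]; first by rewrite /q_/=; split => //; [exact: ltW|split => //; exact: ltW].
rewrite /q_ iterS -/(q_ k); have := svalP (refine (q_ k)) IH.
move: (sval _) => q'; rewrite qE; case: q' => [[[a' b'] c'] d'] /=.
by case.
Qed.

Let q_ref k : refines (q_ k) (q_ k.+1).
Proof. by rewrite {2}/q_ iterS -/(q_ k); exact: (svalP (refine (q_ k)) (q_sub k)). Qed.

Let q_size k : [/\ b_ k - a_ k = (b0 - a0) / 2 ^+ k, d_ k - c_ k = (d0 - c0) / 2 ^+ k &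
  `|J a0 b0 c0 d0| <= 4 ^+ k * `|J (a_ k) (b_ k) (c_ k) (d_ k)| ].
Proof.
elim: k => [|k [IH1 IH2 IH3]].
  by rewrite /a_ /b_ /c_ /d_ /q_/= !expr0 !divr1 mul1r.
have := q_ref k; rewrite !qE => -[_ _ h1 h2 h3]; split.
- by rewrite h1 IH1 exprS invfM; ring.
- by rewrite h2 IH2 exprS invfM; ring.
- by apply: (le_trans IH3); rewrite exprSr -mulrA ler_pM2l// exprn_gt0.
Qed.

Let q_mono k j : (k <= j)%N -> [/\ a_ k <= a_ j, b_ j <= b_ k, c_ k <= c_ j & d_ j <= d_ k].
Proof.
elim: j => [|j IH]; first by rewrite leqn0 => /eqP ->; split.
rewrite leq_eqVlt => /predU1P[->|]; first by split.
rewrite ltnS => /IH[h1 h2 h3 h4].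
have := q_ref j; rewrite !qE => -[_ [h5 h6 h7 h8] _ _ _].
split; [exact: le_trans h5|exact: le_trans h2|exact: le_trans h7|exact: le_trans h4].
Qed.

Let q_lim (u v : nat -> R) : (forall k j, (k <= j)%N -> u k <= u j /\ v j <= v k) ->
  (forall k, u k <= v k) -> exists x, forall k, u k <= x <= v k.
Proof.
move=> mono uv.
have ub k : ubound (range u) (v k).
  move=> _ [j _ <-]; have [kj|/ltnW jk] := leqP k j.
    by apply: (le_trans (uv j)); have [] := mono _ _ kj.
  by apply: le_trans (uv k); have [] := mono _ _ jk.
exists (sup (range u)) => k; apply/andP; split.
  by apply: ub_le_sup; [exists (v 0); exact: ub|exists k].
by apply: ge_sup; [exists (u 0), 0|exact: ub].
Qed.

(** Goursat's argument with the contour integral abstracted into [J]. After [k] halvings |J| has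
    lost at most a factor [4 ^+ k], while the local bound at the common point of the rectangles
    makes it small compared with the square of their size, which has lost exactly that factor. *)
Lemma bisection_eq0 : J a0 b0 c0 d0 = 0.
Proof.
apply/eqP; rewrite -normr_le0 leNgt; apply/negP => K0.
have sub k : sub_rect (a_ k, b_ k, c_ k, d_ k) by rewrite -qE; exact: q_sub.
have [x xP] := @q_lim a_ b_ (fun k j kj => let: And4 h1 h2 _ _ := q_mono kj in conj h1 h2)
  (fun k => let: And5 _ h _ _ _ := sub k in h).
have [y yP] := @q_lim c_ d_ (fun k j kj => let: And4 _ _ h1 h2 := q_mono kj in conj h1 h2)
  (fun k => let: And5 _ _ _ _ h := sub k in proj1 h).
pose K : R := `|J a0 b0 c0 d0|; rewrite -/K in K0; pose s := b0 - a0 + (d0 - c0).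
have s0 : 0 < s by rewrite /s addr_gt0// subr_gt0.
(* With this tolerance the powers of 2 cancel and the two bounds combine into [K <= K / 2]. *)
have e0 : 0 < K / (2 * s ^+ 2) by rewrite divr_gt0// mulr_gt0// exprn_gt0.
have /andP[x1 x2] := xP 0; have /andP[y1 y2] := yP 0.
have [r r0 rP] := @loc x y x1 x2 y1 y2 _ e0.
have [k kr] : exists k : nat, s / 2 ^+ k < r.
  exists (Num.truncn (s / r)).+1; rewrite ltr_pdivrMr ?exprn_gt0//.
  rewrite mulrC -ltr_pdivrMr//; apply: (lt_le_trans (truncnS_gt _)).
  by rewrite -natrX ler_nat ltnW// ltn_expl.
have [h1 h2 h3] := q_size k; have [s1 s2 s3 s4 [s5 s6]] := sub k.
have /andP[xk1 xk2] := xP k; have /andP[yk1 yk2] := yP k.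
have p2 : 0 < (2 : R) ^+ k by rewrite exprn_gt0.
have le1 : (b0 - a0) / 2 ^+ k <= s / 2 ^+ k by rewrite ler_pM2r ?invr_gt0// /s; lra.
have le2 : (d0 - c0) / 2 ^+ k <= s / 2 ^+ k by rewrite ler_pM2r ?invr_gt0// /s; lra.
have := rP _ _ _ _ s1 xk1 xk2 s3 s4 yk1 yk2 s6.
rewrite h1 h2 => /(_ (le_lt_trans le1 kr) (le_lt_trans le2 kr)).
rewrite -mulrDl -/s => hJ.
have : K <= 4 ^+ k * (K / (2 * s ^+ 2) * (s / 2 ^+ k) ^+ 2).
  by apply: (le_trans h3); rewrite ler_pM2l ?exprn_gt0.
have -> : 4 ^+ k * (K / (2 * s ^+ 2) * (s / 2 ^+ k) ^+ 2) = K / 2.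
  have -> : (4 : R) ^+ k = (2 ^+ k) ^+ 2 by rewrite -exprM mulnC exprM; congr (_ ^+ _); ring.
  by field; rewrite !gt_eqF.
lra.
Qed.

End Bisection.

(** * Cauchy's theorem and formula on squares *)

Section ComplexDerivative.
Variable R : realType.
Local Notation C := R[i].
Local Notation normc := (@Normc.normc R).
Local Notation rc := (real_complex R).
Implicit Types (f g : C -> C) (z w h a b : C).

(** No difference quotient: the increment [h = 0] needs no exclusion, and sums and products reduce
    to the triangle inequality. *)
Definition cderiv f z a := forall e, 0 < e -> exists2 d, 0 < d & forall h,
  normc h < d -> normc (f (z + h) - f z - a * h) <= e * normc h.

Definition ccont f z := forall e, 0 < e -> exists2 d, 0 < d & forall h,
  normc h < d -> normc (f (z + h) - f z) < e.

Lemma cderiv_lip f z a : cderiv f z a -> exists2 d, 0 < d & forall h,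
  normc h < d -> normc (f (z + h) - f z) <= (normc a + 1) * normc h.
Proof.
move=> H; have [d d0 Hd] := H 1 ltr01; exists d => // h /Hd.
rewrite mul1r => Hh; rewrite -[f (z + h) - f z](subrK (a * h)).
apply: (le_trans (normcD _ _)); rewrite Normc.normcM mulrDl mul1r addrC lerD2l.
exact: Hh.
Qed.

Lemma cderiv_cont f z a : cderiv f z a -> ccont f z.
Proof.
move=> /cderiv_lip[d d0 Hd] e e0; have a0 := normc_ge0 a.
exists (Num.min d (e / (normc a + 1))).
  by rewrite lt_min d0 divr_gt0//; lra.
move=> h; rewrite lt_min => /andP[/Hd hd he]; apply: (le_lt_trans hd).
by rewrite mulrC -ltr_pdivlMr//; lra.
Qed.

Lemma cderiv_cst c z : cderiv (fun=> c) z 0.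
Proof.
move=> e e0; exists 1 => // h _.
by rewrite subrr mul0r subr0 Normc.normc0 mulr_ge0 ?normc_ge0// ltW.
Qed.

Lemma cderiv_id z : cderiv id z 1.
Proof.
move=> e e0; exists 1 => // h _.
by rewrite mul1r [z + h]addrC addrK subrr Normc.normc0 mulr_ge0 ?normc_ge0// ltW.
Qed.

Lemma cderivB f g z a b : cderiv f z a -> cderiv g z b ->
  cderiv (fun x => f x - g x) z (a - b).
Proof.
move=> Hf Hg e e0; have e2 : 0 < e / 2 by rewrite divr_gt0.
have [d d0 Hd] := Hf _ e2; have [d' d'0 Hd'] := Hg _ e2.
exists (Num.min d d') => [|h]; first by rewrite lt_min d0.
rewrite lt_min => /andP[/Hd h1 /Hd' h2].
rewrite (_ : _ - _ = (f (z + h) - f z - a * h) - (g (z + h) - g z - b * h)); last ring.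
apply: (le_trans (normcD _ _)); rewrite normc_opp; lra.
Qed.

Lemma cderivM f g z a b : cderiv f z a -> cderiv g z b ->
  cderiv (fun x => f x * g x) z (a * g z + f z * b).
Proof.
move=> Hf Hg e e0.
have a0 := normc_ge0 a; have g0 := normc_ge0 (g z); have f0 := normc_ge0 (f z).
have [d1 d10 Hd1] := cderiv_lip Hf.
pose M := normc (g z) + normc (f z) + normc a + 2.
have M0 : 0 < M by rewrite /M; lra.
have eM : 0 < e / M by rewrite divr_gt0.
have [d2 d20 Hd2] := Hf _ eM; have [d3 d30 Hd3] := Hg _ eM.
have [d4 d40 Hd4] := cderiv_cont Hg eM.
exists (Num.min (Num.min d1 d2) (Num.min d3 d4)).
  by rewrite !lt_min d10 d20 d30 d40.
move=> h; rewrite !lt_min => /andP[/andP[/Hd1 h1 /Hd2 h2] /andP[/Hd3 h3 /Hd4 h4]].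
rewrite (_ : _ - _ = (f (z + h) - f z - a * h) * g z + f z * (g (z + h) - g z - b * h)
   + (f (z + h) - f z) * (g (z + h) - g z)); last ring.
have n0 := normc_ge0 h.
apply: (@le_trans _ _ (e / M * normc h * normc (g z) + normc (f z) * (e / M * normc h)
  + ((normc a + 1) * normc h) * (e / M))).
  apply: (le_trans (normcD _ _)); apply: lerD.
    apply: (le_trans (normcD _ _)); rewrite !Normc.normcM.
    by apply: lerD; [apply: ler_pM|apply: ler_pM] => //; exact: normc_ge0.
  by rewrite Normc.normcM; apply: ler_pM => //; try exact: normc_ge0; exact: ltW.
rewrite (_ : _ + _ = e * normc h * ((normc (g z) + normc (f z) + normc a + 1) / M)); last ring.
rewrite -[leRHS]mulr1 ler_wpM2l ?mulr_ge0// ?ltW// ltr_pdivrMr// mul1r /M; lra.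
Qed.

Lemma cderivX f z a m : cderiv f z a -> exists b, cderiv (fun x => f x ^+ m) z b.
Proof.
move=> Hf; elim: m => [|m [b Hb]]; first by exists 0; exact: cderiv_cst.
have := cderivM Hf Hb.
rewrite (_ : (fun x => f x * f x ^+ m) = fun x => f x ^+ m.+1) => [H|].
  by exists (a * f z ^+ m + f z * b).
by apply/funext => x; rewrite exprS.
Qed.

Lemma cderiv_inv z : z != 0 -> cderiv (fun x => x^-1) z (- z ^- 2).
Proof.
move=> z0 e e0.
have nz : 0 < normc z by rewrite lt_neqAle eq_sym normc_eq0 z0 normc_ge0.
(* The first bound keeps |z + h| above |z| / 2; the second makes the exact remainder h^2 / (z^2 (z +
   h)) at most [e * normc h] in modulus. *)
exists (Num.min (normc z / 2) (e * normc z ^+ 3 / 2)).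
  by rewrite lt_min !divr_gt0// mulr_gt0// exprn_gt0.
move=> h; rewrite lt_min => /andP[h1 h2].
have zh : normc z / 2 <= normc (z + h).
  have := normcD (z + h) (- h); rewrite addrK normc_opp; lra.
have zh0 : z + h != 0.
  by rewrite -normc_eq0 gt_eqF// (lt_le_trans _ zh)// divr_gt0.
rewrite (_ : _ - _ = h ^+ 2 / (z ^+ 2 * (z + h))); last by field; rewrite z0 zh0.
rewrite Normc.normcM Normc.normcV normcX [X in X^-1]Normc.normcM normcX.
rewrite ler_pdivrMr ?mulr_gt0 ?exprn_gt0//; last by rewrite (lt_le_trans _ zh)// divr_gt0.
apply: (@le_trans _ _ (e * normc h * (normc z ^+ 2 * (normc z / 2)))).
  have -> : e * normc h * (normc z ^+ 2 * (normc z / 2)) = normc h * (e * normc z ^+ 3 / 2).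
    by ring.
  by rewrite expr2 ler_wpM2l ?normc_ge0// ltW.
apply: ler_wpM2l; first by rewrite mulr_ge0 ?normc_ge0// ltW.
by rewrite ler_pM2l// exprn_gt0.
Qed.

Lemma cderivZ f z a c : cderiv f z a -> cderiv (fun x => c * f x) z (c * a).
Proof. by move=> H; have := cderivM (@cderiv_cst c z) H; rewrite mul0r add0r. Qed.

Lemma cderiv_shift f z w a : cderiv f (z + w) a -> cderiv (fun x => f (z + x)) w a.
Proof. by move=> H e e0; have [d d0 Hd] := H e e0; exists d => // h /Hd; rewrite addrA. Qed.

End ComplexDerivative.

Section Contour.
Variable R : realType.
Local Notation C := R[i].
Local Notation normc := (@Normc.normc R).
Local Notation rc := (real_complex R).
Local Notation Re := (@complex.Re R).
Local Notation Im := (@complex.Im R).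
Implicit Types (f g h : C -> C) (z w : C) (a b c d r s : R).
Local Open Scope complex_scope.

Definition ccont_hseg f a b c := forall x, a <= x -> x <= b -> ccont f (x +i* c).
Definition ccont_vseg f a c d := forall y, c <= y -> y <= d -> ccont f (a +i* y).

(** [L] stands for [Re], [Im] or the modulus, all 1-Lipschitz. *)
Lemma cont_on_hseg f a b c (L : C -> R) :
  (forall u v, `|L u - L v| <= normc (u - v)) ->
  ccont_hseg f a b c -> cont_on (fun x => L (f (x +i* c))) a b.
Proof.
move=> LL H x ax xb e e0; have [r r0 Hr] := H x ax xb e e0; exists r => // y yx.
apply: (le_lt_trans (LL _ _)).
rewrite (_ : y +i* c = x +i* c + rc (y - x)); last by simpc; congr (_ +i* _); ring.
by apply: Hr; rewrite normc_real.
Qed.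

Lemma cont_on_vseg f a c d (L : C -> R) :
  (forall u v, `|L u - L v| <= normc (u - v)) ->
  ccont_vseg f a c d -> cont_on (fun y => L (f (a +i* y))) c d.
Proof.
move=> LL H x ax xb e e0; have [r r0 Hr] := H x ax xb e e0; exists r => // y yx.
apply: (le_lt_trans (LL _ _)).
rewrite (_ : a +i* y = a +i* x + 0 +i* (y - x)); last by simpc; congr (_ +i* _); ring.
by apply: Hr; rewrite /= expr0n add0r sqrtr_sqr.
Qed.

Lemma Re_lip u v : `|Re u - Re v| <= normc (u - v).
Proof. by rewrite -Re_opp -Re_add Re_le_normc. Qed.
Lemma Im_lip u v : `|Im u - Im v| <= normc (u - v).
Proof. by rewrite -Im_opp -Im_add Im_le_normc. Qed.
Lemma normc_lip u v : `|normc u - normc v| <= normc (u - v).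
Proof.
have h1 := normcD (u - v) v; have h2 := normcD (v - u) u.
rewrite !subrK in h1 h2; rewrite normcB in h2.
by rewrite ler_norml; apply/andP; split; lra.
Qed.

(* Real part of the integral of [h dz] along the boundary of [a, b] x [c, d]. *)
Definition contour h a b c d : R :=
  seg_int (fun x => Re (h (x +i* c)) - Re (h (x +i* d))) a b -
  seg_int (fun y => Im (h (b +i* y)) - Im (h (a +i* y))) c d.

Lemma contour_addx h a m b c d : a <= m -> m <= b ->
  ccont_hseg h a b c -> ccont_hseg h a b d ->
  ccont_vseg h a c d -> ccont_vseg h m c d -> ccont_vseg h b c d ->
  contour h a b c d = contour h a m c d + contour h m b c d.
Proof.
move=> am mb Hc Hd Ha Hm Hb; rewrite /contour.
have Cc := cont_on_hseg Re_lip Hc; have Cd := cont_on_hseg Re_lip Hd.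
have Ca := cont_on_vseg Im_lip Ha; have Cm := cont_on_vseg Im_lip Hm.
have Cb := cont_on_vseg Im_lip Hb.
rewrite (seg_int_split am mb (cont_onB Cc Cd)).
by rewrite (seg_intB Cb Ca) (seg_intB Cm Ca) (seg_intB Cb Cm); ring.
Qed.

Lemma contour_addy h a b c m d : c <= m -> m <= d ->
  ccont_hseg h a b c -> ccont_hseg h a b m -> ccont_hseg h a b d ->
  ccont_vseg h a c d -> ccont_vseg h b c d ->
  contour h a b c d = contour h a b c m + contour h a b m d.
Proof.
move=> cm md Hc Hm Hd Ha Hb; rewrite /contour.
have Cc := cont_on_hseg Re_lip Hc; have Cd := cont_on_hseg Re_lip Hd.
have Cm := cont_on_hseg Re_lip Hm.
have Ca := cont_on_vseg Im_lip Ha; have Cb := cont_on_vseg Im_lip Hb.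
rewrite (seg_int_split cm md (cont_onB Cb Ca)).
by rewrite (seg_intB Cc Cd) (seg_intB Cc Cm) (seg_intB Cm Cd); ring.
Qed.

Lemma contourB g h a b c d :
  ccont_hseg g a b c -> ccont_hseg g a b d ->
  ccont_vseg g a c d -> ccont_vseg g b c d ->
  ccont_hseg h a b c -> ccont_hseg h a b d ->
  ccont_vseg h a c d -> ccont_vseg h b c d ->
  contour (fun z => g z - h z) a b c d = contour g a b c d - contour h a b c d.
Proof.
move=> g1 g2 g3 g4 h1 h2 h3 h4; rewrite /contour.
have G1 := cont_on_hseg Re_lip g1; have G2 := cont_on_hseg Re_lip g2.
have G3 := cont_on_vseg Im_lip g3; have G4 := cont_on_vseg Im_lip g4.
have H1 := cont_on_hseg Re_lip h1; have H2 := cont_on_hseg Re_lip h2.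
have H3 := cont_on_vseg Im_lip h3; have H4 := cont_on_vseg Im_lip h4.
transitivity (seg_int (fun x => (Re (g (x +i* c)) - Re (g (x +i* d))) -
    (Re (h (x +i* c)) - Re (h (x +i* d)))) a b -
  seg_int (fun y => (Im (g (b +i* y)) - Im (g (a +i* y))) -
    (Im (h (b +i* y)) - Im (h (a +i* y)))) c d).
  congr (_ - _); apply: eq_seg_int => x _ _.
    by rewrite !Re_add !Re_opp; ring.
  by rewrite !Im_add !Im_opp; ring.
rewrite (seg_intB (cont_onB G1 G2) (cont_onB H1 H2)).
by rewrite (seg_intB (cont_onB G4 G3) (cont_onB H4 H3)); ring.
Qed.

Lemma contour_bound h a b c d M1 M2 : a <= b -> c <= d ->
  ccont_hseg h a b c -> ccont_hseg h a b d ->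
  ccont_vseg h a c d -> ccont_vseg h b c d ->
  (forall x, a <= x -> x <= b -> normc (h (x +i* c)) <= M1 /\ normc (h (x +i* d)) <= M1) ->
  (forall y, c <= y -> y <= d -> normc (h (a +i* y)) <= M2 /\ normc (h (b +i* y)) <= M2) ->
  `|contour h a b c d| <= 2 * M1 * (b - a) + 2 * M2 * (d - c).
Proof.
move=> ab cd h1 h2 h3 h4 B1 B2; rewrite /contour.
have H1 := cont_on_hseg Re_lip h1; have H2 := cont_on_hseg Re_lip h2.
have H3 := cont_on_vseg Im_lip h3; have H4 := cont_on_vseg Im_lip h4.
apply: (le_trans (ler_normB _ _)); apply: lerD.
  have := @seg_int_bound _ _ 0 (2 * M1) _ _ ab (cont_onB H1 H2).
  rewrite mul0r subr0; apply => x ax xb; rewrite subr0.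
  have [b1 b2] := B1 x ax xb; apply: (le_trans (ler_normB _ _)).
  have := Re_le_normc (h (x +i* c)); have := Re_le_normc (h (x +i* d)); lra.
have := @seg_int_bound _ _ 0 (2 * M2) _ _ cd (cont_onB H4 H3).
rewrite mul0r subr0; apply => x ax xb; rewrite subr0.
have [b1 b2] := B2 x ax xb; apply: (le_trans (ler_normB _ _)).
have := Im_le_normc (h (a +i* x)); have := Im_le_normc (h (b +i* x)); lra.
Qed.

Definition cdiff_at h z := exists A, cderiv h z A.

Lemma cdiff_at_cont h z : cdiff_at h z -> ccont h z.
Proof. by case=> A; exact: cderiv_cont. Qed.

Lemma goursat h a b c d : a < b -> c < d ->
  (forall x y, a <= x -> x <= b -> c <= y -> y <= d -> cdiff_at h (x +i* y)) ->
  contour h a b c d = 0.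
Proof.
move=> ab cd H.
have HC x y ax xb cy yd : ccont h (x +i* y) := cdiff_at_cont (H x y ax xb cy yd).
apply: (@bisection_eq0 _ (contour h)) => //.
- move=> a' m b' c' d' *; apply: contour_addx => // t *; apply: HC; lra.
- move=> a' m b' c' d' *; apply: contour_addy => // t *; apply: HC; lra.
move=> x y ax xb cy yd e e0.
have [A HA] := H x y ax xb cy yd.
have e2 : 0 < e / 2 by rewrite divr_gt0.
(* Half the radius, because the modulus is estimated by the sum of the two coordinate distances. *)
have [r r0 Hr] := HA _ e2; exists (r / 2); first by rewrite divr_gt0.
move=> a' b' c' d' aa ax' xb' bb cc cy' yd' dd ba dc.
pose s := b' - a' + (d' - c').
have err u v : a' <= u -> u <= b' -> c' <= v -> v <= d' ->
    normc (h (u +i* v) - h (x +i* y) - A * ((u - x) +i* (v - y))) <= e / 2 * s.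
  move=> au ub cv vd.
  have E : u +i* v = x +i* y + (u - x) +i* (v - y) by simpc; congr (_ +i* _); ring.
  have nl : normc ((u - x) +i* (v - y)) <= `|u - x| + `|v - y| := normc_le_ReIm _.
  have ux : `|u - x| <= b' - a' by rewrite ler_norml; apply/andP; split; lra.
  have vy : `|v - y| <= d' - c' by rewrite ler_norml; apply/andP; split; lra.
  rewrite E; apply: (le_trans (Hr _ _)); first by lra.
  by rewrite ler_pM2l// /s; lra.
have s0 : 0 <= s by rewrite /s; lra.
have cch v : c' <= v -> v <= d' -> ccont_hseg h a' b' v.
  by move=> *; move=> t *; apply: HC; lra.
have ccv u : a' <= u -> u <= b' -> ccont_vseg h u c' d'.
  by move=> *; move=> t *; apply: HC; lra.
have H1 := cont_on_hseg Re_lip (cch c' (lexx _) (le_trans cy' yd')).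
have H2 := cont_on_hseg Re_lip (cch d' (le_trans cy' yd') (lexx _)).
have H3 := cont_on_vseg Im_lip (ccv a' (lexx _) (le_trans ax' xb')).
have H4 := cont_on_vseg Im_lip (ccv b' (le_trans ax' xb') (lexx _)).
(* The affine approximation of [h] contributes [Im A] times the area of the rectangle to the
   horizontal integral and as much to the vertical one. The two cancel in [contour], and only the
   approximation error remains. *)
have B1 := @seg_int_bound _ _ (Im A * (d' - c')) (e * s) _ _ (le_trans ax' xb') (cont_onB H1 H2).
have B2 := @seg_int_bound _ _ (Im A * (b' - a')) (e * s) _ _ (le_trans cy' yd') (cont_onB H4 H3).
have K1 : `|seg_int (fun t => Re (h (t +i* c')) - Re (h (t +i* d'))) a' b'
    - Im A * (d' - c') * (b' - a')| <= e * s * (b' - a').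
  apply: B1 => t at_ tb.
  have e1 := err t c' at_ tb (lexx _) (le_trans cy' yd').
  have e2' := err t d' at_ tb (le_trans cy' yd') (lexx _).
  have := Re_le_normc ((h (t +i* c') - h (x +i* y) - A * ((t - x) +i* (c' - y))) -
     (h (t +i* d') - h (x +i* y) - A * ((t - x) +i* (d' - y)))).
  rewrite !(Re_add, Re_opp, Re_mul) /= => k1.
  rewrite (_ : _ - _ = Re (h (t +i* c')) - Re (h (x +i* y)) -
      (Re A * (t - x) - Im A * (c' - y)) -
      (Re (h (t +i* d')) - Re (h (x +i* y)) - (Re A * (t - x) - Im A * (d' - y)))); last ring.
  apply: (le_trans k1); apply: (le_trans (normcD _ _)); rewrite normc_opp.
  by move: e1 e2'; lra.
have K2 : `|seg_int (fun t => Im (h (b' +i* t)) - Im (h (a' +i* t))) c' d'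
    - Im A * (b' - a') * (d' - c')| <= e * s * (d' - c').
  apply: B2 => t ct td.
  have e1 := err b' t (le_trans ax' xb') (lexx _) ct td.
  have e2' := err a' t (lexx _) (le_trans ax' xb') ct td.
  have := Im_le_normc ((h (b' +i* t) - h (x +i* y) - A * ((b' - x) +i* (t - y))) -
     (h (a' +i* t) - h (x +i* y) - A * ((a' - x) +i* (t - y)))).
  rewrite !(Im_add, Im_opp, Im_mul) /= => k1.
  rewrite (_ : _ - _ = Im (h (b' +i* t)) - Im (h (x +i* y)) -
      (Re A * (t - y) + Im A * (b' - x)) -
      (Im (h (a' +i* t)) - Im (h (x +i* y)) - (Re A * (t - y) + Im A * (a' - x)))); last ring.
  apply: (le_trans k1); apply: (le_trans (normcD _ _)); rewrite normc_opp.
  by move: e1 e2'; lra.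
have -> : e * (b' - a' + (d' - c')) ^+ 2 = e * s * (b' - a') + e * s * (d' - c').
  by rewrite /s; ring.
rewrite /contour; move: K1 K2.
have -> : Im A * (b' - a') * (d' - c') = Im A * (d' - c') * (b' - a') by ring.
rewrite !ler_norml; set S1 := seg_int _ _ _; set S2 := seg_int _ _ _.
by move: S1 S2 => S1 S2 /andP[? ?] /andP[? ?]; apply/andP; split; lra.
Qed.

Definition sq_contour h r := contour h (- r) r (- r) r.

(** The frame between the squares is cut into four rectangles avoiding 0, two side strips of full
    height and one piece above and one below the small square; [goursat] kills each of them. *)
Lemma sq_contour_shrink h s r : 0 < s -> s <= r ->
  (forall x y, `|x| <= r -> `|y| <= r -> x +i* y != 0 -> cdiff_at h (x +i* y)) ->
  sq_contour h r = sq_contour h s.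
Proof.
move=> s0; rewrite le_eqVlt => /predU1P[->//|sr] H.
have N x y : `|x| <= r -> `|y| <= r -> s <= `|x| \/ s <= `|y| -> cdiff_at h (x +i* y).
  move=> xr yr xy; apply: H => //; rewrite eq_complex /=; apply/negP => /andP[/eqP x0 /eqP y0].
  by move: xy; rewrite x0 y0 normr0; case; lra.
have G a b c d : a < b -> c < d -> - r <= a -> b <= r -> - r <= c -> d <= r ->
    s <= a \/ b <= - s \/ s <= c \/ d <= - s -> contour h a b c d = 0.
  move=> ab cd *; apply: goursat => // x y *; apply: N.
  - by rewrite ler_norml; apply/andP; split; lra.
  - by rewrite ler_norml; apply/andP; split; lra.
  - rewrite !ler_normr; have [|[|[|]]] : s <= a \/ b <= - s \/ s <= c \/ d <= - s by [].
    + by move=> ?; left; apply/orP; left; lra.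
    + by move=> ?; left; apply/orP; right; lra.
    + by move=> ?; right; apply/orP; left; lra.
    + by move=> ?; right; apply/orP; right; lra.
have CH a b c : - r <= a -> b <= r -> - r <= c -> c <= r -> s <= `|c| -> ccont_hseg h a b c.
  move=> *; move=> x *; apply: cdiff_at_cont; apply: N; last by right.
  - by rewrite ler_norml; apply/andP; split; lra.
  - by rewrite ler_norml; apply/andP; split; lra.
have CV a c d : - r <= a -> a <= r -> - r <= c -> d <= r -> s <= `|a| -> ccont_vseg h a c d.
  move=> *; move=> x *; apply: cdiff_at_cont; apply: N; last by left.
  - by rewrite ler_norml; apply/andP; split; lra.
  - by rewrite ler_norml; apply/andP; split; lra.
have A1 : s <= `|s| by rewrite ger0_norm// ltW.
have A2 : s <= `|- s| by rewrite normrN.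
have A3 : s <= `|r| by rewrite ger0_norm; lra.
have A4 : s <= `|- r| by rewrite normrN.
rewrite /sq_contour (@contour_addx h (- r) (- s) r); try lra;
  [|by apply: CH => //; lra|by apply: CH => //; lra|by apply: CV => //; lra
   |by apply: CV => //; lra|by apply: CV => //; lra].
rewrite (@contour_addx h (- s) s r); try lra;
  [|by apply: CH => //; lra|by apply: CH => //; lra|by apply: CV => //; lra
   |by apply: CV => //; lra|by apply: CV => //; lra].
rewrite (@contour_addy h (- s) s (- r) (- s) r); try lra;
  [|by apply: CH => //; lra|by apply: CH => //; lra|by apply: CH => //; lra
   |by apply: CV => //; lra|by apply: CV => //; lra].
rewrite (@contour_addy h (- s) s (- s) s r); try lra;
  [|by apply: CH => //; lra|by apply: CH => //; lra|by apply: CH => //; lra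
   |by apply: CV => //; lra|by apply: CV => //; lra].
rewrite (G (- r) (- s) (- r) r); try lra.
rewrite (G s r (- r) r); try lra.
rewrite (G (- s) s (- r) (- s)); try lra.
rewrite (G (- s) s s r); try lra.
Qed.

Lemma sq_normc_ge s (z : C) : 0 <= s -> s <= `|Re z| \/ s <= `|Im z| -> s <= normc z.
Proof. by move=> s0 [] h; apply: (le_trans h); [exact: Re_le_normc|exact: Im_le_normc]. Qed.

(** A removable singularity: on the square of half-side [s] the integrand is at most a small
    multiple of 1 / s, and the length of the contour is 8 s. *)
Lemma sq_contour_eq0 h r : 0 < r ->
  (forall x y, `|x| <= r -> `|y| <= r -> x +i* y != 0 -> cdiff_at h (x +i* y)) ->
  (forall e, 0 < e -> exists2 d, 0 < d &
     forall z, z != 0 -> normc z < d -> normc (h z) * normc z <= e) ->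
  sq_contour h r = 0.
Proof.
move=> r0 H H0; apply/eqP; rewrite -normr_le0; apply/ler_addgt0Pr => e e0; rewrite add0r.
(* The perimeter is 8 times the half-side. *)
have e8 : 0 < e / 8 by rewrite divr_gt0.
have [d d0 Hd] := H0 _ e8.
pose s := Num.min r (d / 3).
have s0 : 0 < s by rewrite lt_min r0 divr_gt0.
have sr : s <= r by rewrite ge_min lexx.
have sd : s <= d / 3 by rewrite ge_min lexx orbT.
rewrite (sq_contour_shrink s0 sr)//.
have nz x y : s <= `|x| \/ s <= `|y| -> x +i* y != 0.
  move=> /(@sq_normc_ge s (x +i* y) (ltW s0)) h1.
  by rewrite -normc_eq0 gt_eqF// (lt_le_trans s0).
have bd x y : `|x| <= s -> `|y| <= s -> s <= `|x| \/ s <= `|y| ->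
    cdiff_at h (x +i* y) /\ normc (h (x +i* y)) <= e / 8 / s.
  move=> xs ys sxy; split; first by apply: H (nz _ _ sxy); lra.
  have h1 := @sq_normc_ge s (x +i* y) (ltW s0) sxy.
  have h2 : normc (x +i* y) < d by have := normc_le_ReIm (x +i* y); rewrite /=; lra.
  rewrite ler_pdivlMr//; apply: le_trans (Hd _ (nz _ _ sxy) h2).
  by rewrite ler_wpM2l ?normc_ge0.
have ns : s <= `|s| by rewrite ger0_norm// ltW.
have nns : s <= `|- s| by rewrite normrN.
have ns' : `|s| <= s by rewrite ger0_norm// ltW.
have nns' : `|- s| <= s by rewrite normrN.
have ab t : - s <= t -> t <= s -> `|t| <= s by move=> *; rewrite ler_norml; apply/andP.
have -> : e = 2 * (e / 8 / s) * (s - - s) + 2 * (e / 8 / s) * (s - - s).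
  by field; rewrite gt_eqF.
apply: contour_bound; try lra.
- by move=> x *; apply: cdiff_at_cont; apply: (bd _ _ _ _ _).1; auto.
- by move=> x *; apply: cdiff_at_cont; apply: (bd _ _ _ _ _).1; auto.
- by move=> x *; apply: cdiff_at_cont; apply: (bd _ _ _ _ _).1; auto.
- by move=> x *; apply: cdiff_at_cont; apply: (bd _ _ _ _ _).1; auto.
- by move=> x *; split; apply: (bd _ _ _ _ _).2; auto.
- by move=> x *; split; apply: (bd _ _ _ _ _).2; auto.
Qed.

Lemma seg_int_cst (k a b : R) : a <= b -> seg_int (fun=> k) a b = k * (b - a).
Proof.
move=> ab; apply/eqP; rewrite -subr_eq0 -normr_le0 -[leRHS](mul0r (b - a)).
apply: seg_int_bound => // [x _ _ e e0|x _ _].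
  by exists 1 => // y _; rewrite subrr normr0.
by rewrite subrr normr0.
Qed.

(* [-i / z] has contour integral [2 pi]; any positive lower bound is enough. *)
Lemma sq_contour_inv s : 0 < s -> 4 <= sq_contour (fun z => (0 -i* 1) * z^-1) s.
Proof.
move=> s0; rewrite /sq_contour /contour.
have invE (x y : R) : (0 -i* 1) * (x +i* y)^-1 =
    (- y / (x ^+ 2 + y ^+ 2)) +i* (- x / (x ^+ 2 + y ^+ 2)).
  by rewrite /GRing.inv /=; simpc; congr (_ +i* _); ring.
have s2 : 0 < s ^+ 2 by rewrite exprn_gt0.
have E1 : seg_int (fun x => Re ((0 -i* 1) * (x +i* - s)^-1) - Re ((0 -i* 1) * (x +i* s)^-1)) (- s) s
    = seg_int (fun x => 2 * s / (x ^+ 2 + s ^+ 2)) (- s) s.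
  by apply: eq_seg_int => x _ _; rewrite !invE /= sqrrN; ring.
have E2 : seg_int (fun y => Im ((0 -i* 1) * (s +i* y)^-1) - Im ((0 -i* 1) * (- s +i* y)^-1)) (- s) s
    = seg_int (fun x => - (2 * s / (x ^+ 2 + s ^+ 2))) (- s) s.
  by apply: eq_seg_int => x _ _; rewrite !invE /= sqrrN [s ^+ 2 + _]addrC; ring.
rewrite E1 E2.
have cinv z : z != 0 -> ccont (fun z => (0 -i* 1) * z^-1) z.
  by move=> z0; apply: cderiv_cont; apply: cderivZ; exact: cderiv_inv.
have nz (x : R) (t : R) : `|t| = s -> x +i* t != 0.
  move=> ts; rewrite eq_complex negb_and /= -[t == 0]normr_eq0 ts (gt_eqF s0) orbT//.
have C1 : cont_on (fun x => 2 * s / (x ^+ 2 + s ^+ 2)) (- s) s.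
  have H1 := @cont_on_hseg _ (- s) s (- s) Re Re_lip
    (fun x _ _ => cinv _ (nz x (- s) _)).
  have H2 := @cont_on_hseg _ (- s) s s Re Re_lip
    (fun x _ _ => cinv _ (nz x s _)).
  have := cont_onB (H1 _) (H2 _); rewrite (gtr0_norm s0) normrN (gtr0_norm s0).
  move=> /(_ erefl erefl).
  rewrite (_ : (fun x => _ - _) = (fun x => 2 * s / (x ^+ 2 + s ^+ 2)))//.
  by apply/funext => x; rewrite !invE /= sqrrN; ring.
have C0 k : cont_on (fun=> k) (- s) s.
  by move=> x _ _ e e0; exists 1 => // y _; rewrite subrr normr0.
have ss : - s <= s by lra.
have lo x : - s <= x -> x <= s -> 1 / s <= 2 * s / (x ^+ 2 + s ^+ 2).
  move=> xs sx; have x2 : x ^+ 2 <= s ^+ 2.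
    rewrite -subr_ge0 (_ : _ - _ = (s - x) * (s + x)); last ring.
    by rewrite mulr_ge0//; lra.
  have p : 0 < x ^+ 2 + s ^+ 2 by have := sqr_ge0 x; lra.
  rewrite ler_pdivlMr// mulrAC ler_pdivrMr// mul1r -mulrA -expr2; lra.
have L1 := seg_int_le ss (C0 _) C1 lo.
have E3 : seg_int (fun x => - (2 * s / (x ^+ 2 + s ^+ 2))) (- s) s =
   - seg_int (fun x => 2 * s / (x ^+ 2 + s ^+ 2)) (- s) s.
  have := seg_intB (C0 0) C1; rewrite seg_int_cst// mul0r sub0r => <-.
  by apply: eq_seg_int => x _ _; rewrite sub0r.
rewrite E3; move: L1; rewrite seg_int_cst//.
have -> : 1 / s * (s - - s) = 2 by field; rewrite gt_eqF.
lra.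
Qed.

(** Subtracting [c0 / z] leaves a removable singularity, so only the pole contributes. As [contour]
    is merely a real part, the unimodular [k] rotates [c0] until that real part shows all of |c0|;
    the constant 4 is the lower bound of [sq_contour_inv]. *)
Lemma residue_bound h (c0 : C) r : 0 < r ->
  (forall x y, `|x| <= r -> `|y| <= r -> x +i* y != 0 -> cdiff_at h (x +i* y)) ->
  (forall e, 0 < e -> exists2 d, 0 < d &
     forall z, z != 0 -> normc z < d -> normc (h z - c0 / z) * normc z <= e) ->
  exists2 k, normc k = 1 & 4 * normc c0 <= sq_contour (fun z => k * h z) r.
Proof.
move=> r0 H H0.
pose k : C := if c0 == 0 then 1 else (0 -i* 1) * (rc (normc c0) / c0).
have kc : k * c0 = (0 -i* 1) * rc (normc c0).
  rewrite /k; case: eqVneq => [->|c00]; first by rewrite Normc.normc0 mulr0 rmorph0 mulr0.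
  by rewrite -!mulrA mulVf// mulr1.
have nI : normc (0 -i* 1) = 1 by rewrite /= expr0n add0r sqrrN expr1n sqrtr1.
have nk : normc k = 1.
  rewrite /k; case: eqVneq => [_|c00]; first exact: Normc.normc1.
  rewrite !Normc.normcM nI mul1r normc_real ger0_norm ?normc_ge0// Normc.normcV.
  by rewrite divff// normc_eq0.
exists k => //.
pose P z := k * (c0 / z).
have DP z : z != 0 -> cdiff_at P z.
  by move=> z0; eexists; do 2 apply: cderivZ; exact: cderiv_inv.
have Dk z : cdiff_at h z -> cdiff_at (fun z => k * h z) z.
  by case=> A HA; eexists; exact: cderivZ HA.
have Z : sq_contour (fun z => k * h z - P z) r = 0.
  apply: sq_contour_eq0 => // [x y xr yr xy|e e0].
    have [A HA] := Dk _ (H x y xr yr xy); have [B HB] := DP _ xy.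
    by exists (A - B); exact: cderivB.
  have [d d0 Hd] := H0 _ e0; exists d => // z z0 zd.
  by rewrite /P -mulrBr Normc.normcM nk mul1r; exact: Hd.
have ab t : - r <= t -> t <= r -> `|t| <= r by move=> *; rewrite ler_norml; apply/andP.
have nr : `|r| = r by rewrite gtr0_norm.
have nnr : `|- r| = r by rewrite normrN.
have nz1 x t : `|t| = r -> x +i* t != 0.
  by move=> ts; rewrite eq_complex negb_and /= -[t == 0]normr_eq0 ts (gt_eqF r0) orbT.
have nz2 x t : `|t| = r -> t +i* x != 0.
  by move=> ts; rewrite eq_complex negb_and /= -[t == 0]normr_eq0 ts (gt_eqF r0).
have CH t : `|t| = r -> ccont_hseg (fun z => k * h z) (- r) r t.
  move=> tr x *; apply/cdiff_at_cont/Dk/H; rewrite ?tr//; [exact: ab|exact: nz1].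
have CV t : `|t| = r -> ccont_vseg (fun z => k * h z) t (- r) r.
  move=> tr x *; apply/cdiff_at_cont/Dk/H; rewrite ?tr//; [exact: ab|exact: nz2].
have PH t : `|t| = r -> ccont_hseg P (- r) r t.
  by move=> tr x *; apply/cdiff_at_cont/DP/nz1.
have PV t : `|t| = r -> ccont_vseg P t (- r) r.
  by move=> tr x *; apply/cdiff_at_cont/DP/nz2.
move: Z; rewrite /sq_contour contourB; [|by auto..].
move=> /eqP; rewrite subr_eq0 => /eqP ->.
have PE : P = fun z => rc (normc c0) * ((0 -i* 1) * z^-1).
  by apply/funext => z; rewrite /P mulrA kc; ring.
have ReZ (t : R) (z : C) : Re (rc t * z) = t * Re z by rewrite Re_mul /= mul0r subr0.
have ImZ (t : R) (z : C) : Im (rc t * z) = t * Im z by rewrite Im_mul /= mul0r addr0.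
have I0 := sq_contour_inv r0.
have n0 := normc_ge0 c0.
suff -> : contour P (- r) r (- r) r = normc c0 * sq_contour (fun z => (0 -i* 1) * z^-1) r.
  by rewrite mulrC ler_wpM2l.
have cinv z : z != 0 -> ccont (fun z => (0 -i* 1) * z^-1) z.
  by move=> z0; apply: cderiv_cont; apply: cderivZ; exact: cderiv_inv.
have IH t : `|t| = r -> ccont_hseg (fun z => (0 -i* 1) * z^-1) (- r) r t.
  by move=> tr x *; apply/cinv/nz1.
have IV t : `|t| = r -> ccont_vseg (fun z => (0 -i* 1) * z^-1) t (- r) r.
  by move=> tr x *; apply/cinv/nz2.
have segZ (g : R -> R) : cont_on g (- r) r ->
    seg_int (fun x => normc c0 * g x) (- r) r = normc c0 * seg_int g (- r) r.
  by move=> /cont_on_integrable ig; exact: RintegralZl.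
rewrite PE /sq_contour /contour mulrBr -!segZ; last 2 first.
- by apply: cont_onB; apply: cont_on_vseg (IV _ _) => //; exact: Im_lip.
- by apply: cont_onB; apply: cont_on_hseg (IH _ _) => //; exact: Re_lip.
by congr (_ - _); apply: eq_seg_int => x _ _; rewrite ?ReZ ?ImZ -mulrBr.
Qed.

(** [f 0] is the residue of f(z) / z at 0, and |z| >= r on the boundary of the square. The value at
    the centre is thus bounded by the integral of |f| over the four sides, which can be averaged
    over [r]. *)
Lemma cauchy_value f r : 0 < r ->
  (forall x y, `|x| <= r -> `|y| <= r -> cdiff_at f (x +i* y)) ->
  4 * r * normc (f 0) <=
  seg_int (fun x => normc (f (x +i* - r))) (- r) r + seg_int (fun x => normc (f (x +i* r))) (- r) r +
  (seg_int (fun y => normc (f (- r +i* y))) (- r) r + seg_int (fun y => normc (f (r +i* y))) (- r) r).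
Proof.
move=> r0 H.
have Hd x y : `|x| <= r -> `|y| <= r -> x +i* y != 0 -> cdiff_at (fun z => z^-1 * f z) (x +i* y).
  move=> xr yr xy; have [A HA] := H x y xr yr; eexists.
  by apply: cderivM HA; exact: cderiv_inv.
have c00 : cdiff_at f 0.
  by have := H 0 0; rewrite normr0 => /(_ (ltW r0) (ltW r0)).
have [|k k1 Hk] := residue_bound (c0 := f 0) r0 Hd.
  move=> e e0; have [d d0 Hd0] := cdiff_at_cont c00 e0.
  exists d => // z z0 zd; rewrite mulrC -Normc.normcM mulrBr mulVKf//.
  by rewrite mulrC divfK// ltW//; have := Hd0 z zd; rewrite add0r.
have nr : `|r| = r by rewrite gtr0_norm.
have nnr : `|- r| = r by rewrite normrN.
have ab t : - r <= t -> t <= r -> `|t| <= r by move=> *; rewrite ler_norml; apply/andP.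
have nz1 x t : `|t| = r -> x +i* t != 0.
  by move=> ts; rewrite eq_complex negb_and /= -[t == 0]normr_eq0 ts (gt_eqF r0) orbT.
have nz2 x t : `|t| = r -> t +i* x != 0.
  by move=> ts; rewrite eq_complex negb_and /= -[t == 0]normr_eq0 ts (gt_eqF r0).
pose F z := k * (z^-1 * f z).
have DF z : cdiff_at (fun z => z^-1 * f z) z -> cdiff_at F z.
  by case=> A HA; eexists; exact: cderivZ HA.
have FH t : `|t| = r -> ccont_hseg F (- r) r t.
  move=> tr x *; apply/cdiff_at_cont/DF/Hd; rewrite ?tr//; [exact: ab|exact: nz1].
have FV t : `|t| = r -> ccont_vseg F t (- r) r.
  move=> tr x *; apply/cdiff_at_cont/DF/Hd; rewrite ?tr//; [exact: ab|exact: nz2].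
have fH t : `|t| = r -> ccont_hseg f (- r) r t.
  by move=> tr x *; apply/cdiff_at_cont/H; rewrite ?tr//; exact: ab.
have fV t : `|t| = r -> ccont_vseg f t (- r) r.
  by move=> tr x *; apply/cdiff_at_cont/H; rewrite ?tr//; exact: ab.
have Fle z : r <= normc z -> r * normc (F z) <= normc (f z).
  move=> rz; have z0 : 0 < normc z by exact: lt_le_trans rz.
  rewrite /F !Normc.normcM k1 mul1r Normc.normcV mulrA -[leRHS]mul1r.
  by rewrite ler_wpM2r ?normc_ge0// ler_pdivrMr// mul1r.
have segZ (g : R -> R) : cont_on g (- r) r ->
    seg_int (fun x => r * g x) (- r) r = r * seg_int g (- r) r.
  by move=> /cont_on_integrable ig; exact: RintegralZl.
have rr : - r <= r by lra.
have side (g G : R -> R) (L : C -> R) (z : R -> C) : (forall u, `|L u| <= normc u) ->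
    (forall u v, `|L u - L v| <= normc (u - v)) ->
    (forall x, r <= normc (z x)) -> cont_on (fun x => L (F (z x))) (- r) r ->
    cont_on (fun x => normc (f (z x))) (- r) r ->
    r * `|seg_int (fun x => L (F (z x))) (- r) r| <= seg_int (fun x => normc (f (z x))) (- r) r.
  move=> L1 L2 zr c1 c2.
  apply: (@le_trans _ _ (r * seg_int (fun x => `|L (F (z x))|) (- r) r)).
    by rewrite ler_pM2l//; exact: seg_int_norm.
  rewrite -segZ; last exact: cont_on_abs.
  apply: seg_int_le => //.
    have c3 := cont_on_abs c1; move=> x xa xb e e0.
    have er : 0 < e / r by rewrite divr_gt0.
    have [d d0 Hd0] := c3 x xa xb _ er; exists d => // y /Hd0.
    by rewrite ltr_pdivlMr// -mulrBr normrM nr mulrC.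
  by move=> x xa xb; apply: le_trans (Fle _ (zr x)); rewrite ler_pM2l.
have n1 x t : `|t| = r -> r <= normc (x +i* t).
  by move=> tr; apply: sq_normc_ge; [exact: ltW|right; rewrite /= tr].
have n2 x t : `|t| = r -> r <= normc (t +i* x).
  by move=> tr; apply: sq_normc_ge; [exact: ltW|left; rewrite /= tr].
have cR t : `|t| = r -> cont_on (fun x => Re (F (x +i* t))) (- r) r.
  by move=> tr; exact: cont_on_hseg Re_lip (FH _ tr).
have cI t : `|t| = r -> cont_on (fun x => Im (F (t +i* x))) (- r) r.
  by move=> tr; exact: cont_on_vseg Im_lip (FV _ tr).
have cf1 t : `|t| = r -> cont_on (fun x => normc (f (x +i* t))) (- r) r.
  by move=> tr; exact: cont_on_hseg normc_lip (fH _ tr).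
have cf2 t : `|t| = r -> cont_on (fun x => normc (f (t +i* x))) (- r) r.
  by move=> tr; exact: cont_on_vseg normc_lip (fV _ tr).
have S1 t (tr : `|t| = r) := side id id Re (fun x => x +i* t) (@Re_le_normc R) Re_lip
  (fun x => n1 x t tr) (cR t tr) (cf1 t tr).
have S2 t (tr : `|t| = r) := side id id Im (fun x => t +i* x) (@Im_le_normc R) Im_lip
  (fun x => n2 x t tr) (cI t tr) (cf2 t tr).
apply: (@le_trans _ _ (r * sq_contour F r)).
  by rewrite [4 * r]mulrC -mulrA ler_pM2l.
rewrite /sq_contour /contour (seg_intB (cR _ nnr) (cR _ nr)) (seg_intB (cI _ nr) (cI _ nnr)).
have T1 := S1 _ nnr; have T2 := S1 _ nr; have T3 := S2 _ nnr; have T4 := S2 _ nr.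
have pn u v : r * u - r * v <= r * `|u| + r * `|v|.
  by rewrite -mulrN; apply: lerD; rewrite ler_pM2l// ?ler_norm// -normrN ler_norm.
rewrite !mulrBr.
apply: (@le_trans _ _ (r * `|seg_int (fun x => Re (F (x +i* - r))) (- r) r| +
  r * `|seg_int (fun x => Re (F (x +i* r))) (- r) r| +
  (r * `|seg_int (fun x => Im (F (- r +i* x))) (- r) r| +
   r * `|seg_int (fun x => Im (F (r +i* x))) (- r) r|))).
  by rewrite opprB; apply: lerD; exact: pn.
by apply: lerD; apply: lerD.
Qed.

(** [a] is the residue at 0 of (f(z) - f(0)) / z^2, which is at most [2 * M / r ^+ 2] on a contour
    of length 8 r. Dividing 16 M / r by the 4 of [residue_bound] gives the constant. *)
Lemma cauchy_deriv f (a : C) r M : 0 < r ->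
  (forall x y, `|x| <= r -> `|y| <= r -> cdiff_at f (x +i* y)) ->
  (forall x y, `|x| <= r -> `|y| <= r -> normc (f (x +i* y)) <= M) ->
  cderiv f 0 a -> normc a <= 4 * M / r.
Proof.
move=> r0 H HM Ha.
pose h z := (z^-1 * z^-1) * (f z - f 0).
have Hd x y : `|x| <= r -> `|y| <= r -> x +i* y != 0 -> cdiff_at h (x +i* y).
  move=> xr yr xy; have [A HA] := H x y xr yr; eexists; apply: cderivM.
    by apply: cderivM; exact: cderiv_inv.
  by apply: (cderivB HA); exact: cderiv_cst.
have [|k k1 Hk] := residue_bound (c0 := a) r0 Hd.
  move=> e e0; have [d d0 Hd0] := Ha _ e0; exists d => // z z0 zd.
  have nz : 0 < normc z by rewrite lt_neqAle eq_sym normc_eq0 z0 normc_ge0.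
  rewrite -Normc.normcM /h.
  rewrite (_ : _ * z = (f (0 + z) - f 0 - a * z) / z); last by rewrite add0r; field.
  by rewrite Normc.normcM Normc.normcV ler_pdivrMr//; exact: Hd0.
have nr : `|r| = r by rewrite gtr0_norm.
have nnr : `|- r| = r by rewrite normrN.
have ab t : - r <= t -> t <= r -> `|t| <= r by move=> *; rewrite ler_norml; apply/andP.
have nz1 x t : `|t| = r -> x +i* t != 0.
  by move=> ts; rewrite eq_complex negb_and /= -[t == 0]normr_eq0 ts (gt_eqF r0) orbT.
have nz2 x t : `|t| = r -> t +i* x != 0.
  by move=> ts; rewrite eq_complex negb_and /= -[t == 0]normr_eq0 ts (gt_eqF r0).
have DF z : cdiff_at h z -> cdiff_at (fun z => k * h z) z.
  by case=> A HA; eexists; exact: cderivZ HA.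
have FH t : `|t| = r -> ccont_hseg (fun z => k * h z) (- r) r t.
  move=> tr x *; apply/cdiff_at_cont/DF/Hd; rewrite ?tr//; [exact: ab|exact: nz1].
have FV t : `|t| = r -> ccont_vseg (fun z => k * h z) t (- r) r.
  move=> tr x *; apply/cdiff_at_cont/DF/Hd; rewrite ?tr//; [exact: ab|exact: nz2].
have M0 : normc (f 0) <= M by have := HM 0 0; rewrite normr0; apply; exact: ltW.
have bd x y : `|x| <= r -> `|y| <= r -> `|x| = r \/ `|y| = r ->
    normc (k * h (x +i* y)) <= 2 * M / r ^+ 2.
  move=> xr yr xy.
  have rz : r <= normc (x +i* y).
    by apply: sq_normc_ge; [exact: ltW|case: xy => /= ->; [left|right]].
  have z0 : 0 < normc (x +i* y) by exact: lt_le_trans rz.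
  rewrite /h !Normc.normcM k1 mul1r !Normc.normcV -invfM mulrC.
  have m1 : normc (f (x +i* y) - f 0) <= 2 * M.
    by apply: (le_trans (normcD _ _)); rewrite normc_opp; have := HM x y xr yr; lra.
  apply: ler_pM => //; first exact: normc_ge0.
    by rewrite invr_ge0 mulr_ge0// ltW.
  by rewrite lef_pV2 ?posrE ?mulr_gt0 ?exprn_gt0// expr2 ler_pM// ltW.
have := le_trans Hk (ler_norm _).
have := @contour_bound (fun z => k * h z) (- r) r (- r) r (2 * M / r ^+ 2) (2 * M / r ^+ 2).
have rr : - r <= r by lra.
move=> /(_ rr rr (FH _ nnr) (FH _ nr) (FV _ nnr) (FV _ nr)) CB K1.
have nr' : `|r| <= r by rewrite nr.
have nnr' : `|- r| <= r by rewrite nnr.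
have {}CB : `|sq_contour (fun z => k * h z) r| <= 16 * M / r.
  rewrite (_ : 16 * M / r = 2 * (2 * M / r ^+ 2) * (r - - r) + 2 * (2 * M / r ^+ 2) * (r - - r)).
    by apply: CB => x *; split; apply: bd; auto.
  by field; rewrite gt_eqF.
have := le_trans K1 CB.
have -> : 16 * M / r = 4 * (4 * M / r) by ring.
by rewrite ler_pM2l.
Qed.

End Contour.

(** * Sub-mean value inequality in one variable *)

Lemma eq_imp_le d (T : porderType d) (x y : T) : x = y -> (x <= y)%O.
Proof. by move=> ->. Qed.

Section AreaMean.
Variable R : realType.
Local Notation C := R[i].
Local Notation Rm := (measurableTypeR R).
Local Notation lebR := (lebesgueR R).
Local Notation normc := (@Normc.normc R).
Local Notation Re := (@complex.Re R).
Local Notation Im := (@complex.Im R).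
Implicit Types (f : C -> C) (r q : R) (U : Rm * Rm -> \bar R).
Local Open Scope complex_scope.

Lemma seg_int_le_integral (g : R -> R) (G : Rm -> \bar R) (a b r : R) :
  a <= b -> cont_on g a b -> (forall x, 0 <= g x) ->
  measurable_fun setT G -> (forall x, 0 <= G x)%E ->
  (forall x, a <= x -> x <= b -> ((g x)%:E <= G x)%E) ->
  ((seg_int g a b)%:E <= \int[lebR]_x G x)%E.
Proof.
move=> ab cg g0 mG G0 H; have ig := cont_on_integrable cg.
rewrite /seg_int /Rintegral fineK; last exact: (integrable_fin_num _ ig).
apply: (@le_trans _ _ (\int[lebR]_(x in `[a, b]) G x)%E).
  apply: ge0_le_integral => //.
  - by move=> x _; rewrite lee_fin.
  - by case/integrableP : ig.
  - exact: measurable_funTS.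
  - by move=> x /=; rewrite in_itv/= => /andP[]; exact: H.
exact: ge0_subset_integral.
Qed.

(** In [submean1], [G] and [F] are the integrals of the majorant over horizontal and vertical lines,
    and [S s] bounds the integral over the boundary of the square of half-side [s]. *)
Lemma integral_symm_sum (F G : Rm -> \bar R) :
  measurable_fun setT F -> (forall x, 0 <= F x)%E ->
  measurable_fun setT G -> (forall x, 0 <= G x)%E ->
  let S := (fun s : Rm => (G (- s)%R + G s) + (F (- s)%R + F s))%E in
  [/\ measurable_fun setT S, (forall s, 0 <= S s)%E &
  (\int[lebR]_s S s = 2%:E * (\int[lebR]_x G x + \int[lebR]_x F x))%E].
Proof.
move=> mF F0 mG G0 S.
have mFN : measurable_fun setT (fun x : Rm => F (- x)) by exact: (measurableT_comp (f := F)).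
have mGN : measurable_fun setT (fun x : Rm => G (- x)) by exact: (measurableT_comp (f := G)).
have IN (h : Rm -> \bar R) : measurable_fun setT h -> (forall x, 0 <= h x)%E ->
    (\int[lebR]_x h (- x)%R = \int[lebR]_x h x)%E.
  move=> mh h0; have N1 : (-1 : R) != 0 by rewrite oppr_eq0 oner_neq0.
  rewrite -[RHS]mul1e -[1%E](_ : (`|-1 : R|^-1)%:E = 1%E); last first.
    by rewrite normrN normr1 invr1.
  rewrite -(ge0_integral_affine 0 N1 mh h0); apply: eq_integral => x _.
  by rewrite mulN1r addr0.
have I0 (h : Rm -> \bar R) : (forall x, 0 <= h x)%E -> (0 <= \int[lebR]_x h x)%E.
  by move=> h0; exact: integral_ge0.
have mF2 : measurable_fun setT (fun s : Rm => F (- s)%R + F s)%E by exact: emeasurable_funD.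
have mG2 : measurable_fun setT (fun s : Rm => G (- s)%R + G s)%E by exact: emeasurable_funD.
split; first exact: emeasurable_funD.
  by move=> s; apply: adde_ge0; apply: adde_ge0.
rewrite ge0_integralD//; [|by move=> s _; apply: adde_ge0|by move=> s _; apply: adde_ge0].
rewrite !ge0_integralD// IN// IN//.
have F1 := I0 F F0; have G1 := I0 G G0.
rewrite -[X in (X%:E * _)%E](_ : (1 + 1 : R) = 2); last lra.
by rewrite EFinD ge0_muleDl ?lee_fin// !mul1e addeACA.
Qed.

(** [cauchy_value] is integrated over the half-sides [s] between [r / 2] and [r]. The majorant [U]
    is nonnegative and lives on the whole plane, so sides can be enlarged to full lines and Tonelli
    applies with no restriction to the square. *)
Lemma submean1 f r U : 0 < r ->
  (forall x y, `|x| <= r -> `|y| <= r -> cdiff_at f (x +i* y)) ->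
  measurable_fun setT U -> (forall p, 0 <= U p)%E ->
  (forall x y, `|x| <= r -> `|y| <= r -> ((normc (f (x +i* y)))%:E <= U (x, y))%E) ->
  ((normc (f 0))%:E <= (4 / r ^+ 2)%:E * \int[lebR]_x \int[lebR]_y U (x, y))%E.
Proof.
move=> r0 Hf mU U0 HU.
have mUx x : measurable_fun setT (fun y => U (x, y)) by exact: measurableT_comp.
have mUy y : measurable_fun setT (fun x => U (x, y)) by exact: measurableT_comp.
have mF := @measurable_fun_fubini_tonelli_F _ _ _ _ _ lebR U mU U0.
have mG := @measurable_fun_fubini_tonelli_G _ _ _ _ _ lebR U mU U0.
pose F x := (\int[lebR]_y U (x, y))%E; pose G y := (\int[lebR]_x U (x, y))%E.
have F0 x : (0 <= F x)%E by exact: integral_ge0.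
have G0 x : (0 <= G x)%E by exact: integral_ge0.
set I := (\int[lebR]_x \int[lebR]_y U (x, y))%E.
have IF : (\int[lebR]_x F x)%E = I by [].
have IG : (\int[lebR]_x G x)%E = I by rewrite /I (fubini_tonelli U).
have key s : r / 2 <= s -> s <= r ->
    ((2 * r * normc (f 0))%:E <= (G (- s)%R + G s) + (F (- s)%R + F s))%E.
  move=> s1 s2; have s0 : 0 < s by apply: lt_le_trans s1; rewrite divr_gt0.
  have abs t : - s <= t -> t <= s -> `|t| <= r.
    by move=> ? ?; rewrite ler_norml; apply/andP; split; lra.
  have nS : `|s| <= r by rewrite gtr0_norm.
  have nNS : `|- s| <= r by rewrite normrN gtr0_norm.
  have Hs x y : `|x| <= s -> `|y| <= s -> cdiff_at f (x +i* y).
    by move=> ? ?; apply: Hf; lra.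
  apply: (@le_trans _ _ (4 * s * normc (f 0))%:E).
    by rewrite lee_fin ler_wpM2r ?normc_ge0//; lra.
  have := cauchy_value s0 Hs; rewrite -lee_fin => /le_trans; apply.
  have ss : - s <= s by lra.
  have CH t : `|t| <= r -> cont_on (fun x => normc (f (x +i* t))) (- s) s.
    move=> tr; apply: (cont_on_hseg (@normc_lip R)) => x *.
    by apply: cdiff_at_cont; apply: Hf => //; exact: abs.
  have CV t : `|t| <= r -> cont_on (fun y => normc (f (t +i* y))) (- s) s.
    move=> tr; apply: (cont_on_vseg (@normc_lip R)) => x *.
    by apply: cdiff_at_cont; apply: Hf => //; exact: abs.
  rewrite !EFinD; apply: leeD; apply: leeD.
  - apply: (seg_int_le_integral r ss (CH _ nNS)) => // [x|x *]; first exact: normc_ge0.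
    by apply: HU => //; exact: abs.
  - apply: (seg_int_le_integral r ss (CH _ nS)) => // [x|x *]; first exact: normc_ge0.
    by apply: HU => //; exact: abs.
  - apply: (seg_int_le_integral r ss (CV _ nNS)) => // [x|x *]; first exact: normc_ge0.
    by apply: HU => //; exact: abs.
  - apply: (seg_int_le_integral r ss (CV _ nS)) => // [x|x *]; first exact: normc_ge0.
    by apply: HU => //; exact: abs.
have [mSum Sum0 tot] := integral_symm_sum mF F0 mG G0.
rewrite IF IG -/I in tot.
have lo : ((r ^+ 2 * normc (f 0))%:E <= 4%:E * I)%E.
  have -> : (4%:E * I = 2%:E * (I + I))%E.
    have I0 : (0 <= I)%E by apply: integral_ge0 => x _; exact: F0.
    transitivity ((2 + 2)%R%:E * I)%E; first by congr (_%:E * _)%E; lra.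
    by rewrite EFinD ge0_muleDl ?lee_fin// -ge0_muleDr.
  rewrite -tot.
  apply: (@le_trans _ _ (\int[lebR]_(s in `[(r / 2)%R, r]) ((G (- s)%R + G s) + (F (- s)%R + F s)))%E).
    apply: (@le_trans _ _ (\int[lebR]_(s in `[(r / 2)%R, r]) (2 * r * normc (f 0))%:E)%E).
      rewrite integral_cst// /lebesgueR /= lebesgue_measure_itv/= lte_fin ifT; last lra.
      by rewrite -EFinD -EFinM lee_fin; apply: eq_imp_le; field.
    apply: ge0_le_integral => //.
    - by move=> s _; rewrite lee_fin mulr_ge0 ?normc_ge0// mulr_ge0// ltW.
    - exact: measurable_funTS.
    - by move=> s /=; rewrite in_itv/= => /andP[]; exact: key.
  exact: ge0_subset_integral.
have r2 : 0 < r ^+ 2 by rewrite exprn_gt0.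
rewrite mulrC EFinM -muleA.
have -> : (normc (f 0))%:E = ((r ^+ 2)^-1%:E * (r ^+ 2 * normc (f 0))%:E)%E.
  by rewrite -EFinM mulKf// gt_eqF.
apply: lee_wpmul2l; first by rewrite lee_fin invr_ge0 ltW.
assumption.
Qed.

Lemma dist_maxr_lt (a b c d e : R) : `|a - c| < e -> `|b - d| < e ->
  `|Num.max a b - Num.max c d| < e.
Proof.
rewrite !ltr_norml => /andP[? ?] /andP[? ?].
by case: (leP a b) => ?; case: (leP c d) => ?; apply/andP; split; lra.
Qed.

(** The weight is a power of the sup-norm distance to the boundary; it forces a maximum point to be
    interior as soon as [f] does not vanish identically. *)
Lemma exists_max_weighted f r N : 0 < r ->
  (forall x y, `|x| <= r -> `|y| <= r -> cdiff_at f (x +i* y)) ->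
  exists x0 y0, [/\ `|x0| <= r, `|y0| <= r & forall x y, `|x| <= r -> `|y| <= r ->
    (r - Num.max `|x| `|y|) ^+ N * normc (f (x +i* y)) <=
    (r - Num.max `|x0| `|y0|) ^+ N * normc (f (x0 +i* y0))].
Proof.
move=> r0 Hf.
pose A : set (R * R) := `[- r, r] `*` `[- r, r].
pose d (p : R * R) := r - Num.max `|p.1| `|p.2|.
pose G (p : R * R) := d p ^+ N * normc (f (p.1 +i* p.2)).
have cA : compact A by apply: compact_setX; exact: segment_compact.
have A0 : A !=set0 by exists (0, 0); split => /=; rewrite in_itv/=; lra.
have cG : {within A, continuous G}.
  apply: continuous_in_subspaceT => -[x y] /[!inE] -[/=].
  rewrite !in_itv/= => /andP[x1 x2] /andP[y1 y2].
  have xr : `|x| <= r by rewrite ler_norml x1.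
  have yr : `|y| <= r by rewrite ler_norml y1.
  apply: (@cvgM _ _ _ _ (fun p => d p ^+ N) (fun p : R * R => normc (f (p.1 +i* p.2)))).
    apply: (continuous_comp (f := d) (g := fun t => t ^+ N)); last exact: exprn_continuous.
    apply/(@cvgrPdist_lt _ R^o) => e e0.
    exists (ball (x : R^o) e, ball (y : R^o) e); first by split; exact: nbhsx_ballx.
    move=> [u v] [/=].
    rewrite /ball/= => xu yv.
    have h1 : `| `|x| - `|u| | < e by exact: le_lt_trans (ler_dist_dist _ _) xu.
    have h2 : `| `|y| - `|v| | < e by exact: le_lt_trans (ler_dist_dist _ _) yv.
    by rewrite /d /= opprB addrC addrA addrNK distrC; exact: dist_maxr_lt.
  apply/(@cvgrPdist_lt _ R^o) => e e0.
  have [t t0 Ht] := cdiff_at_cont (Hf x y xr yr) e0.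
  exists (ball (x : R^o) (t / 2), ball (y : R^o) (t / 2)).
    by split; apply: nbhsx_ballx; rewrite divr_gt0.
  move=> [u v] [/=]; rewrite /ball/= => xu yv; rewrite distrC.
  apply: (le_lt_trans (normc_lip _ _)).
  rewrite (_ : u +i* v = x +i* y + (u - x) +i* (v - y)); last first.
    by simpc; congr (_ +i* _); ring.
  apply: Ht; apply: (le_lt_trans (normc_le_ReIm _)) => /=.
  by rewrite [`|u - x|]distrC [`|v - y|]distrC; lra.
have [[x0 y0] /[!inE] -[/= h1 h2] Hmax] := compact_EVT_max A0 cA cG.
move: h1 h2; rewrite !in_itv/= -!ler_norml => h1 h2.
exists x0, y0; split => // x y xr yr.
by apply: (Hmax (x, y)); rewrite inE; split => /=; rewrite in_itv/= -ler_norml.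
Qed.

(** With a square of half-side [d / 2] around the maximum point, 16 is the 4 of [submean1] times
    [2 ^+ 2]. The other factor comes from |f| being at most [2 ^+ N] times its value at that point,
    raised to the excess m - q; here [N] is the least natural number above 2 / q and [m] the least
    above [q]. *)
Definition submean_cst q : R :=
  16 * ((2 ^+ (Num.truncn (2 / q)).+1) `^ ((Num.truncn q).+1%:R - q)).

Lemma submean_cst_gt0 q : 0 < submean_cst q.
Proof. by rewrite mulr_gt0// powR_gt0// exprn_gt0. Qed.

(* For a maximum point [z0] of [dist ^ N * |f|], [|f|] is bounded by a multiple
   of [|f z0|] near [z0], so the inequality for an integer power [m > q] can be
   divided by [|f z0| ^ (m - q)]. *)
Lemma submean_square f r q U : 0 < r -> 0 < q ->
  (forall x y, `|x| <= r -> `|y| <= r -> cdiff_at f (x +i* y)) ->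
  measurable_fun setT U -> (forall p, 0 <= U p)%E ->
  (forall x y, `|x| <= r -> `|y| <= r -> ((normc (f (x +i* y)) `^ q)%:E <= U (x, y))%E) ->
  ((normc (f 0) `^ q)%:E <=
   (submean_cst q / r ^+ 2)%:E * \int[lebR]_x \int[lebR]_y U (x, y))%E.
Proof.
move=> r0 q0 Hf mU U0 HU.
set m := (Num.truncn q).+1; set N := (Num.truncn (2 / q)).+1.
have qm : q < m%:R by exact: truncnS_gt.
have qN : 2 <= q * N%:R.
  by rewrite mulrC -ler_pdivrMr// ltW// truncnS_gt.
have rhs0 : (0 <= (submean_cst q / r ^+ 2)%:E * \int[lebR]_x \int[lebR]_y U (x, y))%E.
  apply: mule_ge0.
    by rewrite lee_fin divr_ge0 ?exprn_ge0// ltW// submean_cst_gt0.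
  by apply: integral_ge0 => x _; exact: integral_ge0.
have [f0|f0] := eqVneq (f 0) 0.
  by rewrite f0 Normc.normc0 powR0 ?gt_eqF.
have [x0 [y0 [xr yr Hmax]]] := exists_max_weighted N r0 Hf.
set d := r - Num.max `|x0| `|y0| in Hmax.
have nf0 : 0 < normc (f 0) by rewrite lt_neqAle eq_sym normc_eq0 f0 normc_ge0.
have max0 : r ^+ N * normc (f 0) <= d ^+ N * normc (f (x0 +i* y0)).
  have := Hmax 0 0; rewrite normr0 maxxx subr0; apply; exact: ltW.
have dge : 0 <= d by rewrite /d subr_ge0 ge_max xr.
have dle : d <= r by rewrite /d gerBl le_max normr_ge0.
have pos1 : 0 < d ^+ N * normc (f (x0 +i* y0)).
  by apply: lt_le_trans max0; rewrite mulr_gt0// exprn_gt0.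
have d0 : 0 < d.
  rewrite lt_neqAle dge andbT eq_sym; apply: contraTN isT => /eqP dz.
  by move: pos1; rewrite dz expr0n mul0r ltxx.
set A := normc (f (x0 +i* y0)) in max0 pos1 Hmax.
have A0 : 0 < A by move: pos1; rewrite pmulr_rgt0// exprn_gt0.
pose rho := d / 2; have rho0 : 0 < rho by rewrite divr_gt0.
pose g z := f (x0 +i* y0 + z).
have loc x y : `|x| <= rho -> `|y| <= rho -> [/\ `|x0 + x| <= r, `|y0 + y| <= r &
    rho <= r - Num.max `|x0 + x| `|y0 + y| ].
  move=> xrho yrho; have h1 := ler_normD x0 x; have h2 := ler_normD y0 y.
  have h3 : `|x0| <= r - d by rewrite /d subKr le_max lexx.
  have h4 : `|y0| <= r - d by rewrite /d subKr le_max lexx orbT.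
  have E : d = 2 * rho by rewrite /rho; field.
  clear -xrho yrho h1 h2 h3 h4 E rho0.
  split; [lra|lra|rewrite lerBrDl -lerBrDr ge_max; apply/andP; split; lra].
have gE x y : g (x +i* y) = f ((x0 + x) +i* (y0 + y)) by rewrite /g; simpc.
have gle x y : `|x| <= rho -> `|y| <= rho -> normc (g (x +i* y)) <= 2 ^+ N * A.
  move=> xrho yrho; have [h1 h2 h3] := loc _ _ xrho yrho.
  have := Hmax _ _ h1 h2; rewrite -gE.
  have rN : 0 < rho ^+ N by rewrite exprn_gt0.
  move=> H; rewrite -(ler_pM2l rN); apply: le_trans (le_trans _ H) _.
    rewrite ler_wpM2r ?normc_ge0// lerXn2r ?nnegrE// ltW//.
    exact: lt_le_trans h3.
  have -> : d = rho * 2 by rewrite /rho; field.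
  by rewrite exprMn mulrA.
set e := m%:R - q.
have e0 : 0 < e by rewrite subr_gt0.
pose B := (2 ^+ N * A) `^ e.
have B0 : 0 < B by rewrite powR_gt0// mulr_gt0// exprn_gt0.
have powm (t : R) : 0 <= t -> t ^+ m = t `^ q * t `^ e.
  move=> t0; have qe : q + e = m%:R by rewrite /e; ring.
  by rewrite -powRD ?qe ?pnatr_eq0// powR_mulrn.
have Ug : ((normc (g 0 ^+ m))%:E <=
    (4 / rho ^+ 2)%:E * \int[lebR]_x \int[lebR]_y (B%:E * U (x0 + x, y0 + y)%R))%E.
  apply: (submean1 (f := fun z => g z ^+ m) (U := fun p => (B%:E * U (x0 + p.1, y0 + p.2)%R)%E)) => //.
  - move=> x y xrho yrho; have [h1 h2 h3] := loc _ _ xrho yrho.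
    have [a Ha] := Hf _ _ h1 h2.
    have [|b Hb] := @cderivX _ g (x +i* y) a m; last by exists b.
    by apply: cderiv_shift; move: Ha; simpc.
  - apply: measurable_funeM; apply: (measurableT_comp mU).
    apply: measurable_fun_pair; apply: measurable_funD => //.
  - by move=> p; rewrite mule_ge0// lee_fin ltW.
  - move=> x y xrho yrho /=; have [h1 h2 h3] := loc _ _ xrho yrho.
    rewrite normcX powm ?normc_ge0// mulrC EFinM; apply: lee_pmul => //.
    + by rewrite lee_fin powR_ge0.
    + by rewrite lee_fin powR_ge0.
    + rewrite lee_fin; apply: ge0_ler_powR; rewrite ?nnegrE ?normc_ge0//.
      * exact: ltW.
      * by rewrite mulr_ge0 ?exprn_ge0// ltW.
      * exact: gle.
    + by rewrite gE; exact: HU.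
have Ieq : (\int[lebR]_x \int[lebR]_y (B%:E * U (x0 + x, y0 + y)%R) =
    B%:E * \int[lebR]_x \int[lebR]_y U (x, y))%E.
  have N1 : (1 : R) != 0 by exact: oner_neq0.
  have mUx x : measurable_fun setT (fun y => U (x, y)) by exact: measurableT_comp.
  have mF := @measurable_fun_fubini_tonelli_F _ _ _ _ _ lebR U mU U0.
  have sh (h : Rm -> \bar R) t : measurable_fun setT h -> (forall x, 0 <= h x)%E ->
      (\int[lebR]_x h (t + x)%R = \int[lebR]_x h x)%E.
    move=> mh h0; rewrite -[RHS]mul1e -[1%E](_ : (`|1 : R|^-1)%:E = 1%E); last first.
      by rewrite normr1 invr1.
    rewrite -(ge0_integral_affine t N1 mh h0); apply: eq_integral => x _.
    by rewrite mul1r addrC.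
  transitivity (\int[lebR]_x (B%:E * \int[lebR]_y U ((x0 + x)%R, y)))%E.
    apply: eq_integral => x _; rewrite ge0_integralZl_EFin//; last 2 first.
    - apply: (measurableT_comp (mUx _)); exact: measurable_funD.
    - exact: ltW.
    by rewrite (sh (fun y => U ((x0 + x)%R, y))).
  have U1 (x : Rm) : (0 <= \int[lebR]_y U ((x0 + x)%R, y))%E by exact: integral_ge0.
  have mU1 : measurable_fun setT (fun x : Rm => \int[lebR]_y U ((x0 + x)%R, y))%E.
    by apply: (measurableT_comp mF); exact: measurable_funD.
  rewrite (ge0_integralZl_EFin lebR measurableT (fun x _ => U1 x) mU1 (ltW B0)).
  by rewrite (sh (fun x => \int[lebR]_y U (x, y))%E)// => x; exact: integral_ge0.
set I := (\int[lebR]_x \int[lebR]_y U (x, y))%E in rhs0 Ieq *.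
have I0 : (0 <= I)%E by apply: integral_ge0 => x _; exact: integral_ge0.
move: Ug; rewrite Ieq.
have g0A : g 0 = f (x0 +i* y0) by rewrite /g addr0.
rewrite g0A normcX -/A (powm A (ltW A0)) muleA -EFinM => Ug.
have Ae : 0 < A `^ e by rewrite powR_gt0.
have BA : B = (2 ^+ N) `^ e * A `^ e by rewrite /B powRM ?exprn_ge0// ltW.
have Aq : ((A `^ q)%:E <= (4 / rho ^+ 2 * (2 ^+ N) `^ e)%:E * I)%E.
  have -> : (A `^ q)%:E = ((A `^ e)^-1%:E * (A `^ q * A `^ e)%:E)%E.
    by rewrite -EFinM mulrC mulfK// gt_eqF.
  have -> : ((4 / rho ^+ 2 * (2 ^+ N) `^ e)%:E * I =
      (A `^ e)^-1%:E * ((4 / rho ^+ 2 * B)%:E * I))%E.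
    rewrite muleA -EFinM BA; congr (_%:E * _)%E; field.
    by rewrite !gt_eqF.
  by apply: lee_pmul => //; rewrite lee_fin ?invr_ge0 ?mulr_ge0 ?powR_ge0// ltW.
(* The choice [q * N >= 2] turns the weight ratio [(d / r) ^+ N] into [(d / r) ^+ 2] after raising
   to [q], which trades the area of the small square for that of the large one. *)
have fin : normc (f 0) `^ q <= (d / r) ^+ 2 * A `^ q.
  have h : normc (f 0) <= (d / r) ^+ N * A.
    by rewrite expr_div_n mulrAC ler_pdivlMr ?exprn_gt0// mulrC.
  have dr0 : 0 < d / r by rewrite divr_gt0.
  have dr1 : d / r <= 1 by rewrite ler_pdivrMr// mul1r.
  apply: (@le_trans _ _ (((d / r) ^+ N * A) `^ q)).
    by rewrite ge0_ler_powR ?nnegrE ?normc_ge0 ?mulr_ge0 ?exprn_ge0// ltW.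
  have drN : 0 <= (d / r) ^+ N by rewrite exprn_ge0// ltW.
  rewrite (powRM _ drN (ltW A0)) ler_wpM2r ?powR_ge0//.
  rewrite -(powR_mulrn N (ltW dr0)) -powRrM -(powR_mulrn 2 (ltW dr0)).
  by rewrite ger_powR// ?dr0//= mulrC.
have h16 : ((normc (f 0) `^ q)%:E <= ((d / r) ^+ 2)%:E * ((4 / rho ^+ 2 * (2 ^+ N) `^ e)%:E * I))%E.
  apply: (@le_trans _ _ (((d / r) ^+ 2)%:E * (A `^ q)%:E)%E); first by rewrite -EFinM lee_fin.
  by apply: lee_pmul => //; rewrite lee_fin ?exprn_ge0 ?powR_ge0 ?divr_ge0// ltW.
apply: (le_trans h16); rewrite muleA -EFinM; apply: eq_imp_le; congr (_%:E * _)%E.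
rewrite /submean_cst -/m -/N -/e /rho.
by field; rewrite !gt_eqF.
Qed.

End AreaMean.

(** * Holomorphic functions of several variables *)

Section SeveralVariables.
Variables (R : realType) (n : nat).
Local Notation C := R[i].
Local Notation Cn := 'rV[R[i]]_n.
Local Notation normc := (@Normc.normc R).
Local Notation rc := (real_complex R).
Local Notation Re := (@complex.Re R).
Local Notation Im := (@complex.Im R).
Implicit Types (f g : Cn -> C) (x y z w v h : Cn).

Lemma mx_norm_ge_coord h j : `|h 0 j| <= `|h|.
Proof.
rewrite [X in _ <= X]mx_normE -[leLHS]nngE num_le.
exact: (le_bigmax _ (fun i => `|h i.1 i.2|%:nng) (0, j)).
Qed.

Lemma mx_norm_le_enorm h : `|h| <= rc (enorm h).
Proof.
have e0 : 0 <= rc (enorm h) by rewrite lecR enorm_ge0.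
rewrite [X in X <= _]mx_normE -[leRHS]/((NngNum e0)%:num) num_le.
apply/bigmax_leP; split; first exact: e0.
move=> [i j] _; rewrite -num_le /= ord1 norm_normc lecR.
exact: coord_le_enorm.
Qed.

Lemma enorm_le_mx_norm h : rc (enorm h) <= n.+1%:R * `|h|.
Proof.
have [r rE] : exists r, `|h| = rc r.
  have := normr_ge0 h; rewrite lecE /= => /andP[/eqP h1 _].
  exists (Re `|h|); apply/eqP; rewrite eq_complex /= eqxx /=.
  exact/eqP.
have H j : normc (h 0 j) <= r by have := mx_norm_ge_coord h j; rewrite rE norm_normc lecR.
have r0 : 0 <= r by have := normr_ge0 h; rewrite rE lecR.
by rewrite rE -(rmorph_nat rc) -rmorphM lecR; exact: enorm_le_coord.
Qed.

Lemma complex_pos (e : C) : 0 < e -> exists2 r, 0 < r & e = rc r.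
Proof. by case: e => a b; rewrite ltcE /= => /andP[/eqP -> a0]; exists a. Qed.

Lemma diff_eps f w : differentiable f w -> forall e, 0 < e ->
  exists2 d, 0 < d & forall h, enorm h < d ->
    normc (f (w + h) - f w - 'd f w h) <= e * enorm h.
Proof.
move=> /diff_locally/eqaddoP H e e0.
have : 0 < rc e by rewrite ltcR.
move=> /H /nbhs_enorm[d d0 Hd]; exists d => // h hd.
have := Hd h; rewrite subr0 => /(_ hd) H1.
have E : f (w + h) - f w - 'd f w h = (f \o shift w - (cst (f w) + 'd f w)) h.
  by rewrite !fctE /= opprD addrA [w + h]addrC.
rewrite E -lecR -norm_normc rmorphM; apply: (le_trans H1).
by rewrite ler_wpM2l ?lecR ?(ltW e0)// mx_norm_le_enorm.
Qed.

Lemma row_sum_delta h : h = \sum_(j < n) h 0 j *: delta_mx 0 j.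
Proof. exact: row_sum_delta. Qed.

Lemma diff_coords f x h : 'd f x h = \sum_j h 0 j * 'd f x (delta_mx 0 j).
Proof.
by rewrite {1}(row_sum_delta h) linear_sum; apply: eq_bigr => j _; rewrite linearZ.
Qed.

Lemma diffB_app f g x h : differentiable f x -> differentiable g x ->
  'd f x h - 'd g x h = 'd (f - g) x h.
Proof.
move=> df dg.
have H := congr1 (fun F : Cn -> C => F h) (diffB df dg).
symmetry; exact: H.
Qed.

(** Converse of [diff_eps]. The candidate differential is packed as a linear map and shown
    continuous, then identified with ['d f w] by uniqueness. *)
Lemma eps_diff f w (a : 'I_n -> C) :
  (forall e, 0 < e -> exists2 d, 0 < d & forall h, enorm h < d ->
    normc (f (w + h) - f w - \sum_j a j * h 0 j) <= e * enorm h) ->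
  differentiable f w.
Proof.
move=> H; pose L h : C := \sum_j a j * h 0 j.
have Llin : linear L.
  move=> c x y; rewrite /L scaler_sumr -big_split; apply: eq_bigr => j _ /=.
  by rewrite !mxE mulrDr /GRing.scale /=; ring.
pose Lm := GRing.isLinear.Build C Cn C _ L Llin.
pose LL : {linear Cn -> C} := HB.pack L Lm.
have LLE h : LL h = L h by [].
pose A := \sum_j normc (a j).
have A0 : 0 <= A by apply: sumr_ge0 => j _; exact: normc_ge0.
have Lb h : normc (L h) <= A * enorm h.
  apply: (le_trans (normc_sum _ _ _)); rewrite /A mulr_suml; apply: ler_sum => j _.
  by rewrite Normc.normcM ler_wpM2l ?normc_ge0// coord_le_enorm.
have cL : continuous LL.
  move=> z; apply/(@cvgrPdist_lt _ C _ (nbhs z) _ LL (LL z)) => e /complex_pos[r r0 ->].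
  apply/nbhs_enorm; exists (r / (A + 1)); first by rewrite divr_gt0//; lra.
  move=> y yz; rewrite -linearB norm_normc ltcR -normc_opp -linearN opprB.
  apply: (le_lt_trans (Lb _)).
  have A1 : 0 < A + 1 by lra.
  move: yz; rewrite ltr_pdivlMr// => yz.
  have := enorm_ge0 (y - z); lra.
have lo : f \o shift w = cst (f w) + LL +o_ 0 id.
  apply/eqaddoP => e /complex_pos[r r0 ->].
  have r1 : 0 < r / n.+1%:R by rewrite divr_gt0.
  have [d d0 Hd] := H _ r1.
  apply/nbhs_enorm; exists d => // h; rewrite subr0 => /Hd Hh.
  rewrite norm_normc.
  rewrite (_ : _ h = f (w + h) - f w - L h); last first.
    by rewrite /= /shift /= -addrA -opprD [w + h]addrC.
  apply: (@le_trans _ _ (rc (r / n.+1%:R) * rc (enorm h))).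
    by rewrite -rmorphM lecR.
  apply: (@le_trans _ _ (rc (r / n.+1%:R) * (n.+1%:R * `|h|))).
    by rewrite ler_wpM2l ?enorm_le_mx_norm// lecR ltW.
  by rewrite mulrA rmorphM /= fmorphV rmorph_nat mulfVK// pnatr_eq0.
have E := diff_unique cL lo.
apply/diff_locallyP; rewrite E; split; [exact: cL|exact: lo].
Qed.

Lemma cderiv_slice f w v (l : C) : differentiable f (w + l *: v) ->
  cderiv (fun t => f (w + t *: v)) l ('d f (w + l *: v) v).
Proof.
move=> df e e0; have v1 : 0 < enorm v + 1 by have := enorm_ge0 v; lra.
have e1 : 0 < e / (enorm v + 1) by rewrite divr_gt0.
have [d d0 Hd] := diff_eps df e1; exists (d / (enorm v + 1)); first by rewrite divr_gt0.
move=> h; rewrite ltr_pdivlMr// => hd.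
have hv : enorm (h *: v) < d.
  by rewrite enormZ; apply: le_lt_trans hd; rewrite ler_wpM2l ?normc_ge0//; lra.
have := Hd _ hv; rewrite linearZ scalerDl addrA [_ * h]mulrC => H.
apply: (le_trans H); rewrite enormZ.
have -> : e / (enorm v + 1) * (normc h * enorm v) = e * normc h * (enorm v / (enorm v + 1)).
  by ring.
rewrite ler_piMr ?mulr_ge0 ?normc_ge0 ?(ltW e0)// ler_pdivrMr// mul1r; lra.
Qed.

Lemma cderiv_is_derive (phi : C -> C) (s : R) a : cderiv phi (rc s) a ->
  is_derive s 1 (fun t : R => Re (phi (rc t))) (Re a).
Proof.
move=> H.
suff cv : h^-1 *: (((fun t : R => Re (phi (rc t))) \o shift s) (h *: 1) - Re (phi (rc s)))
    @[h --> 0^'] --> Re a.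
  by apply: DeriveDef; [apply/cvg_ex; exists (Re a)|exact: cvg_lim cv].
apply/(@cvgrPdist_le _ R^o) => e e0; have [d d0 Hd] := H e e0.
apply/nbhs_ballP; exists d => //= h; rewrite /ball/= sub0r normrN => hd h0.
have hd' : normc (rc h) < d by rewrite normc_real.
have := Hd _ hd'; rewrite normc_real => H1.
have h0' : 0 < `|h| by rewrite normr_gt0.
rewrite -(ler_pM2r h0') -normrM mulrBl /shift /= [_ *: 1]mulr1.
rewrite (_ : _ - _ = - Re (phi (rc s + rc h) - phi (rc s) - a * rc h)).
  by rewrite normrN; apply: le_trans (Re_le_normc _) _.
rewrite !Re_add !Re_opp Re_mul /= mulr0 subr0 -rmorphD /= [s + h]addrC /GRing.scale /=.
by field.
Qed.

(* Mean value inequality, reduced to the real one by a rotation. *)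
Lemma mean_value_ineq (phi : C -> C) (a : R -> C) (c : C) K :
  (forall s, 0 <= s -> s <= 1 -> cderiv phi (rc s) (a s)) ->
  (forall s, 0 <= s -> s <= 1 -> normc (a s - c) <= K) ->
  normc (phi 1 - phi 0 - c) <= K.
Proof.
move=> H HK; set D := phi 1 - phi 0 - c.
have [D0|D0] := eqVneq D 0.
  by rewrite D0 Normc.normc0; apply: le_trans (normc_ge0 _) (HK 0 (lexx _) ler01).
have nD : 0 < normc D by rewrite lt_neqAle eq_sym normc_eq0 D0 normc_ge0.
pose k := rc (normc D) / D.
have k1 : normc k = 1.
  rewrite Normc.normcM Normc.normcV normc_real gtr0_norm// divff// gt_eqF//.
pose psi t := k * (phi t - t * c).
have Hpsi s : 0 <= s -> s <= 1 -> cderiv psi (rc s) (k * (a s - c)).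
  move=> s0 s1; apply: cderivZ; apply: cderivB; first exact: H.
  have := cderivM (@cderiv_id _ (rc s)) (@cderiv_cst _ c (rc s)).
  by rewrite mul1r mulr0 addr0.
pose g (t : R) := Re (psi (rc t)).
have dg (s : R) : s \in `]0, 1[ -> is_derive s 1 g (Re (k * (a s - c))).
  by rewrite in_itv/= => /andP[/ltW s0 /ltW s1]; apply: cderiv_is_derive; exact: Hpsi.
have cg : {within `[0, 1], continuous g}.
  apply: continuous_in_subspaceT => s; rewrite inE/= in_itv/= => /andP[s0 s1].
  apply/(@cvgrPdist_lt _ R^o) => e e0; have [r r0 rg] := cderiv_cont (Hpsi s s0 s1) e0.
  apply/nbhs_ballP; exists r => //= y; rewrite /ball/= => xy.
  rewrite distrC; apply: (le_lt_trans (Re_lip _ _)).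
  have -> : rc y = rc s + rc (y - s) by rewrite -rmorphD addrC subrK.
  by apply: rg; rewrite normc_real distrC.
have [s s01 E] := MVT ltr01 dg cg.
have gE : g 1 - g 0 = normc D.
  rewrite /g -Re_opp -Re_add /psi -mulrBr rmorph1 rmorph0 mul1r mul0r subr0.
  rewrite (_ : phi 1 - c - phi 0 = D); last by rewrite /D addrAC.
  by rewrite /k mulfVK.
move: s01; rewrite in_itv/= => /andP[/ltW s0 /ltW s1].
rewrite -gE E subr0 mulr1; apply: le_trans (ler_norm _) _.
apply: le_trans (Re_le_normc _) _; rewrite Normc.normcM k1 mul1r.
exact: HK.
Qed.

Lemma normc_square (x y r : R) : `|x| <= r -> `|y| <= r -> normc (x +i* y)%C <= 2 * r.
Proof. by move=> xr yr; apply: (le_trans (normc_le_ReIm _)) => /=; lra. Qed.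

Lemma cauchy_estimate f x rho M : 0 < rho ->
  (forall w, enorm (w - x) < rho -> differentiable f w) ->
  (forall w, enorm (w - x) < rho -> normc (f w) <= M) ->
  forall v, normc ('d f x v) <= 12 * M / rho * enorm v.
Proof.
move=> rho0 df Mf v.
have [->|v0] := eqVneq v 0.
  by rewrite linear0 Normc.normc0 enorm0 mulr0.
have nv : 0 < enorm v by rewrite lt_neqAle eq_sym enorm_eq0 v0 enorm_ge0.
(* On the square |t| <= 2 r, so that [t *: v] has length at most 2 / 3 of [rho]. The constant 12 is
   this 3 times the 4 of [cauchy_deriv]. *)
pose r := rho / (3 * enorm v); have r0 : 0 < r by rewrite divr_gt0// mulr_gt0.
have inb (s t : R) : `|s| <= r -> `|t| <= r -> enorm (x + (s +i* t)%C *: v - x) < rho.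
  move=> sr tr; rewrite addrC addKr enormZ.
  apply: (@le_lt_trans _ _ (2 * r * enorm v)).
    by rewrite ler_wpM2r ?enorm_ge0// normc_square.
  rewrite (_ : _ * _ = 2 / 3 * rho); first lra.
  by rewrite /r; field; rewrite gt_eqF.
have -> : 12 * M / rho * enorm v = 4 * M / r.
  by rewrite /r; field; rewrite !gt_eqF.
apply: (@cauchy_deriv _ (fun t => f (x + t *: v)) ('d f x v) r M r0).
- by move=> s t sr tr; eexists; apply: cderiv_slice; apply: df; exact: inb.
- by move=> s t sr tr; apply: Mf; exact: inb.
have := @cderiv_slice f x v 0; rewrite scale0r addr0; apply.
by apply: df; rewrite subrr enorm0.
Qed.

(** A Taylor bound of second order before the differential is known to be regular. The difference of
    [f] along two parallel lines at distance of order |h| is itself of order |h|; Cauchy's estimate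
    for it bounds ['d f (x + s h) h - 'd f x h] by a multiple of |h|^2, and the mean value
    inequality concludes. *)
Lemma cauchy_remainder f z rho M : 0 < rho ->
  (forall w, enorm (w - z) < 4 * rho -> differentiable f w) ->
  (forall w, enorm (w - z) < 4 * rho -> normc (f w) <= M) ->
  forall x h, enorm (x - z) < 2 * rho -> enorm h < rho / 2 ->
  normc (f (x + h) - f x) <= 12 * M / rho * enorm h /\
  normc (f (x + h) - f x - 'd f x h) <= 240 * M / rho ^+ 2 * enorm h ^+ 2.
Proof.
move=> rho0 df Mf.
have CB y v : enorm (y - z) < 3 * rho -> normc ('d f y v) <= 12 * M / rho * enorm v.
  move=> yz; apply: cauchy_estimate => // w wy; [apply: df|apply: Mf].
    by rewrite -(subrK y w) -addrA; apply: (le_lt_trans (enormD _ _)); lra.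
  by rewrite -(subrK y w) -addrA; apply: (le_lt_trans (enormD _ _)); lra.
have M0 : 0 <= M.
  by apply: (le_trans (normc_ge0 (f z))); apply: Mf; rewrite subrr enorm0 mulr_gt0.
have lip y h : enorm (y - z) < 5 / 2 * rho -> enorm h < rho / 2 ->
    normc (f (y + h) - f y) <= 12 * M / rho * enorm h.
  move=> yz hr.
  have near s : 0 <= s -> s <= 1 -> enorm (y + rc s *: h - z) < 3 * rho.
    move=> s0 s1; rewrite addrAC; apply: (le_lt_trans (enormD _ _)).
    rewrite enormZ normc_real ger0_norm//.
    have : s * enorm h <= enorm h by rewrite ler_piMl ?enorm_ge0.
    lra.
  have := @mean_value_ineq (fun t => f (y + t *: h)) (fun s => 'd f (y + rc s *: h) h) 0
    (12 * M / rho * enorm h).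
  rewrite scale0r addr0 scale1r subr0; apply => s s0 s1.
    by apply: cderiv_slice; apply: df; apply: (lt_trans (near s s0 s1)); lra.
  by rewrite subr0; apply: CB; exact: near.
move=> x h xz hr; split; first by apply: lip => //; lra.
have [->|h0] := eqVneq h 0.
  by rewrite linear0 addr0 subrr subr0 Normc.normc0 enorm0 expr0n mulr0.
have nh : 0 < enorm h by rewrite lt_neqAle eq_sym enorm_eq0 h0 enorm_ge0.
have near s : 0 <= s -> s <= 1 -> enorm (rc s *: h) <= enorm h.
  by move=> s0 s1; rewrite enormZ normc_real ger0_norm// ler_piMl ?enorm_ge0.
have := @mean_value_ineq (fun t => f (x + t *: h)) (fun s => 'd f (x + rc s *: h) h)
  ('d f x h) (240 * M / rho ^+ 2 * enorm h ^+ 2).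
rewrite scale0r addr0 scale1r; apply => s s0 s1.
  apply: cderiv_slice; apply: df; rewrite addrAC.
  by apply: (le_lt_trans (enormD _ _)); have := near s s0 s1; lra.
(* The square then moves the base point by at most 2 / 5 of [rho], which keeps [lip] applicable; 240
   is 4 * 12 * 5. *)
pose r := rho / (5 * enorm h); have r0 : 0 < r by rewrite divr_gt0// mulr_gt0.
have inb (u t : R) : `|u| <= r -> `|t| <= r -> enorm ((u +i* t)%C *: h) <= 2 / 5 * rho.
  move=> ur tr; rewrite enormZ.
  apply: (@le_trans _ _ (2 * r * enorm h)).
    by rewrite ler_wpM2r ?enorm_ge0// normc_square.
  by apply: eq_imp_le; rewrite /r; field; rewrite gt_eqF.
have -> : 240 * M / rho ^+ 2 * enorm h ^+ 2 = 4 * (12 * M / rho * enorm h) / r.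
  by rewrite /r; field; rewrite !gt_eqF.
have dd (u : C) : enorm (u *: h) <= 2 / 5 * rho ->
    cderiv (fun t => f (x + rc s *: h + t *: h) - f (x + t *: h)) u
      ('d f (x + rc s *: h + u *: h) h - 'd f (x + u *: h) h).
  move=> uh; apply: cderivB; apply: cderiv_slice; apply: df.
    rewrite addrAC; apply: (le_lt_trans (enormD _ _)).
    rewrite addrAC; have := enormD (x - z) (rc s *: h); have := near s s0 s1.
    by lra.
  by rewrite addrAC; apply: (le_lt_trans (enormD _ _)); lra.
apply: (@cauchy_deriv _ (fun t => f (x + rc s *: h + t *: h) - f (x + t *: h))
  _ r (12 * M / rho * enorm h) r0).
- by move=> u t ur tr; eexists; apply: dd; exact: inb.
- move=> u t ur tr; rewrite [x + rc s *: h + _]addrAC.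
  apply: (@le_trans _ _ (12 * M / rho * enorm (rc s *: h))).
    apply: lip; last by apply: (le_lt_trans (near s s0 s1)).
    rewrite addrAC; apply: (le_lt_trans (enormD _ _)); have := inb u t ur tr; lra.
  by rewrite ler_wpM2l ?near// divr_ge0 ?mulr_ge0// ltW.
have := dd 0; rewrite scale0r !addr0; apply; rewrite enorm0; lra.
Qed.

(** The limit at 0 is the supremum of the numbers [u t - K * t], each of which lies below every
    [u s + K * s]. *)
Lemma real_family_limit (u : R -> R) (t0 K : R) : 0 < t0 ->
  (forall t s, 0 < t -> t < t0 -> 0 < s -> s < t0 -> `|u t - u s| <= K * (t + s)) ->
  exists S, forall t, 0 < t -> t < t0 -> `|u t - S| <= K * t.
Proof.
move=> t00 H; pose A := [set u t - K * t | t in [set t | 0 < t < t0]].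
have ub s : 0 < s -> s < t0 -> ubound A (u s + K * s).
  move=> s0 s1 _ [t /andP[t1 t2] <-].
  by have := H t s t1 t2 s0 s1; rewrite ler_norml mulrDr => /andP[_]; lra.
have t2 : 0 < t0 / 2 < t0 by apply/andP; split; lra.
have A0 : A !=set0 by exists (u (t0 / 2) - K * (t0 / 2)), (t0 / 2).
exists (sup A) => t tp tt.
have h1 : sup A <= u t + K * t by apply: ge_sup => //; exact: ub.
have h2 : u t - K * t <= sup A.
  apply: ub_le_sup; last by exists t => //; apply/andP.
  by exists (u (t0 / 2) + K * (t0 / 2)); case/andP: t2 => *; exact: ub.
by rewrite ler_norml; apply/andP; split; lra.
Qed.

Lemma complex_family_limit (u : R -> C) (t0 K : R) : 0 < t0 ->
  (forall t s, 0 < t -> t < t0 -> 0 < s -> s < t0 -> normc (u t - u s) <= K * (t + s)) ->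
  exists S, forall t, 0 < t -> t < t0 -> normc (u t - S) <= 2 * K * t.
Proof.
move=> t00 H.
have [|a Ha] := @real_family_limit (Re \o u) t0 K t00.
  by move=> t s *; apply: le_trans (Re_lip _ _) (H _ _ _ _ _ _).
have [|b Hb] := @real_family_limit (Im \o u) t0 K t00.
  by move=> t s *; apply: le_trans (Im_lip _ _) (H _ _ _ _ _ _).
exists (a +i* b)%C => t tp tt; apply: le_trans (normc_le_ReIm _) _.
rewrite Re_add Re_opp Im_add Im_opp /=.
have := Ha t tp tt; have := Hb t tp tt; rewrite /=; lra.
Qed.

Lemma normc_compare (A B Q0 Q1 L S : C) : normc (A - B - S) <=
  normc (Q1 - Q0 - L) + normc (Q1 - A) + normc (Q0 - B) + normc (L - S).
Proof.
rewrite (_ : A - B - S = (Q1 - Q0 - L) - (Q1 - A) + (Q0 - B) + (L - S)); last ring.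
apply: (le_trans (normcD _ _)); apply: (le_trans (lerD (normcD _ _) (lexx _))).
by apply: (le_trans (lerD (lerD (normcD _ _) (lexx _)) (lexx _))); rewrite normc_opp.
Qed.

(** The difference quotients [q t] are holomorphic and converge to the directional derivative
    uniformly, at rate [K1 * t]. Cauchy's estimate for [q t - q s] makes their differentials at [z]
    converge, to the coefficients [a]; these are the differential of the limit, since the
    second-order remainder of [q t] is bounded independently of [t]. *)
Lemma differentiable_derive f z v rho M : 0 < rho ->
  (forall w, enorm (w - z) < 4 * rho -> differentiable f w) ->
  (forall w, enorm (w - z) < 4 * rho -> normc (f w) <= M) ->
  differentiable (fun w => 'D_v f w) z.
Proof.
move=> rho0 df Mf.
have M0 : 0 <= M.
  by apply: (le_trans (normc_ge0 (f z))); apply: Mf; rewrite subrr enorm0 mulr_gt0.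
pose t0 := rho / (2 * (enorm v + 1)); have nv := enorm_ge0 v.
have v1 : 0 < enorm v + 1 by lra.
have t00 : 0 < t0 by rewrite divr_gt0// mulr_gt0.
have tv t : 0 < t -> t < t0 -> enorm (rc t *: v) < rho / 2.
  move=> tp; rewrite enormZ normc_real gtr0_norm// /t0 ltr_pdivlMr ?mulr_gt0// => tt.
  have : t * (2 * (enorm v + 1)) = 2 * (t * enorm v) + 2 * t by ring.
  lra.
pose q t w := rc t^-1 * (f (w + rc t *: v) - f w).
have CR := cauchy_remainder rho0 df Mf.
have DE w : enorm (w - z) < 4 * rho -> 'D_v f w = 'd f w v by move=> /df; exact: deriveE.
pose M1 : R := 12 * M / rho * enorm v.
have M10 : 0 <= M1 by rewrite mulr_ge0// divr_ge0 ?mulr_ge0// ltW.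
have qb t w : 0 < t -> t < t0 -> enorm (w - z) < 2 * rho -> normc (q t w) <= M1.
  move=> tp tt wz; have [H _] := CR w _ wz (tv t tp tt).
  rewrite /q Normc.normcM normc_real gtr0_norm ?invr_gt0// ler_pdivrMl//.
  by apply: (le_trans H); rewrite enormZ normc_real gtr0_norm// /M1 mulrCA.
pose K1 : R := 240 * M / rho ^+ 2 * enorm v ^+ 2.
have K10 : 0 <= K1.
  exact: mulr_ge0 (divr_ge0 (mulr_ge0 (ler0n R _) M0) (sqr_ge0 _)) (sqr_ge0 _).
have qd t w : 0 < t -> t < t0 -> enorm (w - z) < 2 * rho ->
    normc (q t w - 'D_v f w) <= K1 * t.
  move=> tp tt wz; have [_ H] := CR w _ wz (tv t tp tt).
  have wz4 : enorm (w - z) < 4 * rho by lra.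
  have rt0 : rc t != 0 by rewrite fmorph_eq0 gt_eqF.
  rewrite DE//.
  rewrite (_ : _ - _ = rc t^-1 * (f (w + rc t *: v) - f w - 'd f w (rc t *: v))); last first.
    rewrite /q [RHS]mulrBr; congr (_ - _); rewrite linearZ.
    rewrite [RHS](_ : _ = rc t^-1 * (rc t * 'd f w v))//.
    by rewrite mulrA -rmorphM mulVf ?gt_eqF// rmorph1 mul1r.
  rewrite Normc.normcM normc_real gtr0_norm ?invr_gt0// ler_pdivrMl//.
  apply: (le_trans H); rewrite enormZ normc_real gtr0_norm// /K1 exprMn.
  by apply: eq_imp_le; ring.
have dq t w : 0 < t -> t < t0 -> enorm (w - z) < 2 * rho -> differentiable (q t) w.
  move=> tp tt wz.
  have d1 : differentiable f (w + rc t *: v).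
    apply: df; rewrite addrAC; apply: (le_lt_trans (enormD _ _)).
    by have := tv t tp tt; lra.
  have d2 : differentiable f w by apply: df; lra.
  apply: differentiableM; first exact: differentiable_cst.
  apply: differentiableB; last exact: d2.
  apply: (@differentiable_comp _ _ _ _ (fun w => w + rc t *: v) f); last exact: d1.
  by apply: differentiableD; [exact: ex_diff|exact: differentiable_cst].
pose K2 : R := 12 * (2 * K1) / rho.
have lim j : exists S, forall t, 0 < t -> t < t0 ->
    normc ('d (q t) z (delta_mx 0 j) - S) <= 2 * K2 * t.
  apply: complex_family_limit => // t s tp tt sp st.
  have zz : enorm (z - z) < 2 * rho by rewrite subrr enorm0; lra.
  have E : 'd (q t) z (delta_mx 0 j) - 'd (q s) z (delta_mx 0 j) =
     'd (q t - q s) z (delta_mx 0 j).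
    by apply: diffB_app; apply: dq.
  rewrite E; have e1 : enorm (delta_mx 0 j : Cn) = 1.
    apply/eqP; rewrite -(@eqrXn2 _ 2) ?enorm_ge0// enorm_sqr (bigD1 j)//= big1 => [|i ij].
      by rewrite mxE !eqxx Normc.normc1 expr1n addr0.
    by rewrite mxE (negbTE ij) andbF Normc.normc0 expr0n.
  have -> : K2 * (t + s) = 12 * (K1 * (t + s) * 2) / rho * enorm (delta_mx 0 j : Cn).
    by rewrite e1 /K2; ring.
  apply: (@cauchy_estimate (q t - q s) z rho (K1 * (t + s) * 2) rho0) => w wz.
    by apply: differentiableB; apply: dq => //; lra.
  have wz2 : enorm (w - z) < 2 * rho by lra.
  rewrite (_ : (q t - q s) w = (q t w - 'D_v f w) - (q s w - 'D_v f w)); last first.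
    by rewrite /=; rewrite opprB addrA subrK.
  apply: (le_trans (normcD _ _)); rewrite normc_opp.
  apply: (le_trans (lerD (qd t w tp tt wz2) (qd s w sp st wz2))).
  by rewrite -mulrDr ler_peMr ?ler1n// mulr_ge0// addr_ge0// ltW.
have [a Ha] := choice lim.
pose K3 : R := 240 * M1 / (rho / 2) ^+ 2.
have K30 : 0 <= K3 := divr_ge0 (mulr_ge0 (ler0n R _) M10) (sqr_ge0 _).
have K20 : 0 <= K2.
  by apply: divr_ge0; [apply: mulr_ge0 => //; exact: mulr_ge0|exact: (ltW rho0)].
have main h : enorm h < rho / 4 ->
    normc ('D_v f (z + h) - 'D_v f z - \sum_j a j * h 0 j) <= K3 * enorm h ^+ 2.
  (* For fixed [h], the parameter [t] below is taken so small that all errors depending on it add up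
     to at most [e]; what survives is the remainder of [q t], uniform in [t]. *)
  move=> hr; apply/ler_addgt0Pr => e e0.
  pose W := 2 * K1 + n%:R * (2 * K2) + 1.
  have nn : (0 : R) <= n%:R by [].
  have nK : 0 <= n%:R * (2 * K2) by rewrite mulr_ge0// mulr_ge0.
  have W0 : 0 < W by rewrite /W; lra.
  pose t := Num.min (t0 / 2) (e / (W * (1 + rho))).
  have R1 : 0 < 1 + rho by lra.
  have tp : 0 < t by rewrite lt_min !divr_gt0// mulr_gt0.
  have tt : t < t0 by rewrite /t; apply: (@le_lt_trans _ _ (t0 / 2)); [rewrite ge_min lexx|lra].
  have te : t * (W * (1 + rho)) <= e.
    by rewrite -ler_pdivlMr ?mulr_gt0// /t ge_min lexx orbT.
  have zz : enorm (z - z) < 2 * rho by rewrite subrr enorm0; lra.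
  have zh : enorm (z + h - z) < 2 * rho by rewrite addrC addKr; lra.
  have h1 := qd t z tp tt zz; have h2 := qd t (z + h) tp tt zh.
  have rho2 : 0 < rho / 2 by rewrite divr_gt0.
  have [||||_ h3] := @cauchy_remainder (q t) z (rho / 2) M1 rho2 _ _ z h.
  - by move=> w wz; apply: dq => //; move: wz; clear; lra.
  - by move=> w wz; apply: qb => //; move: wz; clear; lra.
  - by rewrite subrr enorm0 mulr_gt0.
  - by move: hr; clear; lra.
  have h4 : normc ('d (q t) z h - \sum_j a j * h 0 j) <= n%:R * (2 * K2 * t) * enorm h.
    have -> : 'd (q t) z h - \sum_j a j * h 0 j =
        \sum_j ('d (q t) z (delta_mx 0 j) - a j) * h 0 j.
      rewrite diff_coords -sumrB; apply: eq_bigr => j _.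
      by rewrite mulrBl [h 0 j * _]mulrC.
    apply: (le_trans (normc_sum _ _ _)).
    apply: (@le_trans _ _ (\sum_(j < n) (2 * K2 * t * enorm h))).
      apply: ler_sum => j _; rewrite Normc.normcM ler_pM ?normc_ge0//; first exact: Ha.
      exact: coord_le_enorm.
    by rewrite sumr_const card_ord -[leLHS]mulr_natl !mulrA.
  apply: le_trans (normc_compare _ _ (q t z) (q t (z + h)) ('d (q t) z h) _) _.
  apply: le_trans (lerD (lerD (lerD h3 h2) h1) h4) _.
  have hh := enorm_ge0 h.
  have h1r : enorm h <= 1 + rho by move: hr rho0; clear; lra.
  have : n%:R * (2 * K2 * t) * enorm h <= n%:R * (2 * K2) * (1 + rho) * t.
    rewrite (_ : _ * enorm h = n%:R * (2 * K2) * t * enorm h); last ring.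
    by rewrite [leRHS]mulrAC ler_wpM2l// mulr_ge0// (ltW tp).
  have : 2 * K1 * t <= 2 * K1 * (1 + rho) * t.
    rewrite -subr_ge0 (_ : _ - _ = 2 * K1 * rho * t); last ring.
    by apply: mulr_ge0 (ltW tp); apply: mulr_ge0 (ltW rho0); exact: mulr_ge0.
  have : t * (W * (1 + rho)) = 2 * K1 * (1 + rho) * t + n%:R * (2 * K2) * (1 + rho) * t + (1 + rho) * t.
    by rewrite /W; ring.
  have : 0 <= (1 + rho) * t by rewrite mulr_ge0// ltW.
  move: te; rewrite /K3; clear.
  lra.
apply: (@eps_diff _ _ a) => e e0.
exists (Num.min (rho / 4) (e / (K3 + 1))) => [|h].
  by rewrite lt_min !divr_gt0//; lra.
rewrite lt_min => /andP[hr]; rewrite ltr_pdivlMr; last lra.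
move=> he; apply: (le_trans (main h hr)); rewrite expr2 mulrA.
rewrite ler_wpM2r ?enorm_ge0//; have := enorm_ge0 h; lra.
Qed.

Lemma hol_radial f : holomorphic_on_ball f -> holomorphic_on_ball (radial f).
Proof.
move=> hf z zB.
have [r r0 rB] := uball_nbhs zB.
have [d d0 Hd] : exists2 d, 0 < d & forall w, enorm (w - z) < d -> normc (f w) <= normc (f z) + 1.
  have := @differentiable_continuous _ _ _ z f (hf z zB).
  move=> /(@cvgrPdist_lt _ C)/(_ 1 ltr01)/nbhs_enorm[d d0 Hd]; exists d => // w /Hd.
  rewrite norm_normc -(rmorph1 rc) ltcR => h.
  have := normcD (f w - f z) (f z); rewrite subrK normcB; lra.
pose rho := Num.min r d / 4.
have rho0 : 0 < rho by rewrite divr_gt0// lt_min r0.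
have rhor w : enorm (w - z) < 4 * rho -> enorm (w - z) < r /\ enorm (w - z) < d.
  have -> : 4 * rho = Num.min r d by rewrite /rho; field.
  by rewrite lt_min => /andP[].
rewrite /radial (_ : (fun _ => _) = \sum_(j < n) (fun w => w 0 j * 'D_(delta_mx 0 j) f w)); last first.
  by apply/funext => w; rewrite fct_sumE.
apply: differentiable_sum => j; apply: differentiableM; first exact: differentiable_coord.
apply: (@differentiable_derive f z _ rho (normc (f z) + 1)) => // w /rhor[wr wd].
  by apply: hf; exact: rB.
exact: Hd.
Qed.

Lemma hol_radial_iter k f : holomorphic_on_ball f -> holomorphic_on_ball (radial_iter k f).
Proof. by move=> hf; elim: k => //= k IH; exact: hol_radial. Qed.

Lemma radialE f z : holomorphic_on_ball f -> uball z -> radial f z = 'd f z z.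
Proof.
move=> hf zB; rewrite /radial diff_coords.
by apply: eq_bigr => j _; rewrite deriveE//; exact: hf.
Qed.

End SeveralVariables.

(** * Sub-mean value inequality in several variables *)

Section PolycubeMean.
Variable R : realType.
Local Notation Rm := (measurableTypeR R).
Local Notation Rm2 := (Rm * Rm)%type.
Local Notation Cn n := 'rV[R[i]]_n.
Local Notation lebR := (lebesgueR R).

Definition tupd n (t : n.-tuple Rm2) (j : 'I_n) (p : Rm2) : n.-tuple Rm2 :=
  [tuple (if i == j then p else tnth t i) | i < n].

Lemma tnth_tcons2_0 n (t : n.-tuple Rm2) x y : tnth (tcons2 (t, x, y)) ord0 = (x, y).
Proof. by rewrite (tnth_nth (0, 0)). Qed.

Lemma tnth_tcons2_lift n (t : n.-tuple Rm2) x y j :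
  tnth (tcons2 (t, x, y)) (lift ord0 j) = tnth t j.
Proof. by rewrite !(tnth_nth (0, 0)). Qed.

Lemma tupd_tcons2_0 n (t : n.-tuple Rm2) x y p :
  tupd (tcons2 (t, x, y)) ord0 p = tcons2 (t, p.1, p.2).
Proof.
apply: eq_from_tnth => i; rewrite tnth_mktuple.
by case: (unliftP ord0 i) => [k|] -> /=; rewrite ?tnth_tcons2_0 ?tnth_tcons2_lift//; case: p.
Qed.

Lemma tupd_tcons2_lift n (t : n.-tuple Rm2) x y j p :
  tupd (tcons2 (t, x, y)) (lift ord0 j) p = tcons2 (tupd t j p, x, y).
Proof.
apply: eq_from_tnth => i; rewrite tnth_mktuple.
case: (unliftP ord0 i) => [k|] -> /=; rewrite ?tnth_tcons2_0 ?tnth_tcons2_lift//.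
by rewrite tnth_mktuple (inj_eq lift_inj).
Qed.

(** Each use of the one-variable inequality replaces a coordinate still equal to 0 by an integral,
    so the hypothesis is only asked where [tnth t j] vanishes. The tail is treated by induction with
    the first coordinate frozen, and Tonelli reorders the integrals. *)
Lemma iterated_submean n (K : R) (G : n.-tuple Rm2 -> \bar R) : 0 <= K ->
  measurable_fun setT G -> (forall t, 0 <= G t)%E ->
  (forall t j, tnth t j = (0, 0)%R ->
    (G t <= K%:E * \int[lebR]_x \int[lebR]_y G (tupd t j (x, y)))%E) ->
  (G [tuple ((0 : R), (0 : R))%R | j < n] <= (K ^+ n)%:E * \int[lebesgue_tuple R n]_t G t)%E.
Proof.
move=> K0; elim: n G => [|n IH] G mG G0 H.
  rewrite integral_lebesgue_tuple0// expr0 mul1e.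
  by apply: eq_imp_le; congr G; apply: eq_from_tnth => -[].
pose o n : n.-tuple Rm2 := [tuple ((0 : R), (0 : R)) | j < n].
have mGt : measurable_fun setT (G \o @tcons2 R n).
  by apply: measurableT_comp => //; exact: measurable_tcons2.
have oE : o n.+1 = tcons2 (o n, 0, 0).
  apply: eq_from_tnth => i; rewrite tnth_mktuple.
  by case: (unliftP ord0 i) => [k|] -> /=; rewrite ?tnth_tcons2_0 ?tnth_tcons2_lift// tnth_mktuple.
have S1 (x y : Rm) : (G (tcons2 (o n, x, y)) <=
    (K ^+ n)%:E * \int[lebesgue_tuple R n]_t G (tcons2 (t, x, y)))%E.
  apply: (IH (fun t => G (tcons2 (t, x, y)))) => //.
    apply: measurableT_comp mG _; apply: measurableT_comp; first exact: measurable_tcons2.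
    by apply: measurable_fun_pair => //; apply: measurable_fun_pair => //; exact: measurable_cst.
  move=> t j tj; have := H (tcons2 (t, x, y)) (lift ord0 j).
  rewrite tnth_tcons2_lift => /(_ tj) Ht; apply: (le_trans Ht); apply: lee_wpmul2l => //.
  by apply: eq_imp_le; apply: eq_integral => x' _; apply: eq_integral => y' _; rewrite tupd_tcons2_lift.
have := H (o n.+1) ord0; rewrite tnth_mktuple => /(_ erefl) H0.
rewrite -/(o n.+1); apply: (le_trans H0).
rewrite (_ : \int[lebR]_x _ = \int[lebR]_x \int[lebR]_y G (tcons2 (o n, x, y)))%E; last first.
  by apply: eq_integral => x _; apply: eq_integral => y _; rewrite oE tupd_tcons2_0.
rewrite exprS EFinM -muleA; apply: lee_wpmul2l => //.
have Ky : 0 <= K ^+ n by exact: exprn_ge0.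
have J0 (x : Rm) t : (0 <= \int[lebR]_y G (tcons2 (t, x, y)))%E by exact: integral_ge0.
have m2 (x : Rm) : measurable_fun setT (fun ty : n.-tuple Rm2 * Rm => G (tcons2 (ty.1, x, ty.2))).
  apply: measurableT_comp mG _; apply: measurableT_comp; first exact: measurable_tcons2.
  apply: measurable_fun_pair => //; apply: measurable_fun_pair => //; exact: measurable_cst.
have swap1 (x : Rm) : (\int[lebR]_y \int[lebesgue_tuple R n]_t G (tcons2 (t, x, y)) =
    \int[lebesgue_tuple R n]_t \int[lebR]_y G (tcons2 (t, x, y)))%E.
  by have := @fubini_tonelli _ _ _ _ _ (lebT R n) lebR _ (m2 x) (fun=> G0 _); rewrite /= => ->.
have mJ : measurable_fun setT (fun p : n.-tuple Rm2 * Rm =>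
    \int[lebR]_y G (tcons2 (p, y)))%E.
  exact: (@measurable_fun_fubini_tonelli_F _ _ _ _ _ lebR _ mGt (fun p => G0 _)).
have swap2 : (\int[lebR]_x \int[lebesgue_tuple R n]_t \int[lebR]_y G (tcons2 (t, x, y)) =
    \int[lebesgue_tuple R n]_t \int[lebR]_x \int[lebR]_y G (tcons2 (t, x, y)))%E.
  by have := @fubini_tonelli _ _ _ _ _ (lebT R n) lebR _ mJ (fun p => J0 p.2 p.1); rewrite /= => ->.
rewrite integral_lebesgue_tupleS// -swap2.
have mt (x : Rm) : measurable_fun setT (fun y : Rm => \int[lebesgue_tuple R n]_t G (tcons2 (t, x, y)))%E.
  exact: (@measurable_fun_fubini_tonelli_G _ _ _ _ _ (lebT R n) _ (m2 x) (fun=> G0 _)).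
have mx : measurable_fun setT (fun x : Rm =>
    \int[lebesgue_tuple R n]_t \int[lebR]_y G (tcons2 (t, x, y)))%E.
  exact: (@measurable_fun_fubini_tonelli_G _ _ _ _ _ (lebT R n) _ mJ (fun p => J0 p.2 p.1)).
have t0 (x y : Rm) : (0 <= \int[lebesgue_tuple R n]_t G (tcons2 (t, x, y)))%E by exact: integral_ge0.
rewrite -ge0_integralZl_EFin//; last by move=> x _; exact: integral_ge0.
apply: ge0_le_integral => //.
- exact: measurable_tonelli1.
- exact: measurable_funeM.
move=> x _; rewrite -swap1 -ge0_integralZl_EFin//.
apply: ge0_le_integral => //.
- exact: measurable_tonelli0.
- exact: measurable_funeM.
Qed.

Lemma iterated_submean_row n (K : R) (G : Cn n -> \bar R) : 0 <= K ->
  measurable_fun setT G -> (forall u, 0 <= G u)%E ->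
  (forall (u : Cn n) j, u 0%R j = 0%R ->
    (G u <= K%:E * \int[lebR]_x \int[lebR]_y G (u + (x +i* y)%C *: delta_mx 0 j)%R)%E) ->
  (G 0%R <= (K ^+ n)%:E * \int[lebesgueC R n]_u G u)%E.
Proof.
move=> K0 mG G0 H; rewrite integral_lebesgueC//.
have {1}-> : 0%R = row_of_tuple [tuple ((0 : Rm), (0 : Rm)) | j < n].
  by apply/rowP => j; rewrite !mxE tnth_mktuple.
apply: (@iterated_submean n K (G \o @row_of_tuple R n)) => //.
- by apply: measurableT_comp => //; exact: measurable_row_of_tuple.
- by move=> t; exact: G0.
move=> t j tj; have := H (row_of_tuple t) j; rewrite mxE tj => /(_ erefl) Ht.
apply: (le_trans Ht); apply: lee_wpmul2l => //.
apply: eq_imp_le; apply: eq_integral => x _; apply: eq_integral => y _ /=; congr G.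
apply/rowP => i; rewrite !mxE tnth_mktuple eqxx /=.
have [->|ij] := eqVneq i j; last by rewrite mulr0 addr0.
by rewrite tj mulr1 /= add0r.
Qed.
End PolycubeMean.

Section BallMean.
Variables (R : realType) (n : nat).
Local Notation C := R[i].
Local Notation Cn := 'rV[R[i]]_n.
Local Notation Rm := (measurableTypeR R).
Local Notation lebR := (lebesgueR R).
Local Notation normc := (@Normc.normc R).
Local Notation rc := (real_complex R).
Local Notation leb := (lebesgueC R n).
Implicit Types (g : Cn -> C) (z w u : Cn) (q s r : R).

(** The extension by 0 jumps at the boundary of [D], but being nonnegative and continuous on an open
    set it is still lower semicontinuous. *)
Lemma measurable_open_ext (D : set Cn) (f : Cn -> R) : open D ->
  (forall z, 0 <= f z) ->
  (forall z e, D z -> 0 < e -> exists2 r, 0 < r & forall w, enorm (w - z) < r ->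
     `|f w - f z| < e) -> measurable_fun setT (fun z => f z * \1_D z).
Proof.
move=> oD f0 cf; apply: lsc_measurable => x; apply: open_enorm => z /= xz.
have [x0|x0] := ltP x 0.
  exists 1 => // w _; apply: (lt_le_trans x0); apply: mulr_ge0 => //.
have Dz : D z.
  apply: contrapT => nD; move: xz; rewrite indicE memNset// mulr0; lra.
have [r1 r10 H1] : exists2 r, 0 < r & forall w, enorm (w - z) < r -> D w.
  by apply/nbhs_enorm; exact: open_nbhs_nbhs.
move: xz; rewrite indicE mem_set// mulr1 => xz.
have [r2 r20 H2] := cf z (f z - x) Dz ltac:(lra).
exists (Num.min r1 r2); first by rewrite lt_min r10.
move=> w; rewrite lt_min => /andP[/H1 Dw /H2]; rewrite indicE mem_set// mulr1 ltr_norml.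
by move=> /andP[]; lra.
Qed.

Lemma measurable_enorm : measurable_fun setT (@enorm R n).
Proof.
apply: continuous_measurable => z e e0; exists e => // w.
exact: le_lt_trans (enorm_lip _ _).
Qed.

Lemma measurable_defect : measurable_fun setT (@defect R n).
Proof.
by apply: measurable_funB => //; apply: measurable_funX; exact: measurable_enorm.
Qed.

Lemma hol_cont g z (e : R) : holomorphic_on_ball g -> uball z -> 0 < e ->
  exists2 r, 0 < r & forall w, enorm (w - z) < r -> normc (g w - g z) < e.
Proof.
move=> hg zB e0; have := @differentiable_continuous _ _ _ z g (hg z zB).
move=> /(@cvgrPdist_lt _ C)/(_ (rc e)).
rewrite ltcR => /(_ e0)/nbhs_enorm[d d0 Hd]; exists d => // w /Hd.
by rewrite norm_normc ltcR normcB.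
Qed.

(* |g|^q (1 - |z|^2)^s, extended by 0 outside the ball to avoid powers of
   negative numbers. *)
Definition bfun g q s z : R := normc (g z) `^ q * defect z `^ s * \1_(@uball R n) z.

Lemma bfun_ge0 g q s z : 0 <= bfun g q s z.
Proof. by rewrite !mulr_ge0 ?powR_ge0. Qed.

Lemma bfunE g q s z : uball z -> bfun g q s z = normc (g z) `^ q * defect z `^ s.
Proof. by move=> zB; rewrite /bfun indicE mem_set// mulr1. Qed.

Lemma bfun_out g q s z : ~ uball z -> bfun g q s z = 0.
Proof. by move=> zB; rewrite /bfun indicE memNset// mulr0. Qed.

(** The indicator is moved inside the power, where [q > 0] makes 0 to the power [q] vanish; [g] is
    uncontrolled outside the ball. *)
Lemma measurable_bfun g q s : holomorphic_on_ball g -> 0 < q ->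
  measurable_fun setT (bfun g q s).
Proof.
move=> hg q0.
have -> : bfun g q s = (fun z => (normc (g z) * \1_(@uball R n) z) `^ q * defect z `^ s).
  apply/funext => z; have [zB|zB] := pselect (uball z).
    by rewrite bfunE// indicE mem_set// mulr1.
  by rewrite bfun_out// indicE memNset// mulr0 powR0 ?mul0r// gt_eqF.
apply: measurable_funM.
  apply: (measurableT_comp (measurable_powR q)).
  apply: measurable_open_ext => [|z|z e zB e0]; [exact: open_uball|exact: normc_ge0|].
  have [r r0 H] := hol_cont hg zB e0; exists r => // w /H; apply: le_lt_trans.
  exact: normc_lip.
by apply: (measurableT_comp (measurable_powR s)); exact: measurable_defect.
Qed.

Lemma adaptD z x y : adapt z (x + y) = adapt z x + adapt z y.
Proof. by rewrite /adapt line_projD opprD addrACA !scalerDr addrACA. Qed.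

Lemma adaptZ z (c : C) x : adapt z (c *: x) = c *: adapt z x.
Proof.
by rewrite /adapt line_projZ -(scalerBr c) [in RHS]scalerDr !scalerA (mulrC c) (mulrC c).
Qed.

Lemma adapt0 z : adapt z 0 = 0.
Proof. by rewrite -{1}(scale0r (0 : Cn)) adaptZ scale0r. Qed.

(** The map u |-> z + adapt z u is complex affine, so its composition with [g] is holomorphic in
    each coordinate separately. Closed squares of half-side [r / 2] are used in order to stay inside
    the open cube. *)
Lemma submean_adapt g z q r : holomorphic_on_ball g -> uball z -> 0 < q -> 0 < r ->
  (forall u, @cube R n r u -> uball (z + adapt z u)) ->
  ((normc (g z) `^ q)%:E <= ((submean_cst q / (r / 2) ^+ 2) ^+ n)%:E *
    \int[leb]_u (bfun g q 0 (z + adapt z u)%R * \1_(@cube R n r) u)%:E)%E.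
Proof.
move=> hg zB q0 r0 Hr; pose K := submean_cst q / (r / 2) ^+ 2.
have K0 : 0 <= K by rewrite divr_ge0 ?sqr_ge0// ltW// submean_cst_gt0.
pose G u := (bfun g q 0 (z + adapt z u)%R * \1_(@cube R n r) u)%:E.
have G0 u : (0 <= G u)%E by rewrite lee_fin mulr_ge0// bfun_ge0.
have mza : measurable_fun setT (fun u => z + adapt z u).
  by apply: measurable_rowD; [exact: measurable_cst|exact: measurable_adapt].
have mG : measurable_fun setT G.
  apply/measurable_EFinP; apply: measurable_funM.
    by apply: measurableT_comp mza; exact: measurable_bfun.
  by apply: measurable_indic; exact: measurable_cube.
have cube0 : @cube R n r 0 by move=> j; rewrite mxE/= normr0.
have G0E : G 0%R = (normc (g z) `^ q)%:E.
  by rewrite /G adapt0 addr0 bfunE// powRr0 mulr1 indicE mem_set// mulr1.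
rewrite -G0E; apply: iterated_submean_row => // u j uj.
have [ucube|ucube] := pselect (@cube R n r u); last first.
  rewrite {1}/G indicE memNset// mulr0; apply: mule_ge0 => //.
  by apply: integral_ge0 => x _; exact: integral_ge0.
have slice (x y : R) : `|x| <= r / 2 -> `|y| <= r / 2 ->
    @cube R n r (u + (x +i* y)%C *: delta_mx 0 j).
  move=> xr yr i; rewrite !mxE eqxx /=.
  have [->|ij] := eqVneq i j; last by rewrite mulr0 addr0.
  by rewrite uj mulr1 add0r /=; split; lra.
pose v := adapt z (delta_mx 0 j).
pose f (l : C) := g (z + adapt z u + l *: v).
have fE (l : C) : f l = g (z + adapt z (u + l *: delta_mx 0 j)).
  by rewrite /f adaptD adaptZ -addrA.
pose U (p : Rm * Rm) := G (u + (p.1 +i* p.2)%C *: delta_mx 0 j).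
have GE w : @cube R n r w -> G w = (normc (g (z + adapt z w)) `^ q)%:E.
  by move=> cw; rewrite /G bfunE ?powRr0 ?mulr1 ?indicE ?mem_set ?mulr1//; exact: Hr.
have r2 : 0 < r / 2 by rewrite divr_gt0.
have -> : G u = (normc (f 0) `^ q)%:E by rewrite GE// /f scale0r addr0.
apply: (@submean_square _ f (r / 2) q U) => //.
- move=> x y xr yr; eexists; apply: cderiv_slice; apply: hg.
  by rewrite -addrA /v -adaptZ -adaptD; exact: Hr (slice x y xr yr).
- apply: measurableT_comp mG _; apply: measurable_rowD; first exact: measurable_cst.
  by apply: measurable_rowZ => /=; [exact: measurable_fst|exact: measurable_snd|exact: measurable_cst].
- by move=> p; exact: G0.
by move=> x y xr yr; rewrite /U GE ?fE//; exact: slice.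
Qed.

End BallMean.

(** * Bergman balls *)

Section Geometry.
Variables (R : realType) (n : nat).
Local Notation C := R[i].
Local Notation Cn := 'rV[R[i]]_n.
Local Notation normc := (@Normc.normc R).
Local Notation rc := (real_complex R).
Local Notation Re := (@complex.Re R).
Local Notation Im := (@complex.Im R).
Implicit Types (z w u x y : Cn) (kap s r : R).

Lemma defectE z : defect z = 1 - enorm z ^+ 2.
Proof. by []. Qed.

Lemma enorm_lt1 z : uball z -> enorm z < 1. Proof. by []. Qed.

Lemma defect_le z : uball z -> defect z <= 2 * (1 - enorm z).
Proof. by move=> /enorm_lt1 zB; rewrite defectE; have := enorm_ge0 z; nra. Qed.

Lemma normc_one_sub_hdot z w : uball z -> uball w ->
  defect z / 2 <= normc (1 - hdot w z).
Proof.
move=> zB wB; have H := normcD (1 - hdot w z) (hdot w z).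
rewrite subrK Normc.normc1 in H.
have := cauchy_schwarz_hdot w z; have := defect_le zB.
have : enorm w * enorm z <= enorm z by rewrite ler_piMl ?enorm_ge0// ltW.
lra.
Qed.

Lemma normc_one_sub_hdot_gt0 z w : uball z -> uball w -> 0 < normc (1 - hdot w z).
Proof.
by move=> zB wB; have := normc_one_sub_hdot zB wB; have := defect_gt0 zB; lra.
Qed.

Lemma normc_one_sub_hdotC z w : normc (1 - hdot w z) = normc (1 - hdot z w).
Proof. by rewrite (hdotC z w) -[LHS]normc_conj rmorphB rmorph1 /= conjcK. Qed.

Lemma line_proj0 w : line_proj 0 w = 0.
Proof. by rewrite /line_proj scaler0. Qed.

Lemma enorm_phi_numerator z w : uball z ->
  enorm (z - line_proj z w - rc (Num.sqrt (defect z)) *: (w - line_proj z w)) ^+ 2 =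
  normc (1 - hdot w z) ^+ 2 - defect z * defect w.
Proof.
move=> zB; have dz := defect_gt0 zB.
have -> : z - line_proj z w = line_proj z (z - w).
  by rewrite -scaleN1r -[in RHS]scaleN1r line_projD line_projZ line_proj_self.
rewrite addrC enormD_sqr enormN enormZ normc_real exprMn real_normK ?num_real//.
rewrite sqr_sqrtr ?(ltW dz)// hdotNl hdotZl hdot_perp_proj mulr0 oppr0 mulr0 addr0.
have PQ := line_proj_pythagoras z w.
rewrite !defectE in dz *.
have [z0|z0] := eqVneq z 0.
  rewrite z0 !line_proj0 subr0 enorm0 hdot0r subr0 Normc.normc1; ring.
have N0 : enorm z ^+ 2 != 0 by rewrite sqrf_eq0 enorm_eq0.
have E : enorm (w - line_proj z w) ^+ 2 = enorm w ^+ 2 - normc (hdot w z) ^+ 2 / enorm z ^+ 2.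
  by rewrite -enorm_line_proj// PQ addrAC subrr add0r.
rewrite E enorm_line_proj// hdotBl hdotzz !normc_sqr !Re_add !Re_opp !Im_add !Im_opp /=.
by move: (enorm z ^+ 2) N0 => N N0; field.
Qed.

(** The geometry of Bergman balls is read off this identity: it converts the metric into an
    inequality between elementary expressions. *)
Lemma phi_defect z w : uball z -> uball w ->
  1 - enorm (phi z w) ^+ 2 = defect z * defect w / normc (1 - hdot w z) ^+ 2.
Proof.
move=> zB wB; have A0 := normc_one_sub_hdot_gt0 zB wB.
rewrite /phi enormZ exprMn enorm_phi_numerator// Normc.normcV; field.
by rewrite gt_eqF.
Qed.

(* As 1 - |phi_z w|^2 = (1 - |z|^2) (1 - |w|^2) / |1 - <w, z>|^2, these are the
   Bergman balls, [kap] being 1 - tanh(gamma)^2. *)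
Definition qb kap z : set Cn :=
  [set w | uball w /\ kap * normc (1 - hdot w z) ^+ 2 < defect z * defect w].

Lemma qb_uball kap z w : qb kap z w -> uball w. Proof. by case. Qed.

Lemma qb_sym kap z w : uball z -> qb kap z w -> qb kap w z.
Proof. by move=> zB [wB H]; split=> //; rewrite normc_one_sub_hdotC [ltRHS]mulrC. Qed.

(** With e = exp (2 gamma) one has tanh gamma = (e - 1) / (e + 1), so this is 1 - tanh(gamma)^2. *)
Definition bergman_kappa (gamma : R) : R :=
  4 * expR (2 * gamma) / (expR (2 * gamma) + 1) ^+ 2.

Lemma bergman_kappa_gt0 gamma : 0 < bergman_kappa gamma.
Proof.
by rewrite divr_gt0 ?mulr_gt0 ?expR_gt0 ?exprn_gt0 ?addr_gt0 ?expR_gt0.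
Qed.

Lemma bergman_kappa_lt1 gamma : 0 < gamma -> bergman_kappa gamma < 1.
Proof.
move=> g0; have e1 : 1 < expR (2 * gamma) by rewrite expR_gt1 mulr_gt0.
rewrite /bergman_kappa ltr_pdivrMr ?mul1r; last by rewrite exprn_gt0; lra.
by rewrite -subr_gt0 (_ : _ - _ = (expR (2 * gamma) - 1) ^+ 2); [rewrite exprn_gt0; lra|ring].
Qed.

Lemma bergman_ball_qb gamma z : 0 < gamma -> uball z ->
  bergman_ball z gamma = qb (bergman_kappa gamma) z.
Proof.
move=> g0 zB; apply/seteqP; split => w [wB H]; split => //; move: H.
all: have A0 := normc_one_sub_hdot_gt0 zB wB; have A2 : 0 < normc (1 - hdot w z) ^+ 2 by rewrite exprn_gt0.
all: rewrite -(ltr_pdivlMr _ _ A2) -phi_defect//.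
all: have dz := defect_gt0 zB; have dw := defect_gt0 wB.
all: have : 0 < 1 - enorm (phi z w) ^+ 2 by rewrite phi_defect// divr_gt0 ?mulr_gt0.
all: rewrite /bergman_dist; have := enorm_ge0 (phi z w).
all: move: (enorm (phi z w)) => t t0 t2.
all: have t1 : t < 1 by nra.
all: have e1 : 1 < expR (2 * gamma) by rewrite expR_gt1 mulr_gt0.
all: rewrite ltr_pdivrMl// -[X in ln _ < X]expRK ltr_ln ?posrE ?expR_gt0//; last by rewrite divr_gt0//; lra.
all: rewrite [(1 + t) / _ < _]ltr_pdivrMr; last by lra.
all: rewrite /bergman_kappa; move: (expR _) e1 => e e1.
all: have e2 : 0 < (e + 1) ^+ 2 by rewrite exprn_gt0; lra.
- move=> H; rewrite ltr_pdivrMr//.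
  have : t * (e + 1) < e - 1 by lra.
  have : 0 <= t * (e + 1) by rewrite mulr_ge0//; lra.
  rewrite (_ : _ * (e + 1) ^+ 2 = (e + 1) ^+ 2 - (t * (e + 1)) ^+ 2); last ring.
  by move: (t * _) => x; nra.
rewrite ltr_pdivrMr// (_ : _ * (e + 1) ^+ 2 = (e + 1) ^+ 2 - (t * (e + 1)) ^+ 2); last ring.
move=> H; suff : t * (e + 1) < e - 1 by lra.
have : 0 <= t * (e + 1) by rewrite mulr_ge0//; lra.
by move: (t * _) H => x; nra.
Qed.

(** The lower bound |1 - <w, z>| >= (1 - |z|^2) / 2 inserted in the definition of [qb]. With its
    mirror image [qb_defect'] it makes powers of the defect essentially constant on a Bergman
    ball. *)
Lemma qb_defect kap z w : 0 < kap -> uball z -> qb kap z w -> kap / 4 * defect z < defect w.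
Proof.
move=> k0 zB [wB H]; have := normc_one_sub_hdot zB wB; have dz := defect_gt0 zB.
move: (normc _) H => a H za.
have : kap * (defect z / 2) ^+ 2 <= kap * a ^+ 2.
  by rewrite ler_pM2l// lerXn2r ?nnegrE//; lra.
move=> H2; rewrite -(ltr_pM2l dz); apply: le_lt_trans H; apply: le_trans H2.
by apply: eq_imp_le; field.
Qed.

Lemma qb_defect' kap z w : 0 < kap -> uball z -> qb kap z w -> kap / 4 * defect w < defect z.
Proof. by move=> k0 zB H; apply: qb_defect (qb_sym zB H) => //; exact: qb_uball H. Qed.

Lemma qb_one_sub kap z w : 0 < kap -> uball z -> qb kap z w ->
  normc (1 - hdot w z) <= 2 / kap * defect z.
Proof.
move=> k0 zB H; have H4 := qb_defect' k0 zB H; case: H => wB H.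
have dz := defect_gt0 zB; rewrite -(@ler_pXn2r _ 2)// ?nnegrE ?normc_ge0//; last first.
  by rewrite mulr_ge0 ?divr_ge0// ltW.
have H5 : defect w < 4 / kap * defect z.
  by rewrite mulrAC ltr_pdivlMr//; lra.
rewrite -(ler_pM2l k0); apply: le_trans (ltW H) _.
apply: (@le_trans _ _ (defect z * (4 / kap * defect z))).
  by rewrite ler_pM2l// ltW.
by apply: eq_imp_le; field; rewrite gt_eqF.
Qed.

Lemma qb_hdot_sub kap z w : 0 < kap -> kap < 1 -> uball z -> qb kap z w ->
  normc (hdot (w - z) z) <= 3 / kap * defect z.
Proof.
move=> k0 k1 zB H; have H1 := qb_one_sub k0 zB H; have dz := defect_gt0 zB.
have -> : hdot (w - z) z = rc (defect z) - (1 - hdot w z).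
  by rewrite hdotBl hdotzz defectE rmorphB rmorph1; ring.
apply: (le_trans (normcD _ _)); rewrite normc_opp normc_real gtr0_norm//.
have : 1 <= kap^-1 by rewrite invf_ge1// ltW.
move=> k2; have : defect z <= kap^-1 * defect z by rewrite ler_peMl// ltW.
lra.
Qed.

Lemma qb_line_proj kap z w : 0 < kap -> kap < 1 -> uball z -> qb kap z w ->
  enorm (line_proj z (w - z)) <= 6 / kap * defect z.
Proof.
move=> k0 k1 zB H; have H1 := qb_hdot_sub k0 k1 zB H; have dz := defect_gt0 zB.
have k2 : 1 < kap^-1 by rewrite invf_gt1.
(* Dividing by |z| costs at most a factor 2 when |z| >= 1 / 2. Near the origin the defect is at
   least 3 / 4 and the trivial bound on |w - z| is enough. *)
have [zb|zs] := leP (1 / 2) (enorm z).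
  have z0 : z != 0 by rewrite -enorm_eq0 gt_eqF//; lra.
  have E : enorm (line_proj z (w - z)) * enorm z = normc (hdot (w - z) z).
    apply/eqP; rewrite -(@eqrXn2 _ 2)// ?mulr_ge0 ?enorm_ge0 ?normc_ge0//.
    by rewrite exprMn enorm_line_proj// divfK// sqrf_eq0 enorm_eq0.
  have : enorm (line_proj z (w - z)) * (1 / 2) <= normc (hdot (w - z) z).
    by rewrite -E ler_wpM2l ?enorm_ge0.
  lra.
apply: le_trans (enorm_line_proj_le _ _) _; apply: le_trans (enormD _ _) _.
rewrite enormN; have := enorm_lt1 (qb_uball H).
have : 3 / 4 <= defect z by rewrite defectE; have := enorm_ge0 z; nra.
move=> dz2; have : kap^-1 * (3 / 4) <= kap^-1 * defect z by rewrite ler_wpM2l// invr_ge0 ltW.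
lra.
Qed.

(** Across the line of [z] only the square root of the defect appears: by Pythagoras the squared
    length is at most 1 - |<w, z>|^2, hence at most 2 |1 - <w, z>|, which is of the order of the
    defect. *)
Lemma qb_perp_proj kap z w : 0 < kap -> kap < 1 -> uball z -> qb kap z w ->
  enorm (w - z - line_proj z (w - z)) <= 3 / kap * Num.sqrt (defect z).
Proof.
move=> k0 k1 zB H; have H1 := qb_one_sub k0 zB H; have dz := defect_gt0 zB.
have wB := enorm_lt1 (qb_uball H); have wB0 := enorm_ge0 w.
have k2 : 1 < kap^-1 by rewrite invf_gt1.
rewrite -(@ler_pXn2r _ 2)// ?nnegrE ?enorm_ge0 ?mulr_ge0 ?sqrtr_ge0 ?divr_ge0 ?invr_ge0 ?(ltW k0)//.
rewrite [leRHS]exprMn (sqr_sqrtr (ltW dz)).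
have k3 : 1 <= kap^-1 ^+ 2 by rewrite exprn_ege1// ltW.
have [z0|z0] := eqVneq z 0.
  rewrite z0 line_proj0 !subr0 /defect enorm0 expr0n subr0 mulr1 exprMn.
  have : enorm w ^+ 2 <= 1 by rewrite exprn_ile1// ltW.
  lra.
have -> : w - z - line_proj z (w - z) = w - line_proj z w.
  rewrite -[in line_proj _ _]scaleN1r line_projD line_projZ line_proj_self scaleN1r.
  by rewrite opprB addrA subrK.
have PQ := line_proj_pythagoras z w; rewrite enorm_line_proj// in PQ.
have zn : 0 < enorm z ^+ 2 by rewrite exprn_gt0// lt_neqAle eq_sym enorm_eq0 z0 enorm_ge0.
have zn1 : enorm z ^+ 2 < 1 by rewrite exprn_ilt1 ?enorm_ge0// enorm_lt1.
have : normc (hdot w z) ^+ 2 <= normc (hdot w z) ^+ 2 / enorm z ^+ 2.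
  by rewrite ler_peMr ?sqr_ge0// invf_ge1// ltW.
have H2 := normcD (1 - hdot w z) (hdot w z); rewrite subrK Normc.normc1 in H2.
have : enorm w ^+ 2 < 1 by rewrite exprn_ilt1.
have := normc_ge0 (hdot w z).
have : normc (hdot w z) < 1.
  apply: le_lt_trans (cauchy_schwarz_hdot _ _) _.
  by rewrite mulr_ilt1 ?enorm_ge0// enorm_lt1.
have : kap^-1 * defect z <= kap^-1 ^+ 2 * defect z.
  by rewrite ler_wpM2r ?(ltW dz)// expr2; apply: ler_peMr; [rewrite invr_ge0 ltW|exact: ltW].
move: PQ; move: (enorm (w - line_proj z w) ^+ 2) => X PQ h1 h2 h3 h4 h5.
have : 1 - normc (hdot w z) ^+ 2 <= 2 * (1 - normc (hdot w z)) by nra.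
have -> : (3 / kap) ^+ 2 = 9 * kap^-1 ^+ 2 by rewrite exprMn; congr (_ * _); ring.
have : 0 <= kap^-1 * defect z by apply: mulr_ge0; [rewrite invr_ge0 ltW|exact: ltW].
by rewrite -mulrA; move: (kap^-1 ^+ 2 * defect z) h1 => Y h1; lra.
Qed.

(** Both sides of the defining inequality scale like [defect z ^+ 2]: one has 1 - <z + adapt z u, z>
    = d (1 - <u, z>) and the new defect is at least d (1 - 4 |u|). It remains that kap (1 + |u|)^2 <
    1 - 4 |u|, which follows from 7 |u| < 1 - kap. *)
Lemma adapt_qb kap z u : 0 < kap -> kap < 1 -> uball z -> enorm u <= (1 - kap) / 8 ->
  qb kap z (z + adapt z u).
Proof.
move=> k0 k1 zB ue; have dz := defect_gt0 zB; have zn := enorm_lt1 zB; have zn0 := enorm_ge0 z.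
pose P := line_proj z u; pose Q := u - P; pose d := defect z; pose s := Num.sqrt d.
have s2 : s ^+ 2 = d by rewrite sqr_sqrtr// ltW.
have Pe : enorm P <= enorm u := enorm_line_proj_le _ _.
have Qe : enorm Q <= enorm u := enorm_perp_proj_le _ _.
have u0 := enorm_ge0 u; have P0 := enorm_ge0 P; have Q0 := enorm_ge0 Q.
have hQ v : hdot Q (line_proj z v) = 0 by exact: hdot_perp_proj.
have hQz : hdot Q z = 0 by have := hQ z; rewrite line_proj_self.
have hP : hdot P z = hdot u z by exact: hdot_line_proj.
have hQP : hdot Q P = 0 by exact: hQ.
have AE : adapt z u = rc d *: P + rc s *: Q by [].
clearbody Q P.
have a1 : normc (hdot u z) <= enorm u.
  by apply: le_trans (cauchy_schwarz_hdot _ _) _; rewrite ler_piMr// ltW.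
have A : 1 - hdot (z + adapt z u) z = rc d * (1 - hdot u z).
  rewrite AE !hdotDl !hdotZl hQz mulr0 addr0 hP hdotzz.
  by rewrite /d /defect rmorphB rmorph1; ring.
have dw : defect (z + adapt z u) = d - 2 * d * Re (hdot u z) - d ^+ 2 * enorm P ^+ 2 - d * enorm Q ^+ 2.
  rewrite {1}/defect AE addrA enormD_sqr hdotZr hdotC hdotDr hdotZr hQP mulr0.
  rewrite addr0 hQz conjc0 mulr0 mulr0 addr0.
  rewrite enormD_sqr !enormZ !normc_real hdotZr hdotC hP.
  rewrite (_ : Re _ = d * Re (hdot u z)); last first.
    by rewrite Re_mul /=; case: (hdot u z) => a b /=; ring.
  rewrite !exprMn !real_normK ?num_real// s2 /d /defect; ring.
have R1 : `|Re (hdot u z)| <= enorm u by apply: le_trans (Re_le_normc _) a1.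
have e8 : enorm u <= 1 / 8 by lra.
have d1 : d <= 1 := defect_le1 z.
have d0 : 0 < d := dz.
have dw2 : d * (1 - 4 * enorm u) <= defect (z + adapt z u).
  rewrite dw; move: R1; rewrite ler_norml => /andP[_ R1].
  have P2 : enorm P ^+ 2 <= enorm u by nra.
  have Q2 : enorm Q ^+ 2 <= enorm u by nra.
  have dP : d * enorm P ^+ 2 <= enorm u.
    by apply: le_trans P2; rewrite ler_piMl// sqr_ge0.
  rewrite (_ : _ - _ - _ - _ = d * (1 - 2 * Re (hdot u z) - d * enorm P ^+ 2 - enorm Q ^+ 2)).
    by rewrite ler_pM2l//; lra.
  ring.
have wB : uball (z + adapt z u) by apply: uball_defect; apply: lt_le_trans dw2; rewrite mulr_gt0//; lra.
split=> //; rewrite A Normc.normcM normc_real gtr0_norm// exprMn -/d.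
apply: (@lt_le_trans _ _ (d * (d * (1 - 4 * enorm u)))); last by rewrite ler_pM2l.
rewrite mulrCA expr2 -!mulrA !ltr_pM2l//.
have : normc (1 - hdot u z) ^+ 2 <= (1 + enorm u) ^+ 2.
  rewrite lerXn2r ?nnegrE ?normc_ge0//; first lra.
  by apply: (le_trans (normcD _ _)); rewrite normc_opp Normc.normc1 lerD2l.
move: (normc _ ^+ 2) => X XX.
have : kap * X <= kap * (1 + enorm u) ^+ 2 by rewrite ler_pM2l.
have : enorm u ^+ 2 <= enorm u by nra.
have : kap * (1 + enorm u) ^+ 2 = kap + kap * (2 * enorm u + enorm u ^+ 2) by ring.
have : kap * (2 * enorm u + enorm u ^+ 2) <= 2 * enorm u + enorm u ^+ 2.
  by rewrite ler_piMl ?(ltW k1)// addr_ge0 ?mulr_ge0 ?sqr_ge0.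
lra.
Qed.

Lemma line_proj_adapt z x : line_proj z (adapt z x) = rc (defect z) *: line_proj z x.
Proof.
rewrite {1}/adapt line_projD 2!line_projZ line_proj_idem.
have -> : line_proj z (x - line_proj z x) = 0.
  by rewrite -[- line_proj z x]scaleN1r line_projD line_projZ line_proj_idem scaleN1r subrr.
by rewrite scaler0 addr0.
Qed.

Lemma qb_adapt_bound kap z x : 0 < kap -> kap < 1 -> uball z ->
  qb kap z (z + adapt z x) -> enorm x <= 9 / kap.
Proof.
move=> k0 k1 zB H; have dz := defect_gt0 zB.
have H1 := qb_line_proj k0 k1 zB H; have H2 := qb_perp_proj k0 k1 zB H.
move: H1 H2; rewrite addrC addKr line_proj_adapt enormZ normc_real gtr0_norm//.
rewrite mulrC ler_pM2r// => H1.
have -> : adapt z x - rc (defect z) *: line_proj z x =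
    rc (Num.sqrt (defect z)) *: (x - line_proj z x).
  by rewrite /adapt addrC addKr.
rewrite enormZ normc_real ger0_norm ?sqrtr_ge0// mulrC ler_pM2r ?sqrtr_gt0// => H2.
rewrite -(subrK (line_proj z x) x); apply: (le_trans (enormD _ _)); lra.
Qed.

(** Four powers of [kap] compensate the square of the bound [52 * b ^+ 2] in [qb_trans], two come
    from the product of the two defects, and [10 ^+ 5] is a round number with 52^2 / 10^5 < 1 /
    16. *)
Definition kappa_trans kap : R := kap ^+ 6 / 10 ^+ 5.

Lemma kappa_trans_gt0 kap : 0 < kap -> 0 < kappa_trans kap.
Proof. by move=> k0; rewrite divr_gt0 ?exprn_gt0. Qed.

Lemma kappa_trans_lt1 kap : 0 < kap -> kap < 1 -> kappa_trans kap < 1.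
Proof.
move=> k0 k1; rewrite ltr_pdivrMr ?exprn_gt0// mul1r.
have : kap ^+ 6 <= 1 by rewrite exprn_ile1// ltW.
by move=> /le_lt_trans; apply; rewrite exprn_egt1//; lra.
Qed.

(* Quasi-triangle inequality, in the coordinates adapted to the middle point. *)
Lemma qb_trans kap w z u : 0 < kap -> kap < 1 -> uball w ->
  qb kap w z -> qb kap w u -> qb (kappa_trans kap) z u.
Proof.
move=> k0 k1 wB Hz Hu; have dw := defect_gt0 wB; have zB := qb_uball Hz.
have dz := defect_gt0 zB.
split; first exact: qb_uball Hu.
pose s := Num.sqrt (defect w); have s2 : s ^+ 2 = defect w by rewrite sqr_sqrtr// ltW.
have z1 := qb_hdot_sub k0 k1 wB Hz; have z2 := qb_line_proj k0 k1 wB Hz.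
have z3 := qb_perp_proj k0 k1 wB Hz; have z4 := qb_defect k0 wB Hz.
have u1 := qb_hdot_sub k0 k1 wB Hu; have u2 := qb_line_proj k0 k1 wB Hu.
have u3 := qb_perp_proj k0 k1 wB Hu; have u4 := qb_defect k0 wB Hu.
rewrite -/s in z3 u3.
pose Pz := line_proj w (z - w); pose Qz := z - w - Pz.
pose Pu := line_proj w (u - w); pose Qu := u - w - Pu.
rewrite -/Pz -/Qz -/Pu -/Qu in z2 z3 u2 u3.
have hq x v : hdot (x - line_proj w x) (line_proj w v) = 0 by exact: hdot_perp_proj.
have hUZ : hdot Qu Pz = 0 by exact: hq.
have hZU : hdot Qz Pu = 0 by exact: hq.
have dU : u - w = Pu + Qu by rewrite /Qu [RHS]addrC subrK.
have dZ : z - w = Pz + Qz by rewrite /Qz [RHS]addrC subrK.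
clearbody Qu Qz Pu Pz.
(* 1 - <u, z> is expanded around [w]; the components along the line of [w] and across it do not mix,
   by orthogonality, so each remaining term is of order [defect w]. *)
have E : 1 - hdot u z = rc (defect w) - ((hdot (z - w) w)^*)%C - hdot (u - w) w
    - hdot Pu Pz - hdot Qu Qz.
  have -> : hdot u z = hdot w w + hdot w (z - w) + hdot (u - w) w + hdot (u - w) (z - w).
    by rewrite !hdotBl !hdotBr; ring.
  have -> : hdot (u - w) (z - w) = hdot Pu Pz + hdot Qu Qz.
    rewrite dU dZ hdotDl 2!hdotDr hUZ add0r.
    by rewrite [hdot Pu Qz]hdotC hZU conjc0 addr0.
  by rewrite hdotzz /defect rmorphB rmorph1 [hdot w (z - w)]hdotC; ring.
have d1 := defect_le1 w.
have ik : 1 < kap^-1 by rewrite invf_gt1.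
pose b := kap^-1; rewrite -/b in z1 z2 z3 u1 u2 u3 ik.
have b0 : 0 < b by rewrite invr_gt0.
have bb : b <= b ^+ 2 by rewrite expr2 ler_peMr// ltW.
have H1 : normc (hdot Pu Pz) <= 36 * b ^+ 2 * defect w.
  apply: le_trans (cauchy_schwarz_hdot _ _) _.
  apply: (@le_trans _ _ (6 * b * defect w * (6 * b * defect w))).
    by rewrite ler_pM ?enorm_ge0.
  rewrite (_ : _ * _ = 36 * b ^+ 2 * defect w * defect w); last ring.
  by rewrite ler_piMr// mulr_ge0 ?(ltW dw)// mulr_ge0// sqr_ge0.
have H2 : normc (hdot Qu Qz) <= 9 * b ^+ 2 * defect w.
  apply: le_trans (cauchy_schwarz_hdot _ _) _.
  apply: (@le_trans _ _ (3 * b * s * (3 * b * s))).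
    by rewrite ler_pM ?enorm_ge0.
  by rewrite -s2; apply: eq_imp_le; ring.
have H3 : normc (1 - hdot u z) <= 52 * b ^+ 2 * defect w.
  rewrite E; apply: (le_trans (normcD _ _)); rewrite normc_opp.
  apply: (le_trans (lerD (normcD _ _) (lexx _))); rewrite normc_opp.
  apply: (le_trans (lerD (lerD (normcD _ _) (lexx _)) (lexx _))); rewrite normc_opp.
  apply: (le_trans (lerD (lerD (lerD (normcD _ _) (lexx _)) (lexx _)) (lexx _))).
  rewrite normc_opp normc_conj normc_real gtr0_norm//.
  have : b * defect w <= b ^+ 2 * defect w by rewrite ler_wpM2r// ltW.
  have : defect w <= b ^+ 2 * defect w by rewrite ler_peMl ?(ltW dw)// exprn_ege1// ltW.
  lra.
have H4 : normc (1 - hdot u z) ^+ 2 <= (52 * b ^+ 2 * defect w) ^+ 2.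
  by rewrite lerXn2r ?nnegrE ?normc_ge0// mulr_ge0 ?(ltW dw)// mulr_ge0// sqr_ge0.
apply: (@lt_trans _ _ (kap / 4 * defect w * (kap / 4 * defect w))); last first.
  by rewrite ltr_pM// mulr_ge0 ?(ltW dw)// divr_ge0// ltW.
apply: (@le_lt_trans _ _ (kappa_trans kap * (52 * b ^+ 2 * defect w) ^+ 2)).
  by rewrite ler_pM2l// kappa_trans_gt0.
rewrite [ltLHS](_ : _ = 2704 / 10 ^+ 5 * (kap * defect w) ^+ 2); last first.
  by rewrite /kappa_trans /b; field; rewrite gt_eqF.
have : 0 < (kap * defect w) ^+ 2 by rewrite exprn_gt0// mulr_gt0.
rewrite (_ : kap / 4 * _ * _ = (kap * defect w) ^+ 2 / 16); last by field.
by move: (_ ^+ 2) => X; lra.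
Qed.

(** Here 1 - s |z|^2 is at most twice the defect of [z], so any constant below 1 / 4 is suitable. *)
Lemma dilate_qb z s : uball z -> 0 <= s -> s <= 1 -> 1 - s <= defect z ->
  qb (1 / 5) z (rc s *: z).
Proof.
move=> zB s0 s1 sd; have dz := defect_gt0 zB.
have ds : defect z <= defect (rc s *: z).
  rewrite /defect enormZ normc_real ger0_norm// lerD2l lerN2 exprMn ler_piMl ?sqr_ge0//.
  by rewrite exprn_ile1.
split; first by apply: uball_defect; exact: lt_le_trans ds.
rewrite hdotZl hdotzz -rmorphM -(rmorph1 rc) -rmorphB normc_real real_normK ?num_real//.
apply: (@lt_le_trans _ _ (defect z * defect z)); last by rewrite ler_pM2l.
move: dz sd; rewrite /defect; have := sqr_ge0 (enorm z); move: (_ ^+ 2) => N N0 dz sd.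
have : 0 <= 1 - s * N by nra.
have : 1 - s * N <= 2 * (1 - N) by nra.
nra.
Qed.

Lemma open_qb kap z : 0 < kap -> uball z -> open (qb kap z).
Proof.
move=> k0 zB.
apply: open_enorm => w [wB H].
have [r1 r10 H1] := uball_nbhs wB.
have dz := defect_le1 z.
pose f x := defect z * defect x - kap * normc (1 - hdot x z) ^+ 2.
have fw : 0 < f w by rewrite subr_gt0.
have K0 : 0 < 3 + 4 * kap by lra.
exists (Num.min r1 (f w / (3 + 4 * kap))); first by rewrite lt_min r10 divr_gt0.
move=> x; rewrite lt_min => /andP[/H1 xB]; rewrite ltr_pdivlMr// => xw.
split=> //; rewrite -subr_gt0 -/(f x).
have e0 := enorm_ge0 (x - w).
have h1 : defect z * defect w - defect z * defect x <= 2 * enorm (x - w).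
  have := enorm_lip x w; rewrite ler_norml => /andP[_ h].
  have := enorm_lt1 xB; have := enorm_lt1 wB; have := enorm_ge0 x; have := enorm_ge0 w.
  move=> a b c d; have h2 : defect w - defect x <= 2 * enorm (x - w).
    by rewrite /defect; nra.
  by rewrite -mulrBr; apply: le_trans (_ : defect z * (2 * enorm (x - w)) <= _);
    [rewrite ler_wpM2l// ltW// defect_gt0|rewrite ler_piMl// mulr_ge0].
have nx : normc (1 - hdot x z) <= normc (1 - hdot w z) + enorm (x - w).
  rewrite (_ : 1 - hdot x z = (1 - hdot w z) - hdot (x - w) z); last by rewrite hdotBl; ring.
  apply: (le_trans (normcD _ _)); rewrite normc_opp lerD2l.
  apply: le_trans (cauchy_schwarz_hdot _ _) _.
  by rewrite ler_piMr// ltW// enorm_lt1.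
have n2 y : uball y -> normc (1 - hdot y z) <= 2.
  move=> yB; apply: (le_trans (normcD _ _)); rewrite normc_opp Normc.normc1.
  have := cauchy_schwarz_hdot y z; have : enorm y * enorm z <= 1.
    by rewrite mulr_ile1 ?enorm_ge0// ltW// enorm_lt1.
  lra.
have h2 : normc (1 - hdot x z) ^+ 2 - normc (1 - hdot w z) ^+ 2 <= 4 * enorm (x - w).
  have := n2 x xB; have := n2 w wB; have := normc_ge0 (1 - hdot x z).
  have := normc_ge0 (1 - hdot w z); move: nx; move: (normc _) (normc _) => a b; nra.
have : kap * normc (1 - hdot x z) ^+ 2 - kap * normc (1 - hdot w z) ^+ 2 <= kap * (4 * enorm (x - w)).
  by rewrite -mulrBr ler_pM2l.
move: xw; rewrite /f; lra.
Qed.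

End Geometry.

(** * Averages over Bergman balls *)

Section PowR.
Variable R : realType.
Implicit Types (a b c s p : R).

(** Handles both signs of the exponent: [a <= c * b] serves for [s >= 0] and [b <= c * a] for
    [s < 0]. *)
Lemma powR_comparable a b c s : 0 < a -> 0 < b -> 0 < c -> a <= c * b -> b <= c * a ->
  a `^ s <= c `^ `|s| * b `^ s.
Proof.
move=> a0 b0 c0 ab ba; have [s0|s0] := leP 0 s.
  by rewrite ger0_norm// -powRM ?(ltW b0) ?(ltW c0)//; apply: (ge0_ler_powR s0) => //; rewrite nnegrE ?mulr_ge0 ?ltW.
have E d : d `^ s = (d `^ (- s))^-1 by rewrite -powRN opprK.
rewrite ltr0_norm// (E a) (E b).
rewrite -[leLHS]div1r ler_pdivrMr ?powR_gt0// mulrAC ler_pdivlMr ?powR_gt0// mul1r.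
have s1 : 0 <= - s by rewrite oppr_ge0 ltW.
by rewrite -powRM ?(ltW a0) ?(ltW c0)//; apply: (ge0_ler_powR s1) => //; rewrite nnegrE ?mulr_ge0 ?ltW.
Qed.
Lemma powR_root a p : 0 < p -> 0 <= a -> (a `^ p^-1) `^ p = a.
Proof. by move=> p0 a0; rewrite -powRrM mulVf ?powRr1// gt_eqF. Qed.

Lemma powRK a p : 0 < p -> 0 <= a -> (a `^ p) `^ p^-1 = a.
Proof. by move=> p0 a0; rewrite -powRrM mulfV ?powRr1// gt_eqF. Qed.

Lemma powR_le_root a b p : 0 < p -> 0 <= a -> 0 <= b -> a `^ p <= b -> a <= b `^ p^-1.
Proof.
move=> p0 a0 b0 ab; rewrite -(powRK p0 a0); apply: ge0_ler_powR => //.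
- by rewrite invr_ge0 ltW.
- by rewrite nnegrE powR_ge0.
Qed.

Lemma powR_le a b p : 0 <= p -> 0 <= a -> a <= b -> a `^ p <= b `^ p.
Proof. by move=> p0 a0 ab; apply: (ge0_ler_powR p0); rewrite // nnegrE// (le_trans a0). Qed.

End PowR.

Lemma indic_in (R : pzRingType) T (A : set T) x : A x -> \1_A x = 1 :> R.
Proof. by move=> Ax; rewrite indicE mem_set. Qed.

Lemma indic_notin (R : pzRingType) T (A : set T) x : ~ A x -> \1_A x = 0 :> R.
Proof. by move=> Ax; rewrite indicE memNset. Qed.

Lemma le_integral_scale d (T : measurableType d) (R : realType)
    (m : {measure set T -> \bar R}) (f h : T -> \bar R) (K : R) : 0 <= K ->
  measurable_fun setT f -> measurable_fun setT h ->
  (forall x, 0 <= f x)%E -> (forall x, 0 <= h x)%E ->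
  (forall x, f x <= K%:E * h x)%E ->
  (\int[m]_x f x <= K%:E * \int[m]_x h x)%E.
Proof.
move=> K0 mf mh f0 h0 fh; rewrite -ge0_integralZl_EFin//.
by apply: ge0_le_integral => //; exact: measurable_funeM.
Qed.

Section BallEstimates.
Variables (R : realType) (n : nat).
Local Notation C := R[i].
Local Notation Cn := 'rV[R[i]]_n.
Local Notation normc := (@Normc.normc R).
Local Notation rc := (real_complex R).
Local Notation Re := (@complex.Re R).
Local Notation Im := (@complex.Im R).
Local Notation leb := (lebesgueC R n).
Local Notation uball := (@uball R n).
Implicit Types (g : Cn -> C) (z w u : Cn) (p q s r kap : R).

Lemma measurable_defect_powR a : measurable_fun setT (fun z : Cn => defect z `^ a).
Proof. exact: (measurableT_comp (measurable_powR a) (@measurable_defect R n)). Qed.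

Lemma qb_powR kap s z w : 0 < kap -> kap < 1 -> uball z -> qb kap z w ->
  defect z `^ s <= (4 / kap) `^ `|s| * defect w `^ s /\
  defect w `^ s <= (4 / kap) `^ `|s| * defect z `^ s.
Proof.
move=> k0 k1 zB H; have h1 := qb_defect k0 zB H; have h2 := qb_defect' k0 zB H.
have dz := defect_gt0 zB; have dw := defect_gt0 (qb_uball H).
have c0 : 0 < 4 / kap by rewrite divr_gt0.
have E a b : kap / 4 * a < b -> a <= 4 / kap * b.
  by move=> ab; rewrite mulrAC ler_pdivlMr//; lra.
by split; apply: powR_comparable => //; apply: E.
Qed.

Lemma measurable_qb2 kap : measurable [set zw : Cn * Cn | qb kap zw.1 zw.2].
Proof.
have [mr mi] := @measurable_hdot R n _ (Cn * Cn)%type snd fst measurable_snd measurable_fst.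
pose f (zw : Cn * Cn) : R := defect zw.1 * defect zw.2 - kap *
  ((1 - Re (hdot zw.2 zw.1)) ^+ 2 + Im (hdot zw.2 zw.1) ^+ 2).
have mf : measurable_fun setT f.
  apply: measurable_funB.
    by apply: measurable_funM; apply: (measurableT_comp (@measurable_defect R n)).
  apply: measurable_funM => //; apply: measurable_funD; apply: measurable_funX => //.
  exact: measurable_funB.
have -> : [set zw : Cn * Cn | qb kap zw.1 zw.2] = (snd @^-1` uball) `&` (f @^-1` `]0, +oo[).
  apply/seteqP; split => -[z w]; rewrite /qb /f /= in_itv /= andbT subr_gt0.
    by rewrite normc_sqr Re_add Im_add Re_opp Im_opp /= sub0r sqrrN.
  by rewrite normc_sqr Re_add Im_add Re_opp Im_opp /= sub0r sqrrN.
apply: measurableI.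
  by rewrite -[X in measurable X]setTI; apply: measurable_snd => //; exact: measurable_uball.
by rewrite -[X in measurable X]setTI; apply: mf.
Qed.

Lemma measurable_qb kap z : measurable (qb kap z).
Proof.
have m : measurable_fun setT (fun w : Cn => (z, w)) by apply: measurable_fun_pair.
by have := m measurableT _ (measurable_qb2 kap); rewrite setTI.
Qed.

Lemma small_cube_qb kap : 0 < kap -> kap < 1 -> exists2 r, 0 < r &
  forall z u, uball z -> @cube R n r u -> qb kap z (z + adapt z u).
Proof.
move=> k0 k1; have n0 : 0 < n.+1%:R :> R by [].
exists ((1 - kap) / (16 * n.+1%:R)); first by rewrite divr_gt0 ?mulr_gt0//; lra.
move=> z u zB cu; apply: adapt_qb => //.
have -> : (1 - kap) / 8 = n.+1%:R * ((1 - kap) / (8 * n.+1%:R)).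
  by field; rewrite gt_eqF.
apply: enorm_le_coord => [|j]; first by rewrite divr_ge0 ?mulr_ge0//; lra.
apply: (le_trans (normc_le_ReIm _)); have [h1 h2] := cu j.
have -> : (1 - kap) / (8 * n.+1%:R) = 2 * ((1 - kap) / (16 * n.+1%:R)).
  by field; rewrite gt_eqF.
by rewrite [2 * _]mulr_natl mulr2n; apply: lerD; exact: ltW.
Qed.

Lemma qb_large_cube kap z u : 0 < kap -> kap < 1 -> uball z ->
  qb kap z (z + adapt z u) -> @cube R n (10 / kap) u.
Proof.
move=> k0 k1 zB H j; have e := qb_adapt_bound k0 k1 zB H.
have : 9 / kap < 10 / kap by rewrite ltr_pM2r ?invr_gt0//; lra.
move=> h; split; apply: le_lt_trans h; apply: le_trans e; apply: le_trans (coord_le_enorm _ j).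
  exact: Re_le_normc.
exact: Im_le_normc.
Qed.

Lemma integral_indic_qb kap z : uball z ->
  (leb (qb kap z) = (defect z ^+ n.+1)%:E *
    \int[leb]_u (\1_(qb kap z) (z + adapt z u)%R)%:E)%E.
Proof.
move=> zB; have dz := defect_gt0 zB.
have m := @measurable_qb kap z.
have := @integral_adapt R n z (fun w => (\1_(qb kap z) w)%:E) zB.
move=> ->//; last by apply/measurable_EFinP; exact: measurable_indic.
rewrite muleA -EFinM divff ?mul1e; last by rewrite expf_neq0// gt_eqF.
by rewrite integral_indic// setIT.
Qed.

(** In the coordinates of [adapt z] the Bergman ball sits inside a cube that does not depend on [z],
    and it contains another one; the latter gives [volume_qb_ge]. *)
Lemma volume_qb_le kap : 0 < kap -> kap < 1 -> exists2 K : R, 0 < K &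
  forall z, uball z -> (leb (qb kap z) <= (K * defect z ^+ n.+1)%:E)%E.
Proof.
move=> k0 k1; have c0 : 0 < 10 / kap by rewrite divr_gt0.
exists ((2 * (10 / kap)) ^+ 2 ^+ n); first by rewrite !exprn_gt0// mulr_gt0.
move=> z zB; have dz := defect_gt0 zB.
rewrite integral_indic_qb// mulrC EFinM; apply: lee_wpmul2l.
  by rewrite lee_fin exprn_ge0// ltW.
rewrite -lebesgueC_cube// -(setIT (cube _)) -integral_indic//; last exact: measurable_cube.
apply: ge0_le_integral => //.
- apply/measurable_EFinP; apply: measurableT_comp; first by apply: measurable_indic; exact: measurable_qb.
  by apply: measurable_rowD; [exact: measurable_cst|exact: measurable_adapt].
- by apply/measurable_EFinP; apply: measurable_indic; exact: measurable_cube.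
move=> u _; rewrite lee_fin.
have [H|H] := pselect (qb kap z (z + adapt z u)); last by rewrite indic_notin.
by rewrite [leRHS]indic_in//; exact: qb_large_cube H.
Qed.

Lemma volume_qb_ge kap : 0 < kap -> kap < 1 -> exists2 K : R, 0 < K &
  forall z, uball z -> ((K * defect z ^+ n.+1)%:E <= leb (qb kap z))%E.
Proof.
move=> k0 k1; have [r r0 Hr] := small_cube_qb k0 k1.
exists ((2 * r) ^+ 2 ^+ n); first by rewrite !exprn_gt0// mulr_gt0.
move=> z zB; have dz := defect_gt0 zB.
rewrite integral_indic_qb// mulrC EFinM; apply: lee_wpmul2l.
  by rewrite lee_fin exprn_ge0// ltW.
rewrite -lebesgueC_cube// -(setIT (cube _)) -integral_indic//; last exact: measurable_cube.
apply: ge0_le_integral => //.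
- by apply/measurable_EFinP; apply: measurable_indic; exact: measurable_cube.
- apply/measurable_EFinP; apply: measurableT_comp; first by apply: measurable_indic; exact: measurable_qb.
  by apply: measurable_rowD; [exact: measurable_cst|exact: measurable_adapt].
move=> u _; rewrite lee_fin.
have [H|H] := pselect (@cube R n r u); last by rewrite indic_notin.
by rewrite [leRHS]indic_in//; exact: Hr.
Qed.

(* The average of |g|^p (1 - |w|^2)^s over the ball [qb kap z] for the invariant
   measure, up to the mass of the unit ball. *)
Definition ball_avg kap g p s z : \bar R :=
  \int[leb]_w (bfun g p (s - n.+1%:R) w * \1_(qb kap z) w)%:E.

Lemma ball_avg_ge0 kap g p s z : (0 <= ball_avg kap g p s z)%E.
Proof. by apply: integral_ge0 => w _; rewrite lee_fin mulr_ge0// bfun_ge0. Qed.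

(** The Jacobian of [adapt] lowers the exponent of the weight at [z] from [s] to [s - n.+1%:R]; this
    power, nearly constant on the ball, is then moved under the integral. *)
Lemma submean_qb kap p s : 0 < kap -> kap < 1 -> 0 < p -> exists2 K : R, 0 < K &
  forall g z, holomorphic_on_ball g -> uball z ->
  ((normc (g z) `^ p * defect z `^ s)%:E <= K%:E * ball_avg kap g p s z)%E.
Proof.
move=> k0 k1 p0; have [r r0 Hr] := small_cube_qb k0 k1.
pose K1 := (submean_cst p / (r / 2) ^+ 2) ^+ n.
have K10 : 0 < K1 by rewrite exprn_gt0// divr_gt0 ?submean_cst_gt0// exprn_gt0// divr_gt0.
pose K2 := (4 / kap) `^ `|s - n.+1%:R|.
have K20 : 0 < K2 by apply: powR_gt0; rewrite divr_gt0.
exists (K1 * K2); first exact: mulr_gt0.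
move=> g z hg zB; have dz := defect_gt0 zB.
have H1 := @submean_adapt R n g z p r hg zB p0 r0 (fun u cu => qb_uball (Hr z u zB cu)).
pose Phi w := (bfun g p 0 w * \1_(qb kap z) w)%:E.
have mI : measurable_fun setT (\1_(qb kap z) : Cn -> R) by apply: measurable_indic; exact: measurable_qb.
have mPhi : measurable_fun setT Phi.
  by apply/measurable_EFinP; apply: measurable_funM => //; exact: measurable_bfun.
have Phi0 w : (0 <= Phi w)%E by rewrite lee_fin mulr_ge0// bfun_ge0.
have ma : measurable_fun setT (fun u => z + adapt z u).
  by apply: measurable_rowD; [exact: measurable_cst|exact: measurable_adapt].
have H2 : ((normc (g z) `^ p)%:E <= K1%:E * ((defect z ^+ n.+1)^-1%:E * \int[leb]_w Phi w))%E.
  apply: (le_trans H1); apply: lee_wpmul2l; first by rewrite lee_fin ltW.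
  rewrite -integral_adapt//; apply: ge0_le_integral => //.
  - by move=> u _; rewrite lee_fin mulr_ge0// bfun_ge0.
  - apply/measurable_EFinP; apply: measurable_funM.
      by apply: measurableT_comp ma; exact: measurable_bfun.
    apply: measurable_indic; exact: measurable_cube.
  - exact: measurableT_comp mPhi ma.
  move=> u _; rewrite lee_fin.
  have [H|H] := pselect (@cube R n r u); last by rewrite indic_notin// mulr0 mulr_ge0// bfun_ge0.
  by rewrite ler_wpM2l ?bfun_ge0// [leRHS]indic_in//; exact: Hr.
have ds : 0 <= defect z `^ s by exact: powR_ge0.
rewrite EFinM; apply: (@le_trans _ _ (K1%:E * ((defect z ^+ n.+1)^-1%:E * \int[leb]_w Phi w) * (defect z `^ s)%:E)%E).
  exact: lee_wpmul2r.
rewrite EFinM -!muleA; apply: lee_wpmul2l; first by rewrite lee_fin ltW.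
rewrite muleCA -EFinM [(_ * _)%R]mulrC muleC.
rewrite (_ : (_ * _)%R = defect z `^ (s - n.+1%:R)); last first.
  by rewrite powRD; [rewrite powRN powR_mulrn ?ltW|rewrite (gt_eqF dz) implybT].
rewrite /ball_avg -!ge0_integralZl_EFin ?(ltW K20) ?powR_ge0//; last 2 first.
- by move=> w _; rewrite lee_fin mulr_ge0// bfun_ge0.
- by apply/measurable_EFinP; apply: measurable_funM => //; exact: measurable_bfun.
apply: ge0_le_integral => //.
- by move=> w _; rewrite mule_ge0// lee_fin powR_ge0.
- exact: measurable_funeM.
- apply: measurable_funeM.
  by apply/measurable_EFinP; apply: measurable_funM => //; exact: measurable_bfun.
move=> w _; rewrite /Phi -!EFinM lee_fin.
have [H|H] := pselect (qb kap z w); last by rewrite indic_notin// !mulr0.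
have wB := qb_uball H.
rewrite (indic_in _ H) !mulr1 (bfunE g p 0 wB) (bfunE _ _ _ wB) powRr0 mulr1.
rewrite [leRHS]mulrCA [leLHS]mulrC ler_wpM2l ?powR_ge0//.
exact: proj1 (qb_powR (s - n.+1%:R) k0 k1 zB H).
Qed.

(** Tonelli and the symmetry of [qb]: after the exchange, the inner integral runs over the ball
    around [w], where [defect z] is comparable to [defect w] and whose volume is of order
    [defect w ^+ n.+1]. *)
Lemma averaging kap a : 0 < kap -> kap < 1 -> exists2 K : R, 0 < K &
  forall h : Cn -> R, measurable_fun setT h -> (forall w, 0 <= h w) ->
  (\int[leb]_z ((defect z `^ a * \1_uball z)%:E *
      \int[leb]_w (h w * \1_(qb kap z) w)%:E) <=
   K%:E * \int[leb]_w (h w * defect w `^ (a + n.+1%:R) * \1_uball w)%:E)%E.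
Proof.
move=> k0 k1; have [K1 K10 HK1] := volume_qb_le k0 k1.
pose K2 := (4 / kap) `^ `|a|.
have K20 : 0 < K2 by apply: powR_gt0; rewrite divr_gt0.
exists (K2 * K1) => [|{}h mh h0]; first exact: mulr_gt0.
have md : measurable_fun setT (fun z : Cn => defect z `^ a * \1_uball z).
  apply: measurable_funM; first exact: measurable_defect_powR.
  by apply: measurable_indic; exact: measurable_uball.
have d0 z : 0 <= defect z `^ a * \1_uball z by rewrite mulr_ge0// powR_ge0.
pose f (zw : Cn * Cn) : \bar R := (defect zw.1 `^ a * \1_uball zw.1 *
  (h zw.2 * \1_[set zw : Cn * Cn | qb kap zw.1 zw.2] zw))%:E.
have f0 zw : (0 <= f zw)%E by rewrite lee_fin mulr_ge0// mulr_ge0.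
have mf : measurable_fun setT f.
  apply/measurable_EFinP; apply: measurable_funM; first exact: measurableT_comp md measurable_fst.
  apply: measurable_funM; first exact: measurableT_comp mh measurable_snd.
  by apply: measurable_indic; exact: measurable_qb2.
have I2 z w : \1_[set zw : Cn * Cn | qb kap zw.1 zw.2] (z, w) = \1_(qb kap z) w :> R.
  by rewrite !indicE.
have mq z : measurable_fun setT (fun w => (h w * \1_(qb kap z) w)%:E).
  apply/measurable_EFinP; apply: measurable_funM => //.
  by apply: measurable_indic; exact: measurable_qb.
have FT : (\int[leb]_z \int[leb]_w f (z, w) = \int[leb]_w \int[leb]_z f (z, w))%E.
  exact: (@fubini_tonelli _ _ _ _ _ (lebC R n) (lebC R n) _ mf f0).
rewrite (_ : \int[leb]_z _ = \int[leb]_z \int[leb]_w f (z, w))%E; last first.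
  apply: eq_integral => z _.
  transitivity (\int[leb]_w ((defect z `^ a * \1_uball z)%:E * (h w * \1_(qb kap z) w)%:E))%E.
    symmetry; apply: ge0_integralZl_EFin => [|w _||];
      [by []|by rewrite lee_fin mulr_ge0|exact: mq|exact: d0].
  by apply: eq_integral => w _; rewrite -EFinM -(I2 z w).
rewrite FT; clear md d0 mq.
apply: le_integral_scale.
- by rewrite mulr_ge0 ?(ltW K10) ?(ltW K20).
- exact: (@measurable_fun_fubini_tonelli_G _ _ _ _ _ (lebC R n) _ mf f0).
- apply/measurable_EFinP; apply: measurable_funM.
    exact: (measurable_funM mh (measurable_defect_powR _)).
  by apply: measurable_indic; exact: measurable_uball.
- by move=> w; exact: integral_ge0.
- move=> w; rewrite lee_fin; apply: mulr_ge0; last by [].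
  by apply: mulr_ge0; [exact: h0|exact: powR_ge0].
move=> w; have [wB|wB] := pselect (uball w); last first.
  apply: (@le_trans _ _ 0%E).
    apply: eq_imp_le; apply: integral0_eq => z _; rewrite /f /=.
    have I0 : \1_(qb kap z) w = 0 :> R by apply: indic_notin => /qb_uball.
    by rewrite (I2 z w) I0 2!mulr0.
  apply: mule_ge0; rewrite lee_fin; first by apply: mulr_ge0; exact: ltW.
  apply: mulr_ge0; last by [].
  by apply: mulr_ge0; [exact: h0|exact: powR_ge0].
have dw := defect_gt0 wB.
have hK : 0 <= h w * (K2 * defect w `^ a) by rewrite !mulr_ge0 ?powR_ge0// ltW.
apply: (@le_trans _ _ ((h w * (K2 * defect w `^ a))%:E * \int[leb]_z (\1_(qb kap w) z)%:E)%E).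
  apply: le_integral_scale.
  - exact: hK.
  - exact: (measurableT_comp mf (measurable_pair2 _)).
  - by apply/measurable_EFinP; apply: measurable_indic; exact: measurable_qb.
  - by move=> z; exact: f0.
  - by move=> z; rewrite lee_fin.
  move=> z; rewrite /f /= (I2 z w) -EFinM lee_fin.
  have [zB|zB] := pselect (uball z); last first.
    by rewrite (indic_notin _ zB) mulr0 mul0r; apply: mulr_ge0.
  have [H|H] := pselect (qb kap z w); last first.
    by rewrite (indic_notin _ H) 2!mulr0; apply: mulr_ge0.
  rewrite (indic_in _ H) (indic_in _ zB) (indic_in _ (qb_sym zB H)) 3!mulr1 [leLHS]mulrC.
  apply: ler_wpM2l; first exact: h0.
  exact: proj1 (qb_powR a k0 k1 zB H).
clear f0 mf FT I2 f; have IE : (\int[leb]_z (\1_(qb kap w) z)%:E = leb (qb kap w))%E.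
  by rewrite integral_indic ?setIT//; exact: measurable_qb.
rewrite IE; apply: (@le_trans _ _ ((h w * (K2 * defect w `^ a))%:E * (K1 * defect w ^+ n.+1)%:E)%E).
  by apply: lee_wpmul2l; [rewrite lee_fin; exact: hK|exact: HK1].
rewrite -!EFinM lee_fin (indic_in _ wB) mulr1 powRD; last by rewrite (gt_eqF dw) implybT.
rewrite powR_mulrn ?(ltW dw)//; clear.
by apply: eq_imp_le; ring.
Qed.

Lemma bfunM_powR g p s a z :
  bfun g p s z * defect z `^ a * \1_uball z = bfun g p (s + a) z.
Proof.
have [zB|zB] := pselect (uball z); last by rewrite !bfun_out// !mul0r.
rewrite indic_in// mulr1 !bfunE// powRD; first by rewrite mulrA.
by rewrite (gt_eqF (defect_gt0 zB)) implybT.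
Qed.

Lemma integral_ball_avg kap a p s : 0 < kap -> kap < 1 -> 0 < p ->
  exists2 K : R, 0 < K & forall g, holomorphic_on_ball g ->
  (\int[leb]_z ((defect z `^ a * \1_uball z)%:E * ball_avg kap g p s z) <=
   K%:E * \int[leb]_w (bfun g p (s + a) w)%:E)%E.
Proof.
move=> k0 k1 p0; have [K K0 HK] := averaging a k0 k1.
exists K => // g hg.
have := HK (bfun g p (s - n.+1%:R)) (measurable_bfun _ hg p0) (fun w => bfun_ge0 _ _ _ w).
move=> /le_trans; apply; apply: lee_wpmul2l; first by rewrite lee_fin ltW.
apply: eq_imp_le; apply: eq_integral => w _; rewrite bfunM_powR.
by congr (bfun _ _ _ _)%:E; ring.
Qed.

Lemma ball_avg_mono kap kap' g p s z z' : holomorphic_on_ball g -> 0 < p ->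
  (qb kap z `<=` qb kap' z') -> (ball_avg kap g p s z <= ball_avg kap' g p s z')%E.
Proof.
move=> hg p0 sub; apply: ge0_le_integral => //.
- by move=> w _; rewrite lee_fin mulr_ge0// bfun_ge0.
- apply/measurable_EFinP; apply: measurable_funM; first exact: measurable_bfun.
  by apply: measurable_indic; exact: measurable_qb.
- apply/measurable_EFinP; apply: measurable_funM; first exact: measurable_bfun.
  by apply: measurable_indic; exact: measurable_qb.
move=> w _; rewrite lee_fin ler_wpM2l ?bfun_ge0//.
have [H|H] := pselect (qb kap z w); last by rewrite indic_notin.
by rewrite [leRHS]indic_in//; exact: sub.
Qed.

(** The sub-mean value inequality at [w] gives an average over a ball around [w]; the quasi-triangle
    inequality encloses that ball in a larger one around [z], the same for all [w]. *)
Lemma sup_qb kap p s : 0 < kap -> kap < 1 -> 0 < p -> exists2 K : R, 0 < K &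
  forall g z w, holomorphic_on_ball g -> uball z -> qb kap z w ->
  ((normc (g w) `^ p * defect z `^ s)%:E <= K%:E * ball_avg (kappa_trans kap) g p s z)%E.
Proof.
move=> k0 k1 p0; have [K1 K10 HK] := submean_qb s k0 k1 p0.
pose K2 := (4 / kap) `^ `|s|.
have K20 : 0 < K2 by apply: powR_gt0; rewrite divr_gt0.
exists (K2 * K1) => [|g z w hg zB H]; first exact: mulr_gt0.
have wB := qb_uball H.
apply: (@le_trans _ _ (K2%:E * (normc (g w) `^ p * defect w `^ s)%:E)%E).
  rewrite -EFinM lee_fin mulrCA ler_wpM2l ?powR_ge0//.
  exact: proj1 (qb_powR s k0 k1 zB H).
rewrite [in leRHS]EFinM -muleA; apply: lee_wpmul2l; first by rewrite lee_fin ltW.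
apply: (le_trans (HK g w hg wB)); apply: lee_wpmul2l; first by rewrite lee_fin ltW.
apply: ball_avg_mono => // x Hx; apply: (@qb_trans _ _ _ w) => //.
exact: qb_sym.
Qed.

(** The radial derivative at [z] is the derivative at 0 of t |-> g (z + t z), and this disc stays in
    the Bergman ball for |t| up to a multiple of the defect. One-variable Cauchy suffices. *)
Lemma radial_bound : exists2 r : R, 0 < r & forall g z M, holomorphic_on_ball g ->
  uball z -> (forall w, qb 2^-1 z w -> normc (g w) <= M) ->
  normc (radial g z) * defect z <= r * M.
Proof.
exists (4 * 32) => // g z M hg zB HM; have dz := defect_gt0 zB.
(* Then 2 r / defect z = 1 / 16, which is the smallness (1 - kap) / 8 asked by [adapt_qb] for kap =
   1 / 2. *)
pose r := defect z / 32; have r0 : 0 < r by rewrite divr_gt0.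
have near (x y : R) : `|x| <= r -> `|y| <= r -> qb 2^-1 z (z + (x +i* y)%C *: z).
  move=> xr yr; have -> : (x +i* y)%C *: z = adapt z (((x +i* y)%C / rc (defect z)) *: z).
    rewrite adaptZ /adapt line_proj_self subrr scaler0 addr0 scalerA divfK//.
    by rewrite fmorph_eq0 gt_eqF.
  apply: adapt_qb => //; [by lra|].
  rewrite enormZ Normc.normcM Normc.normcV normc_real gtr0_norm//.
  have e1 := enorm_lt1 zB; have e0 := enorm_ge0 z.
  have H := normc_square xr yr.
  have : normc (x +i* y)%C / defect z <= 2 * r / defect z by rewrite ler_wpM2r ?invr_ge0 ?(ltW dz).
  have -> : 2 * r / defect z = 1 / 16 by rewrite /r; field; rewrite gt_eqF.
  have : 0 <= normc (x +i* y)%C / defect z by rewrite divr_ge0 ?normc_ge0 ?(ltW dz).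
  move: (normc _ / defect z) => X X0 X1; have : X * enorm z <= X by rewrite ler_piMr// ltW.
  lra.
rewrite radialE//.
have H : normc ('d g z z) <= 4 * M / r.
  apply: (@cauchy_deriv _ (fun t => g (z + t *: z)) ('d g z z) r M r0).
  - by move=> x y xr yr; eexists; apply: cderiv_slice; apply: hg; apply: qb_uball (near x y xr yr).
  - by move=> x y xr yr; apply: HM; exact: near.
  have := @cderiv_slice R n g z z 0; rewrite scale0r addr0; apply; exact: hg.
apply: le_trans (_ : 4 * M / r * defect z <= _); first by rewrite ler_wpM2r// ltW.
by apply: eq_imp_le; rewrite /r; field; rewrite gt_eqF.
Qed.

Lemma radial_avg p s : 0 < p -> exists2 K : R, 0 < K &
  forall g z, holomorphic_on_ball g -> uball z ->
  ((normc (radial g z) `^ p * defect z `^ (s + p))%:E <=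
   K%:E * ball_avg (kappa_trans 2^-1) g p s z)%E.
Proof.
move=> p0; have k0 : (0 : R) < 2^-1 by lra. have k1 : (2^-1 : R) < 1 by lra.
have [K1 K10 HK] := sup_qb s k0 k1 p0; have [r r0 Hr] := radial_bound.
exists (r `^ p * K1) => [|g z hg zB]; first by rewrite mulr_gt0// powR_gt0.
have dz := defect_gt0 zB.
have := ball_avg_ge0 (kappa_trans 2^-1) g p s z.
move: (HK g z) => {}HK.
(* An infinite average leaves nothing to prove. A finite one yields through [sup_qb] a uniform bound
   [M] for |g| on the ball, to which the pointwise estimate applies. *)
case E : (ball_avg _ _ _ _ _) => [h| |]// h0; last first.
  by rewrite gt0_muley ?leey// lte_fin mulr_gt0// powR_gt0.
rewrite lee_fin in h0.
pose M := (K1 * h / defect z `^ s) `^ p^-1.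
have Hs : 0 < defect z `^ s by exact: powR_gt0.
have B0 : 0 <= K1 * h / defect z `^ s by rewrite divr_ge0 ?mulr_ge0// ?(ltW K10) ?(ltW Hs).
have HM : forall w, qb 2^-1 z w -> normc (g w) <= M.
  move=> w Hw; have := HK w hg zB Hw; rewrite E -EFinM lee_fin -ler_pdivlMr// => H.
  by apply: powR_le_root => //; exact: normc_ge0.
have H := Hr g z M hg zB HM.
have M0 : 0 <= M by exact: powR_ge0.
rewrite -EFinM lee_fin powRD; last by rewrite (gt_eqF dz) implybT.
rewrite mulrCA -powRM ?normc_ge0 ?(ltW dz)//.
have H2 : (normc (radial g z) * defect z) `^ p <= (r * M) `^ p.
  by apply: powR_le; rewrite ?(ltW p0)// mulr_ge0 ?normc_ge0 ?(ltW dz).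
apply: le_trans (_ : defect z `^ s * (r * M) `^ p <= _); first by rewrite ler_wpM2l// ltW.
rewrite powRM ?(ltW r0)// /M powR_root//.
by apply: eq_imp_le; field; rewrite gt_eqF.
Qed.

End BallEstimates.

(** * Hardy inequality *)

Section PowRAdd.
Variable R : realType.
Implicit Types (a b p e : R).

Lemma powR_1l p : 1 `^ p = 1 :> R.
Proof. by rewrite powR1. Qed.

(** A factor as close to 1 as desired in front of [a], where [powR_add2] has [2 ^ p]: the
    contraction of the shells has no more room than that. If [b] is small relative to [a] it is
    absorbed by (1 + t)^p = 1 + e, otherwise [b] dominates. *)
Lemma powR_add_eps p e : 0 < p -> 0 < e -> exists2 K : R, 0 < K &
  forall a b, 0 <= a -> 0 <= b -> (a + b) `^ p <= (1 + e) * a `^ p + K * b `^ p.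
Proof.
move=> p0 e0; have e1 : 1 < 1 + e by lra.
pose t := (1 + e) `^ p^-1 - 1.
have ip : 0 < p^-1 by rewrite invr_gt0.
have tE : (1 + t) `^ p = 1 + e by rewrite /t addrC subrK powR_root//; lra.
have t0 : 0 < t.
  rewrite subr_gt0 -[ltLHS](powR_1l p^-1); apply: gt0_ltr_powR => //; rewrite nnegrE; lra.
exists ((t^-1 + 1) `^ p) => [|a b a0 b0].
  by apply: powR_gt0; rewrite addr_gt0// invr_gt0.
have [bt|tb] := leP b (t * a).
  apply: le_trans (_ : (1 + e) * a `^ p <= _).
    have T0 : 0 <= 1 + t by lra.
    rewrite -tE -powRM//; apply: powR_le; [exact: ltW|exact: addr_ge0|].
    by rewrite mulrDl mul1r lerD2l.
  by rewrite lerDl mulr_ge0 ?powR_ge0.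
apply: le_trans (_ : (t^-1 + 1) `^ p * b `^ p <= _); last first.
  by rewrite lerDr mulr_ge0 ?powR_ge0//; lra.
have ti : 0 <= t^-1 + 1 by rewrite addr_ge0// invr_ge0 ltW.
rewrite -powRM//; apply: powR_le; rewrite ?(ltW p0) ?addr_ge0//.
rewrite mulrDl mul1r lerD2r ler_pdivlMl// ltW//.
Qed.

Lemma powR_add2 p a b : 0 < p -> 0 <= a -> 0 <= b ->
  (a + b) `^ p <= 2 `^ p * (a `^ p + b `^ p).
Proof.
move=> p0 a0 b0; wlog ab : a b a0 b0 / a <= b.
  move=> H; have [ab|ba] := leP a b; first exact: H.
  by rewrite addrC [X in _ * X]addrC; apply: H => //; exact: ltW.
apply: le_trans (_ : 2 `^ p * b `^ p <= _).
  by rewrite -powRM//; apply: powR_le; rewrite ?(ltW p0) ?addr_ge0//; lra.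
by rewrite ler_wpM2l ?powR_ge0// lerDr powR_ge0.
Qed.

(** Bernoulli's inequality. *)
Lemma one_sub_expn_ge (x : R) m : 0 <= x -> x <= 1 -> 1 - m%:R * x <= (1 - x) ^+ m.
Proof.
move=> x0 x1; elim: m => [|m IH]; first by rewrite mul0r subr0 expr0.
rewrite exprS -[m.+1]addn1 natrD.
have H : (1 - x) * (1 - m%:R * x) <= (1 - x) * (1 - x) ^+ m by rewrite ler_wpM2l// subr_ge0.
apply: le_trans H; have : 0 <= (m%:R : R) by []. nra.
Qed.

End PowRAdd.

Section Hardy.
Variables (R : realType) (n : nat).
Local Notation C := R[i].
Local Notation Cn := 'rV[R[i]]_n.
Local Notation normc := (@Normc.normc R).
Local Notation rc := (real_complex R).
Local Notation leb := (lebesgueC R n).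
Local Notation uball := (@uball R n).
Implicit Types (g : Cn -> C) (z w u : Cn) (p q s r kap t a b : R).

(** The derivative of x |-> g (x z) is [radial g] at x z divided by [x]; this is the origin of the
    factor [x] in the hypothesis. *)
Lemma hol_dilation_diff g z t M : holomorphic_on_ball g -> uball z -> 0 < t -> t <= 1 ->
  (forall x, t <= x -> x <= 1 -> normc (radial g (rc x *: z)) <= x * M) ->
  normc (g z - g (rc t *: z)) <= (1 - t) * M.
Proof.
move=> hg zB t0 t1 HM.
have xB x : t <= x -> x <= 1 -> uball (rc x *: z).
  move=> tx x1; rewrite /Defs.uball /= enormZ normc_real ger0_norm; last by lra.
  by apply: le_lt_trans (enorm_lt1 zB); rewrite ler_piMl ?enorm_ge0.
have x_E s : rc t *: z + rc s *: (rc (1 - t) *: z) = rc (t + s * (1 - t)) *: z.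
  by rewrite scalerA -scalerDl -rmorphM -rmorphD.
have := @mean_value_ineq R (fun l => g (rc t *: z + l *: (rc (1 - t) *: z)))
  (fun s => 'd g (rc t *: z + rc s *: (rc (1 - t) *: z)) (rc (1 - t) *: z)) 0 ((1 - t) * M).
rewrite scale0r addr0 scale1r subr0.
have -> : rc t *: z + rc (1 - t) *: z = z.
  by rewrite -scalerDl -rmorphD addrC subrK rmorph1 scale1r.
apply => s s0 s1.
  by apply: cderiv_slice; rewrite x_E; apply: hg; apply: xB; nra.
rewrite subr0 x_E; set x := t + s * (1 - t).
have tx : t <= x by rewrite /x; nra.
have x1 : x <= 1 by rewrite /x; nra.
have x0 : 0 < x by lra.
have -> : rc (1 - t) *: z = rc ((1 - t) / x) *: (rc x *: z).
  by rewrite scalerA -rmorphM divfK// gt_eqF.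
rewrite linearZ /= [X in normc X](_ : _ = rc ((1 - t) / x) * 'd g (rc x *: z) (rc x *: z))//.
rewrite Normc.normcM normc_real ger0_norm; last by rewrite divr_ge0 ?(ltW x0)//; lra.
rewrite -radialE//; last exact: xB.
have -> : (1 - t) * M = (1 - t) / x * (x * M) by field; rewrite gt_eqF.
by rewrite ler_wpM2l ?HM// divr_ge0 ?(ltW x0)//; lra.
Qed.

(** The whole segment from [t z] to [z] lies in one Bergman ball around [z], so a single average
    controls [radial g] on it. Its length, at most of the order of the defect, produces the [p]
    additional powers of the weight. *)
Lemma dilation_diff_avg p s : 0 < p -> exists2 K : R, 0 < K &
  forall g z t, holomorphic_on_ball g -> uball z -> 2^-1 <= t -> t <= 1 -> 1 - t <= defect z ->
  ((normc (g z - g (rc t *: z)) `^ p * defect z `^ s)%:E <=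
   K%:E * ball_avg (kappa_trans (1 / 5)) (radial g) p (s + p) z)%E.
Proof.
move=> p0; have k0 : (0 : R) < 1 / 5 by lra. have k1 : 1 / 5 < (1 : R) by lra.
have [K1 K10 HK] := sup_qb n (s + p) k0 k1 p0.
exists (2 `^ p * K1) => [|g z t hg zB t0 t1 td]; first by rewrite mulr_gt0// powR_gt0.
have dz := defect_gt0 zB; have hr := hol_radial hg.
have := ball_avg_ge0 (kappa_trans (1 / 5)) (radial g) p (s + p) z.
move: (HK (radial g) z) => {}HK.
case E : (ball_avg _ _ _ _ _) => [h| |]// h0; last first.
  by rewrite gt0_muley ?leey// lte_fin mulr_gt0// powR_gt0.
rewrite lee_fin in h0.
pose M := (K1 * h / defect z `^ (s + p)) `^ p^-1.
have Hs : 0 < defect z `^ (s + p) by exact: powR_gt0.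
have B0 : 0 <= K1 * h / defect z `^ (s + p).
  by rewrite divr_ge0 ?mulr_ge0// ?(ltW K10) ?(ltW Hs).
have M0 : 0 <= M by exact: powR_ge0.
have HM x : t <= x -> x <= 1 -> normc (radial g (rc x *: z)) <= M.
  move=> tx x1; have Hx : qb (1 / 5) z (rc x *: z) by apply: dilate_qb => //; lra.
  have := HK _ hr zB Hx; rewrite E -EFinM lee_fin -ler_pdivlMr// => H.
  by apply: powR_le_root => //; exact: normc_ge0.
have H : normc (g z - g (rc t *: z)) <= (1 - t) * (2 * M).
  apply: hol_dilation_diff => //; first lra.
  move=> x tx x1; apply: le_trans (HM x tx x1) _; nra.
have H2 : normc (g z - g (rc t *: z)) <= defect z * (2 * M).
  by apply: le_trans H _; rewrite ler_wpM2r// mulr_ge0.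
rewrite -EFinM lee_fin.
apply: le_trans (_ : (defect z * (2 * M)) `^ p * defect z `^ s <= _).
  by rewrite ler_wpM2r ?powR_ge0// powR_le ?normc_ge0 ?(ltW p0).
have dp := powR_gt0 p dz; have ds := powR_gt0 s dz.
rewrite !powRM ?mulr_ge0 ?(ltW dz)// /M powR_root// powRD; last by rewrite (gt_eqF dz) implybT.
by apply: eq_imp_le; field; rewrite !gt_eqF.
Qed.

(** On the slightly larger ball of radius [a'] the weight stays away from 0, so the integral bounds
    |radial g| uniformly there by [B]; integrating along rays from the origin recovers [g]. *)
Lemma interior_bound p s a : 0 < p -> 0 < a -> a < 1 -> exists2 K : R, 0 < K &
  forall g z, holomorphic_on_ball g -> enorm z <= a ->
  ((normc (g z) `^ p)%:E <=
   K%:E * ((normc (g 0%R) `^ p)%:E + \int[leb]_w (bfun (radial g) p s w)%:E))%E.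
Proof.
move=> p0 a0 a1; have k0 : (0 : R) < 2^-1 by lra. have k1 : (2^-1 : R) < 1 by lra.
pose s' := s + n.+1%:R.
have [K1 K10 HK] := submean_qb n s' k0 k1 p0.
pose a' := (1 + a) / 2; pose m := 1 - a' ^+ 2.
have a'1 : a' < 1 by rewrite /a'; lra.
have m0 : 0 < m by rewrite /m /a'; nra.
have m1 : m <= 1 by rewrite lerBlDl lerDr sqr_ge0.
pose rho := (1 - a) / 2; have rho0 : 0 < rho by rewrite /rho; lra.
have mp : 0 < m `^ `|s'| by exact: powR_gt0.
pose K2 := (12 / rho) `^ p * (K1 / m `^ `|s'|).
have K20 : 0 < K2 by rewrite mulr_gt0 ?divr_gt0// powR_gt0// divr_gt0.
exists (2 `^ p * (1 + K2)) => [|g z hg za].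
  by rewrite mulr_gt0 ?powR_gt0// addr_gt0.
have hr := hol_radial hg.
have : (0 <= \int[leb]_w (bfun (radial g) p s w)%:E)%E.
  by apply: integral_ge0 => w _; rewrite lee_fin bfun_ge0.
case E : (\int[leb]_w _)%E => [h| |]// h0; last first.
  by rewrite addey// gt0_muley ?leey// lte_fin mulr_gt0 ?powR_gt0// addr_gt0.
rewrite lee_fin in h0.
pose B := (K1 * h / m `^ `|s'|) `^ p^-1.
have B0 : 0 <= B by exact: powR_ge0.
have BB : 0 <= K1 * h / m `^ `|s'| by rewrite divr_ge0 ?mulr_ge0// ltW.
have HB x : enorm x <= a' -> normc (radial g x) <= B.
  move=> xa; have xB : uball x by exact: le_lt_trans xa a'1.
  have dx := defect_gt0 xB.
  have dxm : m <= defect x.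
    by rewrite lerD2l lerN2 lerXn2r// ?nnegrE ?enorm_ge0// /a'; lra.
  have dms : m `^ `|s'| <= defect x `^ s'.
    have d1 := defect_le1 x.
    have [s0|s0] := leP 0 s'; first by rewrite ger0_norm// powR_le// ltW.
    rewrite ltr0_norm//; apply: le_trans (_ : 1 <= _).
      by rewrite -(powR_1l (- s')) powR_le// ?(ltW m0)// oppr_ge0 ltW.
    rewrite -[s']opprK powRN invf_ge1 ?powR_gt0// -(powR_1l (- s')).
    by rewrite powR_le// ?(ltW dx)// oppr_ge0 ltW.
  have H := HK _ x hr xB.
  have H2 : (ball_avg 2^-1 (radial g) p s' x <= h%:E)%E.
    rewrite -E; apply: ge0_le_integral => //.
    - by move=> w _; rewrite lee_fin mulr_ge0// bfun_ge0.
    - apply/measurable_EFinP; apply: measurable_funM; first exact: measurable_bfun.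
      by apply: measurable_indic; exact: measurable_qb.
    - by apply/measurable_EFinP; exact: measurable_bfun.
    move=> w _; rewrite lee_fin (_ : s' - n.+1%:R = s); last by rewrite addrK.
    have [Hw|Hw] := pselect (qb 2^-1 x w); last by rewrite indic_notin// mulr0 bfun_ge0.
    by rewrite indic_in// mulr1.
  have H3 : normc (radial g x) `^ p * defect x `^ s' <= K1 * h.
    rewrite -lee_fin [in leRHS]EFinM; apply: (le_trans H); apply: lee_wpmul2l; last exact: H2.
    by rewrite lee_fin ltW.
  apply: powR_le_root => //; first exact: normc_ge0.
  rewrite ler_pdivlMr//; apply: le_trans H3; by rewrite ler_wpM2l ?powR_ge0.
(* [radial g] vanishes at 0, and Cauchy's estimate upgrades [B] to a bound linear in |w|. This
   compensates the division by [x] in the derivative along a ray. *)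
have schwarz w : enorm w <= a -> normc (radial g w) <= 12 * B / rho * enorm w.
  move=> wa.
  have := @mean_value_ineq R (fun l => radial g (0 + l *: w))
    (fun s => 'd (radial g) (0 + rc s *: w) w) 0 (12 * B / rho * enorm w).
  rewrite scale0r !addr0 add0r scale1r subr0.
  have -> : radial g 0 = 0 by rewrite /radial big1// => j _; rewrite mxE mul0r.
  rewrite subr0; apply => x x0 x1.
    apply: cderiv_slice; apply: hr; rewrite /Defs.uball /= add0r enormZ normc_real ger0_norm//.
    by apply: le_lt_trans a1; apply: le_trans wa; rewrite ler_piMl ?enorm_ge0.
  rewrite subr0 add0r.
  have xw : enorm (rc x *: w) <= a.
    by rewrite enormZ normc_real ger0_norm//; apply: le_trans wa; rewrite ler_piMl ?enorm_ge0.
  have nb y : enorm (y - rc x *: w) < rho -> enorm y <= a'.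
    move=> yw; rewrite -(subrK (rc x *: w) y); apply: (le_trans (enormD _ _)).
    by rewrite /a'; move: yw; rewrite /rho; lra.
  have dr y : enorm (y - rc x *: w) < rho -> differentiable (radial g) y.
    by move=> /nb yb; apply: hr; exact: le_lt_trans yb a'1.
  have br y : enorm (y - rc x *: w) < rho -> normc (radial g y) <= B.
    by move=> /nb yb; exact: HB.
  exact: (@cauchy_estimate R n (radial g) (rc x *: w) rho B rho0 dr br w).
have zB : uball z by exact: le_lt_trans za a1.
have BR : 0 <= 12 * B / rho by apply: divr_ge0; [exact: mulr_ge0|exact: ltW].
have D0 : normc (g z - g 0) <= 12 * B / rho.
  (* The dilation estimate stops at a factor [t > 0]; continuity of [g] at 0 covers the rest of the
     ray up to [e]. *)
  apply/ler_addgt0Pr => e e0.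
  have [d d0 Hd] := hol_cont hg (@uball0 R n) e0.
  pose t := Num.min (1 / 2) (d / 2).
  have t0 : 0 < t by rewrite lt_min divr_gt0//; lra.
  have t1 : t <= 1 / 2 by rewrite /t ge_min lexx.
  have td : t <= d / 2 by rewrite /t ge_min lexx orbT.
  have zn := enorm_ge0 z.
  have tz : enorm (rc t *: z) < d.
    rewrite enormZ normc_real gtr0_norm//; nra.
  have H1 : normc (g (rc t *: z) - g 0) < e by apply: Hd; rewrite subr0.
  have H2 : normc (g z - g (rc t *: z)) <= (1 - t) * (12 * B / rho).
    apply: hol_dilation_diff => //; first lra.
    move=> x tx x1; have x0 : 0 <= x := le_trans (ltW t0) tx.
    have xE : enorm (rc x *: z) = x * enorm z by rewrite enormZ normc_real ger0_norm.
    apply: le_trans (schwarz _ _) _.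
      by rewrite xE; apply: le_trans za; rewrite ler_piMl.
    rewrite [leRHS]mulrC; apply: (ler_wpM2l BR).
    by rewrite xE ler_piMr// ltW// enorm_lt1.
  have -> : g z - g 0 = (g z - g (rc t *: z)) + (g (rc t *: z) - g 0) by ring.
  apply: (le_trans (normcD _ _)); nra.
have H1 : normc (g z) <= normc (g 0) + 12 * B / rho.
  have := normcD (g z - g 0) (g 0); rewrite subrK; lra.
rewrite -EFinD -EFinM lee_fin.
apply: le_trans (powR_le (ltW p0) (normc_ge0 _) H1) _.
apply: le_trans (powR_add2 p0 (normc_ge0 _) BR) _.
rewrite -[leRHS]mulrA; apply: ler_wpM2l; first exact: powR_ge0.
have -> : (12 * B / rho) `^ p = K2 * h.
  have -> : 12 * B / rho = 12 / rho * B by rewrite mulrAC.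
  have r12 : 0 <= 12 / rho by rewrite divr_ge0// ltW.
  have PB : B `^ p = K1 * h / m `^ `|s'| := powR_root p0 BB.
  by rewrite (powRM _ r12 B0) PB /K2; ring.
have := powR_ge0 (normc (g 0)) p; move: (normc (g 0) `^ p) => X X0.
nra.
Qed.

Definition annulus a b : set Cn := [set z | a <= enorm z < b].

Lemma measurable_annulus a b : measurable (annulus a b).
Proof.
have -> : annulus a b = @enorm R n @^-1` `[a, b[.
  by apply/seteqP; split => z; rewrite /annulus /= in_itv.
by rewrite -[X in measurable X]setTI; apply: measurable_enorm.
Qed.

Definition rint g p s a b : \bar R := \int[leb]_z (bfun g p s z * \1_(annulus a b) z)%:E.

Lemma measurable_rint g p s a b : holomorphic_on_ball g -> 0 < p ->
  measurable_fun setT (fun z => (bfun g p s z * \1_(annulus a b) z)%:E).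
Proof.
move=> hg p0; apply/measurable_EFinP; apply: measurable_funM; first exact: measurable_bfun.
by apply: measurable_indic; exact: measurable_annulus.
Qed.

Lemma rint_ge0 g p s a b : (0 <= rint g p s a b)%E.
Proof. by apply: integral_ge0 => z _; rewrite lee_fin mulr_ge0// bfun_ge0. Qed.

Lemma rint_split g p s a b c : holomorphic_on_ball g -> 0 < p -> a <= b -> b <= c ->
  rint g p s a c = (rint g p s a b + rint g p s b c)%E.
Proof.
move=> hg p0 ab bc; rewrite /rint -ge0_integralD//; last 4 first.
- by move=> z _; rewrite lee_fin mulr_ge0// bfun_ge0.
- exact: measurable_rint.
- by move=> z _; rewrite lee_fin mulr_ge0// bfun_ge0.
- exact: measurable_rint.
apply: eq_integral => z _; rewrite -EFinD -mulrDr; congr (_ * _)%:E.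
have [za|za] := ltP (enorm z) a.
  by rewrite !indic_notin ?addr0//; apply/negP; rewrite negb_and -!ltNge ?za// (lt_le_trans za).
have [zb|zb] := ltP (enorm z) b.
  rewrite [in LHS]indic_in; last by rewrite /annulus /= za (lt_le_trans zb).
  rewrite [\1_(annulus a b) z]indic_in; last by rewrite /annulus /= za zb.
  by rewrite indic_notin ?addr0//; apply/negP; rewrite negb_and -ltNge zb.
rewrite [\1_(annulus a b) z]indic_notin; last by apply/negP; rewrite negb_and -!leNgt zb orbT.
rewrite add0r; have [zc|zc] := ltP (enorm z) c.
  by rewrite !indic_in// /annulus /= zc ?za ?zb.
by rewrite !indic_notin//; apply/negP; rewrite negb_and -!leNgt zc orbT.
Qed.

Lemma rint_dilate g p a b r : holomorphic_on_ball g -> 0 < p -> 0 < r -> r * b <= 1 ->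
  (\int[leb]_z (bfun g p 0 (rc r *: z)%R * \1_(annulus a b) z)%:E =
   ((r ^+ 2) ^- n)%:E * rint g p 0 (r * a) (r * b))%E.
Proof.
move=> hg p0 r0 rb; have rn : r != 0 by rewrite gt_eqF.
rewrite /rint -(@integral_row_scale R n r (fun z => (bfun g p 0 z * \1_(annulus (r * a) (r * b)) z)%:E))//.
- apply: eq_integral => z _; congr (_ * _)%:E.
  have E : annulus (r * a) (r * b) (rc r *: z) = annulus a b z.
    by rewrite /annulus /= enormZ normc_real gtr0_norm// ler_pM2l// ltr_pM2l.
  have [A|A] := pselect (annulus a b z); last by rewrite !indic_notin ?E.
  by rewrite !indic_in ?E.
- exact: measurable_rint.
- by move=> z; rewrite lee_fin mulr_ge0// bfun_ge0.
Qed.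

Lemma measurable_ball_avg kap g p s : holomorphic_on_ball g -> 0 < p ->
  measurable_fun setT (ball_avg kap g p s).
Proof.
move=> hg p0.
pose f (zw : Cn * Cn) : \bar R := (bfun g p (s - n.+1%:R) zw.2 *
  \1_[set zw : Cn * Cn | qb kap zw.1 zw.2] zw)%:E.
have f0 zw : (0 <= f zw)%E by rewrite lee_fin mulr_ge0// bfun_ge0.
have mf : measurable_fun setT f.
  apply/measurable_EFinP; apply: measurable_funM.
    by apply: measurableT_comp measurable_snd; exact: measurable_bfun.
  by apply: measurable_indic; exact: measurable_qb2.
rewrite (_ : ball_avg _ _ _ _ = fun z => \int[lebC R n]_w f (z, w))%E.
  exact: (@measurable_fun_fubini_tonelli_F _ _ _ _ _ (lebC R n) _ mf f0).
apply/funext => z; apply: eq_integral => w _; rewrite /f /=.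
by congr (_ * _)%:E; rewrite !indicE.
Qed.

(** The error of the shell comparison. It is superadditive over consecutive shells, so the errors
    sum to one integral over the ball, where [integral_ball_avg] applies. *)
Definition havg g p s a b : \bar R := \int[leb]_z
  ((\1_(annulus a b) z)%:E * ball_avg (kappa_trans (1 / 5)) (radial g) p s z).

Lemma measurable_havg g p s a b : holomorphic_on_ball g -> 0 < p ->
  measurable_fun setT (fun z => (\1_(annulus a b) z)%:E *
     ball_avg (kappa_trans (1 / 5)) (radial g) p s z)%E.
Proof.
move=> hg p0; apply: emeasurable_funM.
  by apply/measurable_EFinP; apply: measurable_indic; exact: measurable_annulus.
by apply: measurable_ball_avg => //; exact: hol_radial.
Qed.

Lemma havg_ge0 g p s a b : (0 <= havg g p s a b)%E.
Proof. by apply: integral_ge0 => z _; rewrite mule_ge0 ?ball_avg_ge0// lee_fin. Qed.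

Lemma havg_split g p s a b c : holomorphic_on_ball g -> 0 < p -> a <= b -> b <= c ->
  (havg g p s a b + havg g p s b c <= havg g p s a c)%E.
Proof.
move=> hg p0 ab bc; rewrite /havg -ge0_integralD//; last 4 first.
- by move=> z _; rewrite mule_ge0 ?ball_avg_ge0// lee_fin.
- exact: measurable_havg.
- by move=> z _; rewrite mule_ge0 ?ball_avg_ge0// lee_fin.
- exact: measurable_havg.
apply: ge0_le_integral => //.
- by move=> z _; rewrite adde_ge0// mule_ge0 ?ball_avg_ge0// lee_fin.
- by apply: emeasurable_funD; exact: measurable_havg.
- exact: measurable_havg.
move=> z _; rewrite -ge0_muleDl ?lee_fin//; apply: lee_wpmul2r; first exact: ball_avg_ge0.
rewrite -EFinD lee_fin.
have [zb|zb] := ltP (enorm z) b.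
  rewrite [\1_(annulus b c) z]indic_notin ?addr0; last by apply/negP; rewrite negb_and -ltNge zb.
  have [H|H] := pselect (annulus a b z); last by rewrite indic_notin.
  rewrite [leRHS]indic_in//; case/andP : H => za _.
  by rewrite /annulus /= za (lt_le_trans zb).
rewrite [\1_(annulus a b) z]indic_notin ?add0r; last by apply/negP; rewrite negb_and -!leNgt zb orbT.
have [H|H] := pselect (annulus b c z); last by rewrite indic_notin.
rewrite [leRHS]indic_in//; case/andP : H => _ zc.
by rewrite /annulus /= zc (le_trans ab).
Qed.

(* The dilations by t and t^2 map the shell t^2 <= |z| < t onto t^3 <= |z| < t^2
   and t^4 <= |z| < t^3, the two parts of the next shell: hence the factor 2. *)
Lemma shell_step p b e : 0 < p -> 0 < e -> exists2 K : R, 0 < K &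
  forall g t, holomorphic_on_ball g -> 2^-1 <= t ^+ 2 -> 0 < t -> t < 1 ->
  (2%:E * ((1 - t ^+ 4) `^ b)%:E * rint g p 0 (t ^+ 2) t <=
   ((1 + e) * (1 - t ^+ 4) `^ b * (t ^+ 4) ^- n)%:E * rint g p 0 (t ^+ 4) (t ^+ 2) +
   K%:E * havg g p (b + p) (t ^+ 2) t)%E.
Proof.
move=> p0 e0; have [K1 K10 HK1] := powR_add_eps p0 e0.
have [K2 K20 HK2] := dilation_diff_avg b p0.
(* On the shell the defect lies between [1 - t ^+ 2] and [1 - t ^+ 4], whose ratio is below 2, so
   the weight can be frozen at the cost of [c]. *)
pose c := (2 : R) `^ `|b|; have c0 : 0 < c by apply: powR_gt0.
exists (K1 * (2 * (c * K2))) => [|g t hg t2 t0 t1]; first by rewrite !mulr_gt0.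
pose d := (1 - t ^+ 4) `^ b.
have t4 : t ^+ 4 < 1 by rewrite exprn_ilt1// ltW.
have t21 : t ^+ 2 < 1 by rewrite exprn_ilt1// ltW.
have d0 : 0 < d by apply: powR_gt0; rewrite subr_gt0.
have tn : 0 < t ^+ 2 by rewrite exprn_gt0.
have t4E : t ^+ 4 = t ^+ 2 * t ^+ 2 by rewrite -exprD.
have ttt : t ^+ 2 <= t by rewrite expr2 ler_piMr// ltW.
pose I z : R := \1_(annulus (t ^+ 2) t) z.
pose H z := ball_avg (kappa_trans (1 / 5)) (radial g) p (b + p) z.
have H0 z : (0 <= H z)%E by exact: ball_avg_ge0.
have I0 z : 0 <= I z by [].
have pt z r : r = t \/ r = t ^+ 2 ->
  ((d * (bfun g p 0 z * I z))%:E <= ((1 + e) * d)%:E * (bfun g p 0 (rc r *: z) * I z)%:E +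
    (K1 * (c * K2))%:E * ((I z)%:E * H z))%E.
  move=> rt; have [Az|Az] := pselect (annulus (t ^+ 2) t z); last first.
    by rewrite /I indic_notin// !mulr0 mul0e !mule0 addr0.
  have Iz : I z = 1 by exact: indic_in.
  move/andP : Az => [za zb].
  have zB : uball z by exact: lt_trans zb t1.
  have r1 : t ^+ 2 <= r by case: rt => ->.
  have r2 : r <= 1 by case: rt => ->; exact: ltW.
  have rB : uball (rc r *: z).
    rewrite /Defs.uball /= enormZ normc_real ger0_norm; last lra.
    by apply: le_lt_trans (enorm_lt1 zB); rewrite ler_piMl ?enorm_ge0.
  have dz := defect_gt0 zB.
  have dz1 : 1 - t ^+ 2 <= defect z.
    rewrite lerD2l lerN2; apply: (@lerXn2r _ 2%N) (ltW zb) => //; rewrite nnegrE ?enorm_ge0 ?(ltW t0)//.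
  have dz2 : defect z <= 1 - t ^+ 4.
    by rewrite lerD2l lerN2 -[4%N]/(2 * 2)%N exprM lerXn2r// ?nnegrE ?enorm_ge0 ?ltW.
  have dd : d <= c * defect z `^ b.
    apply: powR_comparable => //; first by rewrite subr_gt0.
      rewrite t4E; nra.
    lra.
  have := HK2 g z r hg zB ltac:(lra) r2 ltac:(lra).
  rewrite -/(H z) Iz !mulr1 mul1e !bfunE// !powRr0 !mulr1 => Hd.
  have Ha : normc (g z) <= normc (g (rc r *: z)) + normc (g z - g (rc r *: z)).
    by have := normcD (g z - g (rc r *: z)) (g (rc r *: z)); rewrite subrK addrC.
  have HA := HK1 _ _ (normc_ge0 (g (rc r *: z))) (normc_ge0 (g z - g (rc r *: z))).
  have HB := powR_le (ltW p0) (normc_ge0 _) Ha.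
  move: (powR_ge0 (normc (g z - g (rc r *: z))) p) Hd HA.
  move: (normc (g z - g (rc r *: z)) `^ p) (powR_ge0 (normc (g (rc r *: z))) p) => D.
  move: (normc (g (rc r *: z)) `^ p) => G G0 D0 Hd HA.
  have {HA HB}HX := le_trans HB HA.
  move: (normc (g z) `^ p) HX => X HX.
  apply: (@le_trans _ _ ((1 + e) * d * G + K1 * (d * D))%:E).
    rewrite lee_fin; have : d * X <= d * ((1 + e) * G + K1 * D) by rewrite ler_pM2l.
    lra.
  rewrite EFinD EFinM; apply: leeD2l.
  have -> : ((K1 * (c * K2))%:E * H z = (K1 * c)%:E * (K2%:E * H z))%E.
    by rewrite muleA -EFinM mulrA.
  apply: (@le_trans _ _ ((K1 * c)%:E * (D * defect z `^ b)%:E)%E).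
    rewrite -EFinM lee_fin -mulrA ler_wpM2l ?(ltW K10)// mulrCA [leLHS]mulrC.
    by rewrite ler_wpM2l.
  by apply: lee_wpmul2l; [rewrite lee_fin ltW// mulr_gt0|exact: Hd].
have mI : measurable_fun setT (fun z => (I z)%:E * H z)%E by exact: measurable_havg.
have mdil r : measurable_fun setT (fun z => (bfun g p 0 (rc r *: z) * I z)%:E).
  apply/measurable_EFinP; apply: measurable_funM.
    by apply: (measurableT_comp (measurable_bfun 0 hg p0)); exact: measurable_rowZc.
  by apply: measurable_indic; exact: measurable_annulus.
have dil0 r z : (0 <= (bfun g p 0 (rc r *: z) * I z)%:E)%E by rewrite lee_fin mulr_ge0// bfun_ge0.
have IH0 z : (0 <= (I z)%:E * H z)%E by rewrite mule_ge0// lee_fin.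
have int r : r = t \/ r = t ^+ 2 -> (d%:E * rint g p 0 (t ^+ 2) t <=
    ((1 + e) * d * (t ^+ 4) ^- n)%:E * rint g p 0 (r * t ^+ 2) (r * t) +
    (K1 * (c * K2))%:E * havg g p (b + p) (t ^+ 2) t)%E.
  move=> rt; have r0 : 0 < r by case: rt => ->.
  have r1 : t ^+ 2 <= r by case: rt => ->.
  have r2 : r * t <= 1 by apply: mulr_ile1; rewrite ?ltW//; case: rt => ->.
  have k1 : 0 <= (1 + e) * d by apply: mulr_ge0; [lra|exact: ltW].
  have k2 : 0 <= K1 * (c * K2) by rewrite !mulr_ge0// ltW.
  apply: (@le_trans _ _ (((1 + e) * d)%:E * \int[leb]_z (bfun g p 0 (rc r *: z)%R * I z)%:E +
      (K1 * (c * K2))%:E * havg g p (b + p) (t ^+ 2) t)%E); last first.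
    apply: leeD2r; rewrite rint_dilate// muleA -EFinM.
    apply: lee_wpmul2r; first exact: rint_ge0.
    rewrite lee_fin ler_wpM2l// lef_pV2 ?posrE ?exprn_gt0//.
    apply: lerXn2r; rewrite ?nnegrE ?exprn_ge0 ?(ltW t0) ?(ltW r0)//.
    by rewrite t4E -expr2; apply: lerXn2r; rewrite ?nnegrE ?(ltW tn) ?(ltW r0).
  rewrite /rint /havg -!ge0_integralZl_EFin ?(ltW d0)//; last 2 first.
  - by move=> z _; rewrite lee_fin mulr_ge0// bfun_ge0.
  - exact: measurable_rint.
  rewrite -ge0_integralD//; last 4 first.
  - by move=> z _; rewrite mule_ge0// lee_fin.
  - exact: measurable_funeM.
  - by move=> z _; rewrite mule_ge0.
  - exact: measurable_funeM.
  apply: ge0_le_integral => //.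
  - move=> z _; rewrite -EFinM lee_fin; apply: mulr_ge0; first exact: ltW.
    by rewrite mulr_ge0// bfun_ge0.
  - by apply: measurable_funeM; exact: measurable_rint.
  - by apply: emeasurable_funD; exact: measurable_funeM.
  by move=> z _; rewrite -EFinM; exact: pt.
have h1 := int t (or_introl erefl); have h2 := int (t ^+ 2) (or_intror erefl).
rewrite -/d (_ : 2%:E * d%:E * _ = d%:E * rint g p 0 (t ^+ 2) t + d%:E * rint g p 0 (t ^+ 2) t)%E; last first.
  by rewrite -ge0_muleDl ?lee_fin ?(ltW d0)// -EFinD -EFinM; congr (_%:E * _)%E; ring.
apply: (le_trans (leeD h1 h2)); rewrite addeACA.
have ttt4 : t ^+ 4 <= t ^+ 2 * t by rewrite t4E ler_wpM2l// ltW.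
have ttt3 : t ^+ 2 * t <= t ^+ 2 by rewrite ler_piMr// ltW.
rewrite (@rint_split g p 0 (t ^+ 4) (t ^+ 2 * t) (t ^+ 2))//.
rewrite -t4E -(expr2 t) [t * t ^+ 2]mulrC.
rewrite -ge0_muleDr ?rint_ge0// [X in (_ * X + _ <= _)%E]addeC; apply: leeD2l.
rewrite -ge0_muleDl ?lee_fin ?mulr_ge0 ?(ltW K10) ?(ltW K20) ?(ltW c0)//.
by apply: eq_imp_le; rewrite -EFinD; congr (_%:E * _)%E; ring.
Qed.

End Hardy.

Section HardyInequality.
Variables (R : realType) (n : nat).
Local Notation C := R[i].
Local Notation Cn := 'rV[R[i]]_n.
Local Notation normc := (@Normc.normc R).
Local Notation rc := (real_complex R).
Local Notation leb := (lebesgueC R n).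
Local Notation uball := (@uball R n).
Implicit Types (g : Cn -> C) (z w u : Cn) (p q s r kap t a b : R).

(** The weighted mass of the shell with the weight frozen at its inner edge |z| = t^2. Dilations
    then act on an unweighted integral, and the weights of two shells are compared as plain
    numbers. *)
Definition shell_weight g p b t : \bar R :=
  (((1 - t ^+ 4) `^ b)%:E * rint g p 0 (t ^+ 2) t)%E.

Lemma shell_weight_ge0 g p b t : (0 <= shell_weight g p b t)%E.
Proof. by rewrite mule_ge0 ?rint_ge0// lee_fin powR_ge0. Qed.

(** With y = t^4, the number 1 - y^2 lies between 1 - y and 2 (1 - y): moving inwards costs nothing
    if b >= 0 and at most 2^(-b) otherwise. *)
Lemma defect_ratio b t : 0 < t -> t < 1 ->
  (1 - t ^+ 4) `^ b <= 2 `^ (Num.max 0 (- b)) * (1 - (t ^+ 2) ^+ 4) `^ b.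
Proof.
move=> t0 t1; have -> : (t ^+ 2) ^+ 4 = (t ^+ 4) ^+ 2 by rewrite -!exprM.
have : t ^+ 4 < 1 by rewrite exprn_ilt1// ltW.
have : 0 < t ^+ 4 by rewrite exprn_gt0.
move: (t ^+ 4) => y y0 y1; have y20 : 0 < 1 - y ^+ 2 by nra.
have [b0|b0] := leP 0 b.
  rewrite max_l ?oppr_le0// powRr0 mul1r; apply: powR_le => //; nra.
rewrite max_r; last by lra.
have E : `|b| = - b by rewrite ltr0_norm.
rewrite -E; apply: powR_comparable => //; nra.
Qed.

(* Passing to the next shell costs at most 2 ^ max(0, - b) in the weight, which
   is less than the gain of 2 in [shell_step], as b > -1. *)
Lemma shell_contraction p b : 0 < p -> -1 < b -> exists t0 theta K : R,
  [/\ 0 < t0, t0 < 1, 1 - t0 <= 1 / 20, 0 <= theta & theta < 1] /\ 0 < K /\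
  forall g t, holomorphic_on_ball g -> t0 <= t -> t < 1 ->
  (shell_weight g p b t <= theta%:E * shell_weight g p b (t ^+ 2) +
    K%:E * havg g p (b + p) (t ^+ 2) t)%E.
Proof.
move=> p0 b1; pose m := Num.max 0 (- b).
have m1 : m < 1 by rewrite gt_max ltr01/=; lra.
pose lam := (2 : R) `^ (m - 1).
have lam0 : 0 < lam by apply: powR_gt0.
have lam1 : lam < 1.
  rewrite /lam -(opprK (m - 1)) powRN invf_lt1 ?powR_gt0// -[ltLHS](powR_1l (- (m - 1))).
  apply: gt0_ltr_powR; rewrite ?nnegrE//; lra.
have lamE : 2 `^ m = 2 * lam.
  by rewrite /lam powRB ?powRr1//; [field|apply/implyP].
(* One factor 1 + e of [theta] comes from [powR_add_eps], the other from the Jacobian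
   [(t ^+ 4) ^- n]; with this [e] the product with [lam] is still below 1. *)
pose e := (1 - lam) / 4; have e0 : 0 < e by rewrite divr_gt0// subr_gt0.
pose theta := (1 + e) ^+ 2 * lam.
have th0 : 0 <= theta by rewrite mulr_ge0 ?sqr_ge0// ltW.
have th1 : theta < 1 by rewrite /theta /e; nra.
clearbody e.
have [K K0 HK] := shell_step n b p0 e0.
pose N := (4 * n)%N.
have N0 : 0 < (N.+1)%:R :> R by [].
(* By Bernoulli the second bound keeps [(1 - x) ^+ 4] to the power -n below 1 + e. The first one
   ensures [2^-1 <= t ^+ 2] and is the starting point of [sqrt_seq]. *)
pose x := Num.min (1 / 20) (e / ((1 + e) * N.+1%:R)).
have e1 : 0 < 1 + e by lra.
have e2 : 0 < (1 + e) * N.+1%:R by exact: mulr_gt0.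
have x0 : 0 < x.
  by rewrite lt_min; apply/andP; split; [rewrite divr_gt0|exact: divr_gt0].
have x1 : x <= 1 / 20 by rewrite /x ge_min lexx.
have xN : N%:R * x <= e / (1 + e).
  have : N.+1%:R * x <= e / (1 + e).
    have -> : e / (1 + e) = N.+1%:R * (e / ((1 + e) * N.+1%:R)) by field; rewrite !gt_eqF.
    by rewrite ler_pM2l// /x ge_min lexx orbT.
  by apply: le_trans; rewrite ler_wpM2r ?(ltW x0)// ler_nat.
clearbody x.
have tN : (((1 - x) ^+ 4) ^- n) <= 1 + e.
  rewrite -exprM -/N -[leLHS]div1r ler_pdivrMr ?exprn_gt0//; last lra.
  have H := @one_sub_expn_ge R x N (ltW x0) ltac:(lra).
  have : (1 + e) * (1 - N%:R * x) <= (1 + e) * (1 - x) ^+ N by rewrite ler_pM2l.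
  apply: le_trans; rewrite mulrBr mulr1.
  have : (1 + e) * (N%:R * x) <= (1 + e) * (e / (1 + e)) by rewrite ler_pM2l.
  have -> : (1 + e) * (e / (1 + e)) = e by field; rewrite gt_eqF.
  lra.
exists (1 - x), theta, (K / 2); split; [split => //; lra|split; first by rewrite divr_gt0].
move=> g t hg tx t1; have t0 : 0 < t by lra.
have tt : 2^-1 <= t ^+ 2 by rewrite expr2; nra.
have H := HK g t hg tt t0 t1.
have tn : (t ^+ 4) ^- n <= 1 + e.
  apply: le_trans tN; rewrite lef_pV2 ?posrE ?exprn_gt0//; last lra.
  by apply: lerXn2r; rewrite ?nnegrE ?exprn_ge0 ?(ltW t0)//; [lra|apply: lerXn2r; rewrite ?nnegrE ?(ltW t0)//; lra].
have dr := defect_ratio b t0 t1.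
rewrite -/m lamE in dr.
have X0 := rint_ge0 g p 0 (t ^+ 4) (t ^+ 2).
have Y0 := havg_ge0 g p (b + p) (t ^+ 2) t.
rewrite /shell_weight -[((t ^+ 2) ^+ 2)%R]exprM.
move: X0 Y0 H; rewrite -!muleA.
move: (rint g p 0 (t ^+ 2) t) (rint g p 0 (t ^+ 4) (t ^+ 2)) (havg g p (b + p) (t ^+ 2) t).
move=> U X Y X0 Y0 H.
rewrite -(@lee_pmul2l _ 2%:E)// ; apply: (le_trans H).
rewrite [leRHS]ge0_muleDr; last 2 first.
- by rewrite !mule_ge0// lee_fin powR_ge0.
- by rewrite mule_ge0// lee_fin divr_ge0// ltW.
apply: leeD; last by rewrite muleA -EFinM; apply: eq_imp_le; congr (_%:E * _)%E; field.
rewrite !muleA -!EFinM; apply: lee_wpmul2r => //.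
rewrite lee_fin /theta.
apply: le_trans (_ : (1 + e) * (2 * lam * (1 - (t ^+ 2) ^+ 4) `^ b) * (1 + e) <= _).
  apply: ler_pM => //.
  - by rewrite mulr_ge0 ?powR_ge0// ltW.
  - by rewrite invr_ge0 !exprn_ge0// ltW.
  - by rewrite ler_pM2l.
by apply: eq_imp_le; ring.
Qed.

Lemma shell_rint g p b t : holomorphic_on_ball g -> 0 < p -> 0 < t -> t < 1 ->
  (rint g p b (t ^+ 2) t <= (2 `^ `|b|)%:E * shell_weight g p b t)%E.
Proof.
move=> hg p0 t0 t1; rewrite /shell_weight muleA -EFinM; apply: le_integral_scale.
- by rewrite mulr_ge0// powR_ge0.
- exact: measurable_rint.
- exact: measurable_rint.
- by move=> z; rewrite lee_fin mulr_ge0// bfun_ge0.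
- by move=> z; rewrite lee_fin mulr_ge0// bfun_ge0.
move=> z; rewrite -EFinM lee_fin.
have [Az|Az] := pselect (annulus (t ^+ 2) t z); last by rewrite (indic_notin _ Az) !mulr0.
rewrite (indic_in _ Az) !mulr1; move/andP : Az => [za zb].
have zB : uball z by exact: lt_trans zb t1.
have dz := defect_gt0 zB.
rewrite !bfunE// powRr0 mulr1 [leRHS]mulrC; apply: ler_wpM2l; first exact: powR_ge0.
have z0 := enorm_ge0 z; have tn : 0 < t ^+ 2 by rewrite exprn_gt0.
have t4E : t ^+ 4 = t ^+ 2 * t ^+ 2 by rewrite -exprD.
have z1 : enorm z ^+ 2 <= t ^+ 2 by apply: lerXn2r; rewrite ?nnegrE ?(ltW t0) ?(ltW zb).
have z2 : t ^+ 4 <= enorm z ^+ 2.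
  by rewrite t4E -expr2; apply: lerXn2r; rewrite ?nnegrE ?(ltW tn).
have t2 : t ^+ 2 < 1 by rewrite exprn_ilt1// ltW.
apply: powR_comparable => //; rewrite /defect; nra.
Qed.

Lemma lebesgueC_uball_fin : (leb uball < +oo)%E.
Proof.
apply: (@le_lt_trans _ _ (leb (@cube R n 1))).
  apply: le_measure; rewrite ?inE; [exact: measurable_uball|exact: measurable_cube|].
  move=> z zB j; split; apply: le_lt_trans zB; apply: le_trans (coord_le_enorm _ j).
    exact: Re_le_normc.
  exact: Im_le_normc.
by rewrite lebesgueC_cube// ltry.
Qed.

Lemma inner_rint p s b t0 : 0 < p -> 0 < t0 -> t0 < 1 -> exists2 K : R, 0 < K &
  forall g, holomorphic_on_ball g ->
  (rint g p b 0 t0 <=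
   K%:E * ((normc (g 0%R) `^ p)%:E + \int[leb]_w (bfun (radial g) p s w)%:E))%E.
Proof.
move=> p0 t00 t01; have [K K0 HK] := interior_bound n s p0 t00 t01.
pose D := (1 - t0 ^+ 2)^-1 `^ `|b|.
have m0 : 0 < 1 - t0 ^+ 2 by nra.
have D0 : 0 < D by apply: powR_gt0; rewrite invr_gt0.
pose v := fine (leb uball); have v0 : 0 <= v by rewrite fine_ge0.
exists (D * K * (v + 1)) => [|g hg]; first by rewrite !mulr_gt0// ltr_wpDl.
pose Q := ((normc (g 0%R) `^ p)%:E + \int[leb]_w (bfun (radial g) p s w)%:E)%E.
have Q0 : (0 <= Q)%E.
  by rewrite adde_ge0 ?lee_fin ?powR_ge0//; apply: integral_ge0 => w _; rewrite lee_fin bfun_ge0.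
rewrite -/Q; case E : Q Q0 => [Qr| |]// Q0; last first.
  by rewrite gt0_muley ?leey// lte_fin !mulr_gt0// ltr_wpDl.
rewrite lee_fin in Q0.
have mi : measurable_fun setT (fun z : Cn => (\1_uball z)%:E : \bar R).
  by apply/measurable_EFinP; apply: measurable_indic; exact: measurable_uball.
apply: (@le_trans _ _ ((D * K * Qr)%:E * \int[leb]_z (\1_uball z)%:E)%E).
  apply: le_integral_scale => //.
  - by rewrite !mulr_ge0// ltW.
  - exact: measurable_rint.
  - by move=> z; rewrite lee_fin mulr_ge0// bfun_ge0.
  move=> z; rewrite -EFinM lee_fin.
  have [Az|Az] := pselect (annulus 0 t0 z); last first.
    by rewrite (indic_notin _ Az) mulr0 !mulr_ge0// ltW.
  have zt : enorm z < t0 by case/andP : Az.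
  have zB : uball z by exact: lt_trans zt t01.
  have dz := defect_gt0 zB.
  rewrite (indic_in _ Az) (indic_in _ zB) !mulr1 bfunE//.
  have H := HK g z hg (ltW zt); rewrite -/Q E -EFinM lee_fin in H.
  have : defect z `^ b <= D * 1 `^ b.
    apply: powR_comparable => //.
    - by rewrite invr_gt0.
    - rewrite mulr1; apply: le_trans (defect_le1 z) _; rewrite invf_ge1//.
      by rewrite gerBl sqr_ge0.
    - rewrite -ler_pdivrMl ?invr_gt0// invrK mulr1.
      rewrite lerD2l lerN2; apply: lerXn2r; rewrite ?nnegrE ?enorm_ge0 ?(ltW t00) ?(ltW zt)//.
  rewrite powR_1l mulr1 => HD; rewrite mulrC -mulrA; apply: ler_pM => //; exact: powR_ge0.
rewrite integral_indic ?setIT//; last exact: measurable_uball.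
have -> : leb uball = v%:E.
  by rewrite fineK// ge0_fin_numE//; exact: lebesgueC_uball_fin.
rewrite -!EFinM lee_fin -[leRHS]mulrAC; apply: ler_wpM2l; last by rewrite lerDl.
by rewrite !mulr_ge0// ltW.
Qed.

(** Iterated square roots, so that the shell between [T j] and [T j.+1] has the form [t^2, t). Each
    root multiplies 1 - T by at most 2 / 3, and the crude rate 1 / (j + 2) is all that the
    exhaustion of the ball requires. *)
Lemma sqrt_seq (t0 : R) : 0 < t0 -> t0 < 1 -> 1 - t0 <= 1 / 20 ->
  exists T : nat -> R, [/\ T 0%N = t0, forall j, T j = T j.+1 ^+ 2,
    forall j, t0 <= T j < 1 & forall j, 1 - T j <= j.+2%:R^-1].
Proof.
move=> t00 t01 t02; pose T j := iter j (@Num.sqrt R) t0.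
have T01 j : t0 <= T j < 1.
  elim: j => [|j /andP[h1 h2]]; first by rewrite lexx.
  have T0 : 0 < T j by lra.
  rewrite /T iterS -/(T j); apply/andP; split.
    rewrite -(ger0_norm (ltW t00)) -sqrtr_sqr ler_sqrt//; nra.
  by rewrite -[ltRHS]sqrtr1 ltr_sqrt.
have TS j : T j = T j.+1 ^+ 2.
  have /andP[h _] := T01 j; rewrite [in RHS]/T iterS -/(T j) sqr_sqrtr//; lra.
exists T; split => //; elim => [|j IH]; first by rewrite /T /=; lra.
have /andP[h1 h2] := T01 j.+1; have := TS j => E.
have : (1 - T j.+1) * (3 / 2) <= 1 - T j by rewrite E; nra.
have j0 : 0 < (j.+2)%:R :> R by [].
have j1 : 0 < (j.+3)%:R :> R by [].
move=> H; have : 1 - T j.+1 <= 2 / 3 * j.+2%:R^-1.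
  by move: H IH; move: (T j) (T j.+1) (j.+2%:R^-1) => a b c; clear; lra.
move/le_trans; apply; rewrite -[leRHS]div1r ler_pdivlMr// mulrAC ler_pdivrMr// mul1r.
have -> : (j.+3)%:R = (j.+2)%:R + 1 :> R by rewrite -natr1.
have : (2 : R) <= j.+2%:R by rewrite ler_nat.
lra.
Qed.

Lemma havg_le p s : 0 < p -> exists2 K : R, 0 < K &
  forall g a t, holomorphic_on_ball g -> t <= 1 ->
  (havg g p s a t <= K%:E * \int[leb]_w (bfun (radial g) p s w)%:E)%E.
Proof.
move=> p0; have k0 : 0 < kappa_trans (1 / 5) :> R by apply: kappa_trans_gt0; lra.
have k1 : kappa_trans (1 / 5) < 1 :> R by apply: kappa_trans_lt1; lra.
have [K K0 HK] := integral_ball_avg n 0 s k0 k1 p0.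
exists K => // g a t hg t1; have hr := hol_radial hg.
have := HK (radial g) hr; rewrite addr0; apply: le_trans.
apply: ge0_le_integral => //.
- by move=> z _; rewrite mule_ge0 ?ball_avg_ge0// lee_fin.
- exact: measurable_havg.
- apply: emeasurable_funM; last exact: measurable_ball_avg.
  apply/measurable_EFinP; apply: measurable_funM; first exact: measurable_defect_powR.
  by apply: measurable_indic; exact: measurable_uball.
move=> z _; apply: lee_wpmul2r; first exact: ball_avg_ge0.
rewrite lee_fin powRr0 mul1r.
have [Az|Az] := pselect (annulus a t z); last by rewrite (indic_notin _ Az).
by rewrite (indic_in _ Az) indic_in//; case/andP : Az => _ /lt_le_trans; apply.
Qed.

(** A discrete Gronwall argument that stays within additions of nonnegative extended reals: the
    induction carries the mass inside [T j] plus [A] times the weight of the last shell. The bound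
    does not depend on [j], since the errors [havg] accumulate inside a single average. *)
Lemma rint_uniform_bound p b : 0 < p -> -1 < b -> exists T : nat -> R, exists2 K : R, 0 < K &
  (forall j, T j <= T j.+1) /\ (forall z, uball z -> exists j, enorm z < T j) /\
  (forall j, T j < 1) /\
  forall g, holomorphic_on_ball g -> forall j,
  (rint g p b 0 (T j) <=
   K%:E * ((normc (g 0%R) `^ p)%:E + \int[leb]_w (bfun (radial g) p (b + p) w)%:E))%E.
Proof.
move=> p0 b1.
have [t0 [th [K [[t00 t01 t02 th0 th1] [K0 HK]]]]] := shell_contraction p0 b1.
have [T [T0 TS T01 Tlim]] := sqrt_seq t00 t01 t02.
have [Ki Ki0 HKi] := inner_rint (b + p) b p0 t00 t01.
have [Kj Kj0 HKj] := inner_rint (b + p) 0 p0 t00 t01.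
have [Kh Kh0 HKh] := havg_le (b + p) p0.
pose c := (2 : R) `^ `|b|; have c0 : 0 < c by exact: powR_gt0.
have th' : 0 < 1 - th by rewrite subr_gt0.
(* The solution of [(c + A) * th = A]: the mass [c] of the new shell and [A] times its weight are
   together paid by [A] times the weight of the old one. *)
pose A := c * th / (1 - th); have A0 : 0 <= A by rewrite divr_ge0 ?mulr_ge0// ltW.
pose A' := (c / (1 - th)) * K; have A'0 : 0 <= A' by rewrite mulr_ge0 ?divr_ge0// ltW.
pose d := (1 - t0 ^+ 4) `^ b; have d0 : 0 <= d by exact: powR_ge0.
have T0' j : 0 < T j by have /andP[h _] := T01 j; apply: lt_le_trans h.
have T1 j : T j < 1 by have /andP[_ h] := T01 j.
have C10 : 0 <= A * (d * Kj).
  by apply: mulr_ge0 => //; apply: mulr_ge0 => //; exact: ltW.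
have C20 : 0 <= A' * Kh by apply: mulr_ge0 => //; exact: ltW.
exists T, (Ki + A * (d * Kj) + A' * Kh).
  by apply: ltr_wpDr => //; exact: ltr_wpDr.
split; [|split; [|split]] => //.
- by move=> j; rewrite [leLHS]TS expr2 ler_piMr// ltW.
- move=> z zB; have z1 : 0 < 1 - enorm z by rewrite subr_gt0; exact: enorm_lt1.
  pose j := Num.truncn (1 - enorm z)^-1; exists j.
  have H := truncnS_gt (1 - enorm z)^-1; rewrite -/j in H.
  suff P : j.+2%:R^-1 < 1 - enorm z by have P2 := le_lt_trans (Tlim j) P; lra.
  rewrite invf_plt ?posrE//; apply: lt_trans H _; rewrite ltr_nat.
  by [].
move=> g hg.
pose Q := ((normc (g 0%R) `^ p)%:E + \int[leb]_w (bfun (radial g) p (b + p) w)%:E)%E.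
have I0 : (0 <= \int[leb]_w (bfun (radial g) p (b + p) w)%:E)%E.
  by apply: integral_ge0 => w _; rewrite lee_fin bfun_ge0.
have Q0 : (0 <= Q)%E by rewrite adde_ge0 ?lee_fin ?powR_ge0.
have main j : (rint g p b 0 (T j) + A%:E * shell_weight g p b (T j) <=
    (Ki + A * (d * Kj))%:E * Q + A'%:E * havg g p (b + p) 0 (T j))%E.
  elim: j => [|j IH].
    rewrite T0; apply: (@le_trans _ _ ((Ki + A * (d * Kj))%:E * Q)%E); last first.
      by rewrite leeDl// mule_ge0 ?havg_ge0.
    rewrite EFinD ge0_muleDl ?lee_fin ?C10 ?(ltW Ki0)//.
    apply: leeD; first exact: HKi.
    rewrite [(A * (d * Kj))%:E]EFinM -muleA; apply: lee_wpmul2l; first by rewrite lee_fin.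
    rewrite [(d * Kj)%:E]EFinM -muleA; apply: lee_wpmul2l; first by rewrite lee_fin.
    apply: le_trans (HKj g hg).
    have t0t : t0 ^+ 2 <= t0 by rewrite expr2 ler_piMr// ltW.
    rewrite (@rint_split _ _ g p 0 0 (t0 ^+ 2) t0)// ?sqr_ge0//.
    by rewrite leeDr// rint_ge0.
  have TT := TS j; have Tj := T0' j; have Tj1 := T1 j.+1; have Tj0 := T0' j.+1.
  have TTle : T j <= T j.+1 by rewrite [leLHS]TT expr2 ler_piMr// ltW.
  have [T01a _] := andP (T01 j.+1).
  have H1 := shell_rint b hg p0 Tj0 Tj1; have H2 := HK g (T j.+1) hg T01a Tj1.
  rewrite -TT in H1 H2.
  rewrite (@rint_split _ _ g p b 0 (T j) (T j.+1) hg p0 (ltW Tj) TTle).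
  have Hs := havg_split (b + p) hg p0 (ltW Tj) TTle.
  have h0 := shell_weight_ge0 g p b (T j.+1); have hj0 := shell_weight_ge0 g p b (T j).
  have a0 := havg_ge0 g p (b + p) 0 (T j); have a1 := havg_ge0 g p (b + p) (T j) (T j.+1).
  have r0 := rint_ge0 g p b 0 (T j).
  move: IH H1 H2 Hs h0 hj0 a0 a1 r0.
  move: (rint g p b 0 (T j)) (rint g p b (T j) (T j.+1)) (shell_weight g p b (T j.+1)).
  move: (shell_weight g p b (T j)) (havg g p (b + p) 0 (T j)) (havg g p (b + p) (T j) (T j.+1)).
  move: (havg g p (b + p) 0 (T j.+1)) => Ha' Vj Ha Hs r rs V IH H1 H2 HH V0 Vj0 Ha0 Hs0 r0.
  have cA : c + A = c / (1 - th) by rewrite /A; field; rewrite gt_eqF.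
  have cA0 : 0 <= c / (1 - th) by rewrite divr_ge0// ltW.
  apply: (@le_trans _ _ (r + (c / (1 - th))%:E * V)%E).
    rewrite -addeA; apply: leeD2l; rewrite -cA EFinD ge0_muleDl ?lee_fin ?(ltW c0)//.
    exact: leeD2r.
  apply: (@le_trans _ _ (r + (A%:E * Vj + A'%:E * Hs))%E).
    apply: leeD2l; apply: (@le_trans _ _ ((c / (1 - th))%:E * (th%:E * Vj + K%:E * Hs))%E).
      exact: lee_wpmul2l.
    rewrite ge0_muleDr ?mule_ge0 ?lee_fin ?(ltW K0)// !muleA -!EFinM.
    by apply: eq_imp_le; congr (_%:E * _ + _%:E * _)%E; rewrite /A; ring.
  rewrite addeA; apply: (le_trans (leeD2r _ IH)); rewrite -addeA; apply: leeD2l.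
  by rewrite -ge0_muleDr//; exact: lee_wpmul2l.
move=> j; apply: (@le_trans _ _ (rint g p b 0 (T j) + A%:E * shell_weight g p b (T j))%E).
  by rewrite leeDl// mule_ge0 ?shell_weight_ge0.
apply: (le_trans (main j)); rewrite [in leRHS]EFinD ge0_muleDl ?lee_fin ?C20 ?addr_ge0 ?C10 ?(ltW Ki0)//.
apply: leeD2l; rewrite [(A' * Kh)%:E]EFinM -muleA; apply: lee_wpmul2l; first by rewrite lee_fin.
apply: (le_trans (HKh g 0 (T j) hg (ltW (T1 j)))); apply: lee_wpmul2l; first by rewrite lee_fin ltW.
by rewrite /Q leeDr// lee_fin powR_ge0.
Qed.

Lemma hardy p b : 0 < p -> -1 < b -> exists2 K : R, 0 < K &
  forall g, holomorphic_on_ball g ->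
  (\int[leb]_w (bfun g p b w)%:E <=
   K%:E * ((normc (g 0%R) `^ p)%:E + \int[leb]_w (bfun (radial g) p (b + p) w)%:E))%E.
Proof.
move=> p0 b1; have [T [K K0 [Tnd [Tlim [T1 HK]]]]] := rint_uniform_bound p0 b1.
exists K => // g hg; have {}HK := HK g hg.
pose G j z := (bfun g p b z * \1_(annulus 0 (T j)) z)%:E.
have Tm i j : (i <= j)%N -> T i <= T j.
  by move=> ij; rewrite -(subnKC ij); elim: (j - i)%N => [|k IH]; rewrite ?addn0// addnS (le_trans IH).
have mG j : measurable_fun setT (G j) by exact: measurable_rint.
have G0 j z : setT z -> (0 <= G j z)%E by move=> _; rewrite lee_fin mulr_ge0// bfun_ge0.
have Gnd z : setT z -> nondecreasing_seq (G ^~ z).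
  move=> _ i j ij; rewrite lee_fin; apply: ler_wpM2l; first exact: bfun_ge0.
  have [Az|Az] := pselect (annulus 0 (T i) z); last by rewrite (indic_notin _ Az).
  rewrite (indic_in _ Az) indic_in//; case/andP : Az => h1 h2.
  by rewrite /annulus /= h1 (lt_le_trans h2)// Tm.
have E : (\int[leb]_w (bfun g p b w)%:E = \int[leb]_(w in setT) limn (G ^~ w))%E.
  apply: eq_integral => w _; symmetry; apply/cvg_lim => //.
  have [wB|wB] := pselect (uball w); last first.
    rewrite (_ : G ^~ w = cst (bfun g p b w)%:E); first exact: cvg_cst.
    by apply/funext => j; rewrite /G bfun_out// mul0r.
  have [j wj] := Tlim w wB; apply: cvg_near_cst; exists j => // i /= ji.
  rewrite /G indic_in ?mulr1// /annulus /= enorm_ge0/=.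
  exact: lt_le_trans wj (Tm _ _ ji).
rewrite E monotone_convergence//; apply: lime_le.
  apply: ereal_nondecreasing_is_cvgn => i j ij.
  by apply: ge0_le_integral => // z Dz; [exact: G0|exact: Gnd].
by apply: nearW; exact: HK.
Qed.

End HardyInequality.

(** * Positivity of the Gamma function *)

Lemma integral_indicM d (T : measurableType d) (R : realType)
    (m : {measure set T -> \bar R}) (D : set T) (f : T -> R) : measurable D ->
  (\int[m]_(x in D) (f x)%:E = \int[m]_x (f x * \1_D x)%:E)%E.
Proof.
move=> mD; rewrite integral_mkcond; apply: eq_integral => x _; rewrite patchE.
by rewrite indicE; case: ifP => _; rewrite ?mulr1 ?mulr0.
Qed.

Lemma integral_limit_le d (T : measurableType d) (R : realType)
    (m : {measure set T -> \bar R}) (G : nat -> T -> \bar R) (f : T -> \bar R) (B : \bar R) :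
  (forall j, measurable_fun setT (G j)) -> (forall j x, 0 <= G j x)%E ->
  (forall x i j, (i <= j)%N -> (G i x <= G j x)%E) ->
  (forall x, exists j, forall i, (j <= i)%N -> G i x = f x) ->
  (forall j, \int[m]_x G j x <= B)%E -> (\int[m]_x f x <= B)%E.
Proof.
move=> mG G0 Gnd Gf GB.
have -> : (\int[m]_x f x = \int[m]_(x in setT) limn (G ^~ x))%E.
  apply: eq_integral => x _; symmetry; apply/cvg_lim => //.
  have [j Hj] := Gf x; by apply: cvg_near_cst; exists j => //; exact: Hj.
rewrite monotone_convergence//; last by move=> x _ i j ij; exact: Gnd.
apply: lime_le; last exact: nearW.
apply: ereal_nondecreasing_is_cvgn => i j ij.
by apply: ge0_le_integral => // z _; exact: Gnd.
Qed.

Section GammaPositive.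
Variable R : realType.
Local Notation Rm := (measurableTypeR R).
Local Notation lebR := (lebesgueR R).
Implicit Types (s e t : R).

Let unit_itv : (lebR `]0%R, 1%R]%classic = 1)%E.
Proof. by rewrite /= lebesgue_measure_itv/= lte_fin ltr01 oppr0 adde0. Qed.

Let measurable_powI s (D : set Rm) : measurable D ->
  measurable_fun setT (fun t : Rm => (t `^ (s - 1) * \1_D t)%:E).
Proof.
move=> mD; apply/measurable_EFinP; apply: measurable_funM; last exact: measurable_indic.
exact: measurable_powR.
Qed.

Let powI_ge0 s (D : set Rm) (t : Rm) : (0 <= (t `^ (s - 1) * \1_D t)%:E)%E.
Proof. by rewrite lee_fin mulr_ge0// powR_ge0. Qed.

Let away_from_zero s e : 0 < e -> e <= 1 ->
  (\int[lebR]_t (t `^ (s - 1) * \1_`]e, 1] t)%:E <= ((e^-1) `^ `|s - 1|)%:E)%E.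
Proof.
move=> e0 e1; have i0 : 0 <= (e^-1) `^ `|s - 1| by exact: powR_ge0.
have mI : measurable (`]0%R, 1%R] : set Rm) by exact: measurable_itv.
rewrite -[leRHS]mule1 -unit_itv -(setIT `]0, 1]%classic) -integral_indic//.
apply: le_integral_scale => //; first by apply: measurable_powI; exact: measurable_itv.
  by apply/measurable_EFinP; exact: measurable_indic.
move=> t; rewrite -EFinM lee_fin.
have [At|At] := pselect (`]e, 1]%classic t); last by rewrite (indic_notin _ At) mulr0 mulr_ge0.
rewrite (indic_in _ At) mulr1; move: At; rewrite /= in_itv/= => /andP[et t1].
rewrite indic_in; last by rewrite /= in_itv/= t1 (lt_trans e0).
rewrite mulr1 -[leRHS]mulr1 -[X in _ <= _ * X](powR_1l (s - 1)); apply: powR_comparable => //.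
- exact: lt_trans et.
- by rewrite invr_gt0.
- by rewrite mulr1; apply: (le_trans t1); rewrite invf_ge1.
- by rewrite mulrC ler_pdivlMr// mul1r ltW.
Qed.

(* The substitution t -> t / 2 maps ]2 e, 1] onto ]e, 1/2] and turns the integral
   into 2 ^ - s < 1 times itself. *)
Lemma integral_power_trunc s : 0 < s -> exists B : R, forall e, 0 < e -> e <= 1 / 2 ->
  (\int[lebR]_t (t `^ (s - 1) * \1_`]e, 1] t)%:E <= B%:E)%E.
Proof.
move=> s0; pose D : R := (2^-1^-1) `^ `|s - 1|.
pose c : R := 2^-1 * 2^-1 `^ (s - 1).
have c0 : 0 <= c by rewrite mulr_ge0 ?powR_ge0.
have c1 : c < 1.
  rewrite /c -[X in X * _](@powRr1 R 2^-1) ?invr_ge0// -powRD; last by apply/implyP => _; rewrite gt_eqF.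
  rewrite addrC subrK -[ltRHS](powR_1l s); apply: gt0_ltr_powR; rewrite ?nnegrE//; lra.
exists (D / (1 - c)) => e e0 e1.
have e1' : e <= 1 by lra.
have := away_from_zero s e0 e1'.
have : (0 <= \int[lebR]_t (t `^ (s - 1) * \1_`]e, 1] t)%:E)%E by exact: integral_ge0.
case E : (\int[lebR]_t _)%E => [r| |]//.
rewrite !lee_fin => r0 _; rewrite ler_pdivlMr ?subr_gt0//.
suff : (r%:E <= c%:E * r%:E + D%:E)%E by rewrite -EFinM -EFinD lee_fin; lra.
rewrite -{1}E; pose f (t : Rm) := (t `^ (s - 1) * \1_`]e, 2^-1] t)%:E.
have mf : measurable_fun setT f by apply: measurable_powI; exact: measurable_itv.
have f0 t : (0 <= f t)%E by exact: powI_ge0.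
have H1 : (\int[lebR]_t f t <= c%:E * r%:E)%E.
  have h2 : (2^-1 : R) != 0 by [].
  have := @ge0_integral_affine R 2^-1 0 f h2 mf f0.
  have -> : `|2^-1 : R|^-1 = 2 by rewrite ger0_norm ?invrK.
  move=> A.
  have -> : (\int[lebR]_t f t = (2^-1)%:E * \int[lebR]_x f (2^-1 * x + 0)%R)%E.
    by rewrite A muleA -EFinM mulVf ?mul1e.
  rewrite EFinM -muleA; apply: lee_wpmul2l; first by rewrite lee_fin.
  rewrite -E; apply: le_integral_scale.
  - exact: powR_ge0.
  - by apply: (measurableT_comp mf); apply: measurable_funD => //; exact: measurable_funM.
  - by apply: measurable_powI; exact: measurable_itv.
  - by move=> t; exact: f0.
  - by move=> t; exact: powI_ge0.
  move=> t; rewrite /f addr0 -EFinM lee_fin.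
  have [At|At] := pselect (`]e, 2^-1]%classic (2^-1 * t)); last first.
    by rewrite (indic_notin _ At) mulr0 mulr_ge0 ?powR_ge0// mulr_ge0 ?powR_ge0.
  rewrite (indic_in _ At) mulr1; move: At; rewrite /= in_itv/= => /andP[et t1].
  rewrite indic_in; last by rewrite /= in_itv/=; apply/andP; split; lra.
  by rewrite mulr1 powRM//; lra.
apply: (@le_trans _ _ (\int[lebR]_t f t + \int[lebR]_t (t `^ (s - 1) * \1_`]2^-1, 1] t)%:E)%E).
  rewrite -ge0_integralD//; last by apply: measurable_powI; exact: measurable_itv.
  apply: ge0_le_integral => //.
  - by apply: measurable_powI; exact: measurable_itv.
  - by apply: emeasurable_funD => //; apply: measurable_powI; exact: measurable_itv.
  move=> t _; rewrite /f -EFinD lee_fin -mulrDr; apply: ler_wpM2l; first exact: powR_ge0.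
  have [At|At] := pselect (`]e, 1]%classic t); last by rewrite (indic_notin _ At) addr_ge0.
  rewrite (indic_in _ At); move: At; rewrite /= in_itv/= => /andP[et t1].
  have [th|th] := leP t 2^-1.
    by rewrite [\1_`]e, 2^-1] t]indic_in ?lerDl//= in_itv/= et th.
  by rewrite [\1_`]2^-1, 1] t]indic_in ?lerDr//= in_itv/= t1 th.
apply: leeD => //; apply: away_from_zero; lra.
Qed.

Lemma integral_power_fin s : 0 < s -> exists B : R,
  (\int[lebR]_t (t `^ (s - 1) * \1_`]0%R, 1%R] t)%:E <= B%:E)%E.
Proof.
move=> s0; have [B HB] := integral_power_trunc s0; exists B.
have mono (i j : nat) : (i <= j)%N -> (j.+2%:R^-1 : R) <= i.+2%:R^-1.
  by move=> ij; rewrite lef_pV2 ?posrE// ler_nat.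
apply: (@integral_limit_le _ _ _ lebR (fun j (t : Rm) => (t `^ (s - 1) * \1_`]j.+2%:R^-1, 1%R] t)%:E)).
- by move=> j; apply: measurable_powI; exact: measurable_itv.
- by move=> j t; exact: powI_ge0.
- move=> t i j ij; rewrite lee_fin; apply: ler_wpM2l; first exact: powR_ge0.
  have [At|At] := pselect (`]i.+2%:R^-1, 1]%classic t); last by rewrite (indic_notin _ At).
  rewrite (indic_in _ At) indic_in//; move: At; rewrite /= !in_itv/= => /andP[h ->].
  by rewrite (le_lt_trans (mono i j ij)).
- move=> t; have [At|At] := pselect (`]0, 1]%classic t); last first.
    exists 0%N => i _; rewrite (indic_notin _ At) indic_notin//.
    by move=> /= Bt; apply: At; move: Bt; rewrite /= !in_itv/= => /andP[h ->]; rewrite (lt_trans _ h).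
  move: (At); rewrite /= in_itv/= => /andP[t0 t1].
  exists (Num.truncn t^-1) => i ji; rewrite (indic_in _ At) indic_in//= in_itv/= t1 andbT.
  rewrite invf_plt ?posrE//; apply: (lt_trans (truncnS_gt _)).
  by rewrite ltr_nat; exact: ji.
- move=> j; apply: HB; first by rewrite invr_gt0.
  by rewrite div1r lef_pV2 ?posrE// ler_nat.
Qed.

(** A single term of the exponential series, of an order above |s|, already dominates the power for
    t >= 1. *)
Lemma power_le_exp s : exists2 K : R, 0 < K &
  forall t, 1 <= t -> t `^ (s - 1) <= K * expR (2^-1 * t).
Proof.
pose m := Num.truncn `|s|; exists (2 ^+ m.+1 * m.+1`!%:R) => [|t t1].
  by rewrite mulr_gt0 ?exprn_gt0// ltr0n fact_gt0.
have t0 : 0 <= t by lra.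
apply: (@le_trans _ _ (t ^+ m.+1)).
  rewrite -powR_mulrn//; apply: ler_powR => //.
  have := truncnS_gt `|s|; rewrite -/m; have := ler_norm s; lra.
have F0 : 0 < m.+1`!%:R :> R by rewrite ltr0n fact_gt0.
have h0 : 0 <= 2^-1 * t by rewrite mulr_ge0.
have H := expR_ge1Dxn m h0.
have H2 : (2^-1 * t) ^+ m.+1 <= m.+1`!%:R * expR (2^-1 * t).
  by rewrite -ler_pdivrMl// mulrC; lra.
rewrite -mulrA; have -> : t ^+ m.+1 = 2 ^+ m.+1 * (2^-1 * t) ^+ m.+1.
  by rewrite -exprMn mulrA mulfV// mul1r.
by rewrite ler_pM2l ?exprn_gt0.
Qed.

(** [Gamma] is the [fine] part of an integral and would be 0 if the integral were infinite, so
    convergence has to be proved as well: near 0 by the power, at infinity by comparison with an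
    exponential density. *)
Lemma Gamma_gt0 s : 0 < s -> 0 < Gamma s.
Proof.
move=> s0; pose f t := t `^ (s - 1) * expR (- t).
have f0 t : 0 <= f t by rewrite mulr_ge0 ?powR_ge0 ?expR_ge0.
have mf : measurable_fun setT f.
  by apply: measurable_funM; [exact: measurable_powR|apply: measurableT_comp => //; exact: measurable_oppr].
pose I := (\int[lebR]_t (f t * \1_`]0%R, +oo[ t)%:E)%E.
have mfI : measurable_fun setT (fun t : Rm => (f t * \1_`]0%R, +oo[ t)%:E).
  apply/measurable_EFinP; apply: measurable_funM => //; apply: measurable_indic; exact: measurable_itv.
have GE : Gamma s = fine I.
  by rewrite /Gamma /Rintegral integral_indicM//; exact: measurable_itv.
rewrite GE; apply: fine_gt0; apply/andP; split.
  pose c := expR (- 2) * (2 `^ `|s - 1|)^-1.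
  have c0 : 0 < c by rewrite mulr_gt0 ?expR_gt0// invr_gt0 powR_gt0.
  have u12 : (lebR `]1%R, 2%R]%classic = 1)%E.
    by rewrite /= lebesgue_measure_itv/= lte_fin ltr1n -EFinB; congr EFin; ring.
  apply: (@lt_le_trans _ _ (c%:E * \int[lebR]_t (\1_`]1%R, 2%R] t)%:E)%E).
    have mI : measurable (`]1%R, 2%R] : set Rm) by exact: measurable_itv.
    by rewrite integral_indic// setIT [X in (_ * X)%E](u12) mule1 lte_fin.
  rewrite -ge0_integralZl_EFin ?(ltW c0)//; last first.
    by apply/measurable_EFinP; apply: measurable_indic; exact: measurable_itv.
  apply: ge0_le_integral => //.
  - by move=> t _; rewrite -EFinM lee_fin mulr_ge0// ltW.
  - by apply: measurable_funeM; apply/measurable_EFinP; apply: measurable_indic; exact: measurable_itv.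
  move=> t _; rewrite -EFinM lee_fin.
  have [At|At] := pselect (`]1%R, 2%R]%classic t); last by rewrite (indic_notin _ At) mulr0 mulr_ge0.
  rewrite (indic_in _ At); move: At; rewrite /= in_itv/= => /andP[t1 t2].
  rewrite indic_in ?mulr1; last by rewrite /= in_itv/= andbT; lra.
  rewrite /c /f mulrC; apply: ler_pM; rewrite ?invr_ge0 ?powR_ge0 ?expR_ge0//; last by rewrite ler_expR; lra.
  rewrite -[leLHS]div1r ler_pdivrMr ?powR_gt0// mulrC -[leLHS](powR_1l (s - 1)).
  apply: powR_comparable => //; lra.
have [B HB] := integral_power_fin s0; have [K K0 HK] := power_le_exp s.
have r0 : 0 < (2^-1 : R) by [].
have Ie := integral_exponential_pdf r0.
pose h (t : Rm) := (t `^ (s - 1) * \1_`]0%R, 1%R] t)%:E.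
have mh : measurable_fun setT h by apply: measurable_powI; exact: measurable_itv.
have me : measurable_fun setT (fun t : Rm => (exponential_pdf 2^-1 t)%:E).
  by apply/measurable_EFinP; exact: measurable_exponential_pdf.
have e0 (t : R) : 0 <= exponential_pdf 2^-1 t by exact: exponential_pdf_ge0.
apply: (@le_lt_trans _ _ (\int[lebR]_t h t + (K * 2)%:E * \int[lebR]_t (exponential_pdf 2^-1 t)%:E)%E); last first.
  by rewrite Ie mule1; apply: lte_add_pinfty; [apply: le_lt_trans HB _|]; rewrite ltry.
have K2 : 0 <= K * 2 by rewrite mulr_ge0// ltW.
rewrite -ge0_integralZl_EFin//; last by move=> t _; rewrite lee_fin.
rewrite -ge0_integralD//; last 3 first.
- by move=> t _; exact: powI_ge0.
- by move=> t _; rewrite -EFinM lee_fin mulr_ge0.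
- exact: measurable_funeM.
apply: ge0_le_integral => //.
- by move=> t _; rewrite lee_fin mulr_ge0.
- by apply: emeasurable_funD => //; exact: measurable_funeM.
move=> t _; rewrite /h -EFinM -EFinD lee_fin.
have [At|At] := pselect (`]0%R, +oo[%classic t); last first.
  rewrite (indic_notin _ At) mulr0; apply: addr_ge0; last exact: mulr_ge0.
  by apply: mulr_ge0 => //; exact: powR_ge0.
rewrite (indic_in _ At) mulr1; move: At; rewrite /= in_itv/= andbT => t0.
have [t1|t1] := leP t 1.
  apply: ler_wpDr; first by rewrite mulr_ge0.
  rewrite indic_in ?mulr1; last by rewrite /= in_itv/= t0 t1.
  by rewrite /f ler_piMr ?powR_ge0// -expR0 ler_expR; lra.
apply: ler_wpDl; first by rewrite mulr_ge0 ?powR_ge0.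
rewrite exponential_pdfE ?(ltW t0)// [X in _ <= _ * X](_ : _ = 2^-1 * expR (- 2^-1 * t))//.
have -> : K * 2 * (2^-1 * expR (- 2^-1 * t)) = K * expR (- 2^-1 * t) by field.
rewrite /f; apply: (@le_trans _ _ (K * expR (2^-1 * t) * expR (- t))).
  by rewrite ler_wpM2r ?expR_ge0// HK// ltW.
rewrite -mulrA -expRD ler_pM2l// ler_expR; lra.
Qed.

End GammaPositive.

(** * Area and maximal functions *)

Section PowERoot.
Variable R : realType.
Implicit Types (x y : \bar R) (r p : R).

Lemma poweR_le x y r : 0 <= r -> (0 <= x)%E -> (x <= y)%E -> (x `^ r <= y `^ r)%E.
Proof.
move=> r0 x0 xy; apply: (gt0_ler_poweR r0) => //; rewrite in_itv/= leey andbT//.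
exact: le_trans xy.
Qed.

Lemma poweR_rootK x p : 0 < p -> (0 <= x)%E -> ((x `^ p) `^ p^-1 = x)%E.
Proof. by move=> p0 x0; rewrite -poweRrM mulfV ?poweRe1// gt_eqF. Qed.

Lemma poweR_scale x y (K r : R) : 0 <= r -> 0 <= K -> (0 <= x)%E -> (0 <= y)%E ->
  (x <= K%:E * y)%E -> (x `^ r <= (K `^ r)%:E * y `^ r)%E.
Proof.
move=> r0 K0 x0 y0 xy; rewrite -poweR_EFin -poweRM//; exact: poweR_le.
Qed.

End PowERoot.

Section Pointwise.
Variables (R : realType) (n : nat).
Local Notation C := R[i].
Local Notation Cn := 'rV[R[i]]_n.
Local Notation normc := (@Normc.normc R).
Local Notation leb := (lebesgueC R n).
Local Notation uball := (@uball R n).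
Local Notation vol := (@vol R n).
Implicit Types (f g : Cn -> C) (z w u : Cn) (p q s r kap gamma alpha : R) (k : nat).

(** The reciprocal of the Lebesgue measure of the ball: the scalar relating [vol] to [leb]. *)
Definition ball_mass : R := (fine (leb uball))^-1.

(** Both [fine] and the inverse are total with default value 0, so [vol] is a genuine normalization
    only if the ball has finite nonzero measure. A cube bounds it from above, a Bergman ball around
    0 from below. *)
Lemma ball_mass_gt0 : 0 < ball_mass.
Proof.
rewrite invr_gt0 fine_gt0// lebesgueC_uball_fin andbT.
have k0 : (0 : R) < 2^-1 by lra. have k1 : (2^-1 : R) < 1 by lra.
have [K K0 HK] := volume_qb_ge n k0 k1.
have B0 := @uball0 R n.
apply: (@lt_le_trans _ _ (leb (qb 2^-1 0))).
  by apply: lt_le_trans (HK 0 B0); rewrite lte_fin mulr_gt0// exprn_gt0// defect_gt0.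
apply: le_measure; rewrite ?inE; [exact: measurable_qb|exact: measurable_uball|].
by move=> w /qb_uball.
Qed.

Lemma integral_vol (D : set Cn) (F : Cn -> \bar R) : measurable D -> measurable_fun D F ->
  (forall z, D z -> 0 <= F z)%E ->
  (\int[vol]_(z in D) F z = ball_mass%:E * \int[leb]_(z in D) F z)%E.
Proof. by move=> mD mF F0; rewrite ge0_integral_mscale. Qed.

Lemma integral_vol_bfun (D : set Cn) (F : Cn -> R) g q s (c : R) : measurable D -> D `<=` uball ->
  holomorphic_on_ball g -> 0 < q -> 0 <= c ->
  (forall z, D z -> F z = c * (normc (g z) `^ q * defect z `^ s)) ->
  (\int[vol]_(z in D) (F z)%:E =
   (ball_mass * c)%:E * \int[leb]_z (bfun g q s z * \1_D z)%:E)%E.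
Proof.
move=> mD DB hg q0 c0 HF.
have E : (\int[vol]_(z in D) (F z)%:E = \int[vol]_(z in D) (c * bfun g q s z)%:E)%E.
  by apply: eq_integral => z; rewrite inE => Dz; rewrite HF// bfunE//; exact: DB.
have mb := measurable_bfun s hg q0.
rewrite E integral_vol//; last 2 first.
- apply/measurable_EFinP; apply: measurable_funTS; exact: measurable_funM.
- by move=> z _; rewrite lee_fin mulr_ge0// bfun_ge0.
rewrite EFinM -muleA integral_indicM//; congr (_ * _)%E.
rewrite -ge0_integralZl_EFin//.
- by apply: eq_integral => z _; rewrite -EFinM -mulrA.
- by move=> z _; rewrite lee_fin mulr_ge0// bfun_ge0.
- apply/measurable_EFinP; apply: measurable_funM => //; exact: measurable_indic.
Qed.

Lemma calpha_gt0 alpha : 0 < calpha n alpha.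
Proof.
rewrite /calpha; case: ifPn => //; rewrite -ltNge => a1.
have n0 : (0 : R) <= n%:R by [].
rewrite divr_gt0 ?mulr_gt0 ?Gamma_gt0 ?ltr0n ?fact_gt0//; lra.
Qed.

Lemma weighted_powR k f w q : uball w -> 0 < q ->
  weighted_radial k f w `^ q = normc (radial_iter k f w) `^ q * defect w `^ (k%:R * q).
Proof.
move=> wB q0; have dw := defect_gt0 wB.
rewrite /weighted_radial powRM ?exprn_ge0 ?normc_ge0 ?(ltW dw)// mulrC.
by rewrite -powR_mulrn ?(ltW dw)// -powRrM.
Qed.

Lemma weighted_ge0 k f w : uball w -> 0 <= weighted_radial k f w.
Proof. by move=> /defect_gt0 /ltW dw; rewrite mulr_ge0 ?normc_ge0// exprn_ge0. Qed.

Lemma powR_defectD s r w : uball w -> defect w `^ (s + r) = defect w `^ s * defect w `^ r.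
Proof. by move=> /defect_gt0 dw; rewrite powRD// (gt_eqF dw) implybT. Qed.

Lemma area_fun_ball_avg q gamma k f z : 0 < gamma -> 0 < q -> holomorphic_on_ball f -> uball z ->
  area_fun q gamma k f z =
  ((ball_mass%:E * ball_avg (bergman_kappa gamma) (radial_iter k f) q (k%:R * q) z) `^ q^-1)%E.
Proof.
move=> g0 q0 hf zB; rewrite /area_fun bergman_ball_qb//.
rewrite (@integral_vol_bfun _ _ (radial_iter k f) q (k%:R * q - n.+1%:R) 1)//.
- by rewrite mulr1.
- exact: measurable_qb.
- by move=> w /qb_uball.
- exact: hol_radial_iter.
move=> w /qb_uball wB; rewrite weighted_powR// powR_defectD// mul1r -mulrA; congr (_ * (_ * _)).
by rewrite /tau_density powRN powR_mulrn// ltW// defect_gt0.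
Qed.

Definition mean_num alpha kap q k f w : \bar R :=
  \int[leb]_u (bfun (radial_iter k f) q (k%:R * q + alpha) u * \1_(qb kap w) u)%:E.

Lemma mean_num_ge0 alpha kap q k f w : (0 <= mean_num alpha kap q k f w)%E.
Proof. by apply: integral_ge0 => u _; rewrite lee_fin mulr_ge0// bfun_ge0. Qed.

Lemma maximal_numerator alpha gamma q k f w : 0 < gamma -> 0 < q -> holomorphic_on_ball f ->
  uball w ->
  (\int[vol]_(u in bergman_ball w gamma) (weighted_radial k f u `^ q * valpha_density alpha u)%:E =
   (ball_mass * calpha n alpha)%:E * mean_num alpha (bergman_kappa gamma) q k f w)%E.
Proof.
move=> g0 q0 hf wB; rewrite bergman_ball_qb//.
apply: integral_vol_bfun => //.
- exact: measurable_qb.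
- by move=> u /qb_uball.
- exact: hol_radial_iter.
- by rewrite ltW// calpha_gt0.
by move=> u /qb_uball uB; rewrite weighted_powR// powR_defectD// /valpha_density; ring.
Qed.

(** The volume is exhibited as a positive real [v], which turns the division of extended reals in
    the maximal function into an ordinary one. *)
Lemma valpha_bounds alpha gamma : 0 < gamma -> exists2 V : R, 0 < V &
  forall w, uball w -> exists2 v : R, 0 < v <= V * defect w `^ (alpha + n.+1%:R) &
    valpha alpha (bergman_ball w gamma) = v%:E.
Proof.
move=> g0; pose kap := bergman_kappa gamma.
have k0 : 0 < kap := bergman_kappa_gt0 gamma; have k1 : kap < 1 := bergman_kappa_lt1 g0.
have [V1 V10 HV1] := volume_qb_le n k0 k1; have [V2 V20 HV2] := volume_qb_ge n k0 k1.
have b0 := ball_mass_gt0; have c0 := calpha_gt0 alpha.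
pose K := (4 / kap) `^ `|alpha|; have K0 : 0 < K by apply: powR_gt0; rewrite divr_gt0.
exists (ball_mass * calpha n alpha * (K * V1)) => [|w wB]; first by rewrite !mulr_gt0.
have dw := defect_gt0 wB; have da := powR_gt0 alpha dw.
pose W := (\int[leb]_u (defect u `^ alpha * \1_(qb kap w) u)%:E)%E.
have mq := @measurable_qb R n kap w.
have mI : measurable_fun setT (fun u : Cn => (\1_(qb kap w) u)%:E : \bar R).
  by apply/measurable_EFinP; exact: measurable_indic.
have mW : measurable_fun setT (fun u : Cn => (defect u `^ alpha * \1_(qb kap w) u)%:E).
  apply/measurable_EFinP; apply: measurable_funM; last exact: measurable_indic.
  exact: measurable_defect_powR.
have W0 u : (0 <= (defect u `^ alpha * \1_(qb kap w) u)%:E)%E by rewrite lee_fin mulr_ge0// powR_ge0.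
have vE : valpha alpha (bergman_ball w gamma) = ((ball_mass * calpha n alpha)%:E * W)%E.
  rewrite /valpha bergman_ball_qb// integral_vol//; last 2 first.
  - apply/measurable_EFinP; apply: measurable_funTS; apply: measurable_funM => //.
    exact: measurable_defect_powR.
  - by move=> u _; rewrite lee_fin mulr_ge0 ?powR_ge0// ltW.
  rewrite EFinM -muleA integral_indicM//; congr (_ * _)%E.
  rewrite -ge0_integralZl_EFin ?(ltW c0)//.
  by apply: eq_integral => u _; rewrite -EFinM mulrA.
have IE : (\int[leb]_u (\1_(qb kap w) u)%:E = leb (qb kap w))%E by rewrite integral_indic// setIT.
have H1 : (W <= (K * defect w `^ alpha * (V1 * defect w ^+ n.+1))%:E)%E.
  apply: (@le_trans _ _ ((K * defect w `^ alpha)%:E * leb (qb kap w))%E).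
    rewrite -IE; apply: le_integral_scale => //; first by rewrite mulr_ge0// ltW.
    move=> u; rewrite -EFinM lee_fin.
    have [H|H] := pselect (qb kap w u); last by rewrite (indic_notin _ H) !mulr0.
    rewrite (indic_in _ H) !mulr1; exact: proj2 (qb_powR alpha k0 k1 wB H).
  rewrite [leRHS]EFinM; apply: lee_wpmul2l; last exact: HV1.
  by rewrite lee_fin mulr_ge0// ltW.
have H2 : (leb (qb kap w) <= (K / defect w `^ alpha)%:E * W)%E.
  rewrite -IE; apply: le_integral_scale => //; first by rewrite divr_ge0// ltW.
  move=> u; rewrite -EFinM lee_fin.
  have [H|H] := pselect (qb kap w u); last by rewrite (indic_notin _ H) !mulr0.
  rewrite (indic_in _ H) !mulr1 mulrAC ler_pdivlMr// mul1r.
  exact: proj1 (qb_powR alpha k0 k1 wB H).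
have lpos : (0 < leb (qb kap w))%E.
  by apply: lt_le_trans (HV2 w wB); rewrite lte_fin mulr_gt0// exprn_gt0.
have : (0 <= W)%E by exact: integral_ge0.
move: H1 H2 vE; case: W => [r| |]// H1 H2 vE r0.
rewrite lee_fin in H1; rewrite lee_fin in r0.
have rp : 0 < r.
  rewrite lt_neqAle r0 andbT eq_sym; apply/negP => /eqP rE.
  by move: H2; rewrite rE mule0 leNgt lpos.
exists (ball_mass * calpha n alpha * r); last by rewrite vE EFinM.
apply/andP; split; first by rewrite !mulr_gt0.
rewrite -[leRHS]mulrA ler_pM2l; last exact: mulr_gt0.
apply: (le_trans H1); rewrite powR_defectD// powR_mulrn ?(ltW dw)//.
by apply: eq_imp_le; ring.
Qed.

Lemma qb_self kap z : 0 < kap -> kap < 1 -> uball z -> qb kap z z.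
Proof.
move=> k0 k1 zB; have dz := defect_gt0 zB; split => //.
rewrite hdotzz -[1]/(real_complex R 1) -rmorphB normc_real -/(defect z) gtr0_norm// expr2.
by rewrite -[ltRHS]mul1r ltr_pM2r// mulr_gt0.
Qed.

(* q-th power of the averages whose supremum is the maximal function. *)
Definition mean_pow alpha gamma q k f w : \bar R :=
  (\int[vol]_(u in bergman_ball w gamma)
        (weighted_radial k f u `^ q * valpha_density alpha u)%:E
      / valpha alpha (bergman_ball w gamma))%E.

Lemma inve_EFin (v : R) : 0 < v -> ((v%:E)^-1)%E = (v^-1)%:E.
Proof. by move=> v0; rewrite inver gt_eqF. Qed.

Lemma mean_pow_ge0 alpha gamma q k f w : (0 < gamma) -> uball w ->
  (0 <= mean_pow alpha gamma q k f w)%E.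
Proof.
move=> g0 wB; have [V V0 HV] := valpha_bounds alpha g0; have [v /andP[v0 _] vE] := HV w wB.
rewrite /mean_pow vE inve_EFin// mule_ge0 ?lee_fin ?invr_ge0 ?(ltW v0)//.
by apply: integral_ge0 => u _; rewrite lee_fin mulr_ge0 ?mulr_ge0 ?powR_ge0// ltW// calpha_gt0.
Qed.

(** On the ball around [z] the invariant density and the normalized one of dv_alpha agree up to
    constants, because powers of the defect vary by bounded factors there. Only the upper bound of
    [valpha_bounds] enters the comparison of constants. *)
Lemma area_le_mean alpha gamma q k : 0 < gamma -> 0 < q -> exists2 K : R, 0 < K &
  forall f z, holomorphic_on_ball f -> uball z ->
  (ball_mass%:E * ball_avg (bergman_kappa gamma) (radial_iter k f) q (k%:R * q) z <=
   K%:E * mean_pow alpha gamma q k f z)%E.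
Proof.
move=> g0 q0; pose kap := bergman_kappa gamma.
have k0 : 0 < kap := bergman_kappa_gt0 gamma; have k1 : kap < 1 := bergman_kappa_lt1 g0.
have [V V0 HV] := valpha_bounds alpha g0.
have b0 := ball_mass_gt0; have c0 := calpha_gt0 alpha.
pose a := alpha + n.+1%:R.
pose c := (4 / kap) `^ `|a|; have cp : 0 < c by apply: powR_gt0; rewrite divr_gt0.
exists (c * V / calpha n alpha) => [|f z hf zB]; first by rewrite divr_gt0// mulr_gt0.
have [v /andP[v0 vV] vE] := HV z zB; have dz := defect_gt0 zB.
have hg := hol_radial_iter k hf.
have da : 0 < defect z `^ a by exact: powR_gt0.
rewrite /mean_pow maximal_numerator// vE inve_EFin// -/kap.
have H : (ball_avg kap (radial_iter k f) q (k%:R * q) z <=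
    (c / defect z `^ a)%:E * mean_num alpha kap q k f z)%E.
  have mI : measurable_fun setT (\1_(qb kap z) : Cn -> R).
    by apply: measurable_indic; exact: measurable_qb.
  apply: le_integral_scale.
  - by rewrite divr_ge0// ltW.
  - apply/measurable_EFinP; apply: measurable_funM => //; exact: measurable_bfun.
  - apply/measurable_EFinP; apply: measurable_funM => //; exact: measurable_bfun.
  - by move=> u; rewrite lee_fin mulr_ge0// bfun_ge0.
  - by move=> u; rewrite lee_fin mulr_ge0// bfun_ge0.
  move=> u; rewrite -EFinM lee_fin.
  have [Hu|Hu] := pselect (qb kap z u); last by rewrite (indic_notin _ Hu) !mulr0.
  have uB := qb_uball Hu; have du := defect_gt0 uB.
  rewrite (indic_in _ Hu) !mulr1 (bfunE _ _ _ uB) (bfunE _ _ _ uB) mulrCA.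
  apply: ler_wpM2l; first exact: powR_ge0.
  have -> : k%:R * q + alpha = (k%:R * q - n.+1%:R) + a by rewrite /a; ring.
  rewrite (powR_defectD _ a uB) [leRHS]mulrCA -[leLHS]mulr1; apply: ler_wpM2l; first exact: powR_ge0.
  rewrite mulrAC (ler_pdivlMr _ _ da) mul1r; exact: proj1 (qb_powR a k0 k1 zB Hu).
have b0' : (0 <= ball_mass%:E :> \bar R)%E by rewrite lee_fin ltW.
apply: (le_trans (lee_wpmul2l b0' H)).
have Y0 := mean_num_ge0 alpha kap q k f z.
move: (mean_num _ _ _ _ _ _) Y0 => Y Y0.
rewrite [leLHS]muleA -EFinM [X in (_ <= _ * X)%E]muleAC -EFinM [leRHS]muleA -EFinM.
apply: lee_wpmul2r => //; rewrite lee_fin.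
have -> : c * V / calpha n alpha * (ball_mass * calpha n alpha / v) =
    ball_mass * c * (V / v) by field; rewrite !gt_eqF.
rewrite [leLHS]mulrA; apply: ler_wpM2l; first by rewrite mulr_ge0// ltW.
by rewrite ler_pdivlMr// mulrC ler_pdivrMr.
Qed.

Lemma area_le_maximal alpha gamma q k : 0 < gamma -> 0 < q -> exists2 K : R, 0 < K &
  forall f z, holomorphic_on_ball f -> uball z ->
  (area_fun q gamma k f z <= K%:E * maximal_fun alpha q gamma k f z)%E.
Proof.
move=> g0 q0; have [K K0 HK] := area_le_mean alpha k g0 q0.
have q1 : 0 <= q^-1 by rewrite invr_ge0 ltW.
exists (K `^ q^-1) => [|f z hf zB]; first exact: powR_gt0.
rewrite area_fun_ball_avg//.
apply: le_trans (poweR_scale q1 (ltW K0) _ (mean_pow_ge0 _ _ _ _ g0 zB) (HK f z hf zB)) _.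
  by rewrite mule_ge0 ?ball_avg_ge0// lee_fin ltW// ball_mass_gt0.
apply: lee_wpmul2l; first by rewrite lee_fin powR_ge0.
apply: ereal_sup_ubound; exists z => //; split => //.
by rewrite bergman_ball_qb//; apply: qb_self; rewrite ?bergman_kappa_gt0 ?bergman_kappa_lt1.
Qed.

Lemma weighted_le_area gamma q k : 0 < gamma -> 0 < q -> exists2 K : R, 0 < K &
  forall f z, holomorphic_on_ball f -> uball z ->
  ((weighted_radial k f z)%:E <= K%:E * area_fun q gamma k f z)%E.
Proof.
move=> g0 q0; have b0 := ball_mass_gt0.
have [K K0 HK] := submean_qb n (k%:R * q) (bergman_kappa_gt0 gamma) (bergman_kappa_lt1 g0) q0.
have q1 : 0 <= q^-1 by rewrite invr_ge0 ltW.
have K1 : 0 < K / ball_mass by rewrite divr_gt0.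
exists ((K / ball_mass) `^ q^-1) => [|f z hf zB]; first exact: powR_gt0.
have H := HK _ z (hol_radial_iter k hf) zB.
rewrite -weighted_powR// in H; rewrite area_fun_ball_avg//.
rewrite -[leLHS](@poweR_rootK _ _ q)// ?lee_fin ?weighted_ge0// poweR_EFin.
apply: poweR_scale => //; first exact: ltW.
- by rewrite lee_fin powR_ge0.
- by rewrite mule_ge0 ?ball_avg_ge0// lee_fin ltW.
by rewrite muleA -EFinM divfK// gt_eqF.
Qed.

End Pointwise.

Lemma le_integral_scaleD d (T : measurableType d) (R : realType)
    (m : {measure set T -> \bar R}) (D : set T) (f h : T -> \bar R) (K : R) :
  measurable D -> 0 <= K ->
  measurable_fun D f -> measurable_fun D h ->
  (forall x, D x -> 0 <= f x)%E -> (forall x, D x -> 0 <= h x)%E ->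
  (forall x, D x -> f x <= K%:E * h x)%E ->
  (\int[m]_(x in D) f x <= K%:E * \int[m]_(x in D) h x)%E.
Proof.
move=> mD K0 mf mh f0 h0 fh; rewrite -ge0_integralZl_EFin//.
by apply: ge0_le_integral => //; exact: measurable_funeM.
Qed.

Section LpComparison.
Variables (R : realType) (n : nat).
Local Notation C := R[i].
Local Notation Cn := 'rV[R[i]]_n.
Local Notation normc := (@Normc.normc R).
Local Notation leb := (lebesgueC R n).
Local Notation uball := (@uball R n).
Local Notation vol := (@vol R n).
Implicit Types (f g : Cn -> C) (z w u : Cn) (p q s r kap gamma alpha : R) (k : nat).

(** For p < q Hoelder's inequality cannot pass from an average of order [q] to one of order [p]. A
    uniform bound does: |R^k f| with its weight is at most [B] on an enlarged ball, so every
    normalized average over a ball containing [z] is at most [B], and [B ^ p] is itself an average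
    of order [p]. *)
Lemma maximal_pow_le_avg alpha gamma p q k : 0 < gamma -> 0 < p -> 0 < q ->
  exists2 kap : R, 0 < kap < 1 & exists2 K : R, 0 < K &
  forall f z, holomorphic_on_ball f -> uball z ->
  (maximal_fun alpha q gamma k f z `^ p <=
   K%:E * ball_avg kap (radial_iter k f) p (k%:R * p) z)%E.
Proof.
move=> g0 p0 q0; pose kap := bergman_kappa gamma.
have k0 : 0 < kap := bergman_kappa_gt0 gamma; have k1 : kap < 1 := bergman_kappa_lt1 g0.
have j0 := kappa_trans_gt0 k0; have j1 := kappa_trans_lt1 k0 k1.
(* One enlargement recentres the balls containing [z] at [z]; the other is the one in [sup_qb]. *)
exists (kappa_trans (kappa_trans kap)).
  by rewrite kappa_trans_gt0// kappa_trans_lt1.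
pose s := k%:R * p; have [K1 K10 HK1] := sup_qb n s j0 j1 p0.
pose c := (4 / kappa_trans kap) `^ `|s|.
have cp : 0 < c by apply: powR_gt0; rewrite divr_gt0.
have [V V0 HV] := valpha_bounds n alpha g0.
exists (c * K1) => [|f z hf zB]; first exact: mulr_gt0.
have hg := hol_radial_iter k hf.
have H0 := ball_avg_ge0 (kappa_trans (kappa_trans kap)) (radial_iter k f) p s z.
have HK w := HK1 (radial_iter k f) z w hg zB.
rewrite -/s; move: H0 HK.
case: (ball_avg (kappa_trans (kappa_trans kap)) (radial_iter k f) p s z) => [h| |]// h0 HK; last first.
  by rewrite gt0_muley ?leey// lte_fin mulr_gt0.
rewrite lee_fin in h0.
have ch0 : 0 <= c * K1 * h by rewrite !mulr_ge0// ltW.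
pose B := (c * K1 * h) `^ p^-1; have B0 : 0 <= B by exact: powR_ge0.
have HB u : qb (kappa_trans kap) z u -> weighted_radial k f u <= B.
  move=> Hu; have uB := qb_uball Hu.
  apply: powR_le_root => //; first exact: weighted_ge0.
  rewrite weighted_powR//; have := HK u Hu; rewrite -EFinM lee_fin => H.
  rewrite -/s -mulrA; apply: le_trans (_ : c * (normc (radial_iter k f u) `^ p * defect z `^ s) <= _).
    rewrite mulrCA ler_wpM2l ?powR_ge0//.
    exact: proj2 (qb_powR s j0 j1 zB Hu).
  by rewrite ler_pM2l.
suff HM : (maximal_fun alpha q gamma k f z <= B%:E)%E.
  have M0 : (0 <= maximal_fun alpha q gamma k f z)%E.
    apply: (@le_trans _ _ (mean_pow alpha gamma q k f z `^ q^-1)%E); first exact: poweR_ge0.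
    apply: ereal_sup_ubound; exists z => //; split => //.
    by rewrite bergman_ball_qb//; exact: qb_self.
  apply: le_trans (poweR_le (ltW p0) M0 HM) _.
  by rewrite poweR_EFin /B powR_root// EFinM.
apply: ge_ereal_sup => _ [w [wB zw] <-].
have [v /andP[v0 _] vE] := HV w wB.
have zw' : qb kap w z by rewrite -/kap -bergman_ball_qb.
have dens0 u : uball u -> 0 <= valpha_density alpha u.
  by move=> uB; rewrite mulr_ge0 ?powR_ge0// ltW// calpha_gt0.
have mdens : measurable_fun setT (fun u : Cn => valpha_density alpha u).
  by apply: measurable_funM => //; exact: measurable_defect_powR.
have mB : measurable (bergman_ball w gamma) by rewrite bergman_ball_qb//; exact: measurable_qb.
rewrite -[leRHS](@poweR_rootK _ _ q)// [(B%:E `^ q)%E]poweR_EFin.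
apply: poweR_le; [by rewrite invr_ge0 ltW|exact: (mean_pow_ge0 _ _ _ _ g0 wB)|].
rewrite vE inve_EFin// lee_pdivrMr// -EFinM.
rewrite EFinM -vE /valpha; apply: le_integral_scaleD => //.
- exact: powR_ge0.
- apply/measurable_EFinP.
  apply: (@eq_measurable_fun _ _ _ _ _ (fun u => bfun (radial_iter k f) q (k%:R * q) u * valpha_density alpha u)).
    by move=> u; rewrite inE => -[uB _]; rewrite weighted_powR// bfunE.
  by apply: measurable_funTS; apply: measurable_funM => //; exact: measurable_bfun.
- by apply: measurable_funTS; exact/measurable_EFinP.
- by move=> u [uB _]; rewrite lee_fin mulr_ge0 ?powR_ge0// dens0.
- by move=> u [uB _]; rewrite lee_fin dens0.
move=> u; rewrite bergman_ball_qb// => Hu; have uB := qb_uball Hu.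
rewrite -EFinM lee_fin ler_wpM2r ?dens0//; apply: powR_le; [exact: ltW|exact: weighted_ge0|].
by apply: HB; exact: (qb_trans k0 k1 wB zw' Hu).
Qed.

Lemma mean_le_maximal alpha gamma q k f w z : uball w -> bergman_ball w gamma z ->
  (mean_pow alpha gamma q k f w `^ q^-1 <= maximal_fun alpha q gamma k f z)%E.
Proof. by move=> wB wz; apply: ereal_sup_ubound; exists w. Qed.

Lemma maximal_fun_ge0 alpha gamma q k f z : 0 < gamma -> uball z ->
  (0 <= maximal_fun alpha q gamma k f z)%E.
Proof.
move=> g0 zB; apply: (@le_trans _ _ (mean_pow alpha gamma q k f z `^ q^-1)%E); first exact: poweR_ge0.
apply: ereal_sup_ubound; exists z => //; split => //.
by rewrite bergman_ball_qb//; apply: qb_self; rewrite ?bergman_kappa_gt0 ?bergman_kappa_lt1.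
Qed.

Lemma measurable_area gamma q k f : 0 < gamma -> 0 < q -> holomorphic_on_ball f ->
  measurable_fun uball (area_fun q gamma k f).
Proof.
move=> g0 q0 hf.
apply: (@eq_measurable_fun _ _ _ _ _ (fun z =>
  (((ball_mass R n)%:E * ball_avg (bergman_kappa gamma) (radial_iter k f) q (k%:R * q) z) `^ q^-1)%E)).
  by move=> z; rewrite inE => zB; rewrite area_fun_ball_avg.
apply: measurable_funTS; apply: (measurableT_comp (measurable_poweR _)).
by apply: measurable_funeM; apply: measurable_ball_avg => //; exact: hol_radial_iter.
Qed.

(** A supremum over uncountably many balls, measurable because its superlevel sets are open: a ball
    whose average exceeds [x] contains, with [z], all nearby points. *)
Lemma measurable_maximal alpha gamma q k f : 0 < gamma ->
  measurable_fun uball (maximal_fun alpha q gamma k f).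
Proof.
move=> g0; apply: lsc_emeasurable; first exact: open_uball.
move=> x; apply: open_enorm => z [zB xz].
have [_ [w [wB wz] <-] xv] := ereal_sup_gt xz.
have oq : open (qb (bergman_kappa gamma) w) by apply: open_qb => //; exact: bergman_kappa_gt0.
have zw : qb (bergman_kappa gamma) w z by rewrite -bergman_ball_qb.
have /nbhs_enorm[r r0 Hr] : nbhs z (qb (bergman_kappa gamma) w) by exact: open_nbhs_nbhs.
exists r; first exact: r0.
move=> y /Hr yw; split; first exact: qb_uball yw.
have yw' : bergman_ball w gamma y by rewrite bergman_ball_qb.
exact: lt_le_trans xv (mean_le_maximal _ _ _ _ wB yw').
Qed.

Lemma measurable_weighted k f : holomorphic_on_ball f ->
  measurable_fun uball (fun z => (weighted_radial k f z)%:E).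
Proof.
move=> hf; apply/measurable_EFinP.
apply: (@eq_measurable_fun _ _ _ _ _ (bfun (radial_iter k f) 1 k%:R)).
  move=> z; rewrite inE => zB; rewrite bfunE// powRr1 ?normc_ge0// powR_mulrn ?ltW ?defect_gt0//.
  by rewrite mulrC.
by apply: measurable_funTS; apply: measurable_bfun => //; exact: hol_radial_iter.
Qed.

(** The p-th power of the norm stripped of the constants [ball_mass] and [calpha], so that
    comparisons are linear until the final root. *)
Definition pmass p alpha (G : Cn -> \bar R) : \bar R :=
  (\int[leb]_(z in uball) (`|G z| `^ p * (defect z `^ alpha)%:E))%E.

Lemma pmass_ge0 p alpha G : (0 <= pmass p alpha G)%E.
Proof. by apply: integral_ge0 => z _; rewrite mule_ge0 ?poweR_ge0// lee_fin powR_ge0. Qed.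

Lemma measurable_pmass p alpha G : measurable_fun uball G ->
  measurable_fun uball (fun z => (`|G z| `^ p * (defect z `^ alpha)%:E)%E).
Proof.
move=> mG; apply: emeasurable_funM.
  apply: (measurableT_comp (measurable_poweR _)); exact: (measurableT_comp (@abse_measurable R _)).
by apply: measurable_funTS; apply/measurable_EFinP; exact: measurable_defect_powR.
Qed.

Lemma Lp_normE p alpha G : measurable_fun uball G ->
  Lp_norm p alpha G = (((ball_mass R n * calpha n alpha)%:E * pmass p alpha G) `^ p^-1)%E.
Proof.
move=> mG; rewrite /Lp_norm; congr (_ `^ _)%E.
have c0 := calpha_gt0 n alpha.
have E : (\int[vol]_(z in uball) (`|G z| `^ p * (valpha_density alpha z)%:E) =
    \int[vol]_(z in uball) ((calpha n alpha)%:E * (`|G z| `^ p * (defect z `^ alpha)%:E)))%E.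
  by apply: eq_integral => z _; rewrite /valpha_density EFinM muleCA.
rewrite E integral_vol//; last 3 first.
- exact: measurable_uball.
- by apply: measurable_funeM; exact: measurable_pmass.
- by move=> z _; rewrite !mule_ge0 ?poweR_ge0 ?lee_fin ?powR_ge0// ltW.
rewrite ge0_integralZl_EFin//; last 4 first.
- exact: measurable_uball.
- by move=> z _; rewrite mule_ge0 ?poweR_ge0 ?lee_fin ?powR_ge0.
- exact: measurable_pmass.
- exact: ltW.
by rewrite muleA -EFinM.
Qed.

Lemma pmass_le p alpha (K : R) G1 G2 : 0 <= K -> measurable_fun uball G1 -> measurable_fun uball G2 ->
  (forall z, uball z -> `|G1 z| `^ p <= K%:E * `|G2 z| `^ p)%E ->
  (pmass p alpha G1 <= K%:E * pmass p alpha G2)%E.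
Proof.
move=> K0 m1 m2 H; apply: le_integral_scaleD => //.
- exact: measurable_uball.
- exact: measurable_pmass.
- exact: measurable_pmass.
- by move=> z _; rewrite mule_ge0 ?poweR_ge0 ?lee_fin ?powR_ge0.
- by move=> z _; rewrite mule_ge0 ?poweR_ge0 ?lee_fin ?powR_ge0.
by move=> z zB; rewrite muleA; apply: lee_wpmul2r; rewrite ?lee_fin ?powR_ge0//; exact: H.
Qed.

Definition energy p alpha k f : \bar R :=
  (\int[leb]_z (bfun (radial_iter k f) p (k%:R * p + alpha) z)%:E)%E.

Lemma energy_ge0 p alpha k f : (0 <= energy p alpha k f)%E.
Proof. by apply: integral_ge0 => z _; rewrite lee_fin bfun_ge0. Qed.

Lemma pmass_weighted p alpha k f : 0 < p ->
  pmass p alpha (fun z => (weighted_radial k f z)%:E) = energy p alpha k f.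
Proof.
move=> p0; rewrite /pmass.
have -> : (\int[leb]_(z in uball) (`|(weighted_radial k f z)%:E| `^ p * (defect z `^ alpha)%:E) =
   \int[leb]_(z in uball) (bfun (radial_iter k f) p (k%:R * p + alpha) z)%:E)%E.
  apply: eq_integral => z; rewrite inE => zB.
  rewrite gee0_abs ?lee_fin ?weighted_ge0// poweR_EFin -EFinM weighted_powR// bfunE//.
  by rewrite powR_defectD// mulrA.
rewrite integral_indicM; last exact: measurable_uball.
apply: eq_integral => z _; congr EFin.
have [zB|zB] := pselect (uball z); last by rewrite bfun_out// mul0r.
by rewrite indic_in// mulr1.
Qed.

(** A cycle of one-sided inequalities: any two of the three quantities are then comparable, and
    finiteness passes between them. *)
Lemma three_comparisons alpha gamma p q k : 0 < gamma -> 0 < p -> 0 < q ->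
  exists2 K : R, 0 < K & forall f, holomorphic_on_ball f ->
  [/\ (pmass p alpha (area_fun q gamma k f) <=
         K%:E * pmass p alpha (maximal_fun alpha q gamma k f))%E,
      (pmass p alpha (maximal_fun alpha q gamma k f) <= K%:E * energy p alpha k f)%E &
      (energy p alpha k f <= K%:E * pmass p alpha (area_fun q gamma k f))%E].
Proof.
move=> g0 p0 q0.
have [Ka Ka0 HKa] := area_le_maximal n alpha k g0 q0.
have [kap /andP[k0 k1] [Kb Kb0 HKb]] := maximal_pow_le_avg alpha k g0 p0 q0.
have [Kc Kc0 HKc] := weighted_le_area n k g0 q0.
have [Kd Kd0 HKd] := integral_ball_avg n alpha (k%:R * p) k0 k1 p0.
have A1 : 0 < Ka `^ p by exact: powR_gt0. have A2 : 0 < Kc `^ p by exact: powR_gt0.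
have A3 : 0 < Kb * Kd by exact: mulr_gt0.
exists (Ka `^ p + Kb * Kd + Kc `^ p) => [|f hf]; first by rewrite !addr_gt0.
have mA := measurable_area k g0 q0 hf; have mM := @measurable_maximal alpha gamma q k f g0.
have big (x K : R) (y : \bar R) : (0 <= y)%E -> K <= x -> (K%:E * y <= x%:E * y)%E.
  by move=> y0 Kx; apply: lee_wpmul2r.
have M0 z : uball z -> (0 <= maximal_fun alpha q gamma k f z)%E by exact: maximal_fun_ge0.
have a0 z : (0 <= area_fun q gamma k f z)%E by exact: poweR_ge0.
have P0 := ltW p0.
split.
- apply: (@le_trans _ _ ((Ka `^ p)%:E * pmass p alpha (maximal_fun alpha q gamma k f))%E); last first.
    by apply: big; [exact: pmass_ge0|lra].
  apply: pmass_le => //; first exact: ltW.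
  move=> z zB; rewrite !gee0_abs ?M0//; apply: poweR_scale => //; [exact: ltW|exact: M0|exact: HKa].
- apply: (@le_trans _ _ ((Kb * Kd)%:E * energy p alpha k f)%E); last first.
    by apply: big; [exact: energy_ge0|lra].
  rewrite EFinM -muleA; apply: (@le_trans _ _ (Kb%:E * \int[leb]_z ((defect z `^ alpha * \1_uball z)%:E *
      ball_avg kap (radial_iter k f) p (k%:R * p) z))%E); last first.
    by apply: lee_wpmul2l; [rewrite lee_fin ltW|exact: HKd (hol_radial_iter k hf)].
  have -> : (\int[leb]_z ((defect z `^ alpha * \1_uball z)%:E * ball_avg kap (radial_iter k f) p (k%:R * p) z) =
    \int[leb]_(z in uball) ((defect z `^ alpha)%:E * ball_avg kap (radial_iter k f) p (k%:R * p) z))%E.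
    rewrite [RHS]integral_mkcond; apply: eq_integral => z _; rewrite patchE indicE.
    by case: ifP => _; rewrite ?mulr1 ?mulr0 ?mul0e.
  apply: le_integral_scaleD.
  + exact: measurable_uball.
  + exact: ltW.
  + exact: measurable_pmass.
  + apply: measurable_funTS; apply: emeasurable_funM.
      by apply/measurable_EFinP; exact: measurable_defect_powR.
    by apply: measurable_ball_avg => //; exact: hol_radial_iter.
  + by move=> z _; rewrite mule_ge0 ?poweR_ge0 ?lee_fin ?powR_ge0.
  + by move=> z _; rewrite mule_ge0 ?ball_avg_ge0 ?lee_fin ?powR_ge0.
  move=> z zB; rewrite gee0_abs ?M0// muleC muleCA; apply: lee_wpmul2l; first by rewrite lee_fin powR_ge0.
  exact: HKb.
- apply: (@le_trans _ _ ((Kc `^ p)%:E * pmass p alpha (area_fun q gamma k f))%E); last first.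
    by apply: big; [exact: pmass_ge0|lra].
  rewrite -pmass_weighted//; apply: pmass_le => //; [exact: ltW|exact: measurable_weighted|].
  move=> z zB; rewrite !gee0_abs ?lee_fin ?weighted_ge0//; apply: poweR_scale => //; [exact: ltW| |exact: HKc].
  by rewrite lee_fin weighted_ge0.
Qed.

End LpComparison.

(** * Energies of different orders *)

Section EnergyChain.
Variables (R : realType) (n : nat).
Local Notation C := R[i].
Local Notation Cn := 'rV[R[i]]_n.
Local Notation normc := (@Normc.normc R).
Local Notation leb := (lebesgueC R n).
Local Notation uball := (@uball R n).
Local Notation vol := (@vol R n).
Implicit Types (f g : Cn -> C) (z w u : Cn) (p q s r kap gamma alpha : R) (k m d : nat).

Lemma energy_succ_le p alpha k : 0 < p -> exists2 K : R, 0 < K &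
  forall f, holomorphic_on_ball f -> (energy p alpha k.+1 f <= K%:E * energy p alpha k f)%E.
Proof.
move=> p0; pose kap : R := kappa_trans 2^-1.
have k0 : 0 < kap by apply: kappa_trans_gt0; lra.
have k1 : kap < 1 by apply: kappa_trans_lt1; lra.
have [K1 K10 HK1] := radial_avg n (k%:R * p) p0.
have [K2 K20 HK2] := integral_ball_avg n alpha (k%:R * p) k0 k1 p0.
exists (K1 * K2) => [|f hf]; first exact: mulr_gt0.
have hg := hol_radial_iter k hf; have hg' := hol_radial_iter k.+1 hf.
rewrite EFinM -muleA; apply: (@le_trans _ _ (K1%:E * \int[leb]_z ((defect z `^ alpha * \1_uball z)%:E *
      ball_avg kap (radial_iter k f) p (k%:R * p) z))%E); last first.
  by apply: lee_wpmul2l; [rewrite lee_fin ltW|exact: HK2].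
apply: le_integral_scale.
- exact: ltW.
- by apply/measurable_EFinP; exact: measurable_bfun.
- apply: emeasurable_funM; last exact: measurable_ball_avg.
  apply/measurable_EFinP; apply: measurable_funM; first exact: measurable_defect_powR.
  by apply: measurable_indic; exact: measurable_uball.
- by move=> z; rewrite lee_fin bfun_ge0.
- by move=> z; rewrite mule_ge0 ?ball_avg_ge0// lee_fin mulr_ge0// powR_ge0.
move=> z; have [zB|zB] := pselect (uball z); last first.
  by rewrite bfun_out// (indic_notin _ zB) mulr0 mul0e mule0.
rewrite (indic_in _ zB) mulr1 bfunE// muleCA.
have -> : k.+1%:R * p + alpha = (k%:R * p + p) + alpha by rewrite -natr1; ring.
rewrite powR_defectD// mulrA mulrC EFinM; apply: lee_wpmul2l; first by rewrite lee_fin powR_ge0.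
exact: HK1.
Qed.

(** The value at the origin accounts for constants, which [radial] annihilates; it vanishes
    automatically for k > 0. *)
Lemma energy_le_succ p alpha k : 0 < p -> -1 < p * k%:R + alpha -> exists2 K : R, 0 < K &
  forall f, holomorphic_on_ball f -> (energy p alpha k f <=
    K%:E * ((normc (radial_iter k f 0%R) `^ p)%:E + energy p alpha k.+1 f))%E.
Proof.
move=> p0 hk; have b1 : -1 < k%:R * p + alpha by rewrite mulrC.
have [K K0 HK] := hardy n p0 b1; exists K => // f hf.
have := HK _ (hol_radial_iter k hf).
have -> : k%:R * p + alpha + p = k.+1%:R * p + alpha by rewrite -natr1; ring.
by [].
Qed.

Lemma radial_iter_at0 k f : (0 < k)%N -> radial_iter k f 0 = 0.
Proof. by case: k => // k _; rewrite /radial_iter /= /radial big1// => j _; rewrite mxE mul0r. Qed.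

Lemma energy_addn_le p alpha m d : 0 < p -> exists2 K : R, 0 < K &
  forall f, holomorphic_on_ball f -> (energy p alpha (m + d) f <= K%:E * energy p alpha m f)%E.
Proof.
move=> p0; elim: d => [|d [K K0 HK]]; first by exists 1 => // f _; rewrite addn0 mul1e.
have [K' K'0 HK'] := energy_succ_le alpha (m + d) p0.
exists (K' * K) => [|f hf]; first exact: mulr_gt0.
rewrite addnS; apply: (le_trans (HK' f hf)); rewrite EFinM -muleA.
by apply: lee_wpmul2l; [rewrite lee_fin ltW|exact: HK].
Qed.

Lemma admissible_addn p alpha m d : 0 < p -> -1 < p * m%:R + alpha -> -1 < p * (m + d)%:R + alpha.
Proof.
move=> p0 hm; apply: (lt_le_trans hm); rewrite lerD2r ler_pM2l// ler_nat; exact: leq_addr.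
Qed.

Lemma energy_fin p alpha m d f : 0 < p -> -1 < p * m%:R + alpha -> holomorphic_on_ball f ->
  (energy p alpha (m + d) f < +oo)%E -> (energy p alpha m f < +oo)%E.
Proof.
move=> p0 hm hf; elim: d => [|d IH]; first by rewrite addn0.
rewrite addnS => H; apply: IH.
have [K K0 HK] := energy_le_succ p0 (admissible_addn d p0 hm).
apply: (le_lt_trans (HK f hf)); apply: lte_mul_pinfty; rewrite ?lee_fin ?(ltW K0)//.
by apply: lte_add_pinfty => //; rewrite ltry.
Qed.

Lemma energy_fin_iff p alpha m k f : 0 < p -> -1 < p * m%:R + alpha -> -1 < p * k%:R + alpha ->
  holomorphic_on_ball f -> (energy p alpha m f < +oo)%E -> (energy p alpha k f < +oo)%E.
Proof.
move=> p0 hm hk hf; have [mk|/ltnW km] := leqP m k.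
  rewrite -(subnKC mk); have [K K0 HK] := energy_addn_le alpha m (k - m) p0.
  move=> H; apply: (le_lt_trans (HK f hf)).
  by apply: lte_mul_pinfty; rewrite ?lee_fin ?(ltW K0).
by rewrite -(subnKC km); exact: energy_fin.
Qed.

Lemma energy_le_addn p alpha m d : 0 < p -> -1 < p * m%:R + alpha -> exists2 K : R, 0 < K &
  forall f, holomorphic_on_ball f -> f 0 = 0 ->
  (energy p alpha m f <= K%:E * energy p alpha (m + d) f)%E.
Proof.
move=> p0 hm; elim: d => [|d [K K0 HK]]; first by exists 1 => // f _ _; rewrite addn0 mul1e.
have [K' K'0 HK'] := energy_le_succ p0 (admissible_addn d p0 hm).
exists (K * K') => [|f hf f0]; first exact: mulr_gt0.
apply: (le_trans (HK f hf f0)); rewrite EFinM -muleA; apply: lee_wpmul2l; first by rewrite lee_fin ltW.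
apply: (le_trans (HK' f hf)); rewrite addnS.
have -> : radial_iter (m + d) f 0 = 0.
  by case: (m + d)%N => [|j]; [exact: f0|exact: radial_iter_at0].
by rewrite Normc.normc0 powR0 ?gt_eqF// add0e.
Qed.

Lemma derive_subC f (c : C) v z : 'D_v (fun x => f x - c) z = 'D_v f z.
Proof.
rewrite /derive; suff -> : (fun h : C => h^-1 *: ((fun x => f x - c) (h *: v + z) - (f z - c))) =
  (fun h : C => h^-1 *: (f (h *: v + z) - f z)) by [].
by apply/funext => h; rewrite opprB addrA subrK.
Qed.

Lemma radial_subC f (c : C) : radial (fun z => f z - c) = radial f.
Proof.
apply/funext => z; apply: eq_bigr => j _.
exact: (congr1 ( *%R (z 0 j)) (derive_subC f c (delta_mx 0 j) z)).
Qed.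

Lemma radial_iter_subC k f (c : C) : (0 < k)%N ->
  radial_iter k (fun z => f z - c) = radial_iter k f.
Proof.
case: k => [|k]; first by rewrite ltnn.
move=> _; rewrite /radial_iter; elim: k => [|k IH]; first exact: radial_subC.
exact: (congr1 (@radial R n) IH).
Qed.

Lemma hol_subC f (c : C) : holomorphic_on_ball f -> holomorphic_on_ball (fun z => f z - c).
Proof.
by move=> hf z zB; apply: differentiableB; [exact: hf|exact: differentiable_cst].
Qed.

(** The detour through order [k.+1] serves the case [k = 0]: a radial derivative of positive order
    does not see the subtracted constant, and [energy_succ_le] then returns to order [k]. *)
Lemma energy_subC_le p alpha N k : 0 < p -> -1 < p * N%:R + alpha -> (N <= k)%N ->
  exists2 K : R, 0 < K & forall f, holomorphic_on_ball f ->
  (energy p alpha N (fun z => f z - f 0)%R <= K%:E * energy p alpha k f)%E.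
Proof.
move=> p0 hN Nk.
have [K1 K10 HK1] := energy_le_addn (k.+1 - N) p0 hN.
have [K2 K20 HK2] := energy_succ_le alpha k p0.
exists (K1 * K2) => [|f hf]; first exact: mulr_gt0.
apply: (le_trans (HK1 _ (hol_subC (f 0) hf) (subrr _))).
rewrite EFinM -muleA; apply: lee_wpmul2l; first by rewrite lee_fin ltW.
by rewrite subnKC ?leqW// /energy radial_iter_subC//; exact: HK2.
Qed.

Lemma energy_le_subC p alpha N k : 0 < p -> (N <= k)%N -> (0 < k)%N ->
  exists2 K : R, 0 < K & forall f, holomorphic_on_ball f ->
  (energy p alpha k f <= K%:E * energy p alpha N (fun z => f z - f 0)%R)%E.
Proof.
move=> p0 Nk k0; have [K K0 HK] := energy_addn_le alpha N (k - N) p0.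
exists K; first exact: K0.
move=> f hf; have := HK _ (hol_subC (f 0) hf).
by rewrite (subnKC Nk) {1}/energy (radial_iter_subC _ _ k0).
Qed.

Lemma center_le_energy p alpha : 0 < p -> exists2 K : R, 0 < K &
  forall f, holomorphic_on_ball f -> ((normc (f 0%R) `^ p)%:E <= K%:E * energy p alpha 0 f)%E.
Proof.
move=> p0; have k0 : (0 : R) < 2^-1 by lra. have k1 : (2^-1 : R) < 1 by lra.
have [K K0 HK] := submean_qb n (alpha + n.+1%:R) k0 k1 p0.
exists K => // f hf; have := HK f 0 hf (@uball0 R n).
have -> : defect (0 : Cn) = 1 by rewrite /defect enorm0 expr0n subr0.
rewrite powR_1l mulr1 => H; apply: (le_trans H).
apply: lee_wpmul2l; first by rewrite lee_fin ltW.
apply: ge0_le_integral => //.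
- by move=> w _; rewrite lee_fin mulr_ge0// bfun_ge0.
- apply/measurable_EFinP; apply: measurable_funM; first exact: measurable_bfun.
  by apply: measurable_indic; exact: measurable_qb.
- by apply/measurable_EFinP; exact: measurable_bfun.
move=> w _; rewrite lee_fin addrK mul0r add0r.
have [Hw|Hw] := pselect (qb 2^-1 0 w); last by rewrite (indic_notin _ Hw) mulr0 bfun_ge0.
by rewrite (indic_in _ Hw) mulr1.
Qed.

Lemma bergman_normE p alpha f : 0 < p -> holomorphic_on_ball f ->
  bergman_norm p alpha f = ((normc (f 0%R))%:E +
   ((ball_mass R n * calpha n alpha)%:E * energy p alpha (bergman_order p alpha) f) `^ p^-1)%E.
Proof.
move=> p0 hf; rewrite /bergman_norm; congr (_ + _ `^ _)%E; set N := bergman_order p alpha.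
rewrite (@integral_vol_bfun _ _ uball _ (radial_iter N f) p (N%:R * p + alpha) (calpha n alpha))//.
- congr (_ * _)%E; apply: eq_integral => z _; congr EFin.
  have [zB|zB] := pselect (uball z); last by rewrite bfun_out// mul0r.
  by rewrite (indic_in _ zB) mulr1.
- exact: measurable_uball.
- exact: hol_radial_iter.
- by rewrite ltW// calpha_gt0.
by move=> z zB; rewrite powR_defectD// /valpha_density [p * _]mulrC; ring.
Qed.

Lemma bergman_orderP p alpha k : -1 < p * k%:R + alpha ->
  -1 < p * (bergman_order p alpha)%:R + alpha /\ (bergman_order p alpha <= k)%N.
Proof.
move=> hk; rewrite /bergman_order; case: pselect => [ex|]; last by case; exists k.
by case: ex_minnP => N hN minN; split => //; exact: minN.
Qed.

Lemma in_LpE p alpha (G : Cn -> \bar R) : 0 < p -> measurable_fun uball G ->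
  in_Lp p alpha G <-> (pmass p alpha G < +oo)%E.
Proof.
move=> p0 mG; have c0 : 0 < ball_mass R n * calpha n alpha.
  by rewrite mulr_gt0 ?ball_mass_gt0 ?calpha_gt0.
have ip : p^-1 != 0 by rewrite invr_eq0 gt_eqF.
have P0 := pmass_ge0 p alpha G.
rewrite /in_Lp Lp_normE//; split => [[_ H]|H].
  have := lty_poweRy ip H; case: (pmass p alpha G) P0 => [r| |]// _.
    by move=> _; rewrite ltry.
  by rewrite gt0_muley ?lte_fin// ltxx.
by split => //; apply: poweR_lty; apply: lte_mul_pinfty; rewrite ?lee_fin ?(ltW c0).
Qed.

(** Membership lets the order vary; comparing energies shows that one admissible order decides for
    all. *)
Lemma bergman_mem_energy p alpha k f : 0 < p -> -1 < p * k%:R + alpha -> holomorphic_on_ball f ->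
  bergman_mem p alpha f <-> (energy p alpha k f < +oo)%E.
Proof.
move=> p0 hk hf.
have E m : in_Lp p alpha (fun z => (weighted_radial m f z)%:E) <-> (energy p alpha m f < +oo)%E.
  by rewrite in_LpE ?pmass_weighted//; exact: measurable_weighted.
split=> [[_ [m [hm /E H]]]|H]; first exact: energy_fin_iff hm hk hf H.
by split => //; exists k; split => //; exact/E.
Qed.

End EnergyChain.

(** * Chains of inequalities up to constants *)

Section ScaleChains.
Variable R : realType.
Implicit Types (a b c : R) (x y z : \bar R).

Lemma le_scale_trans a b x y z : 0 <= a -> (x <= a%:E * y)%E -> (y <= b%:E * z)%E ->
  (x <= (a * b)%:E * z)%E.
Proof.
move=> a0 xy yz; apply: (le_trans xy); rewrite EFinM -muleA.
by apply: lee_wpmul2l; rewrite ?lee_fin.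
Qed.

Lemma le_scale_const a c x y : (0 <= y)%E -> a <= c -> (x <= a%:E * y)%E -> (x <= c%:E * y)%E.
Proof. by move=> y0 ac xy; apply: (le_trans xy); apply: lee_wpmul2r. Qed.

Lemma comparable_upto_of a b c x y : 0 < c -> (0 <= x)%E -> (0 <= y)%E -> a <= c -> b <= c ->
  (x <= a%:E * y)%E -> (y <= b%:E * x)%E -> comparable_upto c x y.
Proof.
move=> c0 x0 y0 ac bc xy yx; split; last exact: le_scale_const xy.
by rewrite lee_pdivrMl//; exact: le_scale_const yx.
Qed.

Lemma scaled_poweR_le c p a : 0 < c -> 0 < p -> 0 < a -> exists2 b, 0 < b &
  forall x y, (0 <= x)%E -> (0 <= y)%E -> (x <= a%:E * y)%E ->
  ((c%:E * x) `^ p^-1 <= b%:E * (c%:E * y) `^ p^-1)%E.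
Proof.
move=> c0 p0 a0; exists (a `^ p^-1) => [|x y x0 y0 xy]; first exact: powR_gt0.
apply: poweR_scale; [by rewrite invr_ge0 ltW|exact: ltW| | |].
- by rewrite mule_ge0// lee_fin ltW.
- by rewrite mule_ge0// lee_fin ltW.
by rewrite muleCA; apply: lee_wpmul2l => //; rewrite lee_fin ltW.
Qed.

Lemma seq_upper_bound (s : seq R) : exists2 c : R, 0 < c & {in s, forall t : R, t <= c}.
Proof.
elim: s => [|x s [c c0 cP]]; first by exists 1.
exists (Num.max x c) => [|t]; first by rewrite lt_max c0 orbT.
by rewrite inE le_max => /predU1P[->|/cP->]; rewrite ?lexx ?orbT.
Qed.

End ScaleChains.

(* For k = 0 and f a nonzero constant, f - f 0 has norm 0 while area_fun does
   not: only one half of the first comparison survives, and the two-sided form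
   holds for f itself. *)
Theorem corollary6p1 (R : realType) (n : nat) (gamma q alpha p : R) (k : nat)
    (hn : (1 <= n)%N) (hgamma : 0 < gamma) (hq : 1 <= q) (hp : 0 < p)
    (hk : -1 < p * k%:R + alpha) :
  (forall f : 'rV[R[i]]_n -> R[i], holomorphic_on_ball f ->
     (bergman_mem p alpha f <-> in_Lp p alpha (area_fun q gamma k f)) /\
     (in_Lp p alpha (area_fun q gamma k f) <->
      in_Lp p alpha (maximal_fun alpha q gamma k f))) /\
  (exists c : R, 0 < c /\
   forall f : 'rV[R[i]]_n -> R[i], holomorphic_on_ball f ->
     let normA := Lp_norm p alpha (area_fun q gamma k f) in
     let normM := Lp_norm p alpha (maximal_fun alpha q gamma k f) in
     let norm0 := bergman_norm p alpha (fun z => f z - f 0) in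
     [/\ (0 < k)%N -> comparable_upto c norm0 normA,
         k = 0%N -> (norm0 <= c%:E * normA)%E /\
                    comparable_upto c (bergman_norm p alpha f) normA
       & comparable_upto c normA normM]).
Proof.
have q0 : 0 < q by exact: lt_le_trans hq.
have [K K0 HK] := three_comparisons n alpha k hgamma hp q0.
have scale_fin (a : R) (x y : \bar R) : 0 < a -> (x <= a%:E * y)%E -> (y < +oo)%E -> (x < +oo)%E.
  by move=> a0 xy yfin; apply: (le_lt_trans xy); apply: lte_mul_pinfty; rewrite ?lee_fin ?(ltW a0).
split=> [f hf|].
  have [AM ME EA] := HK f hf.
  have mA := measurable_area k hgamma q0 hf; have mM := @measurable_maximal R n alpha gamma q k f hgamma.
  rewrite (bergman_mem_energy hp hk hf) !in_LpE//; split; split => H.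
  - exact: scale_fin K0 AM (scale_fin _ _ _ K0 ME H).
  - exact: scale_fin K0 EA H.
  - exact: scale_fin K0 ME (scale_fin _ _ _ K0 EA H).
  - exact: scale_fin K0 AM H.
have [hN Nk] := bergman_orderP hk; set N := bergman_order p alpha in hN Nk.
have [K1 K10 HK1] := energy_subC_le n hp hN Nk.
(* For [k = 0] the inequality fails for nonzero constants, so it is guarded by [0 < k] and the
   witness 1 is a dummy. *)
have [K2 K20 HK2] : exists2 K2 : R, 0 < K2 & (0 < k)%N -> forall f, holomorphic_on_ball f ->
    (energy p alpha k f <= K2%:E * energy p alpha N (fun z : 'rV[R[i]]_n => f z - f 0)%R)%E.
  case: k Nk {hk HK HK1} => [|k'] Nk; first by exists 1; [exact: ltr01|].
  by have [K2 K20 HK2] := energy_le_subC n alpha hp Nk (ltn0Sn k'); exists K2.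
have [K3 K30 HK3] := center_le_energy n alpha hp.
have cc0 : 0 < ball_mass R n * calpha n alpha by rewrite mulr_gt0 ?ball_mass_gt0 ?calpha_gt0.
pose rt (x : \bar R) : \bar R := (((ball_mass R n * calpha n alpha)%:E * x) `^ p^-1)%E.
have rt0 x : (0 <= rt x)%E by exact: poweR_ge0.
have rt_scale (a : R) : 0 < a -> exists2 b : R, 0 < b & forall x y, (0 <= x)%E -> (0 <= y)%E ->
    (x <= a%:E * y)%E -> (rt x <= b%:E * rt y)%E.
  by move=> a0; exact: scaled_poweR_le.
have [b b0 Hb] := rt_scale _ K0; have [b1 b10 Hb1] := rt_scale _ K10.
have [b2 b20 Hb2] := rt_scale _ K20.
(* Used for [k = 0], where the norm of [f] contains |f 0|: the energy of order 0 controls that term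
   by the sub-mean value inequality at the origin. *)
have [b3 b30 Hb3] : exists2 b3 : R, 0 < b3 & forall f, holomorphic_on_ball f ->
    ((Normc.normc (f (0 : 'rV[R[i]]_n)%R))%:E <= b3%:E * rt (energy p alpha 0 f))%E.
  have [b3 b30 Hb3] := rt_scale _ (divr_gt0 K30 cc0).
  exists b3 => [//|f hf]; set x := Normc.normc _.
  have x0 : 0 <= x by exact: normc_ge0.
  have xE : x%:E = rt ((ball_mass R n * calpha n alpha)^-1 * x `^ p)%:E.
    by rewrite /rt -EFinM mulVKf ?gt_eqF// poweR_EFin powRK.
  rewrite xE; apply: Hb3 (energy_ge0 _ _ _ _) _.
    by rewrite lee_fin mulr_ge0 ?powR_ge0// invr_ge0 ltW.
  rewrite EFinM [K3 / _]mulrC [(_ * K3)%:E]EFinM -muleA.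
  apply: lee_wpmul2l; last exact: HK3.
  by rewrite lee_fin invr_ge0 ltW.
have LpE (G : 'rV[R[i]]_n -> \bar R) : measurable_fun (@uball R n) G -> Lp_norm p alpha G = rt (pmass p alpha G).
  by move=> mG; rewrite Lp_normE.
have BE (f : 'rV[R[i]]_n -> R[i]) : holomorphic_on_ball f ->
    bergman_norm p alpha f = ((Normc.normc (f (0 : 'rV[R[i]]_n)%R))%:E + rt (energy p alpha N f))%E.
  exact: bergman_normE.
clearbody rt; clear rt_scale.
(* The list holds the constants of all chains below, so that one [c], chosen before [f], serves
   every comparison. *)
have [c c0 cP] := seq_upper_bound [:: b1 * b; b * b * b2; (b3 + 1) * b; b * b * 1; b; b * b].
exists c; split=> [//|f hf normA normM norm0].
have [AM ME EA] := HK f hf.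
have nA : normA = rt (pmass p alpha (area_fun q gamma k f)).
  by apply: LpE; exact: measurable_area.
have nM : normM = rt (pmass p alpha (maximal_fun alpha q gamma k f)).
  by apply: LpE; exact: measurable_maximal.
have n0 : norm0 = rt (energy p alpha N (fun z => f z - f 0)).
  by rewrite /norm0 (BE _ (hol_subC (f 0) hf)) subrr Normc.normc0 add0e.
clearbody normA normM norm0.
have A0 : (0 <= normA)%E by rewrite nA.
have M0 : (0 <= normM)%E by rewrite nM.
have Z0 : (0 <= norm0)%E by rewrite n0.
pose nE := rt (energy p alpha k f).
have rAM : (normA <= b%:E * normM)%E.
  by rewrite nA nM; exact: Hb (pmass_ge0 _ _ _) (pmass_ge0 _ _ _) AM.
have rME : (normM <= b%:E * nE)%E.
  by rewrite nM; exact: Hb (pmass_ge0 _ _ _) (energy_ge0 _ _ _ _) ME.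
have rEA : (nE <= b%:E * normA)%E.
  by rewrite nA; exact: Hb (energy_ge0 _ _ _ _) (pmass_ge0 _ _ _) EA.
have rAE := le_scale_trans (ltW b0) rAM rME; have rMA := le_scale_trans (ltW b0) rME rEA.
have r0E : (norm0 <= b1%:E * nE)%E.
  by rewrite n0; exact: Hb1 (energy_ge0 _ _ _ _) (energy_ge0 _ _ _ _) (HK1 f hf).
have r0A := le_scale_trans (ltW b10) r0E rEA.
split.
- move=> kpos; have rE0 : (nE <= b2%:E * norm0)%E.
    by rewrite n0; exact: Hb2 (energy_ge0 _ _ _ _) (energy_ge0 _ _ _ _) (HK2 kpos f hf).
  have rA0 := le_scale_trans (mulr_ge0 (ltW b0) (ltW b0)) rAE rE0.
  by apply: comparable_upto_of c0 Z0 A0 _ _ r0A rA0; apply: cP; rewrite !inE eqxx ?orbT.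
- move=> k0; split; first by apply: le_scale_const A0 _ r0A; apply: cP; rewrite !inE eqxx.
  have N0 : N = 0%N by apply/eqP; rewrite -leqn0 -k0.
  have nf : bergman_norm p alpha f = ((Normc.normc (f 0%R))%:E + nE)%E.
    by rewrite (BE f hf) N0 /nE k0.
  have cf : ((Normc.normc (f 0%R))%:E <= b3%:E * nE)%E by rewrite /nE k0; exact: Hb3.
  have E0 : (0 <= nE)%E by exact: rt0.
  have nf0 : (0 <= (Normc.normc (f 0%R))%:E)%E by rewrite lee_fin normc_ge0.
  clearbody nE.
  have rfE : (bergman_norm p alpha f <= (b3 + 1)%:E * nE)%E.
    by rewrite nf EFinD ge0_muleDl ?lee_fin ?(ltW b30)// mul1e; exact: leeD2r.
  have rEf : (nE <= 1%:E * bergman_norm p alpha f)%E by rewrite nf mul1e leeDr.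
  have rfA := le_scale_trans (addr_ge0 (ltW b30) ler01) rfE rEA.
  have rAf := le_scale_trans (mulr_ge0 (ltW b0) (ltW b0)) rAE rEf.
  have f0 : (0 <= bergman_norm p alpha f)%E by rewrite nf adde_ge0.
  by apply: comparable_upto_of c0 f0 A0 _ _ rfA rAf; apply: cP; rewrite !inE eqxx ?orbT.
by apply: comparable_upto_of c0 A0 M0 _ _ rAM rMA; apply: cP; rewrite !inE eqxx ?orbT.
Qed.
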